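(* Let $T>0$, and let $\sigma:\mathbb{R}^d\to\mathbb{S}_d$, $b:\mathbb{R}^d\to\mathbb{R}^d$ and $g:\mathbb{R}\times\mathbb{R}^d\to\mathbb{R}$ satisfy, for all $x,x'\in\mathbb{R}^d$, $y,y'\in\mathbb{R}$, $z,z'\in\mathbb{R}^d$: (i) $|\sigma(x)-\sigma(x')|\le L_\sigma|x-x'|$ and $|b(x)-b(x')|\le L_b|x-x'|$; (ii) $\lambda_\sigma I\le\sigma(x)\le\Lambda_\sigma I$ for constants $\Lambda_\sigma\ge\lambda_\sigma>0$; (iii) $|g(y,z)-g(y',z')|\le K_g|y-y'|+L_g|z-z'|$ for constants $K_g,L_g>0$. Put $g_0=g(0,0)$. For $\varphi\in C_b(\mathbb{R}^d)$ and $x\in\mathbb{R}^d$ let $(X^x,Y^x,Z^x)$ solve the forward-backward SDE $$X^x_t=x+\int_0^t\sigma(X^x_s)\,dB_s+\int_0^tb(X^x_s)\,ds,\qquad Y^x_t=\varphi(X^x_T)+\int_t^Tg(Y^x_s,Z^x_s)\,ds-\int_t^TZ^x_s\,dB_s,\quad t\in[0,T],$$ and set $u(T,x)=Y^x_0$. Then there exists a constant $C>0$ depending only on $\Lambda_\sigma,\lambda_\sigma,K_g,L_g,g_0$ such that for all $x,y\in\mathbb{R}^d$ $$|u(T,x)-u(T,y)|\le C\Big(\|\varphi\|_\infty+\frac{|g_0|}{\mu}\Big)\frac{e^{\mu T}}{\sqrt{(1-e^{-LT})/L}}\,|x-y|,$$ where $\mu=K_g+4L_g^2$ and $L=2(L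_gL_\sigma+L_b+2L_\sigma^2)$.
   Context: $B$ is a $d$-dimensional standard Brownian motion (with its augmented filtration), $d$ fixed. $\mathbb{S}_d$ is the space of real symmetric $d\times d$ matrices, with its usual order; $|\cdot|$ is the Euclidean norm on vectors and the Hilbert–Schmidt norm on matrices. $C_b(\mathbb{R}^d)$ is the set of bounded continuous real functions, $\|\varphi\|_\infty=\sup|\varphi|$. The solution of the backward equation is the unique adapted square-integrable solution. If $L=0$, $(1-e^{-LT})/L$ is read as $T$. *)

(* Defs.v *)
From HB Require Import structures.
From mathcomp Require Import all_boot all_order all_algebra.
From mathcomp Require Import all_classical all_reals all_analysis.

Set Implicit Arguments.
Unset Strict Implicit.
Unset Printing Implicit Defensive.

Import Order.TTheory GRing.Theory Num.Theory.
Import numFieldNormedType.Exports.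

Local Open Scope classical_set_scope.
Local Open Scope ring_scope.

Section LinearAlgebra.
Context {R : realType}.

(* Euclidean norm on column vectors, Hilbert-Schmidt norm on square matrices;
   the library norm on matrices is the sup norm of the entries. *)
Definition hsnorm m n (A : 'M[R]_(m, n)) : R :=
  Num.sqrt (\sum_i \sum_j A i j ^+ 2).

Definition loewner_le d (A B : 'M[R]_d) : Prop :=
  forall v : 'cV[R]_d, 0 <= (v^T *m (B - A) *m v) ord0 ord0.

Definition supnorm d (phi : 'cV[R]_d -> R) : R :=
  sup (range (fun x => `|phi x|)).

Definition Cb d (phi : 'cV[R]_d -> R) : Prop :=
  continuous phi /\ exists M : R, forall x, `|phi x| <= M.

Definition decay_factor (L T : R) : R :=
  if L == 0 then T else (1 - expR (- (L * T))) / L.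

End LinearAlgebra.

Section StochasticCalculus.
Context {R : realType} {dd : measure_display} {Omega : measurableType dd}.
Variable P : probability Omega R.

(* Processes are indexed by R; only the values at nonnegative times matter. *)

Definition natural_filtration d (B : R -> Omega -> 'cV[R]_d) (t : R) :
    set (set Omega) :=
  <<s [set A | exists (s : R) (i : 'I_d) (C : set R),
         [/\ 0 <= s <= t, measurable C & A = [set w | C (B s w i ord0)]]] >>.

Definition augmented_filtration d (B : R -> Omega -> 'cV[R]_d) (t : R) :
    set (set Omega) :=
  <<s natural_filtration B t `|` [set A | P.-negligible A] >>.

(* The last clause says that B t - B s is independent of the past of B up to
   time s and is centred Gaussian with covariance (t - s) I; the second
   parameter of normal_prob is the standard deviation. *)
Definition standard_brownian_motion d (B : R -> Omega -> 'cV[R]_d) : Prop :=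
  [/\ forall (t : R) i, 0 <= t -> measurable_fun setT (fun w => B t w i ord0),
      {ae P, forall w, B 0 w = 0},
      {ae P, forall w, {within `[0, +oo[, continuous (B ^~ w)}} &
      forall (s t : R) (A : set Omega) (C : 'I_d -> set R),
        0 <= s < t -> natural_filtration B s A ->
        (forall i, measurable (C i)) ->
        P (A `&` [set w | forall i, C i (B t w i ord0 - B s w i ord0)]) =
        (P A * \prod_(i < d) normal_prob 0 (Num.sqrt (t - s)) (C i))%E].

Section Ito.
Variable F : R -> set (set Omega).

Definition rv_measurable (G : set (set Omega)) (f : Omega -> R) : Prop :=
  forall C : set R, measurable C -> G (f @^-1` C).

Definition measurable_adapted (T : R) (H : R -> Omega -> R) : Prop :=
  measurable_fun (`[0, T] `*` setT) (fun p : R * Omega => H p.1 p.2) /\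
  forall t : R, 0 <= t <= T -> rv_measurable (F t) (H t).

(* The process \sum_(k < n) xi_k 1_]t_k, t_(k+1)] with xi_k bounded and
   F_(t_k)-measurable. *)
Record simple_process := SimpleProcess {
  sp_size : nat ;
  sp_time : nat -> R ;
  sp_coef : nat -> Omega -> R ;
  sp_time_ge0 : forall k, 0 <= sp_time k ;
  sp_time_le : forall k, sp_time k <= sp_time k.+1 ;
  sp_coef_bounded : forall k, exists M : R, forall w, `|sp_coef k w| <= M ;
  sp_coef_adapted : forall k, rv_measurable (F (sp_time k)) (sp_coef k) }.

Definition simple_val (S : simple_process) (s : R) (w : Omega) : R :=
  \sum_(k < sp_size S)
    sp_coef S k w * (sp_time S k < s <= sp_time S k.+1)%R%:R.

Definition simple_ito (W : R -> Omega -> R) (S : simple_process) (t : R)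
    (w : Omega) : R :=
  \sum_(k < sp_size S)
    sp_coef S k w * (W (Num.min (sp_time S k.+1) t) w
                     - W (Num.min (sp_time S k) t) w).

(* M_t = \int_0^t H_s dW_s for t in [0, T]: the continuous version of the
   L^2 limit of the integrals of simple processes converging to H in
   L^2([0, T] x Omega). The first convergence forces E \int_0^T H_s^2 ds to be
   finite. *)
Definition is_ito_integral (T : R) (W H M : R -> Omega -> R) : Prop :=
  [/\ measurable_adapted T H,
      measurable_adapted T M,
      {ae P, forall w, {within `[0, T], continuous (M ^~ w)}} &
      exists S : nat -> simple_process,
        ((fun n => \int[P]_w \int[lebesgue_measure]_(s in `[0%R, T])
            ((simple_val (S n) s w - H s w) ^+ 2)%:E)%E @ \oo --> 0%E) /\
        forall t : R, 0 <= t <= T ->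
          ((fun n => \int[P]_w
              ((simple_ito W (S n) t w - M t w) ^+ 2)%:E)%E @ \oo --> 0%E)].

End Ito.

Variables (d : nat) (B : R -> Omega -> 'cV[R]_d).
Local Notation F := (augmented_filtration B).

Definition forward_solution (T : R) (sigma : 'cV[R]_d -> 'M[R]_d)
    (b : 'cV[R]_d -> 'cV[R]_d) (x : 'cV[R]_d) (X : R -> Omega -> 'cV[R]_d) :
    Prop :=
  [/\ forall i, measurable_adapted F T (fun t w => X t w i ord0),
      {ae P, forall w, {within `[0, T], continuous (X ^~ w)}} &
      exists M : 'I_d -> 'I_d -> R -> Omega -> R,
        (forall i j, is_ito_integral F T (fun t w => B t w j ord0)
                       (fun t w => sigma (X t w) i j) (M i j)) /\
        {ae P, forall w, forall (t : R) i, 0 <= t <= T ->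
           X t w i ord0 = x i ord0 + \sum_(j < d) M i j t w
             + \int[lebesgue_measure]_(s in `[0, t]) b (X s w) i ord0}].

(* \int_t^T Z_s dB_s is the increment over [t, T] of
   \sum_j \int_0^. Z^j_s dB^j_s. *)
Definition backward_solution (T : R) (g : R -> 'cV[R]_d -> R)
    (phi : 'cV[R]_d -> R) (X : R -> Omega -> 'cV[R]_d)
    (Y : R -> Omega -> R) (Z : R -> Omega -> 'cV[R]_d) : Prop :=
  [/\ measurable_adapted F T Y /\
      (forall i, measurable_adapted F T (fun t w => Z t w i ord0)),
      {ae P, forall w, {within `[0, T], continuous (Y ^~ w)}},
      (\int[P]_w \int[lebesgue_measure]_(s in `[0%R, T])
         (Y s w ^+ 2)%:E < +oo)%E,
      (\int[P]_w \int[lebesgue_measure]_(s in `[0%R, T])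
         (hsnorm (Z s w) ^+ 2)%:E < +oo)%E &
      exists N : 'I_d -> R -> Omega -> R,
        (forall j, is_ito_integral F T (fun t w => B t w j ord0)
                     (fun t w => Z t w j ord0) (N j)) /\
        {ae P, forall w, forall t : R, 0 <= t <= T ->
           Y t w = phi (X T w)
             + \int[lebesgue_measure]_(s in `[t, T]) g (Y s w) (Z s w)
             - \sum_(j < d) (N j T w - N j t w)}].

Definition fbsde_solution (T : R) (sigma : 'cV[R]_d -> 'M[R]_d)
    (b : 'cV[R]_d -> 'cV[R]_d) (g : R -> 'cV[R]_d -> R)
    (phi : 'cV[R]_d -> R) (x : 'cV[R]_d)
    (X : R -> Omega -> 'cV[R]_d) (Y : R -> Omega -> R)
    (Z : R -> Omega -> 'cV[R]_d) : Prop :=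
  forward_solution T sigma b x X /\ backward_solution T g phi X Y Z.

End StochasticCalculus.

(* Main.v *)
(** The solution is compared with an explicit time discretisation.  On a grid of
mesh h, let U_0 be a Lipschitz approximation of phi and

  U_(j+1) x = m + h g(m, z),   m = E V,   z = E[V tau] / h,
  V = U_j (x + h b(x) + sigma(x) zeta),

where zeta is N(0, h I) and tau is zeta truncated at a fixed level and centred.

Gradient bound, uniform in h and in the Lipschitz constant of U_0: the inequality
U x <= U y + eps (c - (U y)^2) + q |x - y|^2 is propagated in j.  Linearising g
turns U_(j+1) x - U_(j+1) y into E[w (U_j X' - U_j Y')] with a weight w close to
1.  Translating zeta inside Y' moves Y' towards X' by a chosen fraction of |x - y|;
this costs a chi-square distance, and the cost is absorbed by the conditional
variance of U_j Y' released by the term - eps (U y)^2.  With the optimal fraction,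
q at time T is of order 1 / (eps D), D = (1 - exp (- L T)) / L; optimising eps gives
the square root.

Convergence: U_n x tends to Y_0 in mean square.  Only three properties of the
Ito integral are needed, all inherited from simple processes: the martingale
property, E (M_t - M_s)^2 <= E int H^2, and the covariance of M_t - M_s with a
Brownian increment.  The solution of the backward equation is never constructed.
Since the U_n x are constants, their limit Y_0 is almost surely constant too. *)

Require Import Defs.
From HB Require Import structures.
From mathcomp Require Import all_boot all_order all_algebra.
From mathcomp Require Import all_classical all_reals all_analysis.
From mathcomp Require Import measurable_realfun ring lra zify.
Set Implicit Arguments.
Unset Strict Implicit.
Unset Printing Implicit Defensive.
Import Order.TTheory GRing.Theory Num.Theory.
Import numFieldNormedType.Exports.
Local Open Scope classical_set_scope.
Local Open Scope ring_scope.

(** * Square-integrable functions *)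

(** Truncating the noise at a level independent of h keeps the weight w between 1/2 and 3/2, so each
    step is monotone; the truncation error is only of order h^2 in mean square, like the fourth
    moment of an increment. Values are discounted by (1 + h K_g)^j, which keeps the mean of w at
    most 1.

    To first order q obeys the Riccati equation q' = L q - const eps lambda^2 q^2. Its rescaled
    reciprocal solves the linear equation d' = 1 - L d, whose solution started at 0 is D. The start
    d0 > 0 encodes the Lipschitz constant of U_0; it restricts the mesh but drops out of the final
    bound on q, so that a merely continuous phi can be reached.

    The constant c grows linearly in time; optimising eps therefore leaves a factor sqrt(1 + T),
    absorbed by the part 4 L_g^2 of mu.

    The obstacle in the convergence proof is that Z has no regularity in time. It is compared with
    bounded adapted variables, one per cell. The error of the martingale increment, orthogonal to
    the past, appears on the left-hand side and absorbs its own contribution to the gradient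
    error. *)

Section LebesgueSpaces.
Context d (T : measurableType d) (R : realType).
Variable mu : {measure set T -> \bar R}.
Implicit Types f g : T -> R.

(** The measure is arbitrary: [Ex] serves as expectation, as integral over time and as integral over
    the product of both. *)
Definition Ex f : R := \int[mu]_x f x.
Definition Lone f := mu.-integrable setT (EFin \o f).
Definition Ltwo f := measurable_fun setT f /\ Lone (fun x => f x ^+ 2).

Lemma Lone_meas f : Lone f -> measurable_fun setT f.
Proof. by move=> /measurable_int/measurable_EFinP. Qed.

Lemma Lone_le f g : measurable_fun setT f -> (forall x, `|f x| <= g x) ->
  Lone g -> Lone f.
Proof.
move=> mf fg Lg; apply: (@le_integrable _ _ _ mu _ measurableT _ (EFin \o g)) => //.
  exact/measurable_EFinP.
by move=> x _; rewrite /= lee_fin (le_trans (fg x))// ler_norm.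
Qed.

Lemma LoneD f g : Lone f -> Lone g -> Lone (fun x => f x + g x).
Proof. by move=> Lf Lg; exact: (integrableD measurableT Lf Lg). Qed.

Lemma LoneZ c f : Lone f -> Lone (fun x => c * f x).
Proof. by move=> Lf; exact: (integrableZl measurableT c Lf). Qed.

Lemma LoneN f : Lone f -> Lone (fun x => - f x).
Proof. by move=> Lf; have H := integrableN Lf; by []. Qed.

Lemma LoneB f g : Lone f -> Lone g -> Lone (fun x => f x - g x).
Proof. by move=> Lf /LoneN; exact: LoneD. Qed.

Lemma Lone0 : Lone (fun=> 0).
Proof. exact: integrable0. Qed.

Lemma Lone_sum (I : Type) (s : seq I) (P : pred I) (F : I -> T -> R) :
  (forall i, P i -> Lone (F i)) -> Lone (fun x => \sum_(i <- s | P i) F i x).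
Proof.
move=> H; have := @integrable_sum _ _ _ mu _ measurableT _ s P (fun i => EFin \o F i) H.
by apply: eq_integrable => // x _; rewrite /= sumEFin.
Qed.

Lemma Lone_norm f : Lone f -> Lone (fun x => `|f x|).
Proof. exact: integrable_norm. Qed.

Lemma ExD f g : Lone f -> Lone g -> Ex (fun x => f x + g x) = Ex f + Ex g.
Proof. by move=> Lf Lg; rewrite /Ex RintegralD. Qed.

Lemma ExB f g : Lone f -> Lone g -> Ex (fun x => f x - g x) = Ex f - Ex g.
Proof. by move=> Lf Lg; rewrite /Ex RintegralB. Qed.

Lemma ExZ c f : Lone f -> Ex (fun x => c * f x) = c * Ex f.
Proof. by move=> Lf; rewrite /Ex RintegralZl. Qed.

Lemma ExN f : Lone f -> Ex (fun x => - f x) = - Ex f.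
Proof.
move=> Lf; rewrite -mulN1r -ExZ//; apply: eq_Rintegral => x _.
by rewrite mulN1r.
Qed.

Lemma eq_Ex f g : f =1 g -> Ex f = Ex g.
Proof. by move=> fg; apply: eq_Rintegral => x _; exact: fg. Qed.

Lemma Ex0 : Ex (fun=> 0) = 0.
Proof. by rewrite /Ex Rintegral_cst//= mul0r. Qed.

Lemma Ex_sum (I : Type) (s : seq I) (P : pred I) (F : I -> T -> R) :
  (forall i, P i -> Lone (F i)) ->
  Ex (fun x => \sum_(i <- s | P i) F i x) = \sum_(i <- s | P i) Ex (F i).
Proof.
move=> H; elim: s => [|i s IH].
  by under eq_Ex do rewrite big_nil; rewrite Ex0 big_nil.
under eq_Ex do rewrite big_cons; rewrite big_cons.
case Pi : (P i) => //; rewrite ExD ?IH//; first exact: H.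
exact: Lone_sum.
Qed.

Lemma Ex_ge0 f : (forall x, 0 <= f x) -> 0 <= Ex f.
Proof. by move=> f0; apply: Rintegral_ge0 => x _; exact: f0. Qed.

Lemma Ex_le f g : Lone f -> Lone g -> (forall x, f x <= g x) -> Ex f <= Ex g.
Proof. by move=> Lf Lg fg; apply: le_Rintegral => // x _; exact: fg. Qed.

Lemma ae_eq_Ex f g : measurable_fun setT f -> measurable_fun setT g ->
  {ae mu, forall x, f x = g x} -> Ex f = Ex g.
Proof.
move=> mf mg fg; congr fine; apply: ae_eq_integral => //.
- exact/measurable_EFinP.
- exact/measurable_EFinP.
- by apply: filterS fg => x /= -> _.
Qed.

Lemma ae_eq_Lone f g : measurable_fun setT g ->
  {ae mu, forall x, f x = g x} -> Lone f -> Lone g.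
Proof.
move=> mg fg Lf; apply/integrableP; split; first exact/measurable_EFinP.
have /integrableP[_] := Lf; apply: le_lt_trans; rewrite le_eqVlt.
apply/orP; left; apply/eqP; apply: ae_eq_integral => //.
- by apply: measurableT_comp => //; exact/measurable_EFinP.
- by apply: measurableT_comp => //; exact: measurable_int Lf.
- by apply: filterS fg => x /= -> _.
Qed.

(** Pointwise monotonicity applies to f and max(f, g), and the latter is almost everywhere equal to
    g. *)
Lemma ae_le_Ex f g : Lone f -> Lone g ->
  {ae mu, forall x, f x <= g x} -> Ex f <= Ex g.
Proof.
move=> Lf Lg fg; have Lm : Lone (fun x => Num.max (f x) (g x)).
  apply: (@Lone_le _ (fun x => `|f x| + `|g x|)); last 2 first.
  - by move=> x; rewrite maxEle; case: ifP => _; rewrite ?lerDl ?lerDr.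
  - by apply: LoneD; exact: Lone_norm.
  - by apply: measurable_maxr; exact: Lone_meas.
rewrite (@ae_eq_Ex g (fun x => Num.max (f x) (g x))); first last.
- by apply: filterS fg => x /= ?; rewrite max_r.
- exact: Lone_meas.
- exact: Lone_meas.
by apply: Ex_le => // x; rewrite le_max lexx.
Qed.

Lemma EFin_Ex f : Lone f -> ((Ex f)%:E = \int[mu]_x (f x)%:E)%E.
Proof. by move=> Lf; rewrite /Ex /Rintegral fineK//; exact: integrable_fin_num. Qed.

Lemma Lone_ge0P f : measurable_fun setT f -> (forall x, 0 <= f x) ->
  (\int[mu]_x (f x)%:E < +oo)%E -> Lone f.
Proof.
move=> mf f0 lf; apply/integrableP; split; first exact/measurable_EFinP.
by under eq_integral do rewrite /= ger0_norm//.
Qed.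

Lemma LtwoM f g : Ltwo f -> Ltwo g -> Lone (fun x => f x * g x).
Proof.
move=> [mf Lf] [mg Lg].
apply: (@Lone_le _ (fun x => f x ^+ 2 + g x ^+ 2)); last exact: LoneD.
  exact: measurable_funM.
move=> x; rewrite normrM -[f x ^+ 2]real_normK ?num_real// -[g x ^+ 2]real_normK ?num_real//.
have := sqr_ge0 (`|f x| - `|g x|); have := normr_ge0 (f x); have := normr_ge0 (g x); nra.
Qed.

Lemma LtwoD f g : Ltwo f -> Ltwo g -> Ltwo (fun x => f x + g x).
Proof.
move=> Lf Lg; split; first by apply: measurable_funD; [case: Lf|case: Lg].
have H : Lone (fun x => f x ^+ 2 + 2 * (f x * g x) + g x ^+ 2).
  apply: LoneD; last by case: Lg.
  by apply: LoneD; [case: Lf|apply: LoneZ; exact: LtwoM].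
by rewrite (_ : (fun x => _) = (fun x => f x ^+ 2 + 2 * (f x * g x) + g x ^+ 2))//;
  apply/funext => x; ring.
Qed.

Lemma LtwoZ c f : Ltwo f -> Ltwo (fun x => c * f x).
Proof.
move=> [mf Lf]; split; first exact: measurable_funM.
by under eq_fun do rewrite exprMn; exact: LoneZ.
Qed.

Lemma LtwoN f : Ltwo f -> Ltwo (fun x => - f x).
Proof. by move=> /(LtwoZ (-1)); under eq_fun do rewrite mulN1r. Qed.

Lemma LtwoB f g : Ltwo f -> Ltwo g -> Ltwo (fun x => f x - g x).
Proof. by move=> Lf /LtwoN; exact: LtwoD. Qed.

Lemma Ltwo0 : Ltwo (fun=> 0).
Proof. by split => //; under eq_fun do rewrite expr0n; exact: Lone0. Qed.

Lemma Ltwo_sum (I : Type) (s : seq I) (P : pred I) (F : I -> T -> R) :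
  (forall i, P i -> Ltwo (F i)) -> Ltwo (fun x => \sum_(i <- s | P i) F i x).
Proof.
move=> H; elim: s => [|i s IH].
  by under eq_fun do rewrite big_nil; exact: Ltwo0.
under eq_fun do rewrite big_cons.
by case Pi : (P i) => //; apply: LtwoD => //; exact: H.
Qed.

Lemma Lone_bounded_mul c f g : measurable_fun setT f ->
  (forall x, `|f x| <= c) -> Lone g -> Lone (fun x => f x * g x).
Proof.
move=> mf fc Lg; apply: (@Lone_le _ (fun x => c * `|g x|)).
- by apply: measurable_funM => //; exact: Lone_meas.
- by move=> x; rewrite normrM ler_wpM2r.
- by apply: LoneZ; exact: Lone_norm.
Qed.

Lemma Ltwo_bounded_mul c f g : measurable_fun setT f ->
  (forall x, `|f x| <= c) -> Ltwo g -> Ltwo (fun x => f x * g x).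
Proof.
move=> mf fc [mg Lg]; split; first exact: measurable_funM.
under eq_fun do rewrite exprMn.
apply: (@Lone_bounded_mul (c ^+ 2)) => //; first exact: measurable_funX.
by move=> x; rewrite normrX lerXn2r// nnegrE ?(le_trans _ (fc x)).
Qed.

Lemma Ltwo_le f g : measurable_fun setT f -> (forall x, `|f x| <= `|g x|) ->
  Ltwo g -> Ltwo f.
Proof.
move=> mf fg [mg Lg]; split=> //; apply: Lone_le Lg; first exact: measurable_funX.
move=> x; rewrite normrX -[g x ^+ 2]real_normK ?num_real//.
by rewrite lerXn2r// nnegrE.
Qed.

Lemma Ex_sqrD f g : Ltwo f -> Ltwo g ->
  Ex (fun x => (f x + g x) ^+ 2) =
  Ex (fun x => f x ^+ 2) + 2 * Ex (fun x => f x * g x) + Ex (fun x => g x ^+ 2).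
Proof.
move=> Lf Lg.
rewrite (@eq_Ex _ (fun x => f x ^+ 2 + 2 * (f x * g x) + g x ^+ 2)); last first.
  by move=> x; ring.
have L1 := LtwoM Lf Lg; case: Lf => mf Lf; case: Lg => mg Lg.
by rewrite !ExD ?ExZ//; [exact: LoneZ|apply: LoneD => //; exact: LoneZ].
Qed.

Lemma Ex_sqrB f g : Ltwo f -> Ltwo g ->
  Ex (fun x => (f x - g x) ^+ 2) =
  Ex (fun x => f x ^+ 2) - 2 * Ex (fun x => f x * g x) + Ex (fun x => g x ^+ 2).
Proof.
move=> Lf Lg; rewrite (@Ex_sqrD f (fun x => - g x) Lf (LtwoN Lg)).
congr (_ + _ + _); last by apply: eq_Ex => x; rewrite sqrrN.
under eq_Ex do rewrite mulrN.
by rewrite ExN ?mulrN//; exact: LtwoM.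
Qed.

Lemma Ex_sqr_ge0 f : 0 <= Ex (fun x => f x ^+ 2).
Proof. by apply: Ex_ge0 => x; exact: sqr_ge0. Qed.

Lemma Ex_sqrD_le f g : Ltwo f -> Ltwo g ->
  Ex (fun x => (f x + g x) ^+ 2) <=
  2 * Ex (fun x => f x ^+ 2) + 2 * Ex (fun x => g x ^+ 2).
Proof.
move=> Lf Lg; have := Ex_sqr_ge0 (fun x => f x - g x).
by rewrite Ex_sqrB// Ex_sqrD//; lra.
Qed.

Lemma Ex_young c f g : 0 < c -> Ltwo f -> Ltwo g ->
  2 * Ex (fun x => f x * g x) <=
  c * Ex (fun x => f x ^+ 2) + c^-1 * Ex (fun x => g x ^+ 2).
Proof.
move=> c0 Lf Lg; have := Ex_sqr_ge0 (fun x => c * f x - g x).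
rewrite Ex_sqrB//; last exact: LtwoZ.
under eq_Ex do rewrite exprMn.
rewrite ExZ; last by case: Lf.
under [X in 2 * X]eq_Ex do rewrite -mulrA.
rewrite ExZ; last exact: LtwoM.
move: (Ex _) (Ex _) (Ex _) => A B C H.
rewrite -(ler_pM2l c0) !mulrDr !mulrA divff ?gt_eqF//; lra.
Qed.

Lemma Ex_CS f g : Ltwo f -> Ltwo g ->
  Ex (fun x => f x * g x) ^+ 2 <= Ex (fun x => f x ^+ 2) * Ex (fun x => g x ^+ 2).
Proof.
move=> Lf Lg; set A := Ex (fun x => f x ^+ 2); set B := Ex (fun x => g x ^+ 2).
set C := Ex _; have A0 : 0 <= A by exact: Ex_sqr_ge0.
have B0 : 0 <= B by exact: Ex_sqr_ge0.
have key t : 0 <= A - 2 * t * C + t ^+ 2 * B.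
  have := Ex_sqr_ge0 (fun x => f x - t * g x).
  rewrite Ex_sqrB//; last exact: LtwoZ.
  under [X in _ + X]eq_Ex do rewrite exprMn.
  rewrite (@ExZ (t ^+ 2)); last by case: Lg.
  under [X in 2 * X]eq_Ex do rewrite mulrCA.
  by rewrite ExZ; [rewrite mulrA|exact: LtwoM].
have [B1|B1] := eqVneq B 0.
  have [->|C1] := eqVneq C 0; first by rewrite expr0n/= mulr_ge0.
  (* For B = 0 the quadratic in t is affine; this t gives it the value -1, which excludes C != 0. *)
  have := key ((A + 1) / (2 * C)); rewrite B1 mulr0 addr0.
  rewrite (_ : 2 * _ * C = A + 1); last by field.
  lra.
have B2 : 0 < B by rewrite lt_neqAle eq_sym B1.
have := key (C / B).
rewrite (_ : _ - _ + _ = (A * B - C ^+ 2) / B); last by field.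
by rewrite ler_pdivlMr// mul0r subr_ge0.
Qed.

Lemma ae_eq_Ltwo f g : measurable_fun setT g ->
  {ae mu, forall x, f x = g x} -> Ltwo f -> Ltwo g.
Proof.
move=> mg fg [mf Lf]; split=> //; apply: ae_eq_Lone Lf.
  exact: measurable_funX.
by apply: filterS fg => x /= ->.
Qed.

(** Both sides are double sums, and F i F j is at most (F i ^ 2 + F j ^ 2) / 2 term by term. *)
Lemma sqr_sum_le (I : finType) (F : I -> R) :
  (\sum_i F i) ^+ 2 <= #|I|%:R * \sum_i F i ^+ 2.
Proof.
have -> : #|I|%:R * \sum_i F i ^+ 2 = \sum_i \sum_j (F i ^+ 2 + F j ^+ 2) / 2.
  have e : \sum_(i : I) \sum_(j : I) F i ^+ 2 = #|I|%:R * \sum_i F i ^+ 2.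
    by rewrite mulr_sumr; apply: eq_bigr => i _; rewrite sumr_const mulr_natl.
  under [RHS]eq_bigr do rewrite -mulr_suml big_split/=.
  rewrite -mulr_suml big_split/= e exchange_big/= e.
  by move: (_ * _) => c; lra.
rewrite expr2 mulr_suml; apply: ler_sum => i _.
rewrite mulr_sumr; apply: ler_sum => j _.
by have := sqr_ge0 (F i - F j); nra.
Qed.

Lemma Ex_sqr_sum_le (I : finType) (F : I -> T -> R) : (forall i, Ltwo (F i)) ->
  Ex (fun x => (\sum_i F i x) ^+ 2) <= #|I|%:R * \sum_i Ex (fun x => F i x ^+ 2).
Proof.
move=> LF; rewrite -Ex_sum => [|i _]; last by case: (LF i).
have L : Lone (fun x => \sum_i F i x ^+ 2).
  by apply: Lone_sum => i _; case: (LF i).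
rewrite -ExZ//; apply: Ex_le => [||x]; last exact: sqr_sum_le.
  by have [] : Ltwo (fun x => \sum_i F i x) by exact: Ltwo_sum.
exact: LoneZ.
Qed.

End LebesgueSpaces.

Section Probability.
Context d (T : measurableType d) (R : realType) (P : probability T R).
Implicit Types f g : T -> R.

Lemma Lone_cst c : Lone P (fun=> c).
Proof. exact: finite_measure_integrable_cst. Qed.

Lemma Ex_cst c : Ex P (fun=> c) = c.
Proof.
rewrite /Ex Rintegral_cst// [X in fine X](_ : _ = 1%E) ?mulr1//.
exact: probability_setT.
Qed.

Lemma Lone_bounded c f : measurable_fun setT f -> (forall x, `|f x| <= c) ->
  Lone P f.
Proof. by move=> mf fc; apply: Lone_le (Lone_cst c). Qed.

Lemma Ltwo_cst c : Ltwo P (fun=> c).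
Proof. by split => //; exact: Lone_cst. Qed.

Lemma Ltwo_bounded c f : measurable_fun setT f -> (forall x, `|f x| <= c) ->
  Ltwo P f.
Proof.
move=> mf fc; apply: Ltwo_le (Ltwo_cst c) => // x.
by rewrite (le_trans (fc x))// ler_norm.
Qed.

Lemma Ltwo_Lone f : Ltwo P f -> Lone P f.
Proof. by move=> /(LtwoM (Ltwo_cst 1)); under eq_fun do rewrite mul1r. Qed.

Lemma Ex_sqr_le f : Ltwo P f -> Ex P f ^+ 2 <= Ex P (fun x => f x ^+ 2).
Proof.
move=> Lf; have := Ex_CS (Ltwo_cst 1) Lf.
under eq_Ex do rewrite mul1r.
by under [X in _ <= X * _]eq_Ex do rewrite expr1n; rewrite Ex_cst mul1r.
Qed.

End Probability.

(** * Euclidean and Hilbert-Schmidt norms *)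

Section EuclideanNorm.
Context {R : realType}.

Lemma sum_CS (I : finType) (a b : I -> R) :
  (\sum_i a i * b i) ^+ 2 <= (\sum_i a i ^+ 2) * (\sum_i b i ^+ 2).
Proof.
set A := \sum_i a i ^+ 2; set B := \sum_i b i ^+ 2; set C := \sum_i _.
have A0 : 0 <= A by apply: sumr_ge0 => i _; exact: sqr_ge0.
have B0 : 0 <= B by apply: sumr_ge0 => i _; exact: sqr_ge0.
have key s t : 0 <= s ^+ 2 * A - 2 * s * t * C + t ^+ 2 * B.
  have : 0 <= \sum_i (s * a i - t * b i) ^+ 2.
    by apply: sumr_ge0 => i _; exact: sqr_ge0.
  rewrite (_ : \sum_i _ = s ^+ 2 * A - 2 * s * t * C + t ^+ 2 * B)//.
  rewrite /A /B /C !mulr_sumr -sumrB -big_split/=.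
  by apply: eq_bigr => i _; ring.
have [B1|B1] := eqVneq B 0.
  have [->|C1] := eqVneq C 0; first by rewrite expr0n/= mulr_ge0.
  have := key 1 ((A + 1) / (2 * C)); rewrite B1 mulr0 addr0 expr1n mul1r mulr1.
  rewrite (_ : 2 * _ * C = A + 1); last by field.
  lra.
have B2 : 0 < B by rewrite lt_neqAle eq_sym B1.
have := key B C.
rewrite (_ : _ - _ + _ = B * (A * B - C ^+ 2)); last by ring.
by rewrite pmulr_rge0// subr_ge0.
Qed.

Lemma hsnorm_sqr m n (A : 'M[R]_(m, n)) :
  hsnorm A ^+ 2 = \sum_i \sum_j A i j ^+ 2.
Proof.
by rewrite sqr_sqrtr//; do 2 (apply: sumr_ge0 => ? _); exact: sqr_ge0.
Qed.

Lemma hsnorm_sqrv d (v : 'cV[R]_d) : hsnorm v ^+ 2 = \sum_i v i ord0 ^+ 2.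
Proof. by rewrite hsnorm_sqr; apply: eq_bigr => i _; rewrite big_ord1. Qed.

Lemma hsnorm_ge0 m n (A : 'M[R]_(m, n)) : 0 <= hsnorm A.
Proof. exact: sqrtr_ge0. Qed.

Lemma hsnorm0 m n : hsnorm (0 : 'M[R]_(m, n)) = 0.
Proof.
apply/eqP; rewrite -sqrf_eq0 hsnorm_sqr big1// => i _.
by rewrite big1// => j _; rewrite mxE expr0n.
Qed.

Lemma hsnormZ m n c (A : 'M[R]_(m, n)) : hsnorm (c *: A) = `|c| * hsnorm A.
Proof.
apply/eqP; rewrite -(@eqrXn2 _ 2) ?mulr_ge0 ?hsnorm_ge0//.
rewrite exprMn real_normK ?num_real// !hsnorm_sqr mulr_sumr; apply/eqP.
apply: eq_bigr => i _; rewrite mulr_sumr; apply: eq_bigr => j _.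
by rewrite mxE exprMn.
Qed.

Lemma hsnormN m n (A : 'M[R]_(m, n)) : hsnorm (- A) = hsnorm A.
Proof. by rewrite -scaleN1r hsnormZ normrN1 mul1r. Qed.

Lemma hsnorm_distC m n (A B : 'M[R]_(m, n)) : hsnorm (A - B) = hsnorm (B - A).
Proof. by rewrite -hsnormN opprB. Qed.

Lemma hs_entry_le m n (A : 'M[R]_(m, n)) i j : `|A i j| <= hsnorm A.
Proof.
rewrite -(@ler_pXn2r _ 2)// ?nnegrE ?hsnorm_ge0//.
rewrite real_normK ?num_real// hsnorm_sqr (bigD1 i)//= (bigD1 j)//= -!addrA lerDl.
apply: addr_ge0; first by apply: sumr_ge0 => ? _; exact: sqr_ge0.
by do 2 (apply: sumr_ge0 => ? _); exact: sqr_ge0.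
Qed.

Lemma hsnorm0_eq0 m n (A : 'M[R]_(m, n)) : hsnorm A = 0 -> A = 0.
Proof.
move=> A0; apply/matrixP => i j; rewrite mxE; apply/eqP.
by rewrite -normr_le0 -A0 hs_entry_le.
Qed.

Lemma ler_hsnormD m n (A B : 'M[R]_(m, n)) :
  hsnorm (A + B) <= hsnorm A + hsnorm B.
Proof.
rewrite -(@ler_pXn2r _ 2)// ?nnegrE ?addr_ge0 ?hsnorm_ge0//.
have CS : (\sum_i \sum_j A i j * B i j) <= hsnorm A * hsnorm B.
  apply: le_trans (ler_norm _) _.
  rewrite -(@ler_pXn2r _ 2)// ?nnegrE ?mulr_ge0 ?hsnorm_ge0//.
  rewrite real_normK ?num_real// exprMn !hsnorm_sqr !pair_big/=.
  exact: (sum_CS (fun p => A p.1 p.2) (fun p => B p.1 p.2)).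
have -> : hsnorm (A + B) ^+ 2 =
    hsnorm A ^+ 2 + 2 * (\sum_i \sum_j A i j * B i j) + hsnorm B ^+ 2.
  rewrite !hsnorm_sqr mulr_sumr -!big_split/=; apply: eq_bigr => i _.
  rewrite mulr_sumr -!big_split/=; apply: eq_bigr => j _.
  by rewrite mxE; ring.
lra.
Qed.

Definition dotv d (u v : 'cV[R]_d) : R := \sum_i u i ord0 * v i ord0.

Lemma dotv_le d (u v : 'cV[R]_d) : `|dotv u v| <= hsnorm u * hsnorm v.
Proof.
rewrite -(@ler_pXn2r _ 2)// ?nnegrE ?mulr_ge0 ?hsnorm_ge0//.
rewrite real_normK ?num_real// exprMn !hsnorm_sqrv.
exact: (sum_CS (fun i => u i ord0) (fun i => v i ord0)).
Qed.

Lemma dotvv d (u : 'cV[R]_d) : dotv u u = hsnorm u ^+ 2.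
Proof. by rewrite hsnorm_sqrv; apply: eq_bigr => i _; rewrite expr2. Qed.

Lemma hsnorm_mulmx_le m n (A : 'M[R]_(m, n)) (v : 'cV[R]_n) :
  hsnorm (A *m v) <= hsnorm A * hsnorm v.
Proof.
rewrite -(@ler_pXn2r _ 2)// ?nnegrE ?mulr_ge0 ?hsnorm_ge0//.
rewrite exprMn !hsnorm_sqrv hsnorm_sqr mulr_suml; apply: ler_sum => i _.
by rewrite mxE; exact: (sum_CS (fun j => A i j) (fun j => v j ord0)).
Qed.

Lemma hsnorm_trmx m n (A : 'M[R]_(m, n)) : hsnorm A^T = hsnorm A.
Proof.
apply/eqP; rewrite -(@eqrXn2 _ 2) ?hsnorm_ge0// !hsnorm_sqr exchange_big/=; apply/eqP.
by apply: eq_bigr => i _; apply: eq_bigr => j _; rewrite mxE.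
Qed.

Lemma hsnorm_le_sum d (v : 'cV[R]_d) : hsnorm v <= \sum_i `|v i ord0|.
Proof.
rewrite -(@ler_pXn2r _ 2)// ?nnegrE ?hsnorm_ge0//; last first.
  by apply: sumr_ge0 => i _.
rewrite hsnorm_sqrv [leRHS]expr2 mulr_suml; apply: ler_sum => i _.
rewrite -real_normK ?num_real// expr2 ler_wpM2l//.
by rewrite (bigD1 i)//= lerDl; apply: sumr_ge0 => j _.
Qed.

Section Ellipticity.
Context d (A : 'M[R]_d) (lam : R) (lam0 : 0 < lam).
Hypothesis elliptic : loewner_le lam%:M A.

(** Cauchy-Schwarz applied to lam |v|^2 <= v . A v. *)
Lemma elliptic_lower (v : 'cV[R]_d) : lam * hsnorm v <= hsnorm (A *m v).
Proof.
have := elliptic v; rewrite mulmxBr mulmxBl mxE [X in _ + X]mxE subr_ge0.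
rewrite -mulmxA mul_scalar_mx -scalemxAr mxE [X in _ * X](_ : _ = hsnorm v ^+ 2); last first.
  by rewrite mxE -dotvv; apply: eq_bigr => i _; rewrite mxE.
rewrite -mulmxA (_ : (_ *m _) _ _ = dotv v (A *m v)); last first.
  by rewrite mxE; apply: eq_bigr => i _; rewrite mxE.
move=> H; have := le_trans H (le_trans (ler_norm _) (dotv_le _ _)).
have [v0|v0] := eqVneq (hsnorm v) 0; first by rewrite v0 !mulr0 hsnorm_ge0.
have v1 : 0 < hsnorm v by rewrite lt_neqAle eq_sym v0 hsnorm_ge0.
by rewrite expr2 mulrA [leRHS]mulrC ler_pM2r.
Qed.

Lemma elliptic_unit : A \in unitmx.
Proof.
rewrite -unitmx_tr -row_free_unit -kermx_eq0; apply/eqP/row_matrixP => i; rewrite row0.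
set u := row i _; have uA : u *m A^T = 0.
  by apply/sub_kermxP; rewrite row_sub.
have : A *m u^T = 0 by rewrite -[A]trmxK -trmx_mul uA trmx0.
move=> /(congr1 (fun z => hsnorm z)); rewrite hsnorm0 => H.
have := elliptic_lower u^T; rewrite H pmulr_rle0// => H1.
apply: (can_inj (@trmxK _ _ _)); rewrite trmx0; apply: hsnorm0_eq0.
by apply/eqP; rewrite eq_le H1 hsnorm_ge0.
Qed.

(** Converts a displacement v in space into a displacement of the noise, whose norm is at most |v| /
    lam. *)
Lemma elliptic_inv (v : 'cV[R]_d) :
  A *m (invmx A *m v) = v /\ hsnorm (invmx A *m v) <= hsnorm v / lam.
Proof.
have E : A *m (invmx A *m v) = v by rewrite mulmxA mulmxV ?mul1mx ?elliptic_unit.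
split=> //; rewrite ler_pdivlMr// mulrC.
by have := elliptic_lower (invmx A *m v); rewrite E.
Qed.

End Ellipticity.

(** Polarisation: the form at e_i + e_j and e_i - e_j is at most 4 Lam, its diagonal values are
    nonnegative, and symmetry identifies the two mixed terms. The bound makes frozen diffusion
    coefficients admissible as bounded integrands. *)
Lemma loewner_entry_bounded d (A : 'M[R]_d) (lam Lam : R) :
  A \is symmetricmx -> 0 <= lam -> loewner_le lam%:M A -> loewner_le A Lam%:M ->
  forall i j, `|A i j| <= 2 * Lam.
Proof.
move=> symA lam0 lo hi.
have qE (M : 'M[R]_d) (v : 'cV[R]_d) : (v^T *m M *m v) ord0 ord0 = dotv v (M *m v).
  by rewrite -mulmxA mxE; apply: eq_bigr => i _; rewrite mxE.
have scal c (v : 'cV[R]_d) : dotv v (c%:M *m v) = c * hsnorm v ^+ 2.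
  rewrite mul_scalar_mx -dotvv /dotv mulr_sumr; apply: eq_bigr => i _.
  by rewrite mxE mulrCA.
have dB (u v w : 'cV[R]_d) : dotv u (v - w) = dotv u v - dotv u w.
  by rewrite /dotv -sumrB; apply: eq_bigr => i _; rewrite !mxE mulrBr.
have q v : 0 <= dotv v (A *m v) <= Lam * hsnorm v ^+ 2.
  apply/andP; split.
    have := lo v; rewrite qE mulmxBl dB scal subr_ge0.
    by apply: le_trans; rewrite mulr_ge0// sqr_ge0.
  by have := hi v; rewrite qE mulmxBl dB scal subr_ge0.
pose e i : 'cV[R]_d := delta_mx i ord0.
have ne i : hsnorm (e i) = 1.
  apply/eqP; rewrite -(@eqrXn2 _ 2) ?hsnorm_ge0// hsnorm_sqrv expr1n.
  rewrite (bigD1 i)//= mxE !eqxx expr1n big1 ?addr0// => k ki.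
  by rewrite mxE (negbTE ki) expr0n.
have eE i j : dotv (e i) (A *m e j) = A i j.
  rewrite -colE /dotv (bigD1 i)//= !mxE !eqxx mul1r big1 ?addr0// => k ki.
  by rewrite !mxE (negbTE ki) mul0r.
move=> i j.
have Aij : A j i = A i j.
  by move: symA; rewrite qualifE/= => /eqP E; rewrite [in LHS]E !mxE expr0 mul1r.
have E c : dotv (e i + c *: e j) (A *m (e i + c *: e j)) =
    A i i + c * (A i j + A j i) + c ^+ 2 * A j j.
  rewrite -!eE /dotv mulrDr !mulr_sumr -!big_split/=; apply: eq_bigr => k _.
  by rewrite mulmxDr -scalemxAr !mxE; ring.
have n2 c : `|c| = 1 -> hsnorm (e i + c *: e j) ^+ 2 <= 4.
  move=> c1; rewrite (_ : 4 = 2 ^+ 2); last by ring.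
  rewrite ler_pXn2r ?nnegrE ?hsnorm_ge0//.
  by rewrite (le_trans (ler_hsnormD _ _))// hsnormZ c1 mul1r !ne; lra.
have Lam0 : 0 <= Lam by have := q (e i); rewrite ne expr1n mulr1 => /andP[/le_trans]; apply.
have /andP[a1 a2] := q (e i + 1 *: e j).
have /andP[b1 b2] := q (e i + (-1) *: e j).
have a3 : Lam * hsnorm (e i + 1 *: e j) ^+ 2 <= Lam * 4.
  by rewrite ler_wpM2l// n2 ?normr1.
have b3 : Lam * hsnorm (e i + (-1) *: e j) ^+ 2 <= Lam * 4.
  by rewrite ler_wpM2l// n2 ?normrN1.
have := le_trans a2 a3; have := le_trans b2 b3; move: a1 b1.
have /andP[c1 _] := q (e i); have /andP[d1 _] := q (e j).
move: c1 d1; rewrite !eE !E Aij ler_norml => ? ? ? ? ? ?.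
apply/andP; split; lra.
Qed.

End EuclideanNorm.

(** * Continuity and Borel measurability on Euclidean space *)

Section MeasurableVectors.
Context {R : realType} {n : nat}.
Implicit Types (F : 'cV[R]_n -> R) (S : 'cV[R]_n -> 'cV[R]_n).

Definition coord_measurable d (T : measurableType d) (V : T -> 'cV[R]_n) :=
  forall i, measurable_fun setT (fun w => V w i ord0).

(* Borel measurability on R^n, phrased through test maps because column
   vectors carry no measurable structure in the library. *)
Definition vmeasurable F := forall d (T : measurableType d) (V : T -> 'cV[R]_n),
  coord_measurable V -> measurable_fun setT (fun w => F (V w)).

Lemma continuous_hs F : continuous F <-> forall (x : 'cV[R]_n) (e : R), 0 < e ->
  exists2 r : R, 0 < r & forall y : 'cV[R]_n, hsnorm (x - y) < r -> `|F x - F y| < e.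
Proof.
split.
  move=> cF x e e0.
  have FF : Filter (nbhs x) by exact: (@nbhs_filter 'cV[R^o]_n x).
  have /(@cvgrPdist_lt _ _ _ (nbhs x) FF F (F x))/(_ e e0) := cF x.
  move=> /nbhs_ballP[r/= r0 rF]; exists r => // y xy.
  apply: rF; split=> // i j; rewrite (ord1 j) /ball/=.
  have := hs_entry_le (x - y) i ord0; rewrite !mxE => H.
  exact: le_lt_trans H xy.
move=> H x.
have FF : Filter (nbhs x) by exact: (@nbhs_filter 'cV[R^o]_n x).
apply/(@cvgrPdist_lt _ _ _ (nbhs x) FF F (F x)) => e e0; have [r r0 rF] := H x e e0.
(* The Euclidean norm is at most the sum of the n entries; n + 1 instead of n also covers the empty
   vector. *)
apply/nbhs_ballP; exists (r / (n%:R + 1)) => /=; first by rewrite divr_gt0.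
move=> y [_ xy]; apply: rF; apply: le_lt_trans (hsnorm_le_sum _) _.
apply: (@le_lt_trans _ _ (\sum_(i < n) (r / (n%:R + 1)))).
  apply: ler_sum => i _; rewrite !mxE; apply: ltW.
  exact: (xy i ord0).
rewrite sumr_const card_ord -[X in X < _]mulr_natl mulrA ltr_pdivrMr//.
by rewrite mulrC ltr_pM2l// ltrDl.
Qed.

Lemma lipschitz_continuous F c :
  (forall x y, `|F x - F y| <= c * hsnorm (x - y)) -> continuous F.
Proof.
move=> H; apply/continuous_hs => x e e0.
exists (e / (`|c| + 1)); first by rewrite divr_gt0// ltr_wpDl.
move=> y xy; apply: le_lt_trans (H x y) _.
have c1 : 0 < `|c| + 1 by rewrite ltr_wpDl.
apply: (@le_lt_trans _ _ ((`|c| + 1) * hsnorm (x - y))).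
  rewrite ler_wpM2r ?hsnorm_ge0// (le_trans (ler_norm _))// lerDl//.
by rewrite mulrC -ltr_pdivlMr.
Qed.

Lemma measurable_countable_range d (T : measurableType d) (K : countType)
    (W : T -> K) (h : K -> R) :
  (forall z, measurable [set w | W w = z]) -> measurable_fun setT (fun w => h (W w)).
Proof.
move=> mW _ C mC; rewrite setTI.
rewrite (_ : _ @^-1` C = \bigcup_k
   (if unpickle k is Some z then if `[< C (h z) >] then [set w | W w = z] else set0
    else set0)); last first.
  apply/seteqP; split => w /=.
    move=> Cw; exists (pickle (W w)) => //=; rewrite pickleK.
    by case: asboolP.
  move=> [k _]; case: unpickle => //= z; by case: asboolP => //= Cz ->.
by apply: bigcup_measurable => k _; case: unpickle => // z; case: ifP.
Qed.

(** [F (V w)] is the limit of F at V rounded down to the grid of mesh 1 / (k + 1), and the rounded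
    vector takes countably many values. *)
Lemma continuous_vmeasurable F : continuous F -> vmeasurable F.
Proof.
move=> /continuous_hs cF d T V mV.
pose W k w : {ffun 'I_n -> int} := [ffun i => Num.floor (k.+1%:R * V w i ord0)].
pose h k (z : {ffun 'I_n -> int}) := F (\col_i ((z i)%:~R / k.+1%:R)).
apply: (@measurable_fun_cvg _ _ _ _ (fun k w => h k (W k w))).
  move=> k; apply: measurable_countable_range => z.
  rewrite (_ : [set w | _] =
      \bigcap_(i in [set: 'I_n]) [set w | Num.floor (k.+1%:R * V w i ord0) = z i]).
    apply: fin_bigcap_measurable; first exact: finite_finset.
    move=> i _.
    rewrite (_ : [set w | _] =
      (fun w => k.+1%:R * V w i ord0) @^-1` `[(z i)%:~R, (z i + 1)%:~R[%classic); last first.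
      apply/seteqP; split => w /=; rewrite in_itv/=.
        by move=> <-; exact: (real_floor_itv (num_real _)).
      by move=> H; exact: floor_def.
    rewrite -[X in measurable X]setTI.
    have mk : measurable_fun setT (fun w => k.+1%:R * V w i ord0).
      by apply: measurable_funM => //; exact: mV.
    by apply: mk.
  apply/seteqP; split => w /=; first by move=> <- i _ /=; rewrite ffunE.
  by move=> H; apply/ffunP => i; rewrite ffunE; exact: H.
move=> w _; apply/cvgrPdist_lt => e e0; have [r r0 rF] := cF (V w) e e0.
near=> k; rewrite /h; apply: rF; apply: le_lt_trans (hsnorm_le_sum _) _.
apply: (@le_lt_trans _ _ (\sum_(i < n) k.+1%:R^-1)).
  apply: ler_sum => i _; rewrite !mxE ffunE.
  have /andP[] := real_floor_itv (num_real (k.+1%:R * V w i ord0)).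
  rewrite intrD; set z : R := (Num.floor _)%:~R; set y : R := V w i ord0.
  set c : R := k.+1%:R; rewrite ![c * y]mulrC => f1 f2.
  have c0 : 0 < c by rewrite /c.
  have q1 : z / c <= y by rewrite ler_pdivrMr.
  have q2 : y <= z / c + c^-1.
    by rewrite -[X in _ + X]mul1r -mulrDl ler_pdivlMr// ltW.
  have : 0 <= c^-1 by rewrite invr_ge0 ltW.
  rewrite ler_norml => cv; rewrite lerBlDl q2 andbT.
  by apply: (@le_trans _ _ 0); rewrite ?oppr_le0// subr_ge0.
rewrite sumr_const card_ord -[X in X < _]mulr_natl ltr_pdivrMr//.
rewrite -ltr_pdivrMl// -natr1 -ltrBlDr.
near: k; exact: nbhs_infty_gtr.
Unshelve. all: by end_near. Qed.

Lemma vmeasurable_coord i : vmeasurable (fun v => v i ord0).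
Proof. by move=> d T V mV; exact: mV. Qed.

Lemma vmeasurable_cst c : vmeasurable (fun=> c).
Proof. by move=> d T V mV; exact: measurable_cst. Qed.

Lemma vmeasurableD F G : vmeasurable F -> vmeasurable G -> vmeasurable (fun v => F v + G v).
Proof.
by move=> mF mG d T V mV; apply: measurable_funD; [exact: mF|exact: mG].
Qed.

Lemma vmeasurableM F G : vmeasurable F -> vmeasurable G -> vmeasurable (fun v => F v * G v).
Proof.
by move=> mF mG d T V mV; apply: measurable_funM; [exact: mF|exact: mG].
Qed.

Lemma vmeasurableB F G : vmeasurable F -> vmeasurable G -> vmeasurable (fun v => F v - G v).
Proof.
by move=> mF mG d T V mV; apply: measurable_funB; [exact: mF|exact: mG].
Qed.

Lemma vmeasurable_sum (I : Type) (s : seq I) (G : I -> 'cV[R]_n -> R) :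
  (forall i, vmeasurable (G i)) -> vmeasurable (fun v => \sum_(i <- s) G i v).
Proof.
by move=> mG d T V mV; apply: measurable_sum => i; exact: mG.
Qed.

Lemma vmeasurable_comp F (g : R -> R) : measurable_fun setT g -> vmeasurable F ->
  vmeasurable (fun v => g (F v)).
Proof. by move=> mg mF d T V mV; exact: (measurableT_comp mg (mF _ _ _ mV)). Qed.

Lemma vmeasurable_vcomp F S : (forall i, vmeasurable (fun v => S v i ord0)) ->
  vmeasurable F -> vmeasurable (fun v => F (S v)).
Proof. by move=> mS mF d T V mV; apply: mF => i; exact: mS. Qed.

Lemma vmeasurable_affine (c : 'cV[R]_n) (A : 'M[R]_n) i :
  vmeasurable (fun v => (c + A *m v) i ord0).
Proof.
move=> d T V mV; under eq_fun do rewrite !mxE.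
apply: measurable_funD => //; apply: measurable_sum => j.
by apply: measurable_funM => //; exact: mV.
Qed.

End MeasurableVectors.

(** * Measurable functions of random vectors *)

Section NormalShift.
Context {R : realType}.
Local Open Scope ereal_scope.
Notation leb := (@lebesgue_measure R).

(** Lebesgue measure is determined by its values on half-open intervals, which a translation
    preserves. *)
Lemma ge0_integral_shift (a : R) (F : R -> \bar R) :
  measurable_fun setT F -> (forall x, 0 <= F x) ->
  \int[leb]_x F (x + a)%R = \int[leb]_x F x.
Proof.
move=> mF F0.
have ms : measurable_fun (setT : set R) (fun x : R => x + a)%R.
  exact: measurable_funD.
have E A : measurable A -> leb A = pushforward leb (fun x : R => x + a)%R A.
  move=> mA.
  transitivity (pushforward leb (fun x : R => x + a : measurableTypeR R)%R A) => //.
  move: A mA; apply: lebesgue_measure_unique => //= _ [[b c]] _ <-.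
  rewrite /pushforward.
  have -> : (fun x : R => x + a)%R @^-1` `]b, c] = `](b - a)%R, (c - a)%R]%classic.
    by apply/seteqP; split => x /=; rewrite !in_itv/= ltrBlDr lerBrDr.
  rewrite !lebesgue_measure_itv/= !lte_fin ltrD2r.
  by case: ifP => // _; rewrite -!EFinD; congr EFin; ring.
transitivity (\int[pushforward leb (fun x : R => x + a : measurableTypeR R)%R]_x F x).
  by rewrite ge0_integral_pushforward.
by apply: eq_measure_integral => A mA _; exact/esym/E.
Qed.

Variables (s : R) (s0 : s != 0%R).

(** The Radon-Nikodym derivative of the normal law and the explicit density have the same integral
    over every measurable set, hence agree almost everywhere. *)
Lemma ge0_integral_normal (F : R -> \bar R) :
  measurable_fun setT F -> (forall x, 0 <= F x) ->
  \int[normal_prob 0%R s]_x F x = \int[leb]_x (F x * (normal_pdf 0 s x)%:E).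
Proof.
move=> mF F0.
have mpdf : measurable_fun (setT : set R) (fun x => (normal_pdf 0 s x)%:E).
  apply/measurable_EFinP; exact: (@measurable_normal_pdf R 0 s).
have dom := normal_prob_dominates 0 s.
rewrite -(Radon_Nikodym_SigmaFinite.change_of_variables dom)//.
have mf : measurable_fun setT (Radon_Nikodym_SigmaFinite.f (normal_prob 0%R s) leb).
  exact: measurable_int (Radon_Nikodym_SigmaFinite.f_integrable dom).
apply: ae_eq_integral => //.
- exact: emeasurable_funM.
- exact: (emeasurable_funM mF mpdf).
have : ae_eq leb setT (Radon_Nikodym_SigmaFinite.f (normal_prob 0%R s) leb)
    (EFin \o normal_pdf 0 s).
  apply: integral_ae_eq => //.
  - exact: Radon_Nikodym_SigmaFinite.f_integrable.
  - by move=> A _ mA; rewrite -Radon_Nikodym_SigmaFinite.f_integral.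
by apply: filterS => x /= H _; rewrite H.
Qed.

(** One-dimensional Cameron-Martin formula: translate Lebesgue measure and complete the square in
    the density. *)
Lemma ge0_integral_normal_shift (a : R) (F : R -> \bar R) :
  measurable_fun setT F -> (forall x, 0 <= F x) ->
  \int[normal_prob 0%R s]_x F (x + a)%R =
  \int[normal_prob 0%R s]_x
     (F x * (expR (a * x / s ^+ 2 - a ^+ 2 / (2 * s ^+ 2)))%:E).
Proof.
move=> mF F0.
have ms : measurable_fun (setT : set R) (fun x : R => x + a)%R.
  exact: measurable_funD.
have mpdf : measurable_fun (setT : set R) (fun x => (normal_pdf 0 s x)%:E).
  apply/measurable_EFinP; exact: (@measurable_normal_pdf R 0 s).
have mrho : measurable_fun (setT : set R)
    (fun x => (expR (a * x / s ^+ 2 - a ^+ 2 / (2 * s ^+ 2)))%:E).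
  apply/measurable_EFinP/measurableT_comp => //; apply: measurable_funB => //.
  by apply: measurable_funM => //; exact: measurable_funM.
rewrite !ge0_integral_normal//; last 3 first.
- exact: (emeasurable_funM mF mrho).
- by move=> x; rewrite mule_ge0// lee_fin expR_ge0.
- exact: (measurableT_comp mF ms).
rewrite -(@ge0_integral_shift (- a)); last 2 first.
- exact: (emeasurable_funM (measurableT_comp mF ms) mpdf).
- by move=> x; rewrite mule_ge0// lee_fin normal_pdf_ge0.
apply: eq_integral => x _; rewrite subrK -muleA -EFinM; congr (_ * _%:E).
rewrite !normal_pdfE// mulrCA; congr (_ * _)%R.
rewrite /normal_fun -expRD; congr expR; rewrite !subr0 -mulr_natl.
by field.
Qed.

End NormalShift.

(** * Freezing formula for independent maps *)

Section Independence.
Context d (T : measurableType d) (R : realType) (P : probability T R).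
Context d1 d2 (T1 : measurableType d1) (T2 : measurableType d2).
Variables (X : T -> T1) (Y : T -> T2).
Hypotheses (mX : measurable_fun setT X) (mY : measurable_fun setT Y).

(** Taking for X the identity into Omega with a smaller sigma-algebra expresses independence from
    that sigma-algebra; this is how the past of the Brownian motion enters later. *)
Definition independent_maps := forall A B, measurable A -> measurable B ->
  P (X @^-1` A `&` Y @^-1` B) = (P (X @^-1` A) * P (Y @^-1` B))%E.

Hypothesis indep : independent_maps.

Let mXf : {mfun T >-> T1} := mfun_Sub (mem_set mX).
Let mYf : {mfun T >-> T2} := mfun_Sub (mem_set mY).
Let mXY : measurable_fun setT (fun w => (X w, Y w)).
Proof. exact/measurable_fun_pairP. Qed.
Let XY : {mfun T >-> (T1 * T2)%type} := mfun_Sub (mem_set mXY).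

Let joint A : measurable A ->
  (distribution P mXf \x distribution P mYf)%E A = distribution P XY A.
Proof.
move=> mA; apply: product_measure_unique => // B C mB mC.
Qed.

(** The law of the pair is the product of the laws, so Tonelli applies. Freezing plays the role of
    conditional expectation throughout. *)
Lemma independent_freeze_ge0 (Psi : T1 * T2 -> \bar R) :
  measurable_fun setT Psi -> (forall z, 0 <= Psi z)%E ->
  (\int[P]_w Psi (X w, Y w) = \int[P]_w \int[P]_w' Psi (X w, Y w'))%E.
Proof.
move=> mPsi Psi0.
transitivity (\int[distribution P XY]_z Psi z)%E.
  by rewrite ge0_integral_distribution.
rewrite (eq_measure_integral (distribution P mXf \x distribution P mYf)%E); last first.
  by move=> A mA _; exact/esym/joint.
rewrite fubini_tonelli1// ge0_integral_distribution//; last 2 first.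
- exact: measurable_fun_fubini_tonelli_F.
- by move=> x; apply: integral_ge0 => y _.
apply: eq_integral => w _ /=; rewrite /fubini_F ge0_integral_distribution//.
exact: measurableT_comp.
Qed.

Let integral_distributionE (f : T2 -> \bar R) : measurable_fun setT f ->
  (\int[distribution P mYf]_y f y = \int[P]_w f (Y w))%E.
Proof.
move=> mf; rewrite [LHS]integralE [RHS]integralE.
rewrite !ge0_integral_distribution//; [|exact: measurable_funeneg|exact: measurable_funepos].
have -> : (fun x0 => f (Y x0)) = f \o mYf by [].
by congr (_ - _)%E; apply: eq_integral => w _; rewrite ?(funepos_comp f mYf) ?(funeneg_comp f mYf).
Qed.

Lemma independent_freeze (Psi : T1 * T2 -> R) : measurable_fun setT Psi ->
  Lone P (fun w => Psi (X w, Y w)) ->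
  Ex P (fun w => Psi (X w, Y w)) = Ex P (fun w => Ex P (fun w' => Psi (X w, Y w'))).
Proof.
move=> mPsi LPsi; set prodm := (distribution P mXf \x distribution P mYf)%E.
have mE : measurable_fun setT (EFin \o Psi) by exact/measurable_EFinP.
have ieq f : (\int[prodm]_z f z = \int[distribution P XY]_z f z)%E.
  rewrite (eq_measure_integral (distribution P XY))// => A mA _.
  exact: joint.
have iPsi : prodm.-integrable setT (EFin \o Psi).
  have : (distribution P XY).-integrable setT (EFin \o Psi).
    exact: integrable_pushforward.
  by move=> /integrableP[_ lt]; apply/integrableP; split => //; rewrite ieq.
have mF := measurable_fubini_F iPsi.
have iF : P.-integrable setT (fun w => fubini_F (distribution P mYf) (EFin \o Psi) (X w)).
  have /integrableP[_ lt] := integrable_fubini_F iPsi.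
  apply/integrableP; split; first exact: measurableT_comp mF mX.
  rewrite ge0_integral_distribution// in lt.
  exact: measurableT_comp.
have FE w : fubini_F (distribution P mYf) (EFin \o Psi) (X w) =
    (\int[P]_w' (Psi (X w, Y w'))%:E)%E.
  by rewrite /fubini_F integral_distributionE//; exact: measurableT_comp.
rewrite /Ex /Rintegral; congr fine.
transitivity (\int[prodm]_z (EFin \o Psi) z)%E.
  by rewrite ieq integral_distribution.
rewrite -integral12_prod_meas1//.
transitivity (\int[P]_w fubini_F (distribution P mYf) (EFin \o Psi) (X w))%E.
  by rewrite integral_distribution.
(* The inner integral may be infinite on a null set, where [fine] returns 0; elsewhere the two
   integrands agree. *)
apply: ae_eq_integral => //.
- exact: measurable_int iF.
- apply/measurable_EFinP; under eq_fun do rewrite -FE.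
  by apply: measurableT_comp => //; exact: measurable_int iF.
- have := integrable_ae measurableT iF; apply: filterS => w /= /(_ I) fw _.
  by rewrite -FE fineK.
Qed.

End Independence.

(** * Independence and Gaussian vectors *)

Section IndependentProduct.
Context d (T : measurableType d) (R : realType) (P : probability T R).
Context d1 d2 (T1 : measurableType d1) (T2 : measurableType d2).
Variables (X : T -> T1) (Y : T -> T2).
Hypotheses (mX : measurable_fun setT X) (mY : measurable_fun setT Y).
Hypothesis indep : independent_maps P X Y.
Variables (f : T1 -> R) (g : T2 -> R).
Hypotheses (mf : measurable_fun setT f) (mg : measurable_fun setT g).
Hypotheses (Lf : Lone P (fun w => f (X w))) (Lg : Lone P (fun w => g (Y w))).

Let mfg : measurable_fun setT (fun z : T1 * T2 => f z.1 * g z.2).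
Proof.
by apply: measurable_funM; [exact: measurableT_comp mf _|exact: measurableT_comp mg _].
Qed.

Lemma independent_Lone : Lone P (fun w => f (X w) * g (Y w)).
Proof.
have Mfg : measurable_fun setT (fun w => f (X w) * g (Y w)).
  by apply: measurable_funM; [exact: Lone_meas Lf|exact: Lone_meas Lg].
apply/integrableP; split; first exact/measurable_EFinP.
pose Psi (z : T1 * T2) : \bar R := EFin (`|f z.1| * `|g z.2| : R).
have E1 : (\int[P]_w `|(EFin \o (fun w => f (X w) * g (Y w))%R) w| =
    \int[P]_w Psi (X w, Y w))%E.
  by apply: eq_integral => w _; rewrite /Psi /= normrM.
rewrite E1 (independent_freeze_ge0 mX mY indep); last 2 first.
- apply/measurable_EFinP; rewrite (_ : (fun _ => _) = Num.norm \o (fun z => f z.1 * g z.2)).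
    by apply: measurableT_comp.
  by apply/funext => z; rewrite /= normrM.
- by move=> z; rewrite lee_fin mulr_ge0.
have Ng := EFin_Ex (Lone_norm Lg).
have E2 : (\int[P]_w \int[P]_w' Psi (X w, Y w') =
  \int[P]_w (Ex P (fun w' => `|g (Y w')|) * `|f (X w)|)%:E)%E.
  apply: eq_integral => w _; rewrite /Psi EFinM Ng/=.
  rewrite muleC -ge0_integralZl//; last exact/measurable_EFinP/(Lone_meas (Lone_norm Lg)).
rewrite E2 -EFin_Ex ?ltry//; apply: LoneZ; exact: Lone_norm.
Qed.

Lemma independent_Ex_mul :
  Ex P (fun w => f (X w) * g (Y w)) = Ex P (fun w => f (X w)) * Ex P (fun w => g (Y w)).
Proof.
rewrite (independent_freeze mX mY indep (Psi := fun z => f z.1 * g z.2))//=; last first.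
  exact: independent_Lone.
under eq_Ex do rewrite ExZ// mulrC.
by rewrite ExZ// mulrC.
Qed.

End IndependentProduct.

Section PiSystem.
Context d (T : measurableType d) (R : realType) (P : probability T R).

(** As functions of A, both sides are finite measures; they agree on a pi-system containing the
    whole space, hence on the sigma-algebra it generates. *)
Lemma indep_generated (G : set (set T)) (B : set T) :
  G `<=` measurable -> setI_closed G -> G setT -> measurable B ->
  (forall A, G A -> P (A `&` B) = (P A * P B)%E) ->
  forall A, <<s G >> A -> P (A `&` B) = (P A * P B)%E.
Proof.
move=> Gm GI GT mB GB A GA.
have pB : (0 <= fine (P B)) by exact: fine_ge0.
have EB C : (mscale (NngNum pB) P C = P C * P B)%E.
  by rewrite /mscale/= fineK ?fin_num_measure// muleC.
rewrite -EB; change (mrestr P mB A = mscale (NngNum pB) P A).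
apply: (g_sigma_algebra_measure_unique G Gm (fun=> setT)) GA => //.
- by rewrite bigcup_const//; exists 0%N.
- move=> C GC; change (P (C `&` B) = mscale (NngNum pB) P C).
  by rewrite EB GB.
- by move=> k; rewrite -ge0_fin_numE// fin_num_measure.
Qed.

Variable G : set (set T).

Lemma sub_sigma_id : <<s G >> `<=` measurable ->
  measurable_fun setT (id : T -> g_sigma_algebraType G).
Proof. by move=> Gm _ A mA; rewrite setTI; exact: Gm. Qed.

Lemma sub_sigma_meas d' (U : measurableType d') (f : T -> U) :
  <<s G >> `<=` measurable ->
  measurable_fun setT (f : g_sigma_algebraType G -> U) -> measurable_fun setT f.
Proof.
by move=> Gm mf; exact: (measurableT_comp mf (sub_sigma_id Gm)).
Qed.

Lemma sigma_sub_measurable : G `<=` measurable -> <<s G >> `<=` measurable.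
Proof.
by move=> Gm; apply: smallest_sub => //; exact: sigma_algebra_measurable.
Qed.

End PiSystem.

(** * Gaussian vectors: translation formula and moments *)

Section GaussianVectors.
Context dd (T : measurableType dd) (R : realType) (P : probability T R).
Context (d : nat) (h : R).

(** The law N(0, h I) described on boxes, the form in which Brownian increments deliver it. *)
Definition gaussian_vector (z : T -> 'cV[R]_d) :=
  coord_measurable z /\
  forall C : 'I_d -> set R, (forall i, measurable (C i)) ->
    P [set w | forall i, C i (z w i ord0)] =
    (\prod_(i < d) normal_prob 0 (Num.sqrt h) (C i))%E.

Variable z : T -> 'cV[R]_d.
Hypotheses (h0 : 0 < h) (Gz : gaussian_vector z).

Let mz : coord_measurable z. Proof. by case: Gz. Qed.
Let s0 : Num.sqrt h != 0. Proof. by rewrite gt_eqF// sqrtr_gt0. Qed.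
Let s2 : Num.sqrt h ^+ 2 = h. Proof. by rewrite sqr_sqrtr// ltW. Qed.

Lemma gaussian_marginal i C : measurable C ->
  P ((fun w => z w i ord0) @^-1` C) = normal_prob 0 (Num.sqrt h) C.
Proof.
move=> mC; pose D j := if j == i then C else setT.
have -> : (fun w => z w i ord0) @^-1` C = [set w | forall j, D j (z w j ord0)].
  apply/seteqP; split => w /=.
    by move=> Cw j; rewrite /D; case: eqP => // ->.
  by move=> /(_ i); rewrite /D eqxx.
rewrite Gz.2; last by move=> j; rewrite /D; case: ifP.
rewrite (bigD1 i)//= /D eqxx big1 ?mule1// => j /negbTE ->.
exact: probability_setT.
Qed.

Lemma ge0_integral_gaussian i (F : R -> \bar R) : measurable_fun setT F ->
  (forall x, 0 <= F x)%E ->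
  (\int[P]_w F (z w i ord0) = \int[normal_prob 0 (Num.sqrt h)]_x F x)%E.
Proof.
move=> mF F0.
transitivity (\int[pushforward P (fun w => z w i ord0 : measurableTypeR R)]_x F x)%E.
  have mzi : measurable_fun setT (fun w => z w i ord0 : measurableTypeR R).
    exact: mz.
  by rewrite (ge0_integral_pushforward mzi).
apply: eq_measure_integral => [|mz' A mA _]; first exact: mz.
exact: (gaussian_marginal i mA).
Qed.

Definition other_cylinders (i : 'I_d) : set (set T) :=
  [set A | exists2 C : 'I_d -> set R, forall j, measurable (C j) &
     A = [set w | forall j, j != i -> C j (z w j ord0)]].

Lemma measurable_cylinder (Q : pred 'I_d) (C : 'I_d -> set R) :
  (forall j, measurable (C j)) -> measurable [set w | forall j, Q j -> C j (z w j ord0)].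
Proof.
move=> mC.
rewrite (_ : [set w | _] = \bigcap_(j in [set` Q]) ((fun w => z w j ord0) @^-1` C j)).
  apply: fin_bigcap_measurable; first exact: finite_finset.
  by move=> j _; rewrite -[X in measurable X]setTI; apply: mz.
by apply/seteqP; split => w /= H j; exact: H.
Qed.

Lemma other_cylinders_measurable i : <<s other_cylinders i >> `<=` measurable.
Proof.
apply: sigma_sub_measurable => A [C mC ->].
exact: measurable_cylinder.
Qed.

(** The probability of a box factorises; the full line in coordinate i (E1) identifies the product
    of the remaining factors with the probability of the cylinder. *)
Lemma coord_independent i : independent_maps P
  (id : T -> g_sigma_algebraType (other_cylinders i)) (fun w => z w i ord0).
Proof.
move=> A B mA mB.
have mB' : measurable ((fun w => z w i ord0) @^-1` B).
  by rewrite -[X in measurable X]setTI; apply: mz.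
apply: (indep_generated (G := other_cylinders i)) => //.
- by move=> C [D mD ->]; exact: measurable_cylinder.
- move=> _ _ [C mC ->] [D mD ->]; exists (fun j => C j `&` D j).
    by move=> j; exact: measurableI.
  apply/seteqP; split => w /=; first by case=> H K j ji; split; [exact: H|exact: K].
  by move=> H; split=> j ji; case: (H j ji).
- by exists (fun=> setT) => //; apply/seteqP; split.
move=> _ [C mC ->].
pose D (E : set R) j := if j == i then E else C j.
have mD E : measurable E -> forall j, measurable (D E j).
  by move=> mE j; rewrite /D; case: ifP.
have PE E : measurable E -> P ([set w | forall j, j != i -> C j (z w j ord0)] `&`
    (fun w => z w i ord0) @^-1` E) =
    (normal_prob 0 (Num.sqrt h) E * \prod_(j < d | j != i) normal_prob 0 (Num.sqrt h) (C j))%E.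
  move=> mE.
  have -> : [set w | forall j, j != i -> C j (z w j ord0)] `&`
    (fun w => z w i ord0) @^-1` E = [set w | forall j, D E j (z w j ord0)].
    apply/seteqP; split => w /=.
      move=> [H HE] j; rewrite /D; case: eqP => [->//|/eqP ji]; exact: H.
    move=> H; split; last by have := H i; rewrite /D eqxx.
    by move=> j ji; have := H j; rewrite /D (negbTE ji).
  rewrite Gz.2; last exact: mD.
  rewrite (bigD1 i)//= /D eqxx; congr (_ * _)%E.
  by apply: eq_bigr => j /negbTE ->.
have := PE setT measurableT; rewrite preimage_setT setIT.
rewrite (_ : normal_prob 0 (Num.sqrt h) setT = 1%E) ?mul1e => [E1|]; last first.
  exact: probability_setT.
by rewrite PE// E1 gaussian_marginal// muleC.
Qed.

Lemma measurable_coord_other i j (f : R -> R) : j != i -> measurable_fun setT f ->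
  measurable_fun setT ((fun w => f (z w j ord0)) :
    g_sigma_algebraType (other_cylinders i) -> R).
Proof.
move=> ji mf; apply: (measurableT_comp mf) => _ C mC; rewrite setTI.
apply: sub_sigma_algebra.
exists (fun k => if k == j then C else setT); first by move=> k; case: ifP.
apply/seteqP; split => w /=; first by move=> Cw k _; case: eqP => // ->.
by move=> /(_ j ji); rewrite eqxx.
Qed.

(** Freeze all coordinates but i in the sigma-algebra they generate and use the one-dimensional
    formula. *)
Lemma ge0_gaussian_shift1 i a (F : 'cV[R]_d -> R) : vmeasurable F ->
  (forall v, 0 <= F v) ->
  (\int[P]_w (F (z w + a *: delta_mx i ord0))%:E =
   \int[P]_w (F (z w) * expR (a * z w i ord0 / h - a ^+ 2 / (2 * h)))%:E)%E.
Proof.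
move=> mF F0.
pose repl (w : T) (x : R) : 'cV[R]_d := \col_j (if j == i then x else z w j ord0).
pose Psi (q : g_sigma_algebraType (other_cylinders i) * R) := F (repl q.1 q.2).
have mPsi : measurable_fun setT Psi.
  apply: mF => j; under eq_fun do rewrite mxE.
  case: eqP => [_|/eqP ji]; first exact: measurable_snd.
  exact: (measurableT_comp (measurable_coord_other (f := id) ji _) measurable_fst).
have mPsi2 w : measurable_fun setT (fun x => Psi (w, x)).
  exact: (measurableT_comp mPsi).
have mi := sub_sigma_id (other_cylinders_measurable (i := i)).
have ms : measurable_fun (setT : set R) (fun x : R => x + a).
  exact: measurable_funD.
have mr : measurable_fun (setT : set R) (fun x => expR (a * x / h - a ^+ 2 / (2 * h))).
  apply: measurableT_comp => //; apply: measurable_funB => //.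
  by apply: measurable_funM => //; exact: measurable_funM.
have ind := coord_independent (i := i).
transitivity (\int[P]_w (Psi (w, z w i ord0 + a))%:E)%E.
  apply: eq_integral => w _; congr (F _)%:E.
  apply/colP => j; rewrite !mxE eqxx andbT.
  by case: eqP => [->|_]; rewrite ?mulr1// mulr0 addr0.
transitivity (\int[P]_w (Psi (w, z w i ord0) * expR (a * z w i ord0 / h - a ^+ 2 / (2 * h)))%:E)%E; last first.
  apply: eq_integral => w _; congr (F _ * _)%:E.
  by apply/colP => j; rewrite !mxE; case: eqP => [->|_].
rewrite (independent_freeze_ge0 mi (mz i) ind
  (Psi := fun q => (Psi (q.1, q.2 + a))%:E)); last 2 first.
- apply/measurable_EFinP; apply: (measurableT_comp mPsi).
  apply/measurable_fun_pairP; split; first exact: measurable_fst.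
  exact: (measurableT_comp ms measurable_snd).
- by move=> q; rewrite lee_fin F0.
rewrite [RHS](independent_freeze_ge0 mi (mz i) ind
  (Psi := fun q => (Psi q * expR (a * q.2 / h - a ^+ 2 / (2 * h)))%:E)); last 2 first.
- apply/measurable_EFinP; apply: measurable_funM.
    exact: mPsi.
  exact: (measurableT_comp mr measurable_snd).
- by move=> q; rewrite lee_fin mulr_ge0 ?F0 ?expR_ge0.
apply: eq_integral => w _ /=.
rewrite (ge0_integral_gaussian i (F := fun x => (Psi (w, x + a))%:E)); last 2 first.
- by apply/measurable_EFinP; exact: (measurableT_comp (mPsi2 w) ms).
- by move=> x; rewrite lee_fin F0.
rewrite (ge0_integral_gaussian i (F := fun x =>
  (Psi (w, x) * expR (a * x / h - a ^+ 2 / (2 * h)))%:E)); last 2 first.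
- by apply/measurable_EFinP; apply: measurable_funM.
- by move=> x; rewrite lee_fin mulr_ge0 ?F0 ?expR_ge0.
rewrite (ge0_integral_normal_shift s0 a (F := fun x => (Psi (w, x))%:E)); last 2 first.
- exact/measurable_EFinP.
- by move=> x; rewrite lee_fin F0.
by apply: eq_integral => x _; rewrite s2 EFinM.
Qed.

(** Cameron-Martin density of the law of z + a with respect to the law of z. *)
Definition rho (a v : 'cV[R]_d) : R :=
  expR (dotv a v / h - hsnorm a ^+ 2 / (2 * h)).

Lemma rho_ge0 a v : 0 <= rho a v.
Proof. exact: expR_ge0. Qed.

Lemma vmeasurable_dotv (a : 'cV[R]_d) : vmeasurable (dotv a).
Proof.
apply: vmeasurable_sum => i; apply: vmeasurableM; first exact: vmeasurable_cst.
exact: vmeasurable_coord.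
Qed.

Lemma vmeasurable_rho a : vmeasurable (rho a).
Proof.
apply: (vmeasurable_comp (g := expR)) => //.
apply: vmeasurableB; last exact: vmeasurable_cst.
apply: vmeasurableM; [exact: vmeasurable_dotv|exact: vmeasurable_cst].
Qed.

Lemma ge0_gaussian_shift (a : 'cV[R]_d) (F : 'cV[R]_d -> R) : vmeasurable F ->
  (forall v, 0 <= F v) ->
  (\int[P]_w (F (z w + a))%:E = \int[P]_w (F (z w) * rho a (z w))%:E)%E.
Proof.
move=> mF F0.
pose E i (v : 'cV[R]_d) := a i ord0 * v i ord0 / h - a i ord0 ^+ 2 / (2 * h).
have mE i : vmeasurable (E i).
  apply: vmeasurableB; last exact: vmeasurable_cst.
  apply: vmeasurableM; last exact: vmeasurable_cst.
  by apply: vmeasurableM; [exact: vmeasurable_cst|exact: vmeasurable_coord].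
have key (s : seq 'I_d) : uniq s -> forall F : 'cV[R]_d -> R, vmeasurable F ->
    (forall v, 0 <= F v) ->
    (\int[P]_w (F (z w + (\sum_(i <- s) a i ord0 *: delta_mx i ord0)%R))%:E =
     \int[P]_w (F (z w) * expR (\sum_(i <- s) E i (z w)))%:E)%E.
  elim: s => [_ G mG G0|i s IH /=/andP[si us] G mG G0].
    by apply: eq_integral => w _; rewrite !big_nil addr0 expR0 mulr1.
  have mS j (c : 'cV[R]_d) : vmeasurable (fun v => (v + c) j ord0).
    apply: (eq_ind _ (fun f => vmeasurable f)
      (vmeasurableD (vmeasurable_coord j) (vmeasurable_cst (c j ord0)))).
    by apply/funext => v; rewrite mxE.
  transitivity (\int[P]_w (G (z w + (\sum_(i <- s) a i ord0 *: delta_mx i ord0)%R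
      + a i ord0 *: delta_mx i ord0)%R)%:E)%E.
    by apply: eq_integral => w _; rewrite big_cons addrCA addrA addrC addrA addrAC [_ + z w]addrC.
  rewrite (IH us (fun v => G (v + a i ord0 *: delta_mx i ord0))); last 2 first.
  - exact: vmeasurable_vcomp.
  - by move=> v; exact: G0.
  have mes : vmeasurable (fun v => expR (\sum_(j <- s) E j v)).
    by apply: (vmeasurable_comp (g := expR)) => //; exact: vmeasurable_sum.
  transitivity (\int[P]_w ((fun v => G v * expR (\sum_(j <- s) E j v))%R
     (z w + a i ord0 *: delta_mx i ord0)%R)%:E)%E.
    apply: eq_integral => w _; congr (_ * expR _)%:E.
    (* The list has no repetition, so a shift along coordinate i leaves the exponents of the other
       coordinates unchanged. *)
    rewrite !big_seq; apply: eq_bigr => j js; rewrite /E !mxE.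
    by rewrite (negbTE (memPn si j js)) mulr0 addr0.
  rewrite (ge0_gaussian_shift1 i (a i ord0)
    (F := fun v => G v * expR (\sum_(j <- s) E j v))); last 2 first.
  - exact: vmeasurableM.
  - by move=> v; rewrite mulr_ge0 ?expR_ge0.
  by apply: eq_integral => w _; rewrite big_cons -mulrA -expRD [in RHS]addrC.
transitivity (\int[P]_w (F (z w + (\sum_(i <- index_enum 'I_d) a i ord0 *: delta_mx i ord0)%R))%:E)%E.
  apply: eq_integral => w _; congr (F (_ + _))%:E; apply/colP => j.
  rewrite summxE (bigD1 j)//= !mxE !eqxx mulr1 big1 ?addr0// => k kj.
  by rewrite !mxE [j == k]eq_sym (negbTE kj) mulr0.
rewrite (key _ (index_enum_uniq _) F mF F0); apply: eq_integral => w _.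
congr (_ * expR _)%:E; rewrite /dotv hsnorm_sqrv !mulr_suml -sumrB.
by apply: eq_bigr => i _.
Qed.

Lemma Lone_rho a : Lone P (fun w => rho a (z w)).
Proof.
apply: Lone_ge0P; [exact: vmeasurable_rho|by move=> w; exact: rho_ge0|].
have := ge0_gaussian_shift a (vmeasurable_cst 1) (fun=> ler01).
under [X in _ = X -> _]eq_integral do rewrite mul1r.
move=> <-; rewrite integral_cst//= mul1e.
by rewrite (@probability_setT _ _ _ P) ltry.
Qed.

Lemma Ex_rho a : Ex P (fun w => rho a (z w)) = 1.
Proof.
have := ge0_gaussian_shift a (vmeasurable_cst 1) (fun=> ler01).
under [X in _ = X -> _]eq_integral do rewrite mul1r.
rewrite -EFin_Ex; last exact: Lone_cst.
rewrite -EFin_Ex; last exact: Lone_rho.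
by rewrite Ex_cst => -[].
Qed.

(** Squaring the density doubles the shift, so its second moment reduces to [Ex_rho]. *)
Lemma rho_sqr a v : rho a v ^+ 2 = expR (hsnorm a ^+ 2 / h) * rho (2 *: a) v.
Proof.
rewrite /rho -expRM_natl -expRD; congr expR.
rewrite hsnormZ (_ : dotv (2 *: a) v = 2 * dotv a v); last first.
  by rewrite /dotv mulr_sumr; apply: eq_bigr => i _; rewrite mxE mulrA.
rewrite normr_nat; field.
exact: lt0r_neq0.
Qed.

Lemma Ltwo_rho a : Ltwo P (fun w => rho a (z w)).
Proof.
split; first exact: vmeasurable_rho.
by under eq_fun do rewrite rho_sqr; exact/LoneZ/Lone_rho.
Qed.

Lemma Ex_rho_sqr a : Ex P (fun w => rho a (z w) ^+ 2) = expR (hsnorm a ^+ 2 / h).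
Proof.
under eq_Ex do rewrite rho_sqr.
by rewrite ExZ ?Ex_rho ?mulr1//; exact: Lone_rho.
Qed.

(** The left-hand side is the chi-square distance between the laws of z + a and z, the price of a
    translation of the noise. *)
Lemma gaussian_chi2 a :
  Ex P (fun w => (rho a (z w) - 1) ^+ 2) = expR (hsnorm a ^+ 2 / h) - 1.
Proof.
rewrite Ex_sqrB; [|exact: Ltwo_rho|exact: Ltwo_cst].
under [X in 2 * X]eq_Ex do rewrite mulr1.
under [X in _ + X]eq_Ex do rewrite expr1n.
by rewrite Ex_rho_sqr Ex_rho Ex_cst; ring.
Qed.

(** Adding M makes the integrand nonnegative; the constant then cancels since [rho] has mean 1. *)
Lemma gaussian_shift M a (F : 'cV[R]_d -> R) : vmeasurable F ->
  (forall v, `|F v| <= M) ->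
  Ex P (fun w => F (z w + a)) = Ex P (fun w => F (z w) * rho a (z w)).
Proof.
move=> mF FM.
have M0 : 0 <= M by rewrite (le_trans _ (FM 0)).
have mG : vmeasurable (fun v => F v + M) by apply: vmeasurableD => //; exact: vmeasurable_cst.
have G0 v : 0 <= F v + M by have := FM v; rewrite ler_norml => /andP[? _]; lra.
have := ge0_gaussian_shift a mG G0.
have mFa : measurable_fun setT (fun w => F (z w + a)).
  apply: mF => i; under eq_fun do rewrite mxE.
  by apply: measurable_funD.
have L1 : Lone P (fun w => F (z w + a)) by exact: Lone_bounded.
have L2 : Lone P (fun w => F (z w) * rho a (z w)).
  by apply: Lone_bounded_mul (Lone_rho a) => //; exact: mF.
have L3 := LoneZ M (Lone_rho a).
rewrite -EFin_Ex; last by apply: LoneD => //; exact: Lone_cst.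
under [X in _ = X -> _]eq_integral do rewrite mulrDl.
rewrite -EFin_Ex; last exact: LoneD.
rewrite ExD//; last exact: Lone_cst.
rewrite ExD// ExZ ?Ex_rho ?Ex_cst; last exact: Lone_rho.
by move=> -[]; lra.
Qed.

(** exp(c z_i) is a constant times the density of the shift c h e_i, so its mean follows from that
    of [rho]. The moments below are extracted from this formula. *)
Lemma gaussian_exp i c :
  Lone P (fun w => expR (c * z w i ord0)) /\
  Ex P (fun w => expR (c * z w i ord0)) = expR (c ^+ 2 * h / 2).
Proof.
have E w : expR (c * z w i ord0) =
    expR (c ^+ 2 * h / 2) * rho ((c * h) *: delta_mx i ord0) (z w).
  rewrite /rho -expRD; congr expR.
  rewrite (_ : dotv _ _ = c * h * z w i ord0); last first.
    rewrite /dotv (bigD1 i)//= !mxE !eqxx mulr1 big1 ?addr0// => k ki.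
    by rewrite !mxE (negbTE ki) mulr0 mul0r.
  rewrite (_ : hsnorm _ ^+ 2 = (c * h) ^+ 2).
    by field; exact: lt0r_neq0.
  rewrite hsnorm_sqrv (bigD1 i)//= !mxE !eqxx mulr1 big1 ?addr0// => k ki.
  by rewrite !mxE (negbTE ki) mulr0 expr0n.
under eq_fun do rewrite E; split; first exact/LoneZ/Lone_rho.
by rewrite ExZ ?Ex_rho ?mulr1//; exact: Lone_rho.
Qed.

Lemma expR_norm_le (c x : R) : expR (c * `|x|) <= expR (c * x) + expR (- c * x).
Proof.
case: (lerP 0 x) => x0.
  by rewrite ger0_norm// lerDl expR_ge0.
by rewrite ltr0_norm// mulrN -mulNr lerDr expR_ge0.
Qed.

Lemma gaussian_exp_norm i c :
  Lone P (fun w => expR (c * `|z w i ord0|)) /\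
  Ex P (fun w => expR (c * `|z w i ord0|)) <= 2 * expR (c ^+ 2 * h / 2).
Proof.
have [L1 E1] := gaussian_exp i c; have [L2 E2] := gaussian_exp i (- c).
have L : Lone P (fun w => expR (c * `|z w i ord0|)).
  apply: Lone_le (LoneD L1 L2) => [|w].
    do 2 (apply: measurableT_comp => //); apply: measurableT_comp => //; exact: mz.
  by rewrite ger0_norm ?expR_ge0// expR_norm_le.
split=> //; apply: le_trans (Ex_le L (LoneD L1 L2) _) _.
  by move=> w; exact: expR_norm_le.
by rewrite ExD// E1 E2 sqrrN; lra.
Qed.

(** The n-th power of y / n <= exp(y / n); exponential moments thus control the polynomial ones. *)
Lemma pow_le_expR (n : nat) (y : R) : 0 <= y -> y ^+ n <= n%:R ^+ n * expR y.
Proof.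
case: n => [|n] y0; first by rewrite !expr0 mul1r -expR0 ler_expR.
have n0 : (0 : R) < n.+1%:R by [].
have : y / n.+1%:R <= expR (y / n.+1%:R).
  by apply: le_trans (expR_ge1Dx _); rewrite lerDr.
move=> /(@lerXn2r _ n.+1) -/(_ (divr_ge0 y0 (ltW n0)) (expR_ge0 _)).
rewrite -expRM_natl [n.+1%:R * _]mulrC divfK ?gt_eqF//.
by rewrite expr_div_n ler_pdivrMr ?exprn_gt0// mulrC.
Qed.

Lemma gaussian_Ltwo i : Ltwo P (fun w => z w i ord0).
Proof.
split; first exact: mz.
have [L _] := gaussian_exp_norm i 1.
apply: Lone_le (LoneZ (2%:R ^+ 2) L) => [|w].
  by apply: measurable_funX; exact: mz.
by rewrite normrX mul1r pow_le_expR.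
Qed.

(** Stands for the limit a -> 0, both in the computation of Gaussian moments and in mean-square
    limits. *)
Lemma le0_of_quadratic (m C : R) : (forall a, 0 < a <= 1 -> m <= C * a) -> m <= 0.
Proof.
move=> H; rewrite leNgt; apply/negP => m0.
have C0 : 0 < C by have := H 1; rewrite ltr01 lexx mulr1 => /(_ isT)/(lt_le_trans m0).
have [mC|mC] := lerP (m / (2 * C)) 1.
  have := H (m / (2 * C)); rewrite divr_gt0 ?mulr_gt0//= => /(_ mC).
  rewrite mulrCA (_ : C / (2 * C) = 2^-1); last by field; exact: lt0r_neq0.
  by lra.
have := H 1; rewrite ltr01 lexx mulr1 => /(_ isT).
by move: mC; rewrite ltr_pdivlMr ?mulr_gt0// mul1r; lra.
Qed.

Lemma expR_sub1_le (t : R) : expR t - 1 <= t * expR t.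
Proof.
have := expR_ge1Dx (- t); rewrite expRN => H.
have := ler_wpM2l (expR_ge0 t) H; rewrite divff ?gt_eqF ?expR_gt0//; lra.
Qed.

(** 1 + x <= exp x gives c E z_i <= exp(c^2 h / 2) - 1, which is of order c^2; divide by c of either
    sign and let it tend to 0. *)
Lemma gaussian_mean i : Ex P (fun w => z w i ord0) = 0.
Proof.
have Lz := Ltwo_Lone (gaussian_Ltwo i).
have key c : c * Ex P (fun w => z w i ord0) <= expR (c ^+ 2 * h / 2) - 1.
  have [L E] := gaussian_exp i c.
  rewrite -E -ExZ// lerBrDr -[X in _ + X <= _](Ex_cst P) -ExD//; last 2 first.
  - exact: LoneZ.
  - exact: Lone_cst.
  apply: Ex_le => //; first by apply: LoneD; [exact: LoneZ|exact: Lone_cst].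
  by move=> w; rewrite addrC expR_ge1Dx.
have bnd (c : R) : 0 <= c <= 1 -> expR (c ^+ 2 * h / 2) - 1 <= c * (c * (h / 2 * expR (h / 2))).
  move=> /andP[c0 c1]; apply: le_trans (expR_sub1_le _) _.
  rewrite (_ : c * (c * _) = c ^+ 2 * h / 2 * expR (h / 2)); last by field.
  rewrite ler_wpM2l ?divr_ge0 ?mulr_ge0 ?sqr_ge0 ?(ltW h0)//.
  by rewrite ler_expR -mulrA ler_piMl ?divr_ge0 ?(ltW h0)// exprn_ile1.
apply/eqP; rewrite eq_le; apply/andP; split.
  apply: (@le0_of_quadratic _ (h / 2 * expR (h / 2))) => a /andP[a0 a1].
  have := le_trans (key a) (bnd a _); rewrite (ltW a0) a1 => /(_ isT).
  by rewrite ler_pM2l// mulrC.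
rewrite -oppr_le0.
apply: (@le0_of_quadratic _ (h / 2 * expR (h / 2))) => a /andP[a0 a1].
have := key (- a); rewrite sqrrN => /le_trans/(_ (bnd a _)); rewrite (ltW a0) a1 => /(_ isT).
by rewrite mulNr -mulrN ler_pM2l// mulrC.
Qed.

(** The middle expression is the square of exp(x / 2) - exp(- x / 2), and 1 + t <= exp t at t = x
    and t = - x bounds this difference on both sides. *)
Lemma expR_symm_bounds (x : R) :
  x ^+ 2 * expR (- `|x|) <= expR x + expR (- x) - 2 <= x ^+ 2 * expR `|x|.
Proof.
have key (u : R) : 0 <= u ->
    (2 * u) ^+ 2 * expR (- (2 * u)) <= expR (2 * u) + expR (- (2 * u)) - 2 <=
    (2 * u) ^+ 2 * expR (2 * u).
  move=> u0; set e := expR u; set f := expR (- u).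
  have ef : e * f = 1 by rewrite /e /f -expRD subrr expR0.
  have e2 : expR (2 * u) = e ^+ 2 by rewrite /e -expRM_natl.
  have f2 : expR (- (2 * u)) = f ^+ 2 by rewrite /f -expRM_natl mulrN.
  have e0 : 0 < e := expR_gt0 u.
  have f0 : 0 < f := expR_gt0 (- u).
  have h1 : 1 + 2 * u <= e ^+ 2 by rewrite -e2 expR_ge1Dx.
  have h2 : 1 - 2 * u <= f ^+ 2 by rewrite -f2 expR_ge1Dx.
  rewrite e2 f2 (_ : e ^+ 2 + f ^+ 2 - 2 = (e - f) ^+ 2); last first.
    by rewrite sqrrB ef; ring.
  have d1 : 2 * u * f <= e - f.
    have := ler_wpM2r (ltW f0) h1.
    rewrite (_ : e ^+ 2 * f = e); last by rewrite expr2 -mulrA ef mulr1.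
    by lra.
  have d2 : e - f <= 2 * u * e.
    have := ler_wpM2r (ltW e0) h2.
    rewrite (_ : f ^+ 2 * e = f); last by rewrite expr2 -mulrA [f * e]mulrC ef mulr1.
    by lra.
  have d0 : 0 <= 2 * u * f by rewrite !mulr_ge0// ltW.
  rewrite -!exprMn; apply/andP; split; rewrite lerXn2r ?nnegrE//.
  - exact: le_trans d1.
  - exact: le_trans d1.
  - by rewrite !mulr_ge0// ltW.
have x2 : 0 <= `|x| / 2 by rewrite divr_ge0.
have := key _ x2.
rewrite [2 * (_ / 2)]mulrC divfK ?pnatr_eq0// real_normK ?num_real//.
case: (lerP 0 x) => x0; first by rewrite ger0_norm.
by rewrite ltr0_norm// opprK [expR (- x) + expR x]addrC.
Qed.

(** The mean of exp(a z_i) + exp(- a z_i) - 2 is a^2 E z_i^2 and also a^2 h, each up to a term of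
    order a^3; divide by a^2. *)
Lemma gaussian_var i : Ex P (fun w => z w i ord0 ^+ 2) = h.
Proof.
set V := Ex P _; have [_ L2] := gaussian_Ltwo i.
have [L3 _] := gaussian_exp_norm i 2.
set C := 27 * Ex P (fun w => expR (2 * `|z w i ord0|)).
(* 27 = 3^3 is the constant of [pow_le_expR] at n = 3. *)
have cub w : `|z w i ord0| ^+ 3 * expR `|z w i ord0| <= 27 * expR (2 * `|z w i ord0|).
  rewrite (_ : 2 * _ = `|z w i ord0| + `|z w i ord0|); last by ring.
  rewrite expRD mulrA ler_wpM2r ?expR_ge0//.
  have := pow_le_expR 3 (normr_ge0 (z w i ord0)).
  by rewrite (_ : 3%:R ^+ 3 = 27); last by ring.
have two a : 0 < a <= 1 -> a ^+ 2 * (V - C * a) <= 2 * (expR (a ^+ 2 * h / 2) - 1)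
    <= a ^+ 2 * (V + C * a).
  move=> /andP[a0 a1].
  have [La Ea] := gaussian_exp i a; have [Lb Eb] := gaussian_exp i (- a).
  have -> : 2 * (expR (a ^+ 2 * h / 2) - 1) =
      Ex P (fun w => expR (a * z w i ord0) + expR (- a * z w i ord0) - 2).
    rewrite ExB; [|exact: LoneD|exact: Lone_cst].
    by rewrite ExD// Ea Eb Ex_cst sqrrN; ring.
  have Ls : Lone P (fun w => expR (a * z w i ord0) + expR (- a * z w i ord0) - 2).
    by apply: LoneB; [exact: LoneD|exact: Lone_cst].
  have Lc := LoneZ (27 * a) L3.
  have pt w : a ^+ 2 * (z w i ord0 ^+ 2 - 27 * a * expR (2 * `|z w i ord0|)) <=
     expR (a * z w i ord0) + expR (- a * z w i ord0) - 2 <=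
     a ^+ 2 * (z w i ord0 ^+ 2 + 27 * a * expR (2 * `|z w i ord0|)).
    have := expR_symm_bounds (a * z w i ord0); rewrite -mulNr.
    have := cub w; set y := z w i ord0; rewrite normrM gtr0_norm//.
    set r := `|y|; have -> : (a * y) ^+ 2 = a ^+ 2 * r ^+ 2.
      by rewrite exprMn /r real_normK ?num_real.
    have -> : y ^+ 2 = r ^+ 2 by rewrite /r real_normK ?num_real.
    have r0 : 0 <= r by exact: normr_ge0.
    move=> cb /andP[lo up]; apply/andP; split.
      apply: le_trans lo; rewrite -[leRHS]mulrA ler_wpM2l ?sqr_ge0//.
      have h1 : 1 - a * r <= expR (- (a * r)) by exact: expR_ge1Dx.
      have h2 : 1 <= expR r by rewrite -expR0 ler_expR.
      have := ler_wpM2l (sqr_ge0 r) h1; rewrite mulrBr mulr1.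
      have : r ^+ 3 <= r ^+ 3 * expR r by rewrite ler_peMr// exprn_ge0.
      rewrite (_ : r ^+ 2 * (a * r) = a * r ^+ 3); last by ring.
      move=> /le_trans/(_ cb)/(ler_wpM2l (ltW a0)); lra.
    apply: (le_trans up); rewrite -[leLHS]mulrA ler_wpM2l ?sqr_ge0//.
    have h1 : expR (a * r) - 1 <= a * r * expR (a * r) := expR_sub1_le _.
    have h2 : expR (a * r) <= expR r by rewrite ler_expR ler_piMl.
    have h3 : a * r * expR (a * r) <= a * r * expR r by rewrite ler_wpM2l ?mulr_ge0// ltW.
    have := ler_wpM2l (sqr_ge0 r) (le_trans h1 h3); rewrite mulrBr mulr1.
    rewrite (_ : r ^+ 2 * (a * r * expR r) = a * (r ^+ 3 * expR r)); last by ring.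
    have := ler_wpM2l (ltW a0) cb; lra.
  have EC : C * a = Ex P (fun w => 27 * a * expR (2 * `|z w i ord0|)).
    by rewrite ExZ// /C; ring.
  rewrite EC; apply/andP; split.
    rewrite -ExB// -ExZ; last exact: LoneB.
    by apply: Ex_le => // [|w]; [exact/LoneZ/LoneB|by have /andP[] := pt w].
  rewrite -ExD// -ExZ; last exact: LoneD.
  by apply: Ex_le => // [|w]; [exact/LoneZ/LoneD|by have /andP[] := pt w].
set K := h * (h / 2 * expR (h / 2)).
have expb a : 0 < a <= 1 -> a ^+ 2 * h <= 2 * (expR (a ^+ 2 * h / 2) - 1) <= a ^+ 2 * (h + K * a).
  move=> /andP[a0 a1]; set t := a ^+ 2 * h / 2.
  have t0 : 0 <= t by rewrite !mulr_ge0 ?sqr_ge0 ?ltW.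
  have a2 : a ^+ 2 <= a by rewrite expr2 ler_piMl// ltW.
  have th : t <= a * (h / 2) by rewrite /t -mulrA ler_wpM2r// divr_ge0// ltW.
  have th2 : t <= h / 2 by rewrite (le_trans th)// ler_piMl// divr_ge0// ltW.
  have tE : a ^+ 2 * h = 2 * t by rewrite /t; field.
  apply/andP; split; first by have := expR_ge1Dx t; lra.
  have h1 := expR_sub1_le t.
  have h2 : expR t - 1 <= t * expR (h / 2).
    by apply: le_trans h1 _; rewrite ler_wpM2l// ler_expR.
  have h3 : expR t - 1 <= t + t * (t * expR (h / 2)).
    have := ler_wpM2l t0 h2; have := h1; lra.
  have h4 : t * (t * expR (h / 2)) <= t * (a * (h / 2 * expR (h / 2))).
    by rewrite ler_wpM2l// mulrA ler_wpM2r// expR_ge0.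
  have -> : a ^+ 2 * (h + K * a) = 2 * (t + t * (a * (h / 2 * expR (h / 2)))).
    by rewrite /K /t; field.
  lra.
apply/eqP; rewrite eq_le; apply/andP; split; rewrite -subr_le0;
  apply: (@le0_of_quadratic _ (C + K)) => a a01; have /andP[a0 a1] := a01;
  have /andP[l1 u1] := two a a01; have /andP[l2 u2] := expb a a01;
  have a2 : 0 < a ^+ 2 by rewrite exprn_gt0.
  have := le_trans l1 u2; rewrite ler_pM2l//.
  by rewrite mulrDl; lra.
have := le_trans l2 u1; rewrite ler_pM2l// mulrDl.
have : 0 <= K * a by rewrite !mulr_ge0 ?expR_ge0 ?invr_ge0 ?ltW.
lra.
Qed.

Lemma gaussian_cross i j (f g : R -> R) : j != i ->
  measurable_fun setT f -> measurable_fun setT g ->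
  Lone P (fun w => f (z w j ord0)) -> Lone P (fun w => g (z w i ord0)) ->
  Ex P (fun w => f (z w j ord0) * g (z w i ord0)) =
  Ex P (fun w => f (z w j ord0)) * Ex P (fun w => g (z w i ord0)).
Proof.
move=> ji mf mg Lf Lg.
exact: (independent_Ex_mul (sub_sigma_id (other_cylinders_measurable (i := i)))
  (mz i) (coord_independent (i := i)) (measurable_coord_other ji mf) mg Lf Lg).
Qed.

Lemma gaussian_cov i j :
  Ex P (fun w => z w i ord0 * z w j ord0) = (i == j)%:R * h.
Proof.
have [<-|ij] := eqVneq i j.
  by rewrite mul1r -[RHS](gaussian_var i); apply: eq_Ex => w; rewrite expr2.
rewrite mul0r (gaussian_cross (f := id) (g := id))//; last 2 first.
- exact/Ltwo_Lone/gaussian_Ltwo.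
- exact/Ltwo_Lone/gaussian_Ltwo.
by rewrite gaussian_mean mul0r.
Qed.

(** [pow_le_expR] with n = 4 at |z_i| / sqrt h gives 4^4 = 256; the exponential moment at c = 1 /
    sqrt h contributes the factor 2 exp(1/2). *)
Lemma gaussian_fourth i : Lone P (fun w => z w i ord0 ^+ 4) /\
  Ex P (fun w => z w i ord0 ^+ 4) <= 512 * expR 2^-1 * h ^+ 2.
Proof.
have s1 : 0 < Num.sqrt h by rewrite sqrtr_gt0.
have [L E] := gaussian_exp_norm i (Num.sqrt h)^-1.
have b w : z w i ord0 ^+ 4 <= 256 * h ^+ 2 * expR ((Num.sqrt h)^-1 * `|z w i ord0|).
  have y0 : 0 <= (Num.sqrt h)^-1 * `|z w i ord0| by rewrite mulr_ge0 ?invr_ge0 ?(ltW s1).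
  have := pow_le_expR 4 y0; rewrite exprMn exprVn.
  rewrite (_ : Num.sqrt h ^+ 4 = h ^+ 2); last by rewrite -{2}s2 -exprM.
  rewrite (_ : `|_| ^+ 4 = z w i ord0 ^+ 4); last first.
    by rewrite (exprM _ 2 2) real_normK ?num_real// -exprM.
  rewrite mulrC ler_pdivrMr ?exprn_gt0// (_ : 4%:R ^+ 4 = 256); last by ring.
  by rewrite mulrAC.
have mz4 : measurable_fun setT (fun w => z w i ord0 ^+ 4).
  by apply: measurable_funX; exact: mz.
have L4 : Lone P (fun w => z w i ord0 ^+ 4).
  apply: Lone_le (LoneZ (256 * h ^+ 2) L) => // w.
  by rewrite ger0_norm ?b// exprn_even_ge0.
split=> //; apply: le_trans (Ex_le L4 (LoneZ (256 * h ^+ 2) L) b) _.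
rewrite ExZ; last exact: L.
apply: le_trans (ler_wpM2l _ E) _; first by apply: mulr_ge0; rewrite ?sqr_ge0.
rewrite exprVn s2 mulVf ?gt_eqF// mul1r; lra.
Qed.

End GaussianVectors.

(** * Truncated increments and change of measure *)

(** exp(- t / 2) >= 1 - t / 2 gives exp t <= (1 - t / 2)^(-2), and on [0, 1] this is at most 1 + 3
    t. *)
Lemma expR_sub1_le3 (R : realType) (t : R) : 0 <= t <= 1 -> expR t - 1 <= 3 * t.
Proof.
move=> /andP[t0 t1].
have H : 0 <= 1 - t / 2 <= expR (- (t / 2)).
  by rewrite expR_ge1Dx andbT; lra.
have E : expR t * expR (- (t / 2)) ^+ 2 = 1.
  by rewrite -expRM_natl -expRD mulrN [2%:R * _]mulrC divfK ?pnatr_eq0// subrr expR0.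
have /andP[H1 H2] := H.
have S : (1 - t / 2) ^+ 2 <= expR (- (t / 2)) ^+ 2 by rewrite lerXn2r ?nnegrE ?expR_ge0.
have := ler_wpM2l (expR_ge0 t) S; rewrite E => H3.
have p : 1 <= (1 + 3 * t) * (1 - t / 2) ^+ 2.
  have : 0 <= t * ((1 - t) * (2 - 3 / 4 * t)) by rewrite !mulr_ge0//; lra.
  lra.
have pos : 0 < (1 - t / 2) ^+ 2 by rewrite exprn_gt0//; lra.
have := le_trans H3 p; rewrite ler_pM2r//; lra.
Qed.

Section OneStep.
Context dd (T : measurableType dd) (R : realType) (P : probability T R).
Context (d : nat) (h K : R) (z : T -> 'cV[R]_d).
Hypotheses (h0 : 0 < h) (K0 : 0 <= K) (Gz : gaussian_vector P h z).
Implicit Types (x y v : 'cV[R]_d) (V : 'cV[R]_d -> R).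

Let mz : coord_measurable z. Proof. by case: Gz. Qed.
Let Lz i : Ltwo P (fun w => z w i ord0). Proof. exact: (gaussian_Ltwo h0 Gz). Qed.

Definition clip (t : R) : R := Num.max (- K) (Num.min t K).

Lemma clip_bound t : `|clip t| <= K.
Proof.
rewrite /clip ler_norml le_max lexx/= ge_max ge_min lexx orbT andbT.
by rewrite (le_trans _ K0)// oppr_le0.
Qed.

Lemma clip_lip t t' : `|clip t - clip t'| <= `|t - t'|.
Proof.
have KK : - K <= K by have := K0; lra.
have H1 := ler_norm (t - t'); have H2 := ler_norm (t' - t).
rewrite [`|t' - t|]distrC in H2.
rewrite /clip !maxEle !minEle.
by case: (leP t K) => a1; case: (leP t' K) => a2; rewrite ?KK;
  (case: (leP (- K) t) => a3; try (case: (leP (- K) t') => a4));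
  rewrite ?subrr ?normr0// ler_norml; apply/andP; split; lra.
Qed.

Lemma clip_norm_le t : `|clip t| <= `|t|.
Proof.
have c0 : clip 0 = 0.
  rewrite /clip minEle K0 maxEle; case: leP => // H.
  by apply/eqP; rewrite eq_le; apply/andP; split; rewrite ?oppr_le0 ?(ltW H).
by have := clip_lip t 0; rewrite c0 !subr0.
Qed.

(** Truncation costs at most t^2 / K, so its mean-square error is governed by the fourth moment, of
    order h^2. *)
Lemma clip_sub_le t : `|t - clip t| * K <= t ^+ 2.
Proof.
rewrite /clip maxEle minEle.
have nn : t ^+ 2 = `|t| ^+ 2 by rewrite real_normK ?num_real.
rewrite nn; have t1 := normr_ge0 t; have tn := ler_norm t.
have tn' : - t <= `|t| by rewrite -normrN ler_norm.
have KK : - K <= K by have := K0; lra.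
have K1 := K0.
case: (leP t K) => tK; rewrite ?KK; last first.
  have t0 : 0 < t by lra.
  by rewrite (gtr0_norm t0) ger0_norm; [nra|lra].
case: (leP (- K) t) => H; first by rewrite subrr normr0 mul0r sqr_ge0.
have t0 : t < 0 by lra.
by rewrite (ltr0_norm t0) opprK ltr0_norm; [nra|lra].
Qed.

Lemma measurable_clip : measurable_fun setT clip.
Proof. by apply: measurable_maxr => //; exact: measurable_minr. Qed.

Let mclip i : measurable_fun setT (fun w => clip (z w i ord0)).
Proof. exact: (measurableT_comp measurable_clip (mz i)). Qed.

Definition tau i v : R := clip (v i ord0) - Ex P (fun w => clip (z w i ord0)).

Lemma vmeasurable_tau i : vmeasurable (tau i).
Proof.
apply: vmeasurableB; last exact: vmeasurable_cst.
exact: (vmeasurable_comp measurable_clip (vmeasurable_coord i)).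
Qed.

Let Lclip i : Lone P (fun w => clip (z w i ord0)).
Proof. by apply: Lone_bounded => // w; exact: clip_bound. Qed.

Lemma tau_bound i v : `|tau i v| <= 2 * K.
Proof.
have : `|Ex P (fun w => clip (z w i ord0))| <= K.
  apply: le_trans (le_normr_Rintegral measurableT (Lclip i)) _.
  rewrite -[leRHS](Ex_cst P); apply: Ex_le => [||w].
  - exact: Lone_norm.
  - exact: Lone_cst.
  - exact: clip_bound.
have := clip_bound (v i ord0) => H1 H2.
by rewrite (le_trans (ler_normB _ _))//; lra.
Qed.

Lemma tau_lip i v v' : `|tau i v - tau i v'| <= `|v i ord0 - v' i ord0|.
Proof. by rewrite /tau opprD addrACA subrr addr0; exact: clip_lip. Qed.

Let mtau i : measurable_fun setT (fun w => tau i (z w)).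
Proof. by apply: vmeasurable_tau. Qed.

Lemma Ltwo_tau i : Ltwo P (fun w => tau i (z w)).
Proof. by apply: Ltwo_bounded => // w; exact: tau_bound. Qed.

Lemma Ex_tau i : Ex P (fun w => tau i (z w)) = 0.
Proof. by rewrite ExB// ?Ex_cst ?subrr//; exact: Lone_cst. Qed.

Lemma Ex_tau_sqr i : Ex P (fun w => tau i (z w) ^+ 2) <= h.
Proof.
have L : Ltwo P (fun w => clip (z w i ord0)).
  by apply: Ltwo_bounded => // w; exact: clip_bound.
rewrite Ex_sqrB//; last exact: Ltwo_cst.
under [X in 2 * X]eq_Ex do rewrite mulrC.
rewrite ExZ// Ex_cst -(gaussian_var h0 Gz i).
have : Ex P (fun w => clip (z w i ord0) ^+ 2) <= Ex P (fun w => z w i ord0 ^+ 2).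
  apply: Ex_le; [by case: L|by case: (Lz i)|move=> w].
  rewrite -real_normK ?num_real// -[leRHS]real_normK ?num_real//.
  by rewrite lerXn2r ?nnegrE// clip_norm_le.
set A := Ex P _; set B := Ex P _; have := sqr_ge0 (Ex P (fun w => clip (z w i ord0))).
by rewrite -/A -/B; set C := Ex P _; rewrite (_ : 2 * (C * C) = 2 * C ^+ 2); [lra|ring].
Qed.

Lemma Ex_tau_coord i j : i != j -> Ex P (fun w => tau i (z w) * z w j ord0) = 0.
Proof.
move=> ij.
rewrite (gaussian_cross (f := fun t => clip t - Ex P (fun w => clip (z w i ord0)))
   (g := id) Gz ij)//.
- by rewrite (gaussian_mean h0 Gz) mulr0.
- by apply: measurable_funB => //; exact: measurable_clip.
- exact: (Ltwo_Lone (Ltwo_tau i)).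
- exact: (Ltwo_Lone (Lz j)).
Qed.

Lemma Ex_tau_diag i : `|Ex P (fun w => tau i (z w) * z w i ord0)| <= h.
Proof.
rewrite -(@ler_pXn2r _ 2) ?nnegrE ?(ltW h0)// real_normK ?num_real//.
apply: le_trans (Ex_CS (Ltwo_tau i) (Lz i)) _.
by rewrite (gaussian_var h0 Gz) [leRHS]expr2 ler_wpM2r ?Ex_tau_sqr// ltW.
Qed.

Lemma Ltwo_dotv (u : 'cV[R]_d) : Ltwo P (fun w => dotv u (z w)).
Proof. by apply: Ltwo_sum => i _; exact: LtwoZ. Qed.

Lemma Ex_dotv (u : 'cV[R]_d) : Ex P (fun w => dotv u (z w)) = 0.
Proof.
rewrite Ex_sum => [|i _]; last exact/LoneZ/Ltwo_Lone.
rewrite big1// => i _; rewrite ExZ ?(gaussian_mean h0 Gz) ?mulr0//.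
exact: Ltwo_Lone.
Qed.

Lemma Ex_dotv_sqr (u : 'cV[R]_d) : Ex P (fun w => dotv u (z w) ^+ 2) = h * hsnorm u ^+ 2.
Proof.
have -> : Ex P (fun w => dotv u (z w) ^+ 2) = Ex P (fun w => \sum_i \sum_j
    (u i ord0 * u j ord0) * (z w i ord0 * z w j ord0)).
  apply: eq_Ex => w; rewrite expr2 mulr_suml; apply: eq_bigr => i _.
  by rewrite mulr_sumr; apply: eq_bigr => j _; ring.
have L i j : Lone P (fun w => (u i ord0 * u j ord0) * (z w i ord0 * z w j ord0)).
  by apply: LoneZ; exact: LtwoM.
rewrite Ex_sum => [|i _]; last exact: Lone_sum.
rewrite hsnorm_sqrv mulr_sumr; apply: eq_bigr => i _.
rewrite Ex_sum => [|j _]; last exact: L.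
rewrite (bigD1 i)//= big1 => [|j ji].
  rewrite addr0 ExZ; last exact: LtwoM.
  by rewrite (gaussian_cov h0 Gz) eqxx mul1r; ring.
rewrite ExZ; last exact: LtwoM.
by rewrite (gaussian_cov h0 Gz) eq_sym (negbTE ji) mul0r mulr0.
Qed.

Section Weight.
Variables (k l al : R) (be : 'cV[R]_d).
Hypotheses (k0 : 0 <= k) (l0 : 0 <= l) (alk : `|al| <= k) (bel : hsnorm be <= l).
Hypotheses (hk : h * k <= 8^-1) (lK : 2 * K * d%:R * l <= 4^-1).
Let s := 1 + h * k.

Definition taub v : R := \sum_i be i ord0 * tau i v.
(** With al and be the slopes of the driver in y and z, 1 + h al + be . tau is the factor by which
    one step multiplies a difference of values; division by 1 + h k is the discount that keeps its
    mean at most 1. *)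
Definition weight v : R := s^-1 * (1 + h * al + taub v).

Let s1 : 1 <= s. Proof. by rewrite lerDl mulr_ge0// ltW. Qed.
Let s0 : 0 < s. Proof. exact: lt_le_trans s1. Qed.
Let si1 : s^-1 <= 1. Proof. by rewrite invf_le1. Qed.
Let si0 : 0 <= s^-1. Proof. by rewrite invr_ge0 ltW. Qed.

Lemma taub_bound v : `|taub v| <= 4^-1.
Proof.
apply: le_trans (ler_norm_sum _ _ _) _.
apply: (@le_trans _ _ (\sum_(i < d) l * (2 * K))).
  apply: ler_sum => i _; rewrite normrM ler_pM// ?tau_bound//.
  exact: le_trans (hs_entry_le be i ord0) bel.
rewrite sumr_const card_ord -[leLHS]mulr_natl; apply: le_trans lK.
by rewrite le_eqVlt; apply/orP; left; apply/eqP; ring.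
Qed.

(** Positivity makes a step monotone and is the reason for the truncation: [lK] bounds be . tau by
    1/4 whatever the size of h. *)
Lemma weight_bounds v : 2^-1 <= weight v <= 3 / 2.
Proof.
have := taub_bound v; rewrite ler_norml => /andP[t1 t2].
have : `|h * al| <= 8^-1.
  rewrite normrM gtr0_norm//; apply: le_trans hk; rewrite ler_wpM2l//; exact: ltW.
rewrite ler_norml => /andP[a1 a2].
have h9 : 8 / 9 <= s^-1.
  by rewrite -[s^-1]mul1r ler_pdivlMr// /s; have := hk; lra.
rewrite /weight; apply/andP; split.
  have H : 5 / 8 <= 1 + h * al + taub v by lra.
  have := ler_pM _ _ h9 H; lra.
have H : 1 + h * al + taub v <= 11 / 8 by lra.
have := ler_pM si0 _ si1 H; lra.
Qed.

Lemma weight_norm v : `|weight v| <= 3 / 2.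
Proof. by have /andP[w1 w2] := weight_bounds v; rewrite ger0_norm//; lra. Qed.

Lemma vmeasurable_taub : vmeasurable taub.
Proof.
apply: vmeasurable_sum => i; apply: vmeasurableM; first exact: vmeasurable_cst.
exact: vmeasurable_tau.
Qed.

Lemma vmeasurable_weight : vmeasurable weight.
Proof.
apply: vmeasurableM; first exact: vmeasurable_cst.
apply: vmeasurableD; [exact: vmeasurable_cst|exact: vmeasurable_taub].
Qed.

Let mw : measurable_fun setT (fun w => weight (z w)).
Proof. exact: vmeasurable_weight. Qed.

Lemma Ltwo_taub : Ltwo P (fun w => taub (z w)).
Proof. by apply: Ltwo_sum => i _; apply: LtwoZ; exact: Ltwo_tau. Qed.

Lemma Ltwo_weight : Ltwo P (fun w => weight (z w)).
Proof. by apply: Ltwo_bounded => // w; exact: weight_norm. Qed.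

Lemma Ex_taub : Ex P (fun w => taub (z w)) = 0.
Proof.
rewrite Ex_sum => [|i _]; last exact/LoneZ/Ltwo_Lone/Ltwo_tau.
rewrite big1// => i _; rewrite ExZ ?Ex_tau ?mulr0//.
exact/Ltwo_Lone/Ltwo_tau.
Qed.

Lemma Ex_weight : Ex P (fun w => weight (z w)) = s^-1 * (1 + h * al).
Proof.
rewrite ExZ; last by apply: LoneD; [exact: Lone_cst|exact/Ltwo_Lone/Ltwo_taub].
by rewrite ExD ?Ex_cst ?Ex_taub ?addr0//; [exact: Lone_cst|exact/Ltwo_Lone/Ltwo_taub].
Qed.

Lemma Ex_weight_bounds : 1 - 2 * h * k <= Ex P (fun w => weight (z w)) <= 1.
Proof.
have : `|h * al| <= h * k.
  by rewrite normrM gtr0_norm// ler_wpM2l// ltW.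
rewrite Ex_weight ler_norml => /andP[a1 a2].
rewrite [s^-1 * _]mulrC ler_pdivlMr// ler_pdivrMr// mul1r.
by have := mulr_ge0 (ltW h0) k0; rewrite /s => H; apply/andP; split; nra.
Qed.

Lemma weight_shift_lip v (e : 'cV[R]_d) : `|weight (v - e) - weight v| <= l * hsnorm e.
Proof.
rewrite /weight -mulrBr normrM (ger0_norm si0) opprD addrACA subrr add0r.
apply: (@le_trans _ _ `|taub (v - e) - taub v|); first by rewrite ler_piMl.
rewrite /taub -sumrB; apply: le_trans (ler_norm_sum _ _ _) _.
apply: (@le_trans _ _ (\sum_i `|be i ord0| * `|e i ord0|)).
  apply: ler_sum => i _; rewrite -mulrBr normrM ler_wpM2l//.
  by apply: le_trans (tau_lip _ _ _) _; rewrite !mxE addrAC subrr add0r normrN.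
have -> : \sum_i `|be i ord0| * `|e i ord0| =
    dotv (\col_i `|be i ord0|) (\col_i `|e i ord0|).
  by apply: eq_bigr => i _; rewrite !mxE.
have nabs (u : 'cV[R]_d) : hsnorm (\col_i `|u i ord0|) = hsnorm u.
  apply/eqP; rewrite -(@eqrXn2 _ 2) ?hsnorm_ge0// !hsnorm_sqrv; apply/eqP.
  by apply: eq_bigr => i _; rewrite mxE real_normK ?num_real.
apply: le_trans (ler_norm _) (le_trans (dotv_le _ _) _).
by rewrite !nabs ler_wpM2r ?hsnorm_ge0.
Qed.

(** Pairs of distinct coordinates are independent and centred, so only the diagonal survives; it is
    at most h by Cauchy-Schwarz. *)
Lemma Ex_taub_dotv (u : 'cV[R]_d) :
  Ex P (fun w => taub (z w) * dotv u (z w)) <= h * (l * hsnorm u).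
Proof.
have -> : Ex P (fun w => taub (z w) * dotv u (z w)) = Ex P (fun w => \sum_i \sum_j
    (be i ord0 * u j ord0) * (tau i (z w) * z w j ord0)).
  apply: eq_Ex => w; rewrite mulr_suml; apply: eq_bigr => i _.
  by rewrite mulr_sumr; apply: eq_bigr => j _; ring.
have L i j : Lone P (fun w => tau i (z w) * z w j ord0).
  by apply: LtwoM => //; exact: Ltwo_tau.
rewrite Ex_sum => [|i _]; last by apply: Lone_sum => j _; exact: LoneZ.
apply: (@le_trans _ _ (\sum_i h * (`|be i ord0| * `|u i ord0|))).
  apply: ler_sum => i _; rewrite Ex_sum => [|j _]; last exact: LoneZ.
  rewrite (bigD1 i)//= big1 => [|j ji]; last by rewrite ExZ// Ex_tau_coord ?mulr0// eq_sym.
  rewrite addr0 ExZ//; apply: le_trans (ler_norm _) _.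
  by rewrite 2!normrM mulrC ler_wpM2r ?mulr_ge0// Ex_tau_diag.
rewrite -mulr_sumr ler_wpM2l ?(ltW h0)//.
have -> : \sum_i `|be i ord0| * `|u i ord0| =
    dotv (\col_i `|be i ord0|) (\col_i `|u i ord0|).
  by apply: eq_bigr => i _; rewrite !mxE.
have nabs (e : 'cV[R]_d) : hsnorm (\col_i `|e i ord0|) = hsnorm e.
  apply/eqP; rewrite -(@eqrXn2 _ 2) ?hsnorm_ge0// !hsnorm_sqrv; apply/eqP.
  by apply: eq_bigr => i _; rewrite mxE real_normK ?num_real.
apply: le_trans (ler_norm _) (le_trans (dotv_le _ _) _).
by rewrite !nabs ler_wpM2r ?hsnorm_ge0.
Qed.

Lemma Lone_hs_affine (D : 'cV[R]_d) (S : 'M[R]_d) :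
  Lone P (fun w => hsnorm (D + S *m z w) ^+ 2).
Proof.
under eq_fun do rewrite hsnorm_sqrv.
apply: Lone_sum => i _.
have [] : Ltwo P (fun w => (D + S *m z w) i ord0) => //.
under eq_fun do rewrite !mxE; apply: LtwoD; first exact: Ltwo_cst.
by apply: Ltwo_sum => j _; exact: LtwoZ.
Qed.

(** Expand the square: the weight has mean at most 1, the noise meets only the part be . tau of the
    weight in the cross term, and the weight is at most 3/2 in the last term. This is the origin of
    the terms 2 l Ls and 3/2 Ls^2 in the growth rate. *)
Lemma weight_second_moment (D : 'cV[R]_d) (S : 'M[R]_d) :
  Ex P (fun w => weight (z w) * hsnorm (D + S *m z w) ^+ 2) <=
  hsnorm D ^+ 2 + 2 * h * l * hsnorm S * hsnorm D + 3 / 2 * h * hsnorm S ^+ 2.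
Proof.
set u := S^T *m D.
have uD : hsnorm u <= hsnorm S * hsnorm D.
  by rewrite -[hsnorm S]hsnorm_trmx; exact: hsnorm_mulmx_le.
have E0 w : hsnorm (D + S *m z w) ^+ 2 =
    hsnorm D ^+ 2 + 2 * dotv u (z w) + hsnorm (S *m z w) ^+ 2.
  have -> : dotv u (z w) = dotv D (S *m z w).
    rewrite /dotv /u; under eq_bigr do rewrite mxE mulr_suml.
    under [RHS]eq_bigr do rewrite mxE mulr_sumr.
    rewrite exchange_big/=; apply: eq_bigr => i _; apply: eq_bigr => j _.
    by rewrite mxE; ring.
  rewrite !hsnorm_sqrv /dotv mulr_sumr -!big_split/=; apply: eq_bigr => i _.
  by rewrite mxE; ring.
have LS : Lone P (fun w => hsnorm (S *m z w) ^+ 2).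
  by have := Lone_hs_affine 0 S; under eq_fun do rewrite add0r.
have ES : Ex P (fun w => hsnorm (S *m z w) ^+ 2) = h * hsnorm S ^+ 2.
  have -> : Ex P (fun w => hsnorm (S *m z w) ^+ 2) =
      Ex P (fun w => \sum_i dotv (row i S)^T (z w) ^+ 2).
    apply: eq_Ex => w; rewrite hsnorm_sqrv; apply: eq_bigr => i _.
    by rewrite mxE; congr (_ ^+ 2); apply: eq_bigr => j _; rewrite !mxE.
  rewrite Ex_sum => [|i _]; last by have [] := Ltwo_dotv (row i S)^T.
  rewrite hsnorm_sqr mulr_sumr; apply: eq_bigr => i _.
  by rewrite Ex_dotv_sqr hsnorm_sqrv; congr (_ * _); apply: eq_bigr => j _; rewrite !mxE.
have Lw := Ltwo_Lone Ltwo_weight.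
have Lwd : Lone P (fun w => weight (z w) * dotv u (z w)).
  by apply: LtwoM; [exact: Ltwo_weight|exact: Ltwo_dotv].
have LwS : Lone P (fun w => weight (z w) * hsnorm (S *m z w) ^+ 2).
  by apply: (Lone_bounded_mul (c := 3 / 2)) => // w; exact: weight_norm.
have -> : Ex P (fun w => weight (z w) * hsnorm (D + S *m z w) ^+ 2) =
    hsnorm D ^+ 2 * Ex P (fun w => weight (z w)) +
    2 * Ex P (fun w => weight (z w) * dotv u (z w)) +
    Ex P (fun w => weight (z w) * hsnorm (S *m z w) ^+ 2).
  have L1 := LoneZ (hsnorm D ^+ 2) Lw; have L2 := LoneZ 2 Lwd; have L12 := LoneD L1 L2.
  rewrite -(ExZ (hsnorm D ^+ 2) Lw) -(ExZ 2 Lwd) -(ExD L1 L2) -(ExD L12 LwS).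
  by apply: eq_Ex => w; rewrite E0; ring.
have B1 : hsnorm D ^+ 2 * Ex P (fun w => weight (z w)) <= hsnorm D ^+ 2.
  by rewrite ler_piMr ?sqr_ge0//; have /andP[] := Ex_weight_bounds.
have B2 : Ex P (fun w => weight (z w) * dotv u (z w)) <= h * l * hsnorm S * hsnorm D.
  have -> : Ex P (fun w => weight (z w) * dotv u (z w)) =
      s^-1 * Ex P (fun w => taub (z w) * dotv u (z w)).
    have Ltd : Lone P (fun w => taub (z w) * dotv u (z w)).
      by apply: LtwoM; [exact: Ltwo_taub|exact: Ltwo_dotv].
    have Ld := Ltwo_Lone (Ltwo_dotv u).
    transitivity (Ex P (fun w => s^-1 * (1 + h * al) * dotv u (z w) +
        s^-1 * (taub (z w) * dotv u (z w)))).
      by apply: eq_Ex => w; rewrite /weight; ring.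
    by rewrite ExD ?ExZ ?Ex_dotv ?mulr0 ?add0r//; exact: LoneZ.
  apply: (@le_trans _ _ (s^-1 * (h * (l * hsnorm u)))).
    by rewrite ler_wpM2l// Ex_taub_dotv.
  apply: (@le_trans _ _ (h * (l * hsnorm u))).
    by rewrite ler_piMl// !mulr_ge0 ?hsnorm_ge0// ltW.
  by rewrite -!mulrA ler_wpM2l ?(ltW h0)// ler_wpM2l.
have B3 : Ex P (fun w => weight (z w) * hsnorm (S *m z w) ^+ 2) <= 3 / 2 * h * hsnorm S ^+ 2.
  rewrite -mulrA -ES -ExZ//; apply: Ex_le => [||w]//; first exact: LoneZ.
  by rewrite ler_wpM2r ?sqr_ge0//; have /andP[] := weight_bounds (z w).
lra.
Qed.

(** By the translation formula the difference of the two weighted means is the mean of f - f0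
    against weight(z - a) rho - weight(z). Young's inequality trades it for the variance of f and
    the chi-square cost of the shift. *)
Lemma weight_shift (f : 'cV[R]_d -> R) (F0 f0 th : R) (eta : 'cV[R]_d) :
  vmeasurable f -> (forall v, `|f v| <= F0) -> 0 < th ->
  h * hsnorm eta ^+ 2 <= 1 -> 2 * l ^+ 2 * h <= 1 ->
  Ex P (fun w => weight (z w) * f (z w + h *: eta)) <=
  Ex P (fun w => weight (z w) * f (z w)) + th * Ex P (fun w => (f (z w) - f0) ^+ 2)
  + 15 / (4 * th) * (h * hsnorm eta ^+ 2).
Proof.
move=> mf fF th0 he lh; set a := h *: eta.
have na : hsnorm a ^+ 2 = h ^+ 2 * hsnorm eta ^+ 2.
  by rewrite hsnormZ exprMn real_normK ?num_real.
have mfz : measurable_fun setT (fun w => f (z w)) by exact: mf.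
have mws : vmeasurable (fun v => weight (v - a)).
  apply: (vmeasurable_vcomp (S := fun v => v - a)); last exact: vmeasurable_weight.
  move=> i e1 T1 V mV; under eq_fun do rewrite mxE.
  by apply: measurable_funD => //; exact: mV.
have E1 : Ex P (fun w => weight (z w) * f (z w + a)) =
    Ex P (fun w => (weight (z w - a) * f (z w)) * rho h a (z w)).
  rewrite -(gaussian_shift h0 Gz (M := 3 / 2 * F0) a (F := fun v => weight (v - a) * f v)).
  - by apply: eq_Ex => w; rewrite addrK.
  - exact: vmeasurableM.
  - by move=> v; rewrite normrM ler_pM// weight_norm.
(* The translation formula at f = 1: both weights have the same mean, so a constant f0 may be
   subtracted from f. *)
have E2 : Ex P (fun w => weight (z w)) = Ex P (fun w => weight (z w - a) * rho h a (z w)).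
  rewrite -(gaussian_shift h0 Gz (M := 3 / 2) a (F := fun v => weight (v - a))) => //.
  - by apply: eq_Ex => w; rewrite addrK.
  - by move=> v; rewrite weight_norm.
have Lr := Ltwo_rho h0 Gz a.
have Lwr : Ltwo P (fun w => weight (z w - a) * rho h a (z w)).
  by apply: (Ltwo_bounded_mul (c := 3 / 2)) => //; [exact: mws|move=> w; exact: weight_norm].
have Lf : Ltwo P (fun w => f (z w)) by apply: Ltwo_bounded => // w; exact: fF.
have Lf0 : Ltwo P (fun w => f (z w) - f0) by apply: LtwoB => //; exact: Ltwo_cst.
have Lw := Ltwo_weight.
have Lg : Ltwo P (fun w => weight (z w - a) * rho h a (z w) - weight (z w)) by exact: LtwoB.
have E3 : Ex P (fun w => weight (z w) * f (z w + a)) - Ex P (fun w => weight (z w) * f (z w)) =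
    Ex P (fun w => (f (z w) - f0) * (weight (z w - a) * rho h a (z w) - weight (z w))).
  rewrite E1.
  transitivity (Ex P (fun w => weight (z w - a) * rho h a (z w) * f (z w) - weight (z w) * f (z w)
     - (f0 * (weight (z w - a) * rho h a (z w)) - f0 * weight (z w)))); last first.
    by apply: eq_Ex => w; ring.
  have L1 := LtwoM Lwr Lf; have L2 := LtwoM Lw Lf.
  have L3 := LoneZ f0 (Ltwo_Lone Lwr); have L4 := LoneZ f0 (Ltwo_Lone Lw).
  rewrite ExB; [|exact: LoneB|exact: LoneB].
  rewrite ExB// ExB// ExZ; last exact: Ltwo_Lone.
  rewrite ExZ -?E2 ?subrr ?subr0; last exact: Ltwo_Lone.
  by congr (_ - _); apply: eq_Ex => w; ring.
have Y := Ex_young (c := 2 * th) _ Lf0 Lg; rewrite mulr_gt0// in Y.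
have /(_ isT) {}Y := Y.
(* With t = h |eta|^2, the change of density contributes (9/2)(3 t) and the translated weight 2 l^2
   h t <= t; the sum 14.5 t is rounded to 15 t. *)
have G : Ex P (fun w => (weight (z w - a) * rho h a (z w) - weight (z w)) ^+ 2) <=
    15 * (h * hsnorm eta ^+ 2).
  have Lr1 : Ltwo P (fun w => rho h a (z w) - 1) by apply: LtwoB => //; exact: Ltwo_cst.
  apply: (@le_trans _ _ (Ex P (fun w => 9 / 2 * (rho h a (z w) - 1) ^+ 2 + 2 * (l * hsnorm a) ^+ 2))).
    apply: Ex_le; [by case: Lg|by apply: LoneD; [apply: LoneZ; case: Lr1|exact: Lone_cst]|].
    move=> w; have := weight_shift_lip (z w) a; have := weight_norm (z w - a).
    set A := weight (z w - a); set B := weight (z w); set r := rho h a (z w) - 1.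
    rewrite (_ : A * rho h a (z w) - B = A * r + (A - B)); last by rewrite /r; ring.
    move=> HA HB.
    have A2 : A ^+ 2 <= 9 / 4.
      rewrite -real_normK ?num_real// (_ : 9 / 4 = (3 / 2) ^+ 2); last by field.
      by rewrite lerXn2r// nnegrE.
    have B2 : (A - B) ^+ 2 <= (l * hsnorm a) ^+ 2.
      by rewrite -real_normK ?num_real// lerXn2r// nnegrE mulr_ge0// hsnorm_ge0.
    have := sqr_ge0 (A * r - (A - B)).
    have := ler_wpM2r (sqr_ge0 r) A2.
    rewrite (_ : A ^+ 2 * r ^+ 2 = (A * r) ^+ 2); last by ring.
    set X := A * r; set Y' := A - B => p1 p2.
    have -> : (X + Y') ^+ 2 = 2 * X ^+ 2 + 2 * Y' ^+ 2 - (X - Y') ^+ 2 by ring.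
    by move: B2; rewrite -/Y'; lra.
  rewrite ExD; [|by apply: LoneZ; case: Lr1|exact: Lone_cst].
  rewrite (ExZ (9 / 2) Lr1.2).
  rewrite Ex_cst (gaussian_chi2 h0 Gz) na.
  rewrite (_ : h ^+ 2 * hsnorm eta ^+ 2 / h = h * hsnorm eta ^+ 2); last first.
    by field; exact: lt0r_neq0.
  rewrite exprMn na.
  set t := h * hsnorm eta ^+ 2; have t0 : 0 <= t by rewrite mulr_ge0 ?sqr_ge0// ltW.
  have e1 : expR t - 1 <= 3 * t by apply: expR_sub1_le3; rewrite t0.
  have -> : l ^+ 2 * (h ^+ 2 * hsnorm eta ^+ 2) = l ^+ 2 * h * t by rewrite /t; ring.
  have := ler_wpM2r t0 lh; lra.
have tE : (2 * th)^-1 * (15 * (h * hsnorm eta ^+ 2)) = 2 * (15 / (4 * th) * (h * hsnorm eta ^+ 2)).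
  by field; exact: lt0r_neq0.
have i0 : 0 <= (2 * th)^-1 by rewrite invr_ge0 mulr_ge0// ltW.
have := ler_wpM2l i0 G; rewrite tE; move: Y E3; rewrite -/a.
move: (Ex P _) (Ex P _) (Ex P _) (Ex P _) => e1 e2 e3 e4.
move: (Ex P _) => e5; move: (15 / _ * _) ((2 * th)^-1 * e2) => e6 e7.
lra.
Qed.

End Weight.
End OneStep.

(** * One step of the scheme *)

(** The increment of gam is a fraction th / D in [-1, 1] of its Lipschitz bound D; the two terms of
    D become slopes along the sign of a - a' and along the direction of u - u'. *)
Lemma lipschitz_linearize (R : realType) d (gam : R -> 'cV[R]_d -> R) (k l : R) :
  0 <= k -> 0 <= l ->
  (forall a a' u u', `|gam a u - gam a' u'| <= k * `|a - a'| + l * hsnorm (u - u')) ->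
  forall a a' u u', exists al be, [/\ `|al| <= k, hsnorm be <= l &
    gam a u - gam a' u' = al * (a - a') + dotv be (u - u')].
Proof.
move=> k0 l0 H a a' u u'; set th := gam a u - gam a' u'.
set D := k * `|a - a'| + l * hsnorm (u - u').
have thD : `|th| <= D := H a a' u u'.
have D0 : 0 <= D by rewrite addr_ge0// mulr_ge0// hsnorm_ge0.
have [D1|D1] := eqVneq D 0.
  exists 0, 0; rewrite normr0 hsnorm0; split=> //.
  rewrite mul0r add0r /dotv big1 => [|i _]; last by rewrite mxE mul0r.
  by apply/eqP; rewrite -normr_eq0 eq_le normr_ge0 andbT -D1.
have D2 : 0 < D by rewrite lt_neqAle eq_sym D1.
have r1 : `|th / D| <= 1 by rewrite normrM [`|D^-1|]ger0_norm ?invr_ge0// ler_pdivrMr// mul1r.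
exists (th / D * k * Num.sg (a - a')), ((th / D * l / hsnorm (u - u')) *: (u - u')); split.
- rewrite !normrM -[leRHS]mul1r -mulrA ler_pM ?mulr_ge0//.
    by move: r1; rewrite normrM.
  rewrite ger0_norm// normr_sg; case: (_ != _); rewrite ?mulr1// mulr0//.
- rewrite hsnormZ normrM [`|(hsnorm _)^-1|]ger0_norm ?invr_ge0 ?hsnorm_ge0//.
  have [e|e] := eqVneq (hsnorm (u - u')) 0; first by rewrite e mulr0.
  by rewrite divfK// normrM (ger0_norm l0) -[leRHS]mul1r ler_wpM2r.
have -> : th / D * k * Num.sg (a - a') * (a - a') = th / D * (k * `|a - a'|).
  by rewrite normrEsg; ring.
have -> : dotv ((th / D * l / hsnorm (u - u')) *: (u - u')) (u - u') =
    th / D * (l * hsnorm (u - u')).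
  rewrite (_ : dotv _ _ = th / D * l / hsnorm (u - u') * dotv (u - u') (u - u')); last first.
    by rewrite /dotv mulr_sumr; apply: eq_bigr => i _; rewrite mxE mulrA.
  rewrite dotvv; have [e|e] := eqVneq (hsnorm (u - u')) 0.
    by rewrite e expr0n/= !mulr0.
  by field; apply/andP; split.
by rewrite -mulrDr divfK.
Qed.

Section OneStep.
Context dd (T : measurableType dd) (R : realType) (P : probability T R).
Context (d : nat) (h K : R) (z : T -> 'cV[R]_d).
Variables (b : 'cV[R]_d -> 'cV[R]_d) (sig : 'cV[R]_d -> 'M[R]_d).
Implicit Types (x y v : 'cV[R]_d) (V : 'cV[R]_d -> R) (gam : R -> 'cV[R]_d -> R).

Definition euler x v : 'cV[R]_d := x + h *: b x + sig x *m v.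
Definition smean V x : R := Ex P (fun w => V (euler x (z w))).
Definition sgrad V x : 'cV[R]_d :=
  \col_i (h^-1 * Ex P (fun w => V (euler x (z w)) * tau P K z i (z w))).
Definition snext gam V x : R := smean V x + h * gam (smean V x) (sgrad V x).

Hypotheses (h0 : 0 < h) (K0 : 0 <= K) (Gz : gaussian_vector P h z).
Variables (k l lam Lb Ls : R).
Hypotheses (k0 : 0 <= k) (l0 : 0 <= l) (lam0 : 0 < lam) (Lb0 : 0 <= Lb) (Ls0 : 0 <= Ls).
Hypothesis ell : forall x, loewner_le lam%:M (sig x).
Hypothesis bL : forall x x', hsnorm (b x - b x') <= Lb * hsnorm (x - x').
Hypothesis sL : forall x x', hsnorm (sig x - sig x') <= Ls * hsnorm (x - x').
Hypotheses (hk : h * k <= 8^-1) (lK : 2 * K * d%:R * l <= 4^-1).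
Hypotheses (lh : 2 * l ^+ 2 * h <= 1) (ldh : 16 * h * l ^+ 2 * (d%:R + 1) <= 1) (h1 : h <= 1).

Let mz : coord_measurable z. Proof. by case: Gz. Qed.
Let s := 1 + h * k.
Let s1 : 1 <= s. Proof. by rewrite lerDl mulr_ge0// ltW. Qed.
Let s0 : 0 < s. Proof. exact: lt_le_trans s1. Qed.
Let si1 : s^-1 <= 1. Proof. by rewrite invf_le1. Qed.
Let si0 : 0 <= s^-1. Proof. by rewrite invr_ge0 ltW. Qed.

Lemma vmeasurable_euler V x : vmeasurable V -> vmeasurable (fun v => V (euler x v)).
Proof.
move=> mV; apply: (vmeasurable_vcomp (S := euler x)) => // i.
exact: vmeasurable_affine.
Qed.

Lemma measurable_euler V x : vmeasurable V -> measurable_fun setT (fun w => V (euler x (z w))).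
Proof. by move=> mV; exact: vmeasurable_euler. Qed.

Lemma Ltwo_euler M V x : vmeasurable V -> (forall v, `|V v| <= M) ->
  Ltwo P (fun w => V (euler x (z w))).
Proof. by move=> mV VM; apply: (@Ltwo_bounded _ _ _ P M); [exact: measurable_euler|move=> w]. Qed.

Section Bounded.
Variables (M : R) (V : 'cV[R]_d -> R).
Hypotheses (mV : vmeasurable V) (VM : forall v, `|V v| <= M).

Let LV x : Ltwo P (fun w => V (euler x (z w))).
Proof. exact: Ltwo_euler. Qed.
Let Lt i : Ltwo P (fun w => tau P K z i (z w)).
Proof. exact: (Ltwo_tau K0 Gz). Qed.
Let M0 : 0 <= M. Proof. exact: le_trans (VM 0). Qed.

Lemma smean_bound x : `|smean V x| <= M.
Proof.
apply: le_trans (le_normr_Rintegral measurableT (Ltwo_Lone (LV x))) _.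
rewrite -[leRHS](Ex_cst P); apply: Ex_le => [||w].
- exact/Lone_norm/Ltwo_Lone.
- exact: Lone_cst.
- exact: VM.
Qed.

Lemma Lone_Vtau x i : Lone P (fun w => V (euler x (z w)) * tau P K z i (z w)).
Proof. exact: (LtwoM (LV x) (Lt i)). Qed.

Lemma sgrad_mulh x i :
  h * sgrad V x i ord0 = Ex P (fun w => V (euler x (z w)) * tau P K z i (z w)).
Proof. by rewrite mxE mulrA divff ?mul1r// gt_eqF. Qed.

Definition svar x : R := Ex P (fun w => (V (euler x (z w)) - smean V x) ^+ 2).

Lemma svar_ge0 x : 0 <= svar x.
Proof. exact: Ex_sqr_ge0. Qed.

(** Since tau is centred, V may be replaced by V minus its mean; then Cauchy-Schwarz with E tau^2 <=
    h. The gradient is thereby controlled by the one-step variance. *)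
Lemma sgrad_le_svar x : h * hsnorm (sgrad V x) ^+ 2 <= d%:R * svar x.
Proof.
rewrite hsnorm_sqrv mulr_sumr.
rewrite (_ : d%:R * svar x = \sum_(i < d) svar x); last first.
  by rewrite sumr_const card_ord mulr_natl.
apply: ler_sum => i _.
have Lc : Ltwo P (fun w => V (euler x (z w)) - smean V x).
  by apply: LtwoB => //; exact: Ltwo_cst.
have E : h * sgrad V x i ord0 =
    Ex P (fun w => (V (euler x (z w)) - smean V x) * tau P K z i (z w)).
  rewrite sgrad_mulh; under [RHS]eq_Ex do rewrite mulrBl.
  rewrite ExB; [|exact: Lone_Vtau|exact/LoneZ/Ltwo_Lone/Lt].
  rewrite ExZ; last exact/Ltwo_Lone/Lt.
  by rewrite (Ex_tau K0 Gz) mulr0 subr0.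
have := Ex_CS Lc (Lt i); rewrite -E exprMn => H.
have := le_trans H (ler_wpM2l (svar_ge0 x) (Ex_tau_sqr h0 K0 Gz i)).
by rewrite expr2 -mulrA mulrC ler_pM2r.
Qed.

(** h be . [sgrad V] is the mean of V times be . tau, which merges the mean and the two slopes of
    the driver into a single weight. *)
Lemma snext_diff gam x y :
  (forall a a' u u', `|gam a u - gam a' u'| <= k * `|a - a'| + l * hsnorm (u - u')) ->
  exists al be, [/\ `|al| <= k, hsnorm be <= l &
    s^-1 * snext gam V x - s^-1 * snext gam V y =
    Ex P (fun w => weight P h K z k al be (z w) * (V (euler x (z w)) - V (euler y (z w))))].
Proof.
move=> gL; have [al [be [alk bel E]]] :=
  lipschitz_linearize k0 l0 gL (smean V x) (smean V y) (sgrad V x) (sgrad V y).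
exists al, be; split => //; rewrite -mulrBr /snext.
have LW x' : Lone P (fun w => taub P K z be (z w) * V (euler x' (z w))).
  exact: (LtwoM (Ltwo_taub K0 Gz be) (LV x')).
have tE x' : Ex P (fun w => taub P K z be (z w) * V (euler x' (z w))) =
    h * dotv be (sgrad V x').
  under eq_Ex do rewrite /taub mulr_suml.
  rewrite Ex_sum => [|i _]; last first.
    by under eq_fun do rewrite -mulrA [_ * V _]mulrC; apply: LoneZ; exact: Lone_Vtau.
  rewrite /dotv mulr_sumr; apply: eq_bigr => i _.
  under eq_Ex do rewrite -mulrA [_ * V _]mulrC.
  by rewrite (ExZ _ (Lone_Vtau x' i)) -sgrad_mulh; ring.
transitivity (s^-1 * ((1 + h * al) * (smean V x - smean V y) +
   (h * dotv be (sgrad V x) - h * dotv be (sgrad V y)))).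
  rewrite (_ : _ - _ = (smean V x - smean V y) + h *
     (gam (smean V x) (sgrad V x) - gam (smean V y) (sgrad V y))); last by ring.
  rewrite E (_ : dotv be (sgrad V x - sgrad V y) = dotv be (sgrad V x) - dotv be (sgrad V y)).
    congr (_ * _); move: (smean V x) (smean V y) (dotv _ _) (dotv _ _) => ? ? ? ?.
    by ring.
  by rewrite /dotv -sumrB; apply: eq_bigr => i _; rewrite !mxE mulrBr.
rewrite -!tE /smean.
have L1 x' := Ltwo_Lone (LV x').
have L2 : Lone P (fun w => (1 + h * al) * (V (euler x (z w)) - V (euler y (z w)))).
  by apply: LoneZ; exact: LoneB.
have L3 := LoneB (LW x) (LW y).
rewrite -ExB// -ExZ; last exact: LoneB.
rewrite -[X in _ + X]ExB// -ExD// -ExZ; last exact: LoneD.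
by apply: eq_Ex => w; rewrite /weight; ring.
Qed.

(* The quadratic form of the gradient produced by G(u) = u - eps u^2 is what
   pays for the change of measure: this is the discrete Ito formula for Y^2. *)
Lemma snext_variance gam y al be :
  `|al| <= k -> hsnorm be <= l ->
  (forall a a' u u', `|gam a u - gam a' u'| <= k * `|a - a'| + l * hsnorm (u - u')) ->
  `|gam 0 0| <= k * M ->
  (s^-1 * snext gam V y) ^+ 2 -
    Ex P (fun w => weight P h K z k al be (z w) * V (euler y (z w)) ^+ 2) + svar y / 8 <=
  h * ((8 * k + 18 * k ^+ 2 + 32 * (d%:R + 1) * l ^+ 2) * M ^+ 2).
Proof.
move=> alk bel gL g0; set W := fun w => weight P h K z k al be (z w).
set U := fun w => V (euler y (z w)); set m := smean V y; set ze := sgrad V y.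
have wb w : 2^-1 <= W w <= 3 / 2 by exact: (weight_bounds h0 K0 Gz k0 alk bel hk lK).
have LU : Ltwo P U by exact: LV.
have LW : Ltwo P W by exact: (Ltwo_weight h0 K0 Gz k0 alk bel hk lK).
have LUm : Ltwo P (fun w => U w - m) by apply: LtwoB => //; exact: Ltwo_cst.
have mW : measurable_fun setT W by case: LW.
have Wn w : `|W w| <= 3 / 2 by exact: (weight_norm h0 K0 Gz k0 alk bel hk lK).
have L1 : Lone P (fun w => W w * (U w - m) ^+ 2).
  by apply: (Lone_bounded_mul (c := 3 / 2)) => //; case: LUm.
have L2 : Lone P (fun w => W w * (U w - m)) by exact: LtwoM.
have L3 := Ltwo_Lone LW.
have E1 : Ex P (fun w => W w * U w ^+ 2) = Ex P (fun w => W w * (U w - m) ^+ 2) +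
    2 * m * Ex P (fun w => W w * (U w - m)) + m ^+ 2 * Ex P W.
  have L4 := LoneZ (2 * m) L2; have L5 := LoneZ (m ^+ 2) L3.
  rewrite -(ExZ (2 * m) L2) -(ExZ (m ^+ 2) L3) -(ExD L1 L4) -(ExD (LoneD L1 L4) L5).
  by apply: eq_Ex => w; ring.
have B1 : 2^-1 * svar y <= Ex P (fun w => W w * (U w - m) ^+ 2).
  rewrite /svar -ExZ; last by case: LUm.
  apply: Ex_le => [||w] //; first by apply: LoneZ; case: LUm.
  by rewrite ler_wpM2r ?sqr_ge0//; have /andP[] := wb w.
have E2 : Ex P (fun w => W w * (U w - m)) = s^-1 * (h * dotv be ze).
  have Ltb : Ltwo P (fun w => taub P K z be (z w)) by exact: (Ltwo_taub K0 Gz).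
  have Lt1 := LtwoM Ltb LU; have Lt2 := LoneZ m (Ltwo_Lone Ltb).
  transitivity (Ex P (fun w => s^-1 * ((1 + h * al) * (U w - m)) +
     s^-1 * (taub P K z be (z w) * U w - m * taub P K z be (z w)))).
    by apply: eq_Ex => w; rewrite /W /weight; ring.
  have LUm1 := Ltwo_Lone LUm.
  rewrite ExD; [|by do 2 apply: LoneZ|by apply: LoneZ; exact: LoneB].
  rewrite ExZ; last exact: LoneZ.
  rewrite (ExZ (1 + h * al))// ExB; [|exact: Ltwo_Lone|exact: Lone_cst].
  rewrite Ex_cst subrr !mulr0 add0r ExZ; last exact: LoneB.
  rewrite ExB// ExZ; last exact: Ltwo_Lone.
  rewrite (Ex_taub K0 Gz) mulr0 subr0; congr (_ * _).
  under eq_Ex do rewrite /taub mulr_suml.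
  rewrite Ex_sum => [|i _]; last first.
    by under eq_fun do rewrite -mulrA [_ * U _]mulrC; apply: LoneZ; exact: Lone_Vtau.
  rewrite /dotv mulr_sumr; apply: eq_bigr => i _.
  under eq_Ex do rewrite -mulrA [_ * U _]mulrC.
  by rewrite (ExZ _ (Lone_Vtau y i)) -sgrad_mulh; ring.
have [w1 w2] : 1 - 2 * h * k <= Ex P W /\ Ex P W <= 1.
  by have /andP[] := Ex_weight_bounds h0 K0 Gz be k0 alk.
set q := hsnorm ze; have q0 : 0 <= q := hsnorm_ge0 _.
set va := svar y; have va0 : 0 <= va := svar_ge0 y.
have hq : h * q ^+ 2 <= (d%:R + 1) * va.
  by have := sgrad_le_svar y; rewrite -/q -/va mulrDl mul1r; lra.
have mM : `|m| <= M := smean_bound y.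
have gb : `|gam m ze| <= k * M + k * M + l * q.
  have := gL m 0 ze 0; rewrite !subr0 -/q => H.
  have := ler_normD (gam m ze - gam 0 0) (gam 0 0); rewrite subrK => H2.
  by have := ler_wpM2l k0 mM; lra.
set r := s^-1 * (gam m ze - k * m).
have rb : `|r| <= 3 * k * M + l * q.
  rewrite normrM (ger0_norm si0); apply: le_trans (ler_piMl _ si1) _ => //.
  apply: le_trans (ler_normB _ _) _; rewrite normrM (ger0_norm k0).
  by have := ler_wpM2l k0 mM; lra.
have Es : s^-1 * snext gam V y = m + h * r.
  by rewrite /snext -/m -/ze /r /s; field; rewrite gt_eqF.
have rq0 : 0 <= 3 * k * M + l * q by apply: addr_ge0; rewrite ?mulr_ge0.
have S1 : (s^-1 * snext gam V y) ^+ 2 <= m ^+ 2 + 2 * h * (M * (3 * k * M + l * q))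
     + h * (2 * h * (9 * k ^+ 2 * M ^+ 2 + l ^+ 2 * q ^+ 2)).
  rewrite Es.
  have mr : m * r <= M * (3 * k * M + l * q).
    by apply: le_trans (ler_norm _) _; rewrite normrM ler_pM.
  have r2 : r ^+ 2 <= 2 * (9 * k ^+ 2 * M ^+ 2 + l ^+ 2 * q ^+ 2).
    apply: (@le_trans _ _ ((3 * k * M + l * q) ^+ 2)).
      by rewrite -real_normK ?num_real// lerXn2r// nnegrE.
    by have := sqr_ge0 (3 * k * M - l * q); lra.
  have := ler_wpM2l (ltW h0) mr; have := ler_wpM2l (sqr_ge0 h) r2; lra.
have S2 : - (2 * m * (s^-1 * (h * dotv be ze))) <= 2 * h * (M * (l * q)).
  apply: le_trans (ler_norm _) _; rewrite normrN !normrM.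
  rewrite (ger0_norm si0) (gtr0_norm h0) [`|2|]ger0_norm//.
  have db : `|dotv be ze| <= l * q.
    by apply: le_trans (dotv_le _ _) _; rewrite ler_wpM2r.
  have H1 : s^-1 * (h * `|dotv be ze|) <= h * (l * q).
    apply: le_trans (ler_piMl _ si1) _; first by rewrite mulr_ge0// ltW.
    by rewrite ler_wpM2l// ltW.
  have := ler_pM (normr_ge0 m) _ mM H1.
  rewrite !mulr_ge0 ?(ltW h0)// => /(_ isT); lra.
have S3 : (1 - 2 * h * k) * m ^+ 2 <= m ^+ 2 * Ex P W.
  by rewrite mulrC ler_wpM2l ?sqr_ge0.
have m2 : m ^+ 2 <= M ^+ 2.
  by rewrite -real_normK ?num_real// lerXn2r// nnegrE.
have hk0 : 0 <= 2 * h * k by rewrite !mulr_ge0// ltW.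
have S4 := ler_wpM2l hk0 m2.
set N := d%:R + 1 : R; have N0 : 0 < N by rewrite /N ltr_wpDl.
(* Two gradient terms of size 2 h M l q arise, from the driver (S1) and from the weight (S2); they
   are paid out of the variance [va / 2] of B1. *)
have S5 : 4 * (M * (l * q)) <= q ^+ 2 / (8 * N) + 32 * N * (M * l) ^+ 2.
  have N8 : 0 < 8 * N by rewrite mulr_gt0.
  rewrite -(ler_pM2l N8) [leRHS]mulrDr (_ : 8 * N * (q ^+ 2 / (8 * N)) = q ^+ 2); last first.
    by field; rewrite gt_eqF.
  have := sqr_ge0 (q - 16 * N * (M * l)); lra.
have S6 : h * (q ^+ 2 / (8 * N)) <= va / 8.
  rewrite mulrA ler_pdivrMr ?mulr_gt0//; apply: le_trans hq _.
  by rewrite -/N le_eqVlt; apply/orP; left; apply/eqP; field.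
have S7 : h * (2 * h * (l ^+ 2 * q ^+ 2)) <= va / 8.
  have c0 : 0 <= 2 * h * l ^+ 2 by rewrite !mulr_ge0 ?sqr_ge0// ltW.
  have := ler_wpM2l c0 hq; have := ler_wpM2r va0 ldh; rewrite -/N; lra.
have S8 : h * (2 * h * (9 * k ^+ 2 * M ^+ 2)) <= h * (18 * k ^+ 2 * M ^+ 2).
  have c0 : 0 <= h * (18 * k ^+ 2 * M ^+ 2) by rewrite !mulr_ge0 ?sqr_ge0// ltW.
  have := ler_wpM2l c0 h1; lra.
have S9 := ler_wpM2l (ltW h0) S5.
rewrite E1 E2.
rewrite (_ : (M * l) ^+ 2 = M ^+ 2 * l ^+ 2) in S9; last by ring.
move: B1 S1 S2 S3 S4 S6 S7 S8 S9; rewrite -/va.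
set e1 := Ex P (fun w => W w * (U w - m) ^+ 2).
set e2 := (s^-1 * snext gam V y) ^+ 2; set e3 := 2 * m * _; set e4 := m ^+ 2 * Ex P W.
rewrite -/N; move: (q ^+ 2 / (8 * N)) => e5; lra.
Qed.

(** The hypothesis is used at x moved by the noise z and y moved by z + h eta, which removes a
    fraction h a of the distance. [weight_shift] brings the noise back to z, and [snext_variance]
    pays the variance this requires. *)
Lemma snext_step gam eps c q a L' :
  (forall a a' u u', `|gam a u - gam a' u'| <= k * `|a - a'| + l * hsnorm (u - u')) ->
  `|gam 0 0| <= k * M -> 0 < eps -> eps * M <= 2^-1 -> 0 <= c -> 0 <= q ->
  0 <= a -> h * a <= 1 ->
  2 * (Lb + l * Ls) + 3 / 2 * Ls ^+ 2 + h * (Lb ^+ 2 + 2 * l * Ls * Lb) <= L' ->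
  (forall x y, V x <= V y + eps * (c - V y ^+ 2) + q * hsnorm (x - y) ^+ 2) ->
  forall x y, s^-1 * snext gam V x <= s^-1 * snext gam V y +
    eps * (c + h * ((8 * k + 18 * k ^+ 2 + 32 * (d%:R + 1) * l ^+ 2) * M ^+ 2)
           - (s^-1 * snext gam V y) ^+ 2) +
    (q * (1 - h * a + h * L') + 120 / (eps * lam ^+ 2) * (h * a ^+ 2))
      * hsnorm (x - y) ^+ 2.
Proof.
move=> gL g0 e0 eM c0 q0 a0 ha LL HV x y.
have [al [be [alk bel Ed]]] := snext_diff x y gL.
have SV := snext_variance y alk bel gL g0.
move: Ed SV; set W := fun w => weight P h K z k al be (z w).
set Vx := s^-1 * snext gam V x; set Vy := s^-1 * snext gam V y; set va := svar y.
set X1 := fun w => V (euler x (z w)); set Y1 := fun w => V (euler y (z w)).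
move=> Ed SV.
(* The shift h eta of the noise moves y by h a (x - y). *)
set eta := invmx (sig y) *m (a *: (x - y)).
have [eE eN] := elliptic_inv lam0 (ell y) (a *: (x - y)).
have e2 : hsnorm eta ^+ 2 <= a ^+ 2 * hsnorm (x - y) ^+ 2 / lam ^+ 2.
  have -> : a ^+ 2 * hsnorm (x - y) ^+ 2 / lam ^+ 2 = (hsnorm (a *: (x - y)) / lam) ^+ 2.
    by rewrite hsnormZ (ger0_norm a0) expr_div_n exprMn.
  by rewrite lerXn2r ?nnegrE ?hsnorm_ge0// divr_ge0 ?hsnorm_ge0// ltW.
pose f v := V (euler y v) - eps * V (euler y v) ^+ 2.
have me := vmeasurable_euler y mV.
have mf : vmeasurable f.
  apply: vmeasurableB => //; apply: vmeasurableM; first exact: vmeasurable_cst.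
  exact: vmeasurableM.
have fb v : `|f v| <= 3 / 2 * M.
  have Vb := VM (euler y v); apply: le_trans (ler_normB _ _) _.
  rewrite normrM (gtr0_norm e0) normrX.
  have := ler_wpM2l (normr_ge0 (V (euler y v))) Vb.
  have := ler_wpM2r (normr_ge0 (V (euler y v))) eM.
  have := ler_wpM2l (ltW e0) (ler_wpM2l (normr_ge0 (V (euler y v))) Vb).
  rewrite expr2; lra.
set D := (1 - h * a) *: (x - y) + h *: (b x - b y).
set S := sig x - sig y.
have DE w : euler x (z w) - euler y (z w + h *: eta) = D + S *m z w.
  rewrite /euler /D /S mulmxDr -scalemxAr eE.
  apply/colP => i; rewrite !mulmxBl !mxE; ring.
have wb w : 2^-1 <= W w <= 3 / 2 by exact: (weight_bounds h0 K0 Gz k0 alk bel hk lK).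
have W0 w : 0 <= W w by have /andP[] := wb w; lra.
have Wn w : `|W w| <= 3 / 2 by rewrite ger0_norm//; have /andP[] := wb w.
have LW : Ltwo P W by exact: (Ltwo_weight h0 K0 Gz k0 alk bel hk lK).
have mW : measurable_fun setT W by case: LW.
have LX : Ltwo P X1 by exact: LV.
have LY : Ltwo P Y1 by exact: LV.
have mfa : measurable_fun setT (fun w => f (z w + h *: eta)).
  by apply: mf => i; under eq_fun do rewrite mxE; apply: measurable_funD.
have Lfa : Ltwo P (fun w => f (z w + h *: eta)).
  by apply: (@Ltwo_bounded _ _ _ P (3 / 2 * M)).
have Lf : Ltwo P (fun w => f (z w)).
  by apply: (@Ltwo_bounded _ _ _ P (3 / 2 * M)) => //; exact: mf.
have LD := Lone_hs_affine h0 Gz D S.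
have LWD : Lone P (fun w => W w * hsnorm (D + S *m z w) ^+ 2).
  exact: (Lone_bounded_mul mW Wn LD).
have Lc := LoneZ (eps * c) (Ltwo_Lone LW).
have LWf := LtwoM LW Lfa.
have A1 : Ex P (fun w => W w * X1 w) <= Ex P (fun w => W w * f (z w + h *: eta)) +
    eps * c * Ex P W + q * Ex P (fun w => W w * hsnorm (D + S *m z w) ^+ 2).
  have L3 := LoneZ q LWD.
  rewrite -(ExZ (eps * c) (Ltwo_Lone LW)) -(ExZ q LWD) -(ExD LWf Lc) -(ExD (LoneD LWf Lc) L3).
  apply: Ex_le => [||w]; [exact: LtwoM|exact: LoneD (LoneD LWf Lc) L3|].
  have := HV (euler x (z w)) (euler y (z w + h *: eta)); rewrite DE.
  move=> /(ler_wpM2l (W0 w)); rewrite /X1 /f.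
  by move: (V (euler y _)) (V (euler x _)) (hsnorm _ ^+ 2) (W w) => v1 v2 v3 v4; lra.
have A2 : Ex P (fun w => W w * hsnorm (D + S *m z w) ^+ 2) <=
    hsnorm D ^+ 2 + 2 * h * l * hsnorm S * hsnorm D + 3 / 2 * h * hsnorm S ^+ 2.
  exact: (weight_second_moment h0 K0 Gz k0 l0 alk bel hk lK).
have A3 : Ex P (fun w => W w * f (z w + h *: eta)) <=
    Ex P (fun w => W w * f (z w)) + eps / 8 * va + 120 / eps * (h * hsnorm eta ^+ 2).
  have va0 : 0 <= va := svar_ge0 y.
  (* The chi-square estimate needs a small shift. For a large one the cost 120 / eps already exceeds
     the trivial bound 9 M / 2, since eps M <= 1/2. *)
  have [small|big] := lerP (h * hsnorm eta ^+ 2) 1.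
    (* u - eps u^2 is 2-Lipschitz on the range of V, so its variance is at most [4 * va]; eps / 32
       turns this into eps va / 8, the amount released by [snext_variance]. *)
    have e32 : 0 < eps / 32 by rewrite divr_gt0.
    have := weight_shift h0 K0 Gz k0 l0 alk bel hk lK
      (smean V y - eps * smean V y ^+ 2) mf fb e32 small lh.
    rewrite (_ : 15 / (4 * (eps / 32)) = 120 / eps); last by field; exact: lt0r_neq0.
    move=> H; apply: (le_trans H); rewrite lerD2r lerD2l.
    have Lm : Ltwo P (fun w => Y1 w - smean V y) by apply: LtwoB => //; exact: Ltwo_cst.
    rewrite (_ : eps / 8 * va = eps / 32 * (4 * va)); last by field.
    rewrite ler_wpM2l ?(ltW e32)// /va /svar -(ExZ 4 Lm.2).
    have Lff : Ltwo P (fun w => f (z w) - (smean V y - eps * smean V y ^+ 2)).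
      by apply: LtwoB => //; exact: Ltwo_cst.
    apply: Ex_le => [||w]; [exact: Lff.2|exact: LoneZ Lm.2|].
    have := VM (euler y (z w)); have := smean_bound y; rewrite /f /Y1.
    move: (V (euler y (z w))) (smean V y) => u m mb ub.
    have -> : u - eps * u ^+ 2 - (m - eps * m ^+ 2) = (u - m) * (1 - eps * (u + m)) by ring.
    have : `|1 - eps * (u + m)| <= 2.
      apply: le_trans (ler_normB _ _) _; rewrite normr1 normrM (gtr0_norm e0).
      have := ler_wpM2l (ltW e0) (le_trans (ler_normD u m) (lerD ub mb)); lra.
    move=> H1; rewrite exprMn mulrC ler_wpM2r ?sqr_ge0//.
    by rewrite -real_normK ?num_real// (_ : 4 = 2 ^+ 2); [rewrite lerXn2r// nnegrE|ring].
  apply: (@le_trans _ _ (Ex P (fun w => W w * f (z w) + 9 / 2 * M))).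
    apply: Ex_le => [||w]; [exact: LtwoM|by apply: LoneD; [exact: LtwoM|exact: Lone_cst]|].
    have := fb (z w); have := fb (z w + h *: eta); have /andP[w1 w2] := wb w.
    rewrite !ler_norml => /andP[p1 p2] /andP[p3 p4].
    have p5 : f (z w + h *: eta) - f (z w) <= 3 * M by lra.
    have := ler_wpM2l (W0 w) p5; have := ler_wpM2r M0 w2; lra.
  rewrite (ExD (LtwoM LW Lf) (Lone_cst P _)) Ex_cst.
  have ev : 0 <= eps / 8 * va by rewrite mulr_ge0// divr_ge0// ltW.
  have : 9 / 2 * M <= 120 / eps * (h * hsnorm eta ^+ 2).
    apply: (@le_trans _ _ (120 / eps * 1)).
      by rewrite mulr1 ler_pdivlMr//; have := M0; lra.
    by rewrite ler_wpM2l ?ltW// divr_gt0.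
  lra.
have A4 : Ex P (fun w => W w * f (z w)) =
    Ex P (fun w => W w * Y1 w) - eps * Ex P (fun w => W w * Y1 w ^+ 2).
  have L1 : Lone P (fun w => W w * Y1 w ^+ 2) by exact: (Lone_bounded_mul mW Wn LY.2).
  rewrite -(ExZ eps L1) -(ExB (LtwoM LW LY) (LoneZ eps L1)).
  by apply: eq_Ex => w; rewrite /f /Y1; ring.
have Ed' : Vx - Vy = Ex P (fun w => W w * X1 w) - Ex P (fun w => W w * Y1 w).
  rewrite Ed -(ExB (LtwoM LW LX) (LtwoM LW LY)).
  by apply: eq_Ex => w; rewrite mulrBr.
have EW1 : Ex P W <= 1 by have /andP[] := Ex_weight_bounds h0 K0 Gz be k0 alk.
set r := hsnorm (x - y); have r0 : 0 <= r := hsnorm_ge0 _.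
have A5 : hsnorm D ^+ 2 + 2 * h * l * hsnorm S * hsnorm D + 3 / 2 * h * hsnorm S ^+ 2 <=
    (1 - h * a + h * L') * r ^+ 2.
  set t := 1 - h * a; have t0 : 0 <= t by rewrite /t; lra.
  have ha0 : 0 <= h * a by rewrite mulr_ge0// ltW.
  have t1 : t <= 1 by rewrite /t; lra.
  have Db : hsnorm D <= (t + h * Lb) * r.
    apply: le_trans (ler_hsnormD _ _) _; rewrite !hsnormZ (ger0_norm t0) (gtr0_norm h0).
    by have := ler_wpM2l (ltW h0) (bL x y); rewrite -/r; lra.
  have Sb : hsnorm S <= Ls * r := sL x y.
  have D0 := hsnorm_ge0 D; have S0 := hsnorm_ge0 S.
  have hLb0 : 0 <= h * Lb by rewrite mulr_ge0// ltW.
  have D2 : hsnorm D ^+ 2 <= ((t + h * Lb) * r) ^+ 2.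
    by rewrite lerXn2r// nnegrE mulr_ge0// addr_ge0.
  have S2 : hsnorm S ^+ 2 <= (Ls * r) ^+ 2 by rewrite lerXn2r// nnegrE mulr_ge0.
  have SD : hsnorm S * hsnorm D <= (Ls * r) * ((t + h * Lb) * r) by exact: ler_pM.
  have hl0 : 0 <= 2 * h * l by rewrite !mulr_ge0// ltW.
  have := ler_wpM2l hl0 SD.
  have h32 : 0 <= 3 / 2 * h by rewrite mulr_ge0// ltW.
  have := ler_wpM2l h32 S2.
  have r2 := sqr_ge0 r.
  have key : (t + h * Lb) ^+ 2 + 2 * h * l * Ls * (t + h * Lb) + 3 / 2 * h * Ls ^+ 2 <=
      t + h * L'.
    have LL' := ler_wpM2l (ltW h0) LL.
    have tt : t ^+ 2 <= t by rewrite expr2 ler_piMl.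
    have tb : t * (h * Lb) <= h * Lb by rewrite ler_piMl.
    have tl : t * (2 * h * l * Ls) <= 2 * h * l * Ls by rewrite ler_piMl// mulr_ge0.
    move: LL' tt tb tl; rewrite -/t; lra.
  have := ler_wpM2r r2 key; lra.
have A6 : 120 / eps * (h * hsnorm eta ^+ 2) <= 120 / (eps * lam ^+ 2) * (h * a ^+ 2) * r ^+ 2.
  have -> : 120 / (eps * lam ^+ 2) * (h * a ^+ 2) * r ^+ 2 =
      120 / eps * (h * (a ^+ 2 * r ^+ 2 / lam ^+ 2)).
    by field; rewrite !gt_eqF.
  rewrite ler_wpM2l//; first by rewrite ltW// divr_gt0.
  by rewrite ler_wpM2l// ltW.
have B1 := ler_wpM2l q0 (le_trans A2 A5).
have B2 : eps * c * Ex P W <= eps * c by rewrite ler_piMr// mulr_ge0// ltW.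
have B3 := ler_wpM2l (ltW e0) SV.
rewrite A4 in A3; move: Ed' A1 A3 A6 B1 B2 B3; rewrite -/W -/Y1.
move: (Ex P _) (Ex P _) (Ex P _) (Ex P _) (Ex P _) (Ex P _) => x1 x2 x3 x4 x5 x6.
lra.
Qed.

(** Linearise against (0, 0): the weight is nonnegative with mean at most 1, so only the discounted
    value of the driver at 0 is added to the bound. *)
Lemma snext_bound gam : (forall a a' u u',
    `|gam a u - gam a' u'| <= k * `|a - a'| + l * hsnorm (u - u')) ->
  forall x, `|s^-1 * snext gam V x| <= M + s^-1 * (h * `|gam 0 0|).
Proof.
move=> gL x.
have [al [be [alk bel E]]] :=
  lipschitz_linearize k0 l0 gL (smean V x) 0 (sgrad V x) 0.
rewrite !subr0 in E.
set W := fun w => weight P h K z k al be (z w).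
have LW : Ltwo P W by exact: (Ltwo_weight h0 K0 Gz k0 alk bel hk lK).
have EW1 : Ex P W <= 1 by have /andP[] := Ex_weight_bounds h0 K0 Gz be k0 alk.
have W0 w : 0 <= W w.
  by have /andP[] := weight_bounds h0 K0 Gz k0 alk bel hk lK (z w); rewrite -/(W w); lra.
have tE : Ex P (fun w => taub P K z be (z w) * V (euler x (z w))) = h * dotv be (sgrad V x).
  under eq_Ex do rewrite /taub mulr_suml.
  rewrite Ex_sum => [|i _]; last first.
    by under eq_fun do rewrite -mulrA [_ * V _]mulrC; apply: LoneZ; exact: Lone_Vtau.
  rewrite /dotv mulr_sumr; apply: eq_bigr => i _.
  under eq_Ex do rewrite -mulrA [_ * V _]mulrC.
  by rewrite (ExZ _ (Lone_Vtau x i)) -sgrad_mulh; ring.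
have E2 : s^-1 * snext gam V x = Ex P (fun w => W w * V (euler x (z w))) + s^-1 * (h * gam 0 0).
  have L1 := Ltwo_Lone (LV x); have L2 := LtwoM (Ltwo_taub K0 Gz be) (LV x).
  transitivity (Ex P (fun w => s^-1 * ((1 + h * al) * V (euler x (z w)) +
      taub P K z be (z w) * V (euler x (z w)))) + s^-1 * (h * gam 0 0)).
    rewrite (ExZ _ (LoneD (LoneZ _ L1) L2)) (ExD (LoneZ _ L1) L2) (ExZ _ L1) tE.
    rewrite /snext -[gam (smean V x) _](subrK (gam 0 0)) E /smean.
    by move: (Ex P _) (dotv _ _) => e1 e2; ring.
  by congr (_ + _); apply: eq_Ex => w; rewrite /W /weight; ring.
rewrite E2; apply: le_trans (ler_normD _ _) _.
rewrite [X in _ + X]normrM (ger0_norm si0) [`|h * _|]normrM (gtr0_norm h0) lerD2r.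
apply: le_trans (le_normr_Rintegral measurableT (LtwoM LW (LV x))) _.
apply: (@le_trans _ _ (Ex P (fun w => M * W w))).
  apply: Ex_le => [||w]; [exact/Lone_norm/LtwoM|exact/LoneZ/Ltwo_Lone|].
  by rewrite normrM (ger0_norm (W0 w)) mulrC ler_wpM2r.
by rewrite (ExZ _ (Ltwo_Lone LW)) ler_piMr.
Qed.

(** This constant may deteriorate with the number of steps: it only serves to make the next iterate
    continuous, hence measurable. *)
Lemma snext_lipschitz gam c : 0 <= c ->
  (forall a a' u u', `|gam a u - gam a' u'| <= k * `|a - a'| + l * hsnorm (u - u')) ->
  (forall x y, `|V x - V y| <= c * hsnorm (x - y)) ->
  exists2 c', 0 <= c' &
    forall x y, `|s^-1 * snext gam V x - s^-1 * snext gam V y| <= c' * hsnorm (x - y).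
Proof.
move=> c0 gL VL.
have Lz i : Ltwo P (fun w => z w i ord0) by exact: (gaussian_Ltwo h0 Gz).
pose g w := 1 + h * Lb + Ls * \sum_i `|z w i ord0|.
have Lg : Lone P g.
  apply: LoneD; first exact: Lone_cst.
  apply: LoneZ; apply: Lone_sum => i _; exact/Lone_norm/Ltwo_Lone.
have g0 w : 0 <= g w.
  by rewrite !addr_ge0// !mulr_ge0 ?(ltW h0)//; apply: sumr_ge0 => i _.
exists (3 / 2 * c * Ex P g).
  by rewrite !mulr_ge0//; exact: Ex_ge0.
move=> x y; have [al [be [alk bel ->]]] := snext_diff x y gL.
set W := fun w => weight P h K z k al be (z w).
have LW : Ltwo P W by exact: (Ltwo_weight h0 K0 Gz k0 alk bel hk lK).
have LXY : Ltwo P (fun w => V (euler x (z w)) - V (euler y (z w))) by exact: LtwoB.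
apply: le_trans (le_normr_Rintegral measurableT (LtwoM LW LXY)) _.
rewrite (_ : _ * hsnorm (x - y) = 3 / 2 * c * hsnorm (x - y) * Ex P g); last by ring.
rewrite -(ExZ _ Lg); apply: Ex_le => [||w]; [exact/Lone_norm/LtwoM|exact: LoneZ|].
have Wn : `|W w| <= 3 / 2 by exact: (weight_norm h0 K0 Gz k0 alk bel hk lK).
rewrite normrM (_ : 3 / 2 * c * _ * _ = 3 / 2 * (c * (hsnorm (x - y) * g w))); last by ring.
rewrite ler_pM//; apply: le_trans (VL _ _) _; rewrite ler_wpM2l//.
have -> : euler x (z w) - euler y (z w) = (x - y) + h *: (b x - b y) + (sig x - sig y) *m z w.
  by apply/colP => i; rewrite !mulmxBl !mxE; ring.
apply: le_trans (ler_hsnormD _ _) _; rewrite [X in _ <= X]mulrC /g 2!mulrDl mul1r.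
apply: lerD.
  apply: le_trans (ler_hsnormD _ _) _; rewrite lerD2l hsnormZ (gtr0_norm h0) -mulrA.
  by rewrite ler_wpM2l ?(ltW h0).
apply: le_trans (hsnorm_mulmx_le _ _) _; rewrite mulrAC.
by rewrite ler_pM ?hsnorm_ge0 ?hsnorm_le_sum.
Qed.

End Bounded.

(** Discounting conjugates the driver by a dilation, and the conjugate has the same Lipschitz
    constants. *)
Lemma snext_scale gam V c x : c != 0 -> Lone P (fun w => V (euler x (z w))) ->
  (forall i, Lone P (fun w => V (euler x (z w)) * tau P K z i (z w))) ->
  snext gam (fun v => c * V v) x = c * snext (fun a u => c^-1 * gam (c * a) (c *: u)) V x.
Proof.
move=> cn LV LVt; rewrite /snext.
have -> : smean (fun v => c * V v) x = c * smean V x by rewrite /smean ExZ.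
have -> : sgrad (fun v => c * V v) x = c *: sgrad V x.
  apply/colP => i; rewrite !mxE.
  by under eq_Ex do rewrite -mulrA; rewrite ExZ// mulrCA.
by field.
Qed.

End OneStep.

(** * Gradient bound for the scheme *)

Section DecayFactor.
Context {R : realType}.
Implicit Types L t h : R.

(** Flow property of the equation D' = 1 - L D with D(0) = 0. *)
Lemma decay_factorD L t h :
  decay_factor L (t + h) = decay_factor L h + expR (- (L * h)) * decay_factor L t.
Proof.
rewrite /decay_factor; case: eqP => [->|/eqP L0].
  by rewrite mul0r oppr0 expR0 mul1r addrC.
by rewrite mulrDr opprD expRD; field.
Qed.

Lemma decay_factor0 L : decay_factor L 0 = 0.
Proof.
by rewrite /decay_factor; case: eqP => // _; rewrite mulr0 oppr0 expR0 subrr mul0r.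
Qed.

Lemma decay_factor_le L h : 0 <= L -> 0 <= h -> decay_factor L h <= h.
Proof.
move=> L0 h0; rewrite /decay_factor; case: eqP => // /eqP L1.
have L2 : 0 < L by rewrite lt_neqAle eq_sym L1.
by rewrite ler_pdivrMr//; have := expR_ge1Dx (- (L * h)); rewrite [h * L]mulrC; lra.
Qed.

Lemma decay_factor_gt0 L t : 0 <= L -> 0 < t -> 0 < decay_factor L t.
Proof.
move=> L0 t0; rewrite /decay_factor; case: eqP => // /eqP L1.
have L2 : 0 < L by rewrite lt_neqAle eq_sym L1.
by rewrite divr_gt0// subr_gt0 expR_lt1 oppr_lt0 mulr_gt0.
Qed.

End DecayFactor.

Section Scheme.
Context dd (T : measurableType dd) (R : realType) (P : probability T R).
Context (d : nat) (h K : R) (z : nat -> T -> 'cV[R]_d).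
Variables (b : 'cV[R]_d -> 'cV[R]_d) (sig : 'cV[R]_d -> 'M[R]_d).
Variables (g : R -> 'cV[R]_d -> R) (phi : 'cV[R]_d -> R).
Implicit Types (x y v : 'cV[R]_d).

Fixpoint scheme (j : nat) : 'cV[R]_d -> R :=
  if j is j'.+1 then snext P h K (z j') b sig g (scheme j') else phi.

Hypotheses (h0 : 0 < h) (K0 : 0 <= K) (Gz : forall j, gaussian_vector P h (z j)).
Variables (k l lam Lb Ls B m0 : R).
Hypotheses (k0 : 0 < k) (l0 : 0 <= l) (lam0 : 0 < lam) (Lb0 : 0 <= Lb) (Ls0 : 0 <= Ls).
Hypotheses (B0 : 0 <= B) (m00 : 0 <= m0).
Hypothesis ell : forall x, loewner_le lam%:M (sig x).
Hypothesis bL : forall x x', hsnorm (b x - b x') <= Lb * hsnorm (x - x').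
Hypothesis sL : forall x x', hsnorm (sig x - sig x') <= Ls * hsnorm (x - x').
Hypothesis gL : forall a a' u u',
  `|g a u - g a' u'| <= k * `|a - a'| + l * hsnorm (u - u').
Hypothesis phiB : forall x, `|phi x| <= B.
Hypothesis phiL : forall x y, `|phi x - phi y| <= m0 * hsnorm (x - y).
Hypotheses (hk : h * k <= 8^-1) (lK : 2 * K * d%:R * l <= 4^-1).
Hypotheses (lh : 2 * l ^+ 2 * h <= 1) (ldh : 16 * h * l ^+ 2 * (d%:R + 1) <= 1) (h1 : h <= 1).

Let s := 1 + h * k.
Let s1 : 1 < s. Proof. by rewrite ltrDl mulr_gt0. Qed.
Let s0 : 0 < s. Proof. exact: lt_trans s1. Qed.
Let sX j : 0 < s ^+ j. Proof. exact: exprn_gt0. Qed.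

Definition disc j x := (s ^+ j)^-1 * scheme j x.
Definition dgen j a u := (s ^+ j)^-1 * g (s ^+ j * a) (s ^+ j *: u).

Let dgenL j a a' u u' :
  `|dgen j a u - dgen j a' u'| <= k * `|a - a'| + l * hsnorm (u - u').
Proof.
have si : 0 <= (s ^+ j)^-1 by rewrite invr_ge0 ltW.
rewrite /dgen -mulrBr normrM (ger0_norm si) ler_pdivrMl//.
apply: le_trans (gL _ _ _ _) _; rewrite -mulrBr -scalerBr normrM hsnormZ.
by rewrite (gtr0_norm (sX j)) le_eqVlt; apply/orP; left; apply/eqP; ring.
Qed.

Let dgen0 j : `|dgen j 0 0| = (s ^+ j)^-1 * `|g 0 0|.
Proof. by rewrite /dgen mulr0 scaler0 normrM ger0_norm// invr_ge0 ltW. Qed.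

(** With s = 1 + h k, the discounted contributions h |g(0, 0)| / s^(j + 1) sum up to |g(0, 0)| /
    k. *)
Definition scheme_bound : R := B + `|g 0 0| / k.

(** The bound carries the exact partial sum of the geometric series. The properties are proved
    together because the step formula needs measurability and boundedness, while measurability comes
    from the Lipschitz property. *)
Lemma scheme_invariant j :
  [/\ vmeasurable (disc j),
      forall x, `|disc j x| <= B + `|g 0 0| / k * (1 - (s ^+ j)^-1),
      exists2 c, 0 <= c & forall x y, `|disc j x - disc j y| <= c * hsnorm (x - y) &
      forall x, disc j.+1 x = s^-1 * snext P h K (z j) b sig (dgen j) (disc j) x].
Proof.
have step i : vmeasurable (disc i) ->
    (forall x, `|disc i x| <= B + `|g 0 0| / k * (1 - (s ^+ i)^-1)) ->
    forall x, disc i.+1 x = s^-1 * snext P h K (z i) b sig (dgen i) (disc i) x.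
  move=> mD bD x.
  have E : scheme i = fun v => s ^+ i * disc i v.
    by apply/funext => v; rewrite /disc mulrA divff ?mul1r// gt_eqF.
  have LD : Ltwo P (fun w => disc i (euler h b sig x (z i w))).
    apply: (Ltwo_euler b sig (Gz i) x mD) => v; apply: le_trans (bD v) _.
    exact: lexx.
  rewrite {1}/disc /= E snext_scale.
  - by rewrite exprS; field; rewrite !gt_eqF.
  - by rewrite gt_eqF.
  - exact: Ltwo_Lone.
  - by move=> q; apply: LtwoM => //; exact: (Ltwo_tau K0 (Gz i)).
elim: j => [|j [mD bD [c c0 LD] ED]].
  have E0 : disc 0 = phi by apply/funext => v; rewrite /disc expr0 invr1 mul1r.
  have m : vmeasurable (disc 0).
    by rewrite E0; apply/continuous_vmeasurable/(lipschitz_continuous (c := m0)).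
  have bb x : `|disc 0 x| <= B + `|g 0 0| / k * (1 - (s ^+ 0)^-1).
    by rewrite E0 expr0 invr1 subrr mulr0 addr0.
  split=> //; first by exists m0 => // x y; rewrite E0.
  exact: step.
have Lip : exists2 c, 0 <= c & forall x y, `|disc j.+1 x - disc j.+1 y| <= c * hsnorm (x - y).
  have [c' c'0 H] := snext_lipschitz h0 K0 (Gz j) (ltW k0) l0 Lb0 Ls0 bL sL hk lK mD bD c0
    (@dgenL j) LD.
  by exists c' => // x y; rewrite !ED.
have m : vmeasurable (disc j.+1).
  by have [c' _ H] := Lip; apply/continuous_vmeasurable/(lipschitz_continuous H).
have bb x : `|disc j.+1 x| <= B + `|g 0 0| / k * (1 - (s ^+ j.+1)^-1).
  have := snext_bound b sig h0 K0 (Gz j) (ltW k0) l0 hk lK mD bD (@dgenL j) x.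
  rewrite -/s -ED => H; apply: (le_trans H).
  rewrite dgen0 -addrA lerD2l -/s.
  rewrite le_eqVlt; apply/orP; left; apply/eqP.
  by rewrite exprS /s; field; rewrite !gt_eqF ?exprn_gt0.
by split; [exact: m|exact: bb|exact: Lip|exact: step].
Qed.

Opaque disc.

Lemma disc_bound j x : `|disc j x| <= scheme_bound.
Proof.
have [_ H _ _] := scheme_invariant j; apply: le_trans (H x) _.
rewrite /scheme_bound lerD2l ler_piMr ?divr_ge0 ?(ltW k0)//.
by rewrite gerBl invr_ge0 ltW.
Qed.

Variables (M eps L Lt d0 : R).
Hypotheses (MB : scheme_bound <= M) (M0 : 0 < M).
Hypotheses (e0 : 0 < eps) (eM : eps * M <= 2^-1).
Hypothesis Ldef : 2 * (Lb + l * Ls) + 3 / 2 * Ls ^+ 2 <= L.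
Hypothesis Lt_def : L + h * (Lb ^+ 2 + 2 * l * Ls * Lb) <= Lt.
Hypotheses (L0 : 0 <= L) (hLt : h * Lt <= 1) (d00 : 0 < d0).
Hypothesis d0_small : d0 * (lam ^+ 2 * m0 ^+ 2) <= (32 * 120) * M ^+ 2.

Let Lt0 : L <= Lt.
Proof.
apply: le_trans Lt_def; rewrite lerDl mulr_ge0 ?(ltW h0)// addr_ge0 ?sqr_ge0//.
by rewrite !mulr_ge0.
Qed.
Let hLt0 : 0 <= h * Lt.
Proof. by rewrite mulr_ge0 ?(ltW h0)// (le_trans L0). Qed.

(** Implicit Euler scheme for d' = 1 - Lt d; the coefficient q of the induction is a constant
    divided by [dseq]. *)
Fixpoint dseq j : R := if j is j'.+1 then (dseq j' + h) / (1 + h * Lt) else d0.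

Lemma dseq_gt0 j : 0 < dseq j.
Proof.
have p : 0 < 1 + h * Lt by apply: lt_le_trans ltr01 _; rewrite lerDl.
by elim: j => [|i IH] //=; apply: divr_gt0 => //; apply: addr_gt0.
Qed.

(** This crude bound only guarantees 4 h <= [dseq j] on a fine mesh, so that at most the full
    distance is removed in one step. *)
Lemma dseq_lower j : expR (- (Lt * (j%:R * h))) * d0 <= dseq j.
Proof.
elim: j => [|j IH] /=; first by rewrite mul0r mulr0 oppr0 expR0 mul1r.
have p : 0 < 1 + h * Lt by apply: lt_le_trans ltr01 _; rewrite lerDl.
rewrite ler_pdivlMr//; apply: (@le_trans _ _ (dseq j)); last by rewrite lerDl ltW.
apply: le_trans IH.
rewrite -natr1 mulrDl mulrDr opprD expRD mul1r mulrAC [leLHS]mulrAC.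
rewrite [leLHS]mulrAC ler_pM2r// -[leLHS]mulrA ler_piMr ?expR_ge0//.
rewrite [Lt * h]mulrC expRN ler_pdivrMl ?expR_gt0// mulr1.
exact: expR_ge1Dx.
Qed.

(** Each step divides by 1 + h Lt <= exp(L h) exp(delta h), and [decay_factorD] adds up the
    contributions. As d0 has dropped out, the bound does not see the Lipschitz constant of the
    terminal value. *)
Lemma dseq_decay delta j : Lt = L + delta ->
  expR (- (delta * (j%:R * h))) * (expR (- (L * h)) * decay_factor L (j%:R * h)) <= dseq j.
Proof.
move=> LtE; elim: j => [|j IH] /=.
  by rewrite mul0r decay_factor0 !mulr0 ltW.
have p : 0 < 1 + h * Lt by apply: lt_le_trans ltr01 _; rewrite lerDl.
rewrite -[X in _ <= X]mulrC mulrC.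
have ip : expR (- (L * h)) * expR (- (delta * h)) <= (1 + h * Lt)^-1.
  rewrite -expRD -[leLHS]invrK lef_pV2 ?posrE ?invr_gt0 ?expR_gt0//.
  rewrite -expRN opprD !opprK; apply: le_trans (expR_ge1Dx _) _.
  by rewrite LtE ler_expR; lra.
rewrite -natr1 mulrDl mul1r decay_factorD.
set e1 := expR (- (L * h)); set e2 := expR (- (delta * h)).
have -> : expR (- (delta * (j%:R * h + h))) = expR (- (delta * (j%:R * h))) * e2.
  by rewrite mulrDr opprD expRD.
set e3 := expR (- (delta * (j%:R * h))); set D := decay_factor L (j%:R * h).
move: IH; rewrite -/e3 -/e1 -/D => IH.
have Dh : decay_factor L h <= h by apply: decay_factor_le => //; exact: ltW.
have e10 : 0 <= e1 by exact: expR_ge0.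
have e20 : 0 <= e2 by exact: expR_ge0.
have e30 : 0 <= e3 by exact: expR_ge0.
have dl0 : 0 <= delta.
  by rewrite (_ : delta = Lt - L) ?subr_ge0 ?Lt0// LtE [L + _]addrC addrK.
have e31 : e3 <= 1.
  by rewrite -[leRHS]expR0 ler_expR oppr_le0 !mulr_ge0// ltW.
apply: (@le_trans _ _ (e1 * e2 * (e3 * h + dseq j))).
  rewrite (_ : e3 * e2 * _ = e1 * e2 * (e3 * decay_factor L h + e3 * (e1 * D))); last by ring.
  rewrite ler_wpM2l ?mulr_ge0//; apply: lerD => //; exact: ler_wpM2l.
apply: (@le_trans _ _ (e1 * e2 * (dseq j + h))).
  by rewrite ler_wpM2l ?mulr_ge0// addrC lerD2l ler_piMl// ltW.
by rewrite [leRHS]mulrC ler_wpM2r// addr_ge0 ?(ltW h0) ?(ltW (dseq_gt0 j)).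
Qed.

Let disc0 x : disc 0 x = phi x.
Proof. Transparent disc. by rewrite /disc /= expr0 invr1 mul1r. Qed.
Opaque disc.

(** [snext_step] is iterated with q = A / [dseq]; the constant grows by h C2 M^2 per step, hence
    linearly in time. *)
Lemma disc_induction n : (forall j, (j < n)%N -> 4 * h <= dseq j) ->
  forall x y, disc n x <= disc n y +
    eps * (2 * M ^+ 2 + n%:R * (h * ((8 * k + 18 * k ^+ 2 + 32 * (d%:R + 1) * l ^+ 2) * M ^+ 2))
      - disc n y ^+ 2) + (8 * 120) / (eps * lam ^+ 2) / dseq n * hsnorm (x - y) ^+ 2.
Proof.
have M00 := ltW M0; have lam2 : 0 < lam ^+ 2 by rewrite exprn_gt0.
set C2 := 8 * k + 18 * k ^+ 2 + 32 * (d%:R + 1) * l ^+ 2.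
have C20 : 0 <= C2.
  by rewrite !addr_ge0// !mulr_ge0 ?sqr_ge0 ?(ltW k0)// addr_ge0.
set A := (8 * 120) / (eps * lam ^+ 2); have A0 : 0 < A by rewrite divr_gt0 ?mulr_gt0 ?ltr0n.
have DB j x : `|disc j x| <= M by exact: le_trans (disc_bound j x) MB.
elim: n => [_ x y|n IH Hn x y].
  rewrite mul0r addr0.
  have H1 : disc 0 x - disc 0 y <= m0 * hsnorm (x - y).
    by apply: le_trans (ler_norm _) _; rewrite !disc0.
  have H2 : disc 0 y ^+ 2 <= M ^+ 2.
    by rewrite -real_normK ?num_real// lerXn2r// nnegrE.
  (* Young's inequality: [d0_small] means m0^2 <= 4 (A / d0) (eps M^2). The spare M^2 in 2 M^2 -
     phi(y)^2 pays for the constant. *)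
  have H3 : m0 * hsnorm (x - y) <= eps * M ^+ 2 + A / dseq 0 * hsnorm (x - y) ^+ 2.
    set r := hsnorm (x - y); have r0 : 0 <= r := hsnorm_ge0 _.
    have Q0 : 0 < A / d0 by rewrite divr_gt0.
    have m02 : m0 ^+ 2 <= 4 * (A / d0) * (eps * M ^+ 2).
      rewrite (_ : 4 * (A / d0) * (eps * M ^+ 2) = (32 * 120) * M ^+ 2 / (d0 * lam ^+ 2)); last first.
        by rewrite /A; field; rewrite !gt_eqF.
      by rewrite ler_pdivlMr ?mulr_gt0//; apply: le_trans d0_small; rewrite mulrC -mulrA.
    have p4 : 0 < 4 * (A / d0) by rewrite mulr_gt0.
    rewrite /= -(ler_pM2l p4).
    have := sqr_ge0 (m0 - 2 * (A / d0) * r); lra.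
  have := ler_wpM2l (ltW e0) H2; lra.
have dn := dseq_gt0 n; set dd0 := dseq n in dn *.
have Hd : 4 * h <= dd0 by apply: Hn.
have [mD bD _ ED] := scheme_invariant n.
have g0M : `|dgen n 0 0| <= k * M.
  rewrite dgen0 mulrC ler_pdivrMr//; apply: (@le_trans _ _ (k * M)).
    rewrite mulrC -ler_pdivrMr//; apply: le_trans MB; rewrite /scheme_bound lerDr//.
  by rewrite ler_peMr ?mulr_ge0 ?(ltW k0)// exprn_ege1// ltW.
have c0 : 0 <= 2 * M ^+ 2 + n%:R * (h * (C2 * M ^+ 2)).
  by rewrite addr_ge0 ?mulr_ge0 ?sqr_ge0 ?(ltW h0).
have q0 : 0 <= A / dd0 by rewrite divr_ge0// ltW.
(* As 120 / (eps lam^2) = A / 8, the choice a = 4 / dd0 minimises - (A / dd0) a + (A / 8) a^2. *)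
have a0 : 0 <= 4 / dd0 by rewrite divr_ge0// ltW.
have ha : h * (4 / dd0) <= 1 by rewrite mulrA ler_pdivrMr// mul1r mulrC.
have LLt : 2 * (Lb + l * Ls) + 3 / 2 * Ls ^+ 2 + h * (Lb ^+ 2 + 2 * l * Ls * Lb) <= Lt.
  by apply: le_trans Lt_def; rewrite lerD2r.
have IHn : forall x y, disc n x <= disc n y +
    eps * ((2 * M ^+ 2 + n%:R * (h * (C2 * M ^+ 2))) - disc n y ^+ 2) +
    A / dd0 * hsnorm (x - y) ^+ 2 by apply: IH => j jn; apply: Hn; exact: ltnW.
set F := fun v => s^-1 * snext P h K (z n) b sig (dgen n) (disc n) v.
have H : forall x y, F x <= F y +
    eps * ((2 * M ^+ 2 + n%:R * (h * (C2 * M ^+ 2))) + h * (C2 * M ^+ 2) - F y ^+ 2) +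
    (A / dd0 * (1 - h * (4 / dd0) + h * Lt) + 120 / (eps * lam ^+ 2) * (h * (4 / dd0) ^+ 2))
      * hsnorm (x - y) ^+ 2.
  exact: (snext_step h0 K0 (Gz n) (ltW k0) l0 lam0 Lb0 Ls0 ell bL sL hk lK lh ldh h1 mD
    (DB n) (@dgenL n) g0M e0 eM c0 q0 a0 ha LLt IHn).
suff S (v1 v2 : R) : v1 = F x -> v2 = F y -> v1 <= v2 +
    eps * (2 * M ^+ 2 + n.+1%:R * (h * (C2 * M ^+ 2)) - v2 ^+ 2) +
    A / dseq n.+1 * hsnorm (x - y) ^+ 2.
  by apply: S; exact: ED.
move=> -> ->; apply: (le_trans (H x y)); clear H.
move: (F y) => v3.
rewrite (_ : 2 * M ^+ 2 + n.+1%:R * (h * (C2 * M ^+ 2)) =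
   2 * M ^+ 2 + n%:R * (h * (C2 * M ^+ 2)) + h * (C2 * M ^+ 2)); last first.
  by rewrite -natr1; ring.
rewrite lerD2l ler_wpM2r ?sqr_ge0// /= -/dd0.
have -> : A / dd0 * (1 - h * (4 / dd0) + h * Lt) + 120 / (eps * lam ^+ 2) * (h * (4 / dd0) ^+ 2)
    = A / dd0 * (1 - 2 * h / dd0 + h * Lt).
  by rewrite /A; field; rewrite !gt_eqF.
rewrite -mulrA ler_wpM2l ?(ltW A0)// invf_div.
have dh : 0 < dd0 + h by rewrite addr_gt0.
rewrite ler_pdivrMl// mulrA ler_pdivlMr// -subr_ge0.
(* The gain 2 h / dd0 exceeds what the recursion of [dseq] asks for; the surplus pays for the term
   h^2 Lt. *)
have -> : dd0 * (1 + h * Lt) - (1 - 2 * h / dd0 + h * Lt) * (dd0 + h) =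
   h * (1 - h * Lt) + 2 * h ^+ 2 / dd0 by field; rewrite gt_eqF.
rewrite addr_ge0//; first by rewrite mulr_ge0 ?(ltW h0)// subr_ge0.
by rewrite divr_ge0 ?(ltW dn)// mulr_ge0// sqr_ge0.
Qed.

Transparent disc.
Lemma scheme_disc n x y : `|scheme n x - scheme n y| <= expR (k * (n%:R * h)) * `|disc n x - disc n y|.
Proof.
have E v : scheme n v = s ^+ n * disc n v.
  by rewrite /disc mulrA divff ?mul1r// gt_eqF.
rewrite !E -mulrBr normrM (gtr0_norm (sX n)) ler_wpM2r//.
rewrite (_ : k * (n%:R * h) = n%:R * (h * k)); last by ring.
by rewrite expRM_natl lerXn2r ?nnegrE ?expR_ge0 ?expR_ge1Dx// ltW.
Qed.

End Scheme.

(** * Choice of the mesh and of eps *)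

Section Estimate.
Context dd (T : measurableType dd) (R : realType) (P : probability T R).
Context (d : nat) (b : 'cV[R]_d -> 'cV[R]_d) (sig : 'cV[R]_d -> 'M[R]_d).
Variables (g : R -> 'cV[R]_d -> R) (phi : 'cV[R]_d -> R).
Variables (k l lam Lb Ls B m0 M L S : R).
Hypotheses (k0 : 0 < k) (l0 : 0 <= l) (lam0 : 0 < lam) (Lb0 : 0 <= Lb) (Ls0 : 0 <= Ls).
Hypotheses (B0 : 0 <= B) (m00 : 0 <= m0).
Hypothesis ell : forall x, loewner_le lam%:M (sig x).
Hypothesis bL : forall x x', hsnorm (b x - b x') <= Lb * hsnorm (x - x').
Hypothesis sL : forall x x', hsnorm (sig x - sig x') <= Ls * hsnorm (x - x').
Hypothesis gL : forall a a' u u',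
  `|g a u - g a' u'| <= k * `|a - a'| + l * hsnorm (u - u').
Hypothesis phiB : forall x, `|phi x| <= B.
Hypothesis phiL : forall x y, `|phi x - phi y| <= m0 * hsnorm (x - y).
Hypotheses (MB : B + `|g 0 0| / k <= M) (M0 : 0 < M).
Hypothesis LE : 2 * (Lb + l * Ls) + 3 / 2 * Ls ^+ 2 <= L.
Hypothesis S0 : 0 < S.

Let C2 := 8 * k + 18 * k ^+ 2 + 32 * (d%:R + 1) * l ^+ 2.
Let C20 : 0 <= C2.
Proof.
by rewrite !addr_ge0// !mulr_ge0 ?sqr_ge0 ?(ltW k0)// addr_ge0.
Qed.

(** C2 + 6 covers the additive constant of [disc_induction], and 6 alone the trivial bound for
    distant points; the last term covers the coefficient of |x - y|^2. *)
Definition scheme_const : R := C2 + 6 + 16 * (8 * 120) / lam ^+ 2.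

Let L0 : 0 <= L.
Proof.
apply: le_trans LE; rewrite addr_ge0// mulr_ge0 ?addr_ge0 ?mulr_ge0// sqr_ge0.
Qed.

Let e16 (t : R) : t <= 1 + 1 -> 16^-1 <= expR (- t).
Proof.
move=> t2; apply: (@le_trans _ _ (expR (- (1 + 1)))); last by rewrite ler_expR lerN2.
rewrite expRN lef_pV2 ?posrE ?expR_gt0// expRD.
have e1 : expR 1 <= 4 :> R.
  have h01 : 0 <= (1 : R) <= 1 by rewrite ler01 lexx.
  by have := expR_sub1_le3 h01; lra.
have -> : 16 = 4 * 4 :> R by ring.
by rewrite ler_pM ?expR_ge0.
Qed.

(* Here 8 * 120 / lam ^+ 2 is the constant of [disc_induction], 16 bounds the loss exp(2)
   between [dseq] and the decay factor, and eps is chosen to balance the two error terms. *)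
Lemma scheme_estimate : exists2 h1, 0 < h1 & forall h n K (z : nat -> T -> 'cV[R]_d),
  0 < h -> h <= h1 -> n%:R * h = S -> 0 <= K -> 2 * K * d%:R * l <= 4^-1 ->
  (forall j, gaussian_vector P h (z j)) ->
  forall x y, `|scheme P h K z b sig g phi n x - scheme P h K z b sig g phi n y| <=
    expR (k * S) * (scheme_const * M * Num.sqrt (1 + S) / Num.sqrt (decay_factor L S)
                    * hsnorm (x - y)).
Proof.
have lam2 : 0 < lam ^+ 2 by rewrite exprn_gt0.
have S00 := ltW S0; have M00 := ltW M0; have k00 := ltW k0.
set Q := Lb ^+ 2 + 2 * l * Ls * Lb.
have Q0 : 0 <= Q by rewrite addr_ge0 ?sqr_ge0// !mulr_ge0.
(* The surplus S^-1 absorbs the term h Q on a fine mesh and costs only a factor exp(-1) at time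
   S. *)
set Lt := L + S^-1; have Lt0 : 0 <= Lt by rewrite addr_ge0// invr_ge0.
(* The value dictated by [d0_small], with m0^2 + 1 in place of m0^2 to keep the denominator
   positive. *)
set d0 := 32 * 120 * M ^+ 2 / (lam ^+ 2 * (m0 ^+ 2 + 1)).
have m1 : 0 < m0 ^+ 2 + 1 by rewrite ltr_wpDl ?sqr_ge0.
have d00 : 0 < d0 by rewrite divr_gt0 ?mulr_gt0 ?exprn_gt0 ?ltr0n.
have d0s : d0 * (lam ^+ 2 * m0 ^+ 2) <= 32 * 120 * M ^+ 2.
  rewrite /d0 mulrAC ler_pdivrMr ?mulr_gt0// ler_wpM2l ?mulr_ge0 ?sqr_ge0 ?ler0n//.
  by rewrite ler_wpM2l ?(ltW lam2)// lerDl.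
set c0 := d0 * expR (- (Lt * S)); have c00 : 0 < c0 by rewrite mulr_gt0 ?expR_gt0.
set N := d%:R + 1 : R; have N0 : 0 <= N by rewrite /N addr_ge0.
(* The reciprocals of all thresholds on h are added, so that h <= 1 / W implies each of them. *)
set W := 1 + 8 * k + 2 * l ^+ 2 + 16 * l ^+ 2 * N + Lt + S * Q + L + 4 / c0.
have t1 : 0 <= 8 * k by rewrite mulr_ge0.
have t2 : 0 <= 2 * l ^+ 2 by rewrite mulr_ge0 ?sqr_ge0.
have t3 : 0 <= 16 * l ^+ 2 * N by rewrite !mulr_ge0 ?sqr_ge0.
have t4 : 0 <= S * Q by rewrite mulr_ge0.
have t5 : 0 <= 4 / c0 by rewrite divr_ge0// ltW.
have W1 : 1 <= W by rewrite /W; move: (16 * l ^+ 2 * N) t3 (4 / c0) t5 => ? ? ? ?; have L1 := L0; lra.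
have W0 : 0 < W by exact: lt_le_trans W1.
exists W^-1; first by rewrite invr_gt0.
move=> h n K z h0 hW hn K0 lK Gz.
have hh w : w <= W -> h * w <= 1.
  move=> wW; apply: (@le_trans _ _ (h * W)); first by rewrite ler_wpM2l// ltW.
  by rewrite -ler_pdivlMr// mul1r.
have h1 : h <= 1 by have := hh 1 W1; rewrite mulr1.
have L1 := L0.
have hw w : 0 <= W - w -> h * w <= 1 by rewrite subr_ge0; exact: hh.
have hk : h * k <= 8^-1.
  have : h * (8 * k) <= 1 by apply: hw; rewrite /W; move: (16 * _ * N) t3 (4 / c0) t5 (S * Q) t4 => *; lra.
  by lra.
have lh : 2 * l ^+ 2 * h <= 1.
  by rewrite mulrC; apply: hw; rewrite /W; move: (16 * _ * N) t3 (4 / c0) t5 (S * Q) t4 => *; lra.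
have ldh : 16 * h * l ^+ 2 * (d%:R + 1) <= 1.
  rewrite -/N (_ : 16 * h * l ^+ 2 * N = h * (16 * l ^+ 2 * N)); last by ring.
  by apply: hw; rewrite /W; move: (16 * _ * N) t3 (4 / c0) t5 (S * Q) t4 => *; lra.
have hLt : h * Lt <= 1.
  by apply: hw; rewrite /W; move: (16 * _ * N) t3 (4 / c0) t5 (S * Q) t4 => *; lra.
have hL : L * h <= 1.
  by rewrite mulrC; apply: hw; rewrite /W; move: (16 * _ * N) t3 (4 / c0) t5 (S * Q) t4 => *; lra.
have hQ : L + h * Q <= Lt.
  have : h * (S * Q) <= 1.
    by apply: hw; rewrite /W; move: (16 * _ * N) t3 (4 / c0) t5 => *; lra.
  by rewrite lerD2l -[S^-1]mul1r ler_pdivlMr// mulrAC -mulrA.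
have h4 : 4 * h <= c0.
  have : h * (4 / c0) <= 1.
    by apply: hw; rewrite /W; move: (16 * _ * N) t3 (S * Q) t4 => *; lra.
  by rewrite mulrA ler_pdivrMr// mul1r mulrC.
set ds := dseq h Lt d0.
have hLt0 : 0 <= h * Lt by rewrite mulr_ge0// ltW.
have h4j j : (j < n)%N -> 4 * h <= ds j.
  move=> jn; apply: (le_trans h4).
  have := dseq_lower h0 l0 Lb0 Ls0 hQ L0 d00 j.
  apply: le_trans; rewrite /c0 mulrC ler_wpM2r ?(ltW d00)// ler_expR lerN2 ler_wpM2l//.
  by rewrite -hn ler_wpM2r ?(ltW h0)// ler_nat ltnW.
set D := decay_factor L S; have D0 : 0 < D by exact: decay_factor_gt0.
have dn : 16^-1 * D <= ds n.
  have := dseq_decay h0 l0 Lb0 Ls0 hQ L0 d00 n (delta := S^-1) erefl.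
  apply: le_trans; rewrite hn mulVf ?gt_eqF// mulrA -expRD -opprD ler_wpM2r ?(ltW D0)//.
  by apply: e16; lra.
have dn0 : 0 < ds n by apply: lt_le_trans dn; rewrite mulr_gt0.
set cst := scheme_const * M * Num.sqrt (1 + S) / Num.sqrt D.
have S1 : 0 < 1 + S by rewrite addr_gt0.
have q1 : 0 < Num.sqrt (1 + S) by rewrite sqrtr_gt0.
have qD : 0 < Num.sqrt D by rewrite sqrtr_gt0.
have sc6 : 6 <= scheme_const.
  rewrite /scheme_const -addrA addrCA lerDl addr_ge0//.
  by rewrite divr_ge0 ?(ltW lam2)// mulr_ge0// ltW// mulr_gt0// ltr0n.
have sc0 : 0 <= scheme_const by apply: le_trans sc6.
have one x y : disc P h K z b sig g phi k n x - disc P h K z b sig g phi k n y <= cst * hsnorm (x - y).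
  set r := hsnorm (x - y).
  have [r0|r0] := eqVneq r 0.
    by rewrite (subr0_eq (hsnorm0_eq0 r0)) subrr r0 mulr0.
  have r1 : 0 < r by rewrite lt_neqAle eq_sym r0 hsnorm_ge0.
  have DB x' : `|disc P h K z b sig g phi k n x'| <= M.
    apply: le_trans MB.
    exact: (disc_bound h0 K0 Gz k0 l0 Lb0 Ls0 m00 bL sL gL phiB phiL hk lK).
  (* eps = e / M balances eps (1 + S) M^2 against r^2 / (eps D): both equal M (1 + S) e. *)
  set e := r / (Num.sqrt (1 + S) * Num.sqrt D).
  have e0 : 0 < e by rewrite divr_gt0// mulr_gt0.
  have cr : cst * r = scheme_const * (M * ((1 + S) * e)).
    rewrite /cst /e; have := sqr_sqrtr (ltW S1).
    move: (Num.sqrt (1 + S)) q1 => q q1 <-.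
    by field; rewrite !gt_eqF.
  rewrite cr.
  (* eps M <= 1/2 fails for large e; there the bound 2 M on the difference suffices. *)
  have [es|es] := lerP e 2^-1; last first.
    apply: (@le_trans _ _ (M + M)).
      by apply: le_trans (ler_norm _) _; apply: le_trans (ler_normB _ _) _; apply: lerD.
    have : M + M <= 6 * (M * ((1 + S) * e)).
      have : M * 2^-1 <= M * ((1 + S) * e).
        rewrite ler_wpM2l// (le_trans (ltW es))// ler_peMl ?(ltW e0)//; lra.
      lra.
    move=> H; apply: (le_trans H); apply: ler_wpM2r sc6.
    by apply: mulr_ge0 => //; apply: mulr_ge0; exact: ltW.
  have eM : e / M * M <= 2^-1 by rewrite divfK// gt_eqF.
  have eM0 : 0 < e / M by rewrite divr_gt0.
  have := disc_induction h0 K0 Gz k0 l0 lam0 Lb0 Ls0 B0 m00 ell bL sL gL phiB phiL hk lK lh ldh h1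
    MB M0 eM0 eM LE hQ L0 hLt d00 d0s h4j x y.
  rewrite -/N -/r -/ds.
  have -> : n%:R * (h * ((8 * k + 18 * k ^+ 2 + 32 * N * l ^+ 2) * M ^+ 2)) = S * (C2 * M ^+ 2).
    by rewrite -hn /C2 -/N; ring.
  have sq : 0 <= e / M * disc P h K z b sig g phi k n y ^+ 2.
    by rewrite mulr_ge0 ?sqr_ge0// ltW.
  have T2 : 8 * 120 / (e / M * lam ^+ 2) / ds n * r ^+ 2 <=
      16 * (8 * 120) / lam ^+ 2 * (M * ((1 + S) * e)).
    have -> : 16 * (8 * 120) / lam ^+ 2 * (M * ((1 + S) * e)) =
      8 * 120 / (e / M * lam ^+ 2) / (16^-1 * D) * r ^+ 2.
      have -> : r ^+ 2 = e ^+ 2 * ((1 + S) * D).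
        rewrite /e expr_div_n exprMn (sqr_sqrtr (ltW S1)) (sqr_sqrtr (ltW D0)).
        by field; rewrite !gt_eqF.
      by field; rewrite !gt_eqF.
    rewrite ler_wpM2r ?sqr_ge0// ler_wpM2l//.
      by apply: divr_ge0; apply: mulr_ge0; rewrite ?ler0n// ltW.
    by rewrite lef_pV2 ?posrE// mulr_gt0.
  have T1 : e / M * (2 * M ^+ 2 + S * (C2 * M ^+ 2)) <= (C2 + 6) * (M * ((1 + S) * e)).
    have -> : e / M * (2 * M ^+ 2 + S * (C2 * M ^+ 2)) = (2 + S * C2) * (M * e).
      by field; rewrite gt_eqF.
    rewrite [leRHS](_ : _ = (C2 + 6) * (1 + S) * (M * e)); last by ring.
    apply: ler_wpM2r; first by apply: mulr_ge0 => //; exact: ltW.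

    rewrite -subr_ge0 (_ : _ - _ = C2 + 6 * S + 4); last by ring.
    by rewrite !addr_ge0 ?mulr_ge0.
  rewrite /scheme_const; move: sq T1 T2.
  move: (disc _ _ _ _ _ _ _ _ _ _ x) (disc _ _ _ _ _ _ _ _ _ _ y) => v1 v2.
  move: (8 * 120 / _ / _ * _) => u1; move: (16 * _ / _) => u2.
  move: (M * ((1 + S) * e)) (S * (C2 * M ^+ 2)) (e / M) => u3 u4 u5; lra.
move=> x y; apply: le_trans (scheme_disc P K z b sig g phi h0 k0 n x y) _.
rewrite hn ler_wpM2l ?expR_ge0// ler_norml lerNl opprB one andbT.
by rewrite -[x - y]opprB hsnormN one.
Qed.

End Estimate.

(** * Brownian filtration and increments *)

Section Filtration.
Context {R : realType} {dd : measure_display} {Omega : measurableType dd}.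
Context (P : probability Omega R) (d : nat) (B : R -> Omega -> 'cV[R]_d).
Hypotheses (cP : measure_is_complete P) (BM : standard_brownian_motion P B).

Definition filtration_gen (t : R) : set (set Omega) :=
  natural_filtration B t `|` [set A | P.-negligible A].
Local Notation Om t := (g_sigma_algebraType (filtration_gen t)).

(** Measurability from Omega equipped with F_t, so that the closure properties of measurable
    functions apply directly. *)
Definition adapted (t : R) (f : Omega -> R) := measurable_fun setT (f : Om t -> R).

Lemma measurableB t i : 0 <= t -> measurable_fun setT (fun w => B t w i ord0).
Proof. by case: BM => mB _ _ _ /mB. Qed.

Lemma natural_filtration_measurable t : natural_filtration B t `<=` measurable.
Proof.
apply: sigma_sub_measurable => A [s [i [C [/andP[s0 _] mC ->]]]].
by rewrite -[X in measurable X]setTI; exact: measurableB.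
Qed.

(** Completeness of P enters here: the null sets added to the filtration are events. *)
Lemma filtration_gen_measurable t : filtration_gen t `<=` measurable.
Proof. by move=> A [/natural_filtration_measurable//|/cP]. Qed.

Lemma filtration_measurable t : <<s filtration_gen t >> `<=` measurable.
Proof. exact/sigma_sub_measurable/filtration_gen_measurable. Qed.

Lemma adapted_rv t f : adapted t f <-> rv_measurable (augmented_filtration P B t) f.
Proof.
split=> [mf C mC|mf _ C mC]; last by rewrite setTI; exact: mf.
by have := mf measurableT C mC; rewrite setTI.
Qed.

Lemma adapted_measurable t f : adapted t f -> measurable_fun setT f.
Proof. by move=> mf; apply: sub_sigma_meas mf; exact: filtration_measurable. Qed.

Lemma natural_filtration_le s t : s <= t -> natural_filtration B s `<=` natural_filtration B t.
Proof.
move=> st; apply: smallest_sub; first exact: smallest_sigma_algebra.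
move=> A [r [i [C [/andP[r0 rs] mC ->]]]]; apply: sub_sigma_algebra.
by exists r, i, C; split=> //; rewrite r0 (le_trans rs).
Qed.

Lemma adapted_le s t f : s <= t -> adapted s f -> adapted t f.
Proof.
move=> st mf _ C mC; have := mf measurableT C mC; rewrite !setTI.
move: (f @^-1` C) => D; apply: smallest_sub; first exact: smallest_sigma_algebra.
by move=> A [nA|nA]; apply: sub_sigma_algebra; [left; exact: natural_filtration_le nA|right].
Qed.

Lemma adapted_cst t c : adapted t (fun=> c).
Proof. exact: measurable_cst. Qed.

Lemma adapted_add t f g : adapted t f -> adapted t g -> adapted t (fun w => f w + g w).
Proof. by move=> af ag; exact: measurable_funD. Qed.

Lemma adapted_sub t f g : adapted t f -> adapted t g -> adapted t (fun w => f w - g w).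
Proof. by move=> af ag; exact: measurable_funB. Qed.

Lemma adapted_mul t f g : adapted t f -> adapted t g -> adapted t (fun w => f w * g w).
Proof. by move=> af ag; exact: measurable_funM. Qed.

Lemma adapted_sqr t f : adapted t f -> adapted t (fun w => f w ^+ 2).
Proof. by move=> af; exact: measurable_funX. Qed.

Lemma adapted_sum t (I : Type) (s : seq I) (f : I -> Omega -> R) :
  (forall i, adapted t (f i)) -> adapted t (fun w => \sum_(i <- s) f i w).
Proof. by move=> af; apply: measurable_sum. Qed.

Lemma adapted_vcomp t (F : 'cV[R]_d -> R) (V : Omega -> 'cV[R]_d) : vmeasurable F ->
  (forall i, adapted t (fun w => V w i ord0)) -> adapted t (fun w => F (V w)).
Proof. by move=> mF aV; exact: mF. Qed.

Lemma adaptedB s t i : 0 <= s <= t -> adapted t (fun w => B s w i ord0).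
Proof.
move=> /andP[s0 st]; apply: (adapted_le st) => _ C mC; rewrite setTI.
apply: sub_sigma_algebra; left; apply: sub_sigma_algebra; exists s, i, C; split=> //.
by rewrite s0 lexx.
Qed.

Definition incB (s t : R) (w : Omega) : 'cV[R]_d := B t w - B s w.

Lemma adapted_incB s t u i : 0 <= s -> 0 <= t -> s <= u -> t <= u ->
  adapted u (fun w => incB s t w i ord0).
Proof.
move=> s0 t0 su tu; rewrite /incB; under eq_fun do rewrite !mxE.
by apply: adapted_sub; apply: adaptedB; rewrite ?s0 ?t0.
Qed.

Lemma gaussian_inc s t : 0 <= s -> s < t -> gaussian_vector P (t - s) (incB s t).
Proof.
move=> s0 st; split=> [i|C mC].
  under eq_fun do rewrite /incB !mxE.
  by apply: measurable_funB; apply: measurableB => //; rewrite (le_trans s0)// ltW.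
case: BM => _ _ _ /(_ s t setT C); rewrite s0 st => /(_ isT).
have -> : [set w | forall i, C i (incB s t w i ord0)] =
    setT `&` [set w | forall i, C i (B t w i ord0 - B s w i ord0)].
  by rewrite setTI; apply/seteqP; split=> w /= H i; have := H i; rewrite /incB !mxE.
move=> ->//; last first.
  by have := @measurableT _ (g_sigma_algebraType [set A | exists (s0 : R) (i : 'I_d) (C0 : set R),
         [/\ 0 <= s0 <= s, measurable C0 & A = [set w | C0 (B s0 w i ord0)]]]).
by rewrite probability_setT mul1e.
Qed.

Definition inc_cylinders (s t : R) : set (set Omega) :=
  [set A | exists2 C : 'I_d -> set R, forall i, measurable (C i) &
     A = [set w | forall i, C i (incB s t w i ord0)]].

Lemma inc_cylinders_measurable s t : 0 <= s -> s < t -> inc_cylinders s t `<=` measurable.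
Proof.
move=> s0 st A [C mC ->]; have [mi _] := gaussian_inc s0 st.
rewrite (_ : [set w | _] = [set w | forall j, predT j -> C j (incB s t w j ord0)]); last first.
  by apply/seteqP; split=> w /= H i; [move=> _; exact: H|exact: H].
exact: (measurable_cylinder (gaussian_inc s0 st) _ mC).
Qed.

(** Brownian motion gives independence from the natural past only. The sets A1 [&] N with A1 in that
    past and N of full measure form a pi-system; it generates the augmented past, and N does not
    change probabilities. A second pi-system argument treats the increment. *)
Lemma inc_independent s t : 0 <= s -> s < t ->
  independent_maps P (id : Omega -> Om s) (id : Omega -> g_sigma_algebraType (inc_cylinders s t)).
Proof.
move=> s0 st A D mA mD; rewrite !preimage_id.
have mcyl := inc_cylinders_measurable s0 st.
have mA' : (measurable : set (set Omega)) A := @filtration_measurable s A mA.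
have key D' : inc_cylinders s t D' -> P (A `&` D') = (P A * P D')%E.
  move=> cD'; have mD' := mcyl _ cD'.
  pose H := [set A | exists A1 N, [/\ natural_filtration B s A1, measurable N, P (~` N) = 0%E &
    A = A1 `&` N]] : set (set Omega).
  have nT : natural_filtration B s setT.
    exact: (@measurableT _ (g_sigma_algebraType [set A | exists (s0 : R) (i : 'I_d) (C0 : set R),
         [/\ 0 <= s0 <= s, measurable C0 & A = [set w | C0 (B s0 w i ord0)]]])).
  have PN A1 N : measurable A1 -> measurable N -> P (~` N) = 0%E -> P (A1 `&` N) = P A1.
    move=> mA1 mN N0; rewrite [RHS](measureDI P mA1 mN).
    rewrite -[LHS]add0e; congr (_ + _)%E; apply/esym/eqP; rewrite -measure_le0 -N0.
    by apply: le_measure; rewrite ?inE; [exact: measurableD|exact: measurableC|move=> w []].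
  apply: (@indep_generated _ _ _ P H) => //.
  - move=> _ [A1 [N [/natural_filtration_measurable mA1 mN _ ->]]]; exact: measurableI.
  - move=> _ _ [A1 [N [nA1 mN N0 ->]]] [A2 [N2 [nA2 mN2 N20 ->]]].
    exists (A1 `&` A2), (N `&` N2); split.
    + exact: (@measurableI _ (g_sigma_algebraType [set A | exists (s0 : R) (i : 'I_d) (C0 : set R),
         [/\ 0 <= s0 <= s, measurable C0 & A = [set w | C0 (B s0 w i ord0)]]])).
    + exact: measurableI.
    + by rewrite setCI; apply: null_set_setU => //; exact: measurableC.
    + by rewrite setIACA.
  - by exists setT, setT; rewrite setCT measure0 setTI.
  - move=> _ [A1 [N [nA1 mN N0 ->]]].
    have mA1 := natural_filtration_measurable nA1.
    rewrite (PN A1 N)// setIAC (PN _ N)//; last exact: measurableI.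
    case: cD' => C mC E; have [_ G] := gaussian_inc s0 st.
    rewrite [in RHS]E G// E.
    case: BM => _ _ _ /(_ s t A1 C); rewrite s0 st => /(_ isT nA1 mC) <-.
    congr (P (_ `&` _)); apply/seteqP; split=> w /= Hw i; have := Hw i; rewrite /incB !mxE//.
  - move: mA; apply: smallest_sub; first exact: smallest_sigma_algebra.
    move=> A1 [nA1|nA1].
      by apply: sub_sigma_algebra; exists A1, setT; rewrite setCT measure0 setIT.
    have mN1 := cP nA1; have [N [mN N0 A1N]] := nA1.
    have -> : A1 = ~` (setT `&` ~` A1) by rewrite setTI setCK.
    apply: (@measurableC _ (g_sigma_algebraType H)); apply: sub_sigma_algebra.
    exists setT, (~` A1); split=> //; first exact: measurableC.
    by rewrite setCK; apply/eqP; rewrite -measure_le0 -N0; apply: le_measure; rewrite ?inE.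
rewrite setIC muleC; apply: (@indep_generated _ _ _ P (inc_cylinders s t)) => //.
- move=> _ _ [C mC ->] [C' mC' ->]; exists (fun i => C i `&` C' i).
    by move=> i; exact: measurableI.
  rewrite predeqE => w; split=> [[H1 H2] i|H] /=; first by split; [exact: H1|exact: H2].
  by split=> i; case: (H i).
- by exists (fun=> setT) => //; apply/seteqP; split.
- by move=> D' cD'; rewrite setIC muleC; exact: key.
Qed.

Local Notation Oinc s t := (g_sigma_algebraType (inc_cylinders s t)).

Lemma inc_coord_measurable s t : coord_measurable (incB s t : Oinc s t -> 'cV[R]_d).
Proof.
move=> i _ C mC; rewrite setTI; apply: sub_sigma_algebra.
exists (fun j => if j == i then C else setT) => [j|]; first by case: ifP.
rewrite predeqE => w; split=> [H j /=|/(_ i)]; last by rewrite eqxx.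
by case: eqP => // ->.
Qed.

Section OneIncrement.
Variables s t : R.
Hypotheses (s0 : 0 <= s) (st : s < t).

Let mid1 : measurable_fun setT (id : Omega -> Om s).
Proof. by apply: sub_sigma_id; exact: filtration_measurable. Qed.
Let mid2 : measurable_fun setT (id : Omega -> Oinc s t).
Proof.
by apply: sub_sigma_id; apply: sigma_sub_measurable; exact: inc_cylinders_measurable.
Qed.

Lemma adapted_inc_mul f (psi : 'cV[R]_d -> R) : adapted s f -> Lone P f -> vmeasurable psi ->
  Lone P (fun w => psi (incB s t w)) ->
  Lone P (fun w => f w * psi (incB s t w)) /\
  Ex P (fun w => f w * psi (incB s t w)) = Ex P f * Ex P (fun w => psi (incB s t w)).
Proof.
move=> af Lf mpsi Lpsi.
have mp : measurable_fun setT (fun w : Oinc s t => psi (incB s t w)).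
  by apply: mpsi; exact: inc_coord_measurable.
have ind := inc_independent s0 st.
split; first exact: (independent_Lone mid1 mid2 ind af mp Lf Lpsi).
exact: (independent_Ex_mul mid1 mid2 ind af mp Lf Lpsi).
Qed.

(** The first argument of [Psi] sees the past, the second the increment: the freezing formula in
    place of conditional expectation given F_s. *)
Lemma adapted_inc_freeze (Psi : Omega * Omega -> R) :
  measurable_fun setT (Psi : Om s * Oinc s t -> R) ->
  Lone P (fun w => Psi (w, w)) ->
  Ex P (fun w => Psi (w, w)) = Ex P (fun w => Ex P (fun w' => Psi (w, w'))).
Proof. by move=> mP LP; exact: (independent_freeze mid1 mid2 (inc_independent s0 st) mP). Qed.

End OneIncrement.

Section Increments.
Variables s t : R.
Hypotheses (s0 : 0 <= s) (st : s <= t).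

Let inc_eq : s = t -> forall i w, incB s t w i ord0 = 0.
Proof. by move=> -> i w; rewrite /incB !mxE subrr. Qed.

Let Lcoord i j : s < t -> Lone P (fun w => incB s t w i ord0 * incB s t w j ord0).
Proof.
move=> st'; have G := gaussian_inc s0 st'; have h0 : 0 < t - s by rewrite subr_gt0.
by apply: LtwoM; exact: (gaussian_Ltwo h0 G).
Qed.

Lemma inc_mean f i : adapted s f -> Lone P f ->
  Lone P (fun w => f w * incB s t w i ord0) /\ Ex P (fun w => f w * incB s t w i ord0) = 0.
Proof.
(* Degenerate increments occur when the times of a simple process are clamped to an interval. *)
move=> af Lf; case: (eqVneq s t) => [e|ne].
  have E : (fun w => f w * incB s t w i ord0) = fun=> 0.
    by apply/funext => w; rewrite (inc_eq e) mulr0.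
  by rewrite E Ex0; split=> //; exact: Lone0.
have st' : s < t by rewrite lt_neqAle ne st.
have G := gaussian_inc s0 st'; have h0 : 0 < t - s by rewrite subr_gt0.
have Lp := Ltwo_Lone (gaussian_Ltwo h0 G i).
have [L ->] := adapted_inc_mul s0 st' af Lf (vmeasurable_coord i) Lp.
by rewrite (gaussian_mean h0 G) mulr0.
Qed.

Lemma inc_cov f i j : adapted s f -> Lone P f ->
  Lone P (fun w => f w * (incB s t w i ord0 * incB s t w j ord0)) /\
  Ex P (fun w => f w * (incB s t w i ord0 * incB s t w j ord0)) = (i == j)%:R * (t - s) * Ex P f.
Proof.
move=> af Lf; case: (eqVneq s t) => [e|ne].
  have E : (fun w => f w * (incB s t w i ord0 * incB s t w j ord0)) = fun=> 0.
    by apply/funext => w; rewrite (inc_eq e) mul0r mulr0.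
  by rewrite E Ex0 e subrr mulr0 mul0r; split=> //; exact: Lone0.
have st' : s < t by rewrite lt_neqAle ne st.
have G := gaussian_inc s0 st'; have h0 : 0 < t - s by rewrite subr_gt0.
have mp : vmeasurable (fun v : 'cV[R]_d => v i ord0 * v j ord0).
  by apply: vmeasurableM; exact: vmeasurable_coord.
have [L ->] := adapted_inc_mul s0 st' af Lf mp (Lcoord i j st').
by rewrite (gaussian_cov h0 G) mulrC.
Qed.

Lemma inc_Ltwo f i : adapted s f -> Ltwo P f -> Ltwo P (fun w => f w * incB s t w i ord0).
Proof.
move=> af [mf Lf]; have af2 : adapted s (fun w => f w ^+ 2) by exact: measurable_funX.
have [L _] := inc_cov i i af2 Lf.
have [L1 _] := inc_mean i af (Ltwo_Lone (conj mf Lf)).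
split; first exact: (Lone_meas L1).
by under eq_fun do rewrite exprMn expr2 [X in _ * X]expr2 -expr2.
Qed.

End Increments.

End Filtration.

Arguments adapted_measurable {R dd Omega P d B} cP BM {t f}.
Arguments adapted_le {R dd Omega P d B s t f}.
Arguments inc_mean {R dd Omega P d B} cP BM {s t} s0 st {f} i.
Arguments inc_cov {R dd Omega P d B} cP BM {s t} s0 st {f} i j.
Arguments inc_Ltwo {R dd Omega P d B} cP BM {s t} s0 st {f} i.
Arguments adapted_inc_mul {R dd Omega P d B} cP BM {s t} s0 st {f psi}.
Arguments adapted_inc_freeze {R dd Omega P d B} cP BM {s t} s0 st Psi.
Arguments adapted_cst {R dd Omega P d B} t c.
Arguments adapted_add {R dd Omega P d B t f g}.
Arguments adapted_sub {R dd Omega P d B t f g}.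
Arguments adapted_mul {R dd Omega P d B t f g}.
Arguments adapted_sqr {R dd Omega P d B t f}.
Arguments adapted_sum {R dd Omega P d B t I s f}.
Arguments adapted_vcomp {R dd Omega P d B t F V}.
Arguments adaptedB {R dd Omega P d B s t} i.
Arguments adapted_incB {R dd Omega P d B s t u} i.

(** * Mean-square limits and product integrals *)

Section MeanSquareLimits.
Context {R : realType} {d1 d2 : measure_display}.
Context {T1 : measurableType d1} {T2 : measurableType d2}.
Variables (mu1 : {measure set T1 -> \bar R}) (mu2 : {measure set T2 -> \bar R}).

Lemma Ex_sqr_perturb (th : R) (f g : T1 -> R) : 0 < th -> Ltwo mu1 f -> Ltwo mu1 g ->
  Ex mu1 (fun x => f x ^+ 2) <= (1 + th) * Ex mu1 (fun x => g x ^+ 2) +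
    (1 + th^-1) * Ex mu1 (fun x => (f x - g x) ^+ 2).
Proof.
move=> th0 Lf Lg; have Lfg := LtwoB Lf Lg.
have E : Ex mu1 (fun x => f x ^+ 2) = Ex mu1 (fun x => (g x + (f x - g x)) ^+ 2).
  by apply: eq_Ex => x; rewrite addrC subrK.
rewrite E Ex_sqrD//; have := Ex_young th0 Lg Lfg; lra.
Qed.

End MeanSquareLimits.

Section MeanSquareLimits2.
Context {R : realType} {d1 d2 : measure_display}.
Context {T1 : measurableType d1} {T2 : measurableType d2}.
Variables (mu1 : {measure set T1 -> \bar R}) (mu2 : {measure set T2 -> \bar R}).

Lemma Ltwo_limit_sqr_le (X : T1 -> R) (Y : T2 -> R) : Ltwo mu1 X -> Ltwo mu2 Y ->
  (forall e, 0 < e -> exists X' Y', [/\ Ltwo mu1 X', Ltwo mu2 Y',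
     Ex mu1 (fun x => (X x - X' x) ^+ 2) <= e, Ex mu2 (fun y => (Y' y - Y y) ^+ 2) <= e &
     Ex mu1 (fun x => X' x ^+ 2) <= Ex mu2 (fun y => Y' y ^+ 2)]) ->
  Ex mu1 (fun x => X x ^+ 2) <= Ex mu2 (fun y => Y y ^+ 2).
Proof.
move=> LX LY H; rewrite -subr_le0.
set b := Ex mu2 (fun y => Y y ^+ 2); have b0 : 0 <= b by exact: Ex_sqr_ge0.
apply: (@le0_of_quadratic R _ (3 * b + 6)) => th /andP[th0 th1].
(* With tolerance th^2, the factor 1 + 1 / th leaves an error of order th. *)
have e0 : 0 < th ^+ 2 by rewrite exprn_gt0.
have [X' [Y' [LX' LY' HX HY XY]]] := H _ e0.
have K1 := Ex_sqr_perturb th0 LX LX'; have K2 := Ex_sqr_perturb th0 LY' LY.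
have tt : (1 + th^-1) * th ^+ 2 <= 2 * th.
  rewrite [leLHS](_ : _ = th ^+ 2 + th); last by field; rewrite gt_eqF.
  have := ler_wpM2l (ltW th0) th1; rewrite expr2; lra.
have t1 : 0 <= 1 + th^-1 by rewrite addr_ge0// invr_ge0 ltW.
have J1 := le_trans (ler_wpM2l t1 HX) tt; have J2 := le_trans (ler_wpM2l t1 HY) tt.
have t2 : 0 <= 1 + th by rewrite addr_ge0// ltW.
have K3 := ler_wpM2l t2 (le_trans XY K2); have K4 := ler_wpM2l t2 J2.
have K5 := ler_wpM2r b0 (ler_wpM2l (ltW th0) th1).
have K6 := ler_wpM2l (ltW th0) th1.
rewrite -/b in K2 K3.
move: K1 K3 K4 K5 K6 J1; move: (Ex mu1 _) (Ex mu1 _) (Ex mu1 _) (Ex mu2 _) => x1 x2 x3 x4.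
lra.
Qed.

Lemma Ltwo_limit_le (Z1 X : T1 -> R) (Z2 Y : T2 -> R) :
  Ltwo mu1 Z1 -> Ltwo mu1 X -> Ltwo mu2 Z2 -> Ltwo mu2 Y ->
  (forall e, 0 < e -> exists X' Y', [/\ Ltwo mu1 X', Ltwo mu2 Y',
     Ex mu1 (fun x => (X x - X' x) ^+ 2) <= e, Ex mu2 (fun y => (Y' y - Y y) ^+ 2) <= e &
     Ex mu1 (fun x => Z1 x * X' x) = Ex mu2 (fun y => Z2 y * Y' y)]) ->
  Ex mu1 (fun x => Z1 x * X x) <= Ex mu2 (fun y => Z2 y * Y y).
Proof.
move=> LZ1 LX LZ2 LY H; rewrite -subr_le0.
set a := Ex mu1 (fun x => Z1 x ^+ 2); set b := Ex mu2 (fun y => Z2 y ^+ 2).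
apply: (@le0_of_quadratic R _ (a + b + 2)) => th /andP[th0 th1].
have e0 : 0 < th ^+ 2 by rewrite exprn_gt0.
have [X' [Y' [LX' LY' HX HY XY]]] := H _ e0.
have LB1 := LtwoB LX LX'; have LB2 := LtwoB LY' LY.
have E1 : Ex mu1 (fun x => Z1 x * X x) =
    Ex mu1 (fun x => Z1 x * X' x) + Ex mu1 (fun x => Z1 x * (X x - X' x)).
  rewrite -ExD; [|exact: LtwoM|exact: LtwoM].
  by apply: eq_Ex => x; rewrite -mulrDr addrC subrK.
have E2 : Ex mu2 (fun y => Z2 y * Y y) =
    Ex mu2 (fun y => Z2 y * Y' y) - Ex mu2 (fun y => Z2 y * (Y' y - Y y)).
  rewrite -ExB; [|exact: LtwoM|exact: LtwoM].
  by apply: eq_Ex => x; rewrite -mulrBr opprB addrC subrK.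
have Y1 := Ex_young th0 LZ1 LB1; have Y2 := Ex_young th0 LZ2 LB2.
have ti : 0 <= th^-1 by rewrite invr_ge0 ltW.
have tt : th^-1 * th ^+ 2 = th by field; rewrite gt_eqF.
have J1 := ler_wpM2l ti HX; have J2 := ler_wpM2l ti HY.
rewrite tt in J1 J2; rewrite E1 E2 XY; move: Y1 Y2 J1 J2; rewrite -/a -/b.
move: (Ex mu1 _) (Ex mu1 _) (Ex mu2 _) (Ex mu2 _) (Ex mu2 _) => x1 x2 x3 x4 x5.
have a0 : 0 <= a by exact: Ex_sqr_ge0.
have b0 : 0 <= b by exact: Ex_sqr_ge0.
have := mulr_ge0 (ltW th0) a0; have := mulr_ge0 (ltW th0) b0; lra.
Qed.

(** The inequality for (Z1, Z2) together with the one for (- Z1, - Z2). *)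
Lemma Ltwo_limit_eq (Z1 X : T1 -> R) (Z2 Y : T2 -> R) :
  Ltwo mu1 Z1 -> Ltwo mu1 X -> Ltwo mu2 Z2 -> Ltwo mu2 Y ->
  (forall e, 0 < e -> exists X' Y', [/\ Ltwo mu1 X', Ltwo mu2 Y',
     Ex mu1 (fun x => (X x - X' x) ^+ 2) <= e, Ex mu2 (fun y => (Y' y - Y y) ^+ 2) <= e &
     Ex mu1 (fun x => Z1 x * X' x) = Ex mu2 (fun y => Z2 y * Y' y)]) ->
  Ex mu1 (fun x => Z1 x * X x) = Ex mu2 (fun y => Z2 y * Y y).
Proof.
move=> LZ1 LX LZ2 LY H; apply/eqP; rewrite eq_le Ltwo_limit_le//=.
rewrite -lerN2 -!ExN; [|exact: LtwoM|exact: LtwoM].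
under eq_Ex do rewrite -mulNr; under [leRHS]eq_Ex do rewrite -mulNr.
apply: Ltwo_limit_le => //; [exact: LtwoN|exact: LtwoN|].
move=> e /H[X' [Y' [LX' LY' HX HY XY]]]; exists X', Y'; split=> //.
under eq_Ex do rewrite mulNr; under [RHS]eq_Ex do rewrite mulNr.
by rewrite !ExN ?XY//; exact: LtwoM.
Qed.

End MeanSquareLimits2.

(** * Fubini on the product of probability space and time *)

Section TimeSpace.
Context {R : realType} {d1 d2 : measure_display}.
Context {Omega : measurableType d1} {T2 : measurableType d2}.
Variables (P : probability Omega R) (m2 : {sigma_finite_measure set T2 -> \bar R}).
Local Notation nu := (P \x m2)%E.
Implicit Types (f : Omega * T2 -> R) (g : T2 -> R) (a : Omega -> R).

Lemma measurable_section1 f w : measurable_fun setT f -> measurable_fun setT (fun u => f (w, u)).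
Proof. by move=> mf; apply: measurableT_comp => //; exact: pair1_measurable. Qed.

Lemma Lone_rect a g : Lone P a -> Lone m2 g -> Lone nu (fun z => a z.1 * g z.2) /\
  Ex nu (fun z => a z.1 * g z.2) = Ex P a * Ex m2 g.
Proof.
move=> La Lg.
have m : measurable_fun setT (fun z : Omega * T2 => a z.1 * g z.2).
  apply: measurable_funM; first exact: measurableT_comp (Lone_meas La) measurable_fst.
  exact: measurableT_comp (Lone_meas Lg) measurable_snd.
have mE : measurable_fun setT (EFin \o (fun z : Omega * T2 => a z.1 * g z.2)).
  exact/measurable_EFinP.
have L : Lone nu (fun z => a z.1 * g z.2).
  apply: (proj2 (integrable12ltyP P m2 mE)) => /=.
  have E x : (\int[m2]_y `|(a x * g y)%:E| = `|a x|%:E * (Ex m2 (fun y => `|g y|))%:E)%E.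
    rewrite EFin_Ex; last exact: Lone_norm.
    rewrite -ge0_integralZl_EFin//; last exact/measurable_EFinP/(Lone_meas (Lone_norm Lg)).
    by apply: eq_integral => y _; rewrite abse_EFin normrM EFinM.
  under eq_integral do rewrite E.
  rewrite ge0_integralZr//=.
  - rewrite -EFin_Ex; last exact: Lone_norm.
    by rewrite -EFinM ltry.
  - exact/measurable_EFinP/(Lone_meas (Lone_norm La)).
  - by rewrite lee_fin; exact: Ex_ge0.
split=> //; apply: EFin_inj; rewrite EFin_Ex// -(integral12_prod_meas1 L).
rewrite EFinM (EFin_Ex La) -integralZr//.
apply: eq_integral => w _; rewrite /fubini_F/= EFin_Ex// -integralZl//.
Qed.

Lemma Ex_section f : Lone nu f -> {ae P, forall w, Lone m2 (fun u => f (w, u))} /\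
  Lone P (fun w => Ex m2 (fun u => f (w, u))) /\
  Ex nu f = Ex P (fun w => Ex m2 (fun u => f (w, u))).
Proof.
move=> Lf; have ae := ae_integrable1 Lf; split=> //.
have iF := integrable_fubini_F Lf.
have E w : fine (fubini_F m2 (EFin \o f) w) = Ex m2 (fun u => f (w, u)) by [].
have mF : measurable_fun setT (fun w => Ex m2 (fun u => f (w, u))).
  apply: (eq_measurable_fun (fun w => fine (fubini_F m2 (EFin \o f) w))) => [w _|]//.
  exact: measurableT_comp (measurable_int _ iF).
have aeE : {ae P, forall w, fubini_F m2 (EFin \o f) w = (Ex m2 (fun u => f (w, u)))%:E}.
  by apply: filterS ae => w /= Lw; rewrite EFin_Ex.
have L : Lone P (fun w => Ex m2 (fun u => f (w, u))).
  apply/integrableP; split; first exact/measurable_EFinP.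
  have /integrableP[m1 f1] := iF; apply: le_lt_trans f1; rewrite le_eqVlt; apply/orP; left.
  apply/eqP; apply: ae_eq_integral => //.
  - by apply: measurableT_comp => //; exact/measurable_EFinP.
  - exact: measurableT_comp.
  - by apply: filterS aeE => w /= -> _.
split=> //; apply: EFin_inj; rewrite EFin_Ex// EFin_Ex// -(integral12_prod_meas1 Lf).
apply: ae_eq_integral => //.
- by have /integrableP[] := iF.
- exact/measurable_EFinP/(Lone_meas L).
- by apply: filterS aeE => w /= -> _.
Qed.

Lemma section_integral f g : Ltwo nu f -> Ltwo m2 g -> Lone m2 g ->
  Ltwo P (fun w => Ex m2 (fun u => f (w, u) * g u)) /\
  Ex P (fun w => Ex m2 (fun u => f (w, u) * g u) ^+ 2) <=
  Ex m2 (fun u => g u ^+ 2) * Ex nu (fun z => f z ^+ 2).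
Proof.
move=> [mf Lf] Lg Lg1.
have Lg' : Ltwo nu (fun z => g z.2).
  have [L _] := Lone_rect (Lone_cst P 1) Lg.2.
  split; first by apply: measurableT_comp => //; case: Lg.
  by under eq_fun do rewrite -[_ ^+ 2]mul1r.
have [ae1 [L1 _]] := Ex_section (LtwoM (conj mf Lf) Lg').
have [ae2 [L2 E2]] := Ex_section Lf.
have m : measurable_fun setT (fun w => Ex m2 (fun u => f (w, u) * g u)) by exact: Lone_meas L1.
have bnd : {ae P, forall w, Ex m2 (fun u => f (w, u) * g u) ^+ 2 <=
    Ex m2 (fun u => g u ^+ 2) * Ex m2 (fun u => f (w, u) ^+ 2)}.
  apply: filterS ae2 => w /= Lw; rewrite mulrC; apply: Ex_CS => //.
  by split=> //; exact: measurable_section1.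
have L : Lone P (fun w => Ex m2 (fun u => f (w, u) * g u) ^+ 2).
  have L3 := LoneZ (Ex m2 (fun u => g u ^+ 2)) L2.
  (* The bound holds almost everywhere only; domination is applied to the minimum, which agrees with
     the square off a null set. *)
  apply: (ae_eq_Lone (f := fun w => Num.min (Ex m2 (fun u => f (w, u) * g u) ^+ 2)
     (Ex m2 (fun u => g u ^+ 2) * Ex m2 (fun u => f (w, u) ^+ 2)))).
  - exact: measurable_funX.
  - by apply: filterS bnd => w /= H; rewrite min_l.
  - apply: (Lone_le _ _ L3); first apply: measurable_minr; [exact: measurable_funX|exact: Lone_meas L3|].
    move=> w; rewrite ger0_norm ?ge_min ?lexx ?orbT// le_min sqr_ge0 mulr_ge0//.
      exact: Ex_sqr_ge0.
    exact: Ex_sqr_ge0.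
split; first by split.
by rewrite E2 -ExZ//; apply: ae_le_Ex => //; exact: LoneZ.
Qed.

(** Tonelli with time outside: a bound on the expectation at each time becomes a bound on the
    product space. *)
Lemma section_bound f g c : measurable_fun setT f -> (forall z, 0 <= f z) ->
  Lone m2 g -> (forall u, 0 <= g u) -> 0 <= c ->
  (forall u, g u != 0 -> Lone P (fun w => f (w, u)) /\ Ex P (fun w => f (w, u)) <= c) ->
  Lone nu (fun z => f z * g z.2) /\ Ex nu (fun z => f z * g z.2) <= c * Ex m2 g.
Proof.
move=> mf f0 Lg g0 c0 H.
have m : measurable_fun setT (fun z : Omega * T2 => f z * g z.2).
  apply: measurable_funM => //; exact: measurableT_comp (Lone_meas Lg) measurable_snd.
have mE : measurable_fun setT (EFin \o (fun z : Omega * T2 => f z * g z.2)).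
  exact/measurable_EFinP.
have fg0 (z : Omega * T2) : (0 <= (EFin \o (fun z : Omega * T2 => (f z * g z.2)%R)) z)%E.
  by rewrite lee_fin mulr_ge0.
have I : (\int[nu]_z (f z * g z.2)%R%:E <= (c * Ex m2 g)%:E)%E.
  rewrite (fubini_tonelli2 (EFin \o (fun z : Omega * T2 => (f z * g z.2)%R)) mE fg0).
  rewrite -(ExZ c Lg) EFin_Ex; last exact: LoneZ.
  apply: ge0_le_integral => //.
  - by move=> u _; apply: integral_ge0.
  - exact: (measurable_fun_fubini_tonelli_G _ mE fg0).
  - exact/measurable_EFinP/(Lone_meas (LoneZ c Lg)).
  - move=> u _; rewrite /fubini_G /=; have [->|/H[Lu Eu]] := eqVneq (g u) 0.
      rewrite mulr0 integral0_eq// => w _; rewrite mulr0//.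
    rewrite -EFin_Ex; last by under eq_fun do rewrite mulrC; exact: LoneZ.
    rewrite lee_fin; under eq_Ex do rewrite mulrC.
    by rewrite ExZ// mulrC ler_wpM2r.
have L : Lone nu (fun z => f z * g z.2).
  apply: Lone_ge0P => //.
  by apply: le_lt_trans I _; rewrite ltry.
by split=> //; rewrite -lee_fin EFin_Ex.
Qed.

End TimeSpace.

(** * Ito integrals *)

Section TimeWindow.
Context {R : realType}.
Implicit Types s t u a b : R.
Local Notation leb := (@lebesgue_measure R).

(** Open on the left like the cells of simple processes, so that windows of adjacent cells add up
    exactly; a product with it restricts a process to the cell. *)
Definition window s t u : R := (s < u <= t)%R%:R.

Lemma window_ge0 s t u : 0 <= window s t u.
Proof. exact: ler0n. Qed.

Lemma window_le1 s t u : window s t u <= 1.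
Proof. by rewrite /window; case: (_ && _). Qed.

Lemma window_sqr s t u : window s t u ^+ 2 = window s t u.
Proof. by rewrite /window; case: (_ && _); rewrite ?expr1n// expr0n. Qed.

Lemma window_indic s t : window s t = \1_(`]s, t]%classic).
Proof.
by apply/funext => u; rewrite /window indicE mem_setE in_itv.
Qed.

Lemma window_neq0 s t u : window s t u != 0 -> s < u <= t.
Proof. by rewrite /window; case: (_ && _) => //; rewrite eqxx. Qed.

Lemma measurable_window s t : measurable_fun setT (window s t : measurableTypeR R -> R).
Proof. by rewrite window_indic; exact: measurable_indic. Qed.

Lemma Lone_window s t : Lone leb (window s t).
Proof.
apply: Lone_ge0P; [exact: measurable_window|by move=> u; exact: window_ge0|].
under eq_integral do rewrite window_indic.
rewrite integral_indic//= setIT lebesgue_measure_itv/=.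
by case: ifP => _; rewrite ?ltry.
Qed.

Lemma Ltwo_window s t : Ltwo leb (window s t).
Proof.
split; first exact: measurable_window.
by under eq_fun do rewrite window_sqr; exact: Lone_window.
Qed.

Lemma Ex_window s t : s <= t -> Ex leb (window s t) = t - s.
Proof.
move=> st; apply: EFin_inj; rewrite EFin_Ex; last exact: Lone_window.
under eq_integral do rewrite window_indic.
rewrite integral_indic//= setIT lebesgue_measure_itv/= lte_fin.
by move: st; rewrite le_eqVlt => /orP[/eqP->|->//]; rewrite ltxx subrr.
Qed.

Definition clamp s t a := Num.max s (Num.min a t).

Lemma clamp_le s t a b : a <= b -> clamp s t a <= clamp s t b.
Proof.
move=> ab; rewrite /clamp; have : Num.min a t <= Num.min b t.
  by rewrite le_min ge_min ab/= ge_min lexx orbT.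
by move=> H; rewrite ge_max !le_max lexx H orbT.
Qed.

Lemma clamp_bounds s t a : s <= t -> s <= clamp s t a <= t.
Proof. by move=> st; rewrite /clamp le_max lexx ge_max st ge_min lexx orbT. Qed.

Lemma window_clamp s t a b u : s <= t ->
  window a b u * window s t u = window (clamp s t a) (clamp s t b) u.
Proof.
move=> st; rewrite /window -natrM mulnb; congr (_%:R).
rewrite /clamp gt_max gt_min le_max le_min [t < u]ltNge [u <= s]leNgt.
by case: (s < u); case: (u <= t); case: (a < u); case: (u <= b).
Qed.

(** A coefficient known at time a is then known at the clamped time, unless the clamped cell is
    empty. *)
Lemma clamp_lt_ge s t a b : a <= b -> clamp s t a < clamp s t b -> a <= clamp s t a.
Proof.
move=> ab; rewrite /clamp le_max le_min lexx/=.
case: (leP a s) => //= sa; case: (leP a t) => //= ta.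
by rewrite (@min_r _ _ b t) ?ltxx// (le_trans (ltW ta)).
Qed.

Lemma stopped_increment (W : R -> R) s t a : s <= t ->
  W (Num.min a t) - W (Num.min a s) = W (clamp s t a) - W s.
Proof.
move=> st; rewrite /clamp; case: (leP a s) => [as'|sa].
  by rewrite (min_l (le_trans as' st)) max_l// !subrr.
by rewrite max_r// le_min st ltW.
Qed.

End TimeWindow.

Section ItoIntegral.
Context {R : realType} {dd : measure_display} {Omega : measurableType dd}.
Context (P : probability Omega R) (d : nat) (B : R -> Omega -> 'cV[R]_d).
Hypotheses (cP : measure_is_complete P) (BM : standard_brownian_motion P B).
Local Notation leb := (@lebesgue_measure R).
Local Notation nu := (P \x leb)%E.
Local Notation adapted := (adapted P B).

Section ElementarySum.
Variables (s t : R) (n : nat) (c : nat -> Omega -> R) (r : nat -> R) (j : 'I_d).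
Hypotheses (s0 : 0 <= s) (st : s <= t).
Hypotheses (rst : forall k, s <= r k <= t) (r_le : forall k, r k <= r k.+1).
Hypotheses (cb : forall k, exists M : R, forall w, `|c k w| <= M).
Hypothesis ca : forall k, adapted (r k) (c k).

Definition elem_sum w : R := \sum_(k < n) c k w * incB B (r k) (r k.+1) w j ord0.
Definition elem_val (z : Omega * measurableTypeR R) : R :=
  \sum_(k < n) c k z.1 * window (r k) (r k.+1) z.2.

Let r0 k : 0 <= r k.
Proof. by have /andP[+ _] := rst k; exact: le_trans. Qed.
Let Lc k : Ltwo P (c k).
Proof.
have [M HM] := cb k; apply: (@Ltwo_bounded _ _ _ P M) => //.
exact: (adapted_measurable cP BM (@ca k)).
Qed.
Let r_mono k l : (k <= l)%N -> r k <= r l.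
Proof. by move=> kl; apply: (homo_leq_in (D := predT) (@lexx _ _) (@le_trans _ _)). Qed.
Let Lterm k : Ltwo P (fun w => c k w * incB B (r k) (r k.+1) w j ord0).
Proof. exact: (inc_Ltwo cP BM (r0 k) (r_le k) j (@ca k) (Lc k)). Qed.
Let Lrect a k : Ltwo P a ->
  Ltwo nu (fun z => a z.1 * window (r k) (r k.+1) z.2).
Proof.
move=> [ma La]; split.
  apply: measurable_funM; first exact: measurableT_comp ma measurable_fst.
  exact: measurableT_comp (measurable_window _ _) measurable_snd.
have [L _] := Lone_rect La (Lone_window (r k) (r k.+1)).
by under eq_fun do rewrite exprMn window_sqr.
Qed.

Lemma elem_sum_Ltwo : Ltwo P elem_sum.
Proof. by apply: Ltwo_sum => k _; exact: Lterm. Qed.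

Lemma elem_val_Ltwo : Ltwo nu elem_val.
Proof. by apply: Ltwo_sum => k _; exact: (Lrect k (Lc k)). Qed.

Lemma elem_sum_mean a : adapted s a -> Ltwo P a -> Ex P (fun w => a w * elem_sum w) = 0.
Proof.
move=> aa La.
under eq_Ex do rewrite mulr_sumr.
rewrite Ex_sum => [|k _]; last exact: (LtwoM La (Lterm k)).
apply: big1 => k _; under eq_Ex do rewrite mulrA.
have aac : adapted (r k) (fun w => a w * c k w).
  apply: measurable_funM; last exact: (@ca k).
  by apply: (adapted_le _ aa); have /andP[] := rst k.
by have [_ ->] := inc_mean cP BM (r0 k) (r_le k) j aac (LtwoM La (Lc k)).
Qed.

(** B_t - B_s is split into the parts before, inside and after the k-th cell. The first part belongs
    to the past of the cell and the last to its future, so both have mean 0 against the term; the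
    inner one gives the length of the cell. *)
Lemma elem_sum_cov a i : adapted s a -> (exists M : R, forall w, `|a w| <= M) ->
  Ex P (fun w => a w * incB B s t w i ord0 * elem_sum w) =
  Ex nu (fun z => (i == j)%:R * a z.1 * window s t z.2 * elem_val z).
Proof.
move=> aa [M aM].
have ma := adapted_measurable cP BM aa.
have La : Ltwo P a by apply: (@Ltwo_bounded _ _ _ P M).
have Lai : Ltwo P (fun w => a w * incB B s t w i ord0).
  exact: (inc_Ltwo cP BM s0 st i aa La).
have st1 k := rst k; have st2 k := rst k.+1.
have Lac k : Lone P (fun w => a w * c k w) by exact: (LtwoM La (Lc k)).
have E2 : Ex nu (fun z => (i == j)%:R * a z.1 * window s t z.2 * elem_val z) =
    \sum_(k < n) (i == j)%:R * (Ex P (fun w => a w * c k w) * (r k.+1 - r k)).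
  have Eq z : (i == j)%:R * a z.1 * window s t z.2 * elem_val z =
      \sum_(k < n) (i == j)%:R * ((a z.1 * c k z.1) * window (r k) (r k.+1) z.2).
    rewrite /elem_val mulr_sumr; apply: eq_bigr => k _.
    have Ew : window s t z.2 * window (r k) (r k.+1) z.2 = window (r k) (r k.+1) z.2.
      rewrite /window -natrM mulnb; congr (nat_of_bool _)%:R.
      apply/idP/idP => [/andP[]//|/andP[u1 u2]]; rewrite u1 u2 andbT.
      have /andP[k1 _] := st1 k; have /andP[_ k2] := st2 k.
      by rewrite (le_lt_trans k1)//= (le_trans u2).
    by rewrite -[in RHS]Ew; ring.
  under eq_Ex do rewrite Eq.
  have Lk (k : 'I_n) := Lone_rect (Lac k) (Lone_window (r k) (r k.+1)).
  rewrite Ex_sum => [|k _]; last by apply: LoneZ; case: (Lk k).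
  apply: eq_bigr => k _; have [L E] := Lk k.
  by rewrite ExZ// E Ex_window.
rewrite E2; under eq_Ex do rewrite mulr_sumr.
rewrite Ex_sum => [|k _]; last exact: LtwoM.
apply: eq_bigr => k _.
have /andP[k1 k2] := st1 k; have /andP[k3 k4] := st2 k.
have aa1 : adapted (r k) a by exact: (adapted_le k1 aa).
have aac : adapted (r k) (fun w => a w * c k w) by exact: adapted_mul aa1 (@ca k).
set Dk := fun w => incB B (r k) (r k.+1) w j ord0.
have [L1 E1] := inc_cov cP BM (r0 k) (r_le k) i j aac (Lac k).
pose f1 w := incB B s (r k) w i ord0.
have af1 : adapted (r k) f1.
  exact: adapted_incB.
have Laf : Ltwo P (fun w => a w * f1 w) by exact: (inc_Ltwo cP BM s0 k1 i aa La).
have aacf : adapted (r k) (fun w => a w * f1 w * c k w).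
  exact: adapted_mul (adapted_mul aa1 af1) (@ca k).
have [L3 E3] := inc_mean cP BM (r0 k) (r_le k) j aacf (LtwoM Laf (Lc k)).
pose f2 w := a w * (c k w * Dk w).
have af2 : adapted (r k.+1) f2.
  apply: measurable_funM; first exact: (adapted_le k3 aa).
  apply: measurable_funM; first exact: (adapted_le (r_le k) (@ca k)).
  exact: adapted_incB.
have Lf2 : Lone P f2 by exact: LtwoM.
have [L4 E4] := inc_mean cP BM (r0 k.+1) k4 i af2 Lf2.
have -> : Ex P (fun w => a w * incB B s t w i ord0 * (c k w * incB B (r k) (r k.+1) w j ord0)) =
  Ex P (fun w => (a w * f1 w * c k w * Dk w +
     a w * c k w * (incB B (r k) (r k.+1) w i ord0 * Dk w)) + f2 w * incB B (r k.+1) t w i ord0).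
  by apply: eq_Ex => w; rewrite /f1 /f2 /Dk /incB !mxE; ring.
rewrite ExD//; last exact: LoneD.
by rewrite ExD// E1 E3 E4 add0r addr0; ring.
Qed.

(** Ito isometry: off-diagonal terms vanish on the left by the martingale property and on the right
    because the cells are disjoint. *)
Lemma elem_sum_sqr : Ex P (fun w => elem_sum w ^+ 2) = Ex nu (fun z => elem_val z ^+ 2).
Proof.
set D := fun k w => incB B (r k) (r k.+1) w j ord0.
set W := fun k => window (r k) (r k.+1).
have E1 w : elem_sum w ^+ 2 = \sum_(k < n) \sum_(l < n) (c k w * D k w) * (c l w * D l w).
  by rewrite expr2 /elem_sum mulr_suml; apply: eq_bigr => k _; rewrite mulr_sumr.
have E2 z : elem_val z ^+ 2 =
    \sum_(k < n) \sum_(l < n) (c k z.1 * W k z.2) * (c l z.1 * W l z.2).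
  by rewrite expr2 /elem_val mulr_suml; apply: eq_bigr => k _; rewrite mulr_sumr.
under eq_Ex do rewrite E1; under [RHS]eq_Ex do rewrite E2.
have LkP k l : Lone P (fun w => (c k w * D k w) * (c l w * D l w)) by exact: (LtwoM (Lterm k) (Lterm l)).
have Lkn k l : Lone nu (fun z => (c k z.1 * W k z.2) * (c l z.1 * W l z.2)).
  exact: (LtwoM (Lrect k (Lc k)) (Lrect l (Lc l))).
rewrite Ex_sum => [|k _]; last by apply: Lone_sum => l _.
rewrite [RHS]Ex_sum => [|k _]; last by apply: Lone_sum => l _.
apply: eq_bigr => k _; rewrite Ex_sum// [RHS]Ex_sum//; apply: eq_bigr => l _.
have off k' l' : (k' < l')%N ->
   Ex P (fun w => (c k' w * D k' w) * (c l' w * D l' w)) = 0 /\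
   Ex nu (fun z => (c k' z.1 * W k' z.2) * (c l' z.1 * W l' z.2)) = 0.
  move=> kl; have kr : r k'.+1 <= r l' by exact: r_mono.
  split.
    have af : adapted (r l') (fun w => c k' w * D k' w * c l' w).
      apply: measurable_funM; last exact: (@ca l').
      apply: measurable_funM.
        by apply: (adapted_le _ (@ca k')); exact: le_trans (r_le _) kr.
      by apply: adapted_incB => //; exact: le_trans (r_le _) kr.
    have [_ E] := inc_mean cP BM (r0 l') (r_le l') j af (LtwoM (Lterm k') (Lc l')).
    by rewrite -[RHS]E; apply: eq_Ex => w; rewrite mulrA.
  rewrite -[RHS](Ex0 nu); apply: eq_Ex => z.
  rewrite (_ : _ * _ = c k' z.1 * c l' z.1 * (W k' z.2 * W l' z.2)); last by ring.
  rewrite /W /window -natrM mulnb; case: (ltP (r l') z.2) => u1; last by rewrite andbF mulr0.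
  by rewrite [_ && (z.2 <= r k'.+1)]andbC leNgt (le_lt_trans kr u1) mulr0.
have [kl|lk|->] := ltngtP k l.
- by have [-> ->] := off _ _ kl.
- have [e1 e2] := off _ _ lk.
  under eq_Ex do rewrite mulrC; rewrite e1.
  by under eq_Ex do rewrite mulrC; rewrite e2.
have ac2 : adapted (r l) (fun w => c l w ^+ 2) by exact: adapted_sqr (@ca l).
have [_ E] := inc_cov cP BM (r0 l) (r_le l) j j ac2 (Lc l).2.
transitivity ((r l.+1 - r l) * Ex P (fun w => c l w ^+ 2)).
  rewrite -[RHS]mul1r mulrA -[1](_ : (j == j)%:R = 1); last by rewrite eqxx.
  by rewrite -E; apply: eq_Ex => w; rewrite /D; ring.
have [_ F] := Lone_rect (Lc l).2 (Lone_window (r l) (r l.+1)).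
rewrite mulrC -(Ex_window (r_le l)) -F; apply: eq_Ex => z.
by rewrite /W mulrACA -!expr2 window_sqr.
Qed.

End ElementarySum.

Local Notation F := (augmented_filtration P B).

Definition closed_window (T u : R) : R := (0 <= u <= T)%R%:R.

(** Processes become functions on the product space with 0 outside a time interval: the closed one
    here, as in the definition of the integral, a half-open cell in [proc_window]. *)
Definition proc_on (T : R) (f : R -> Omega -> R) (z : Omega * measurableTypeR R) : R :=
  f z.2 z.1 * closed_window T z.2.

Definition proc_window (s t : R) (f : R -> Omega -> R) (z : Omega * measurableTypeR R) : R :=
  f z.2 z.1 * window s t z.2.

Definition jointly_measurable (T : R) (f : R -> Omega -> R) :=
  measurable_fun (`[0, T] `*` setT) (fun p : R * Omega => f p.1 p.2).

Lemma measurable_proc_on T f :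
  jointly_measurable T f ->
  measurable_fun setT (proc_on T f).
Proof.
set D : set (R * Omega) := `[0, T] `*` setT => mf.
have mD : measurable D by apply: measurableX.
have mfD : measurable_fun setT (patch (fun=> 0) D (fun p : R * Omega => f p.1 p.2)).
  exact/(measurable_restrictT _ mD).
have ms : measurable_fun setT (fun z : Omega * measurableTypeR R => (z.2, z.1) : R * Omega).
  by apply/measurable_fun_pairP; split; [exact: measurable_snd|exact: measurable_fst].
apply: (eq_measurable_fun _ _ (measurableT_comp mfD ms)) => z _ /=.
rewrite /proc_on /closed_window; case: (boolP (0 <= z.2 <= T)) => h.
  by rewrite mulr1 patchT//; apply: mem_set; split=> //=; rewrite in_itv.
by rewrite mulr0 patchN//; apply/negP => /set_mem[/=]; rewrite in_itv/= (negbTE h).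
Qed.

Lemma integral_proc_on T f :
  jointly_measurable T f ->
  (\int[P]_w \int[leb]_(s in `[0%R, T]) (f s w ^+ 2)%:E =
   \int[nu]_z (proc_on T f z ^+ 2)%:E)%E.
Proof.
move=> /measurable_proc_on mf.
have mE : measurable_fun setT (EFin \o (fun z => proc_on T f z ^+ 2)).
  by apply/measurable_EFinP; exact: measurable_funX.
have f0 z : (0 <= (EFin \o (fun z => (proc_on T f z ^+ 2)%R)) z)%E by rewrite lee_fin sqr_ge0.
rewrite [RHS](fubini_tonelli1 _ mE f0).
apply: eq_integral => w _; rewrite integral_mkcond; apply: eq_integral => u _.
rewrite /= /proc_on /closed_window; case: (boolP (0 <= u <= T)) => h.
  by rewrite mulr1 patchT//; apply: mem_set; rewrite /= in_itv.
by rewrite mulr0 expr0n patchN//; apply/negP => /set_mem; rewrite /= in_itv/= (negbTE h).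
Qed.

Lemma Ltwo_proc_on T f e :
  jointly_measurable T f ->
  (\int[P]_w \int[leb]_(s in `[0%R, T]) (f s w ^+ 2)%:E < e)%E ->
  Ltwo nu (proc_on T f) /\ ((Ex nu (fun z => proc_on T f z ^+ 2))%:E < e)%E.
Proof.
move=> mf; rewrite (integral_proc_on mf) => fe; have m := measurable_proc_on mf.
have L : Lone nu (fun z => proc_on T f z ^+ 2).
  apply: Lone_ge0P; [exact: measurable_funX|by move=> z; exact: sqr_ge0|].
  by apply: lt_le_trans fe _; rewrite leey.
by split; [split|rewrite EFin_Ex].
Qed.

Lemma proc_window_on T f s t z : 0 <= s -> t <= T ->
  proc_window s t f z = proc_on T f z * window s t z.2.
Proof.
move=> s0 tT; rewrite /proc_window /proc_on /closed_window.
case: (eqVneq (window s t z.2) 0) => [->|/window_neq0/andP[u1 u2]]; first by rewrite !mulr0.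
by rewrite (le_trans s0 (ltW u1)) (le_trans u2 tT) mulr1.
Qed.

Lemma measurable_proc_window T f s t : 0 <= s -> t <= T ->
  measurable_fun setT (proc_on T f) -> measurable_fun setT (proc_window s t f).
Proof.
move=> s0 tT mf; rewrite (_ : proc_window s t f = fun z => proc_on T f z * window s t z.2); last first.
  by apply/funext => z; exact: proc_window_on.
by apply: measurable_funM => //; exact: measurableT_comp (measurable_window _ _) measurable_snd.
Qed.

Lemma Ltwo_proc_window T f s t : 0 <= s -> t <= T -> Ltwo nu (proc_on T f) ->
  Ltwo nu (proc_window s t f) /\
  Ex nu (fun z => proc_window s t f z ^+ 2) <= Ex nu (fun z => proc_on T f z ^+ 2).
Proof.
move=> s0 tT Lf.
have le1 z : `|proc_window s t f z| <= `|proc_on T f z|.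
  rewrite (proc_window_on _ _ s0 tT) normrM -[leRHS]mulr1 ler_wpM2l//.
  by rewrite ger0_norm ?window_ge0 ?window_le1.
have L : Ltwo nu (proc_window s t f).
  by apply: (Ltwo_le _ le1 Lf); apply: measurable_proc_window Lf.1.
split=> //; apply: Ex_le => [||z]; [exact: L.2|exact: Lf.2|].
by rewrite -(real_normK (num_real (proc_window _ _ _ _)))
  -(real_normK (num_real (proc_on _ _ _))) lerXn2r ?nnegrE.
Qed.

Section SimpleProcess.
Variables (S : simple_process F) (s t : R) (j : 'I_d).
Hypotheses (s0 : 0 <= s) (st : s <= t).

Definition simple_time k := clamp s t (sp_time S k).
(** The coefficient of a collapsed cell is replaced by 0, because it need not be known at the
    clamped time. *)
Definition simple_coef k w := if simple_time k < simple_time k.+1 then sp_coef S k w else 0.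
Local Notation r := simple_time.
Local Notation c := simple_coef.

Lemma simple_time_bounds k : s <= r k <= t.
Proof. exact: clamp_bounds. Qed.

Lemma simple_time_le k : r k <= r k.+1.
Proof. by apply: clamp_le; exact: sp_time_le. Qed.

Lemma simple_coef_bounded k : exists M : R, forall w, `|c k w| <= M.
Proof.
have [M HM] := sp_coef_bounded S k; exists M => w; rewrite /simple_coef; case: ifP => // _.
by rewrite normr0; apply: le_trans (HM w).
Qed.

Lemma simple_coef_adapted k : adapted (r k) (c k).
Proof.
have -> : c k = if r k < r k.+1 then sp_coef S k else fun=> 0.
  by apply/funext => w; rewrite /simple_coef; case: ifP.
case: ifPn => [rr|_]; last exact: adapted_cst.
have tk := clamp_lt_ge (sp_time_le S k) rr.
by apply: (adapted_le tk); apply/adapted_rv; exact: sp_coef_adapted.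
Qed.

Lemma simple_ito_increment w :
  simple_ito (fun t w => B t w j ord0) S t w - simple_ito (fun t w => B t w j ord0) S s w =
  elem_sum (sp_size S) c r j w.
Proof.
rewrite /simple_ito /elem_sum -sumrB; apply: eq_bigr => k _.
rewrite -mulrBr /incB !mxE.
have E a := @stopped_increment R (fun u => B u w j ord0) s t a st.
rewrite (_ : _ - (_ - _) = B (r k.+1) w j ord0 - B (r k) w j ord0); last first.
  have := E (sp_time S k.+1); have := E (sp_time S k); rewrite -/(r k) -/(r k.+1).
  move: (B _ w j ord0) (B _ w j ord0) (B _ w j ord0) (B _ w j ord0) => x1 x2 x3 x4.
  by move: (B _ w j ord0) (B _ w j ord0) (B _ w j ord0) => x5 x6 x7 h1 h2; lra.
rewrite /simple_coef; case: ifPn => //; rewrite -leNgt => rr.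
have -> : r k.+1 = r k by apply/eqP; rewrite eq_le rr simple_time_le.
by rewrite subrr !mulr0.
Qed.

Lemma simple_val_window z :
  proc_window s t (simple_val S) z = elem_val (sp_size S) c r z.
Proof.
rewrite /proc_window /simple_val /elem_val mulr_suml; apply: eq_bigr => k _.
rewrite -mulrA -[X in _ * (X * _)]/(window (sp_time S k) (sp_time S k.+1) z.2).
rewrite window_clamp// -/(r k) -/(r k.+1) /simple_coef; case: ifPn => //; rewrite -leNgt => rr.
rewrite /window (_ : (_ && _) = false) ?mulr0//; apply/negbTE/negP => /andP[u1 u2].
by have := lt_le_trans u1 (le_trans u2 rr); rewrite ltxx.
Qed.

End SimpleProcess.

Lemma measurable_simple_val (S : simple_process F) (T : R) :
  jointly_measurable T (simple_val S).
Proof.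
apply: measurable_funTS; rewrite /simple_val; apply: measurable_sum => k.
apply: measurable_funM.
  have mc : measurable_fun setT (sp_coef S k).
    by apply: (adapted_measurable cP BM (t := sp_time S k)); apply/adapted_rv; exact: sp_coef_adapted.
  exact: measurableT_comp mc measurable_snd.
have mw : measurable_fun setT (window (sp_time S k) (sp_time S k.+1) : R -> R).
  exact: measurable_window.
exact: measurableT_comp mw measurable_fst.
Qed.

Lemma simple_ito0 (S : simple_process F) j w :
  simple_ito (fun t w => B t w j ord0) S 0 w = 0.
Proof.
rewrite /simple_ito big1// => k _.
by rewrite !min_r ?sp_time_ge0// subrr mulr0.
Qed.

Lemma eventually_lt (u : nat -> \bar R) (e : R) : u @ \oo --> 0%E -> 0 < e ->
  \forall n \near \oo, (u n < e%:E)%E.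
Proof.
move=> cu e0; have := cu [set x | (x < e%:E)%E]; apply.
rewrite /nbhs/= /ereal_nbhs/=.
by near=> r; rewrite lte_fin; near: r; exact: lt_nbhsl.
Unshelve. all: by end_near. Qed.

Section ItoFacts.
Variables (T : R) (j : 'I_d) (H M : R -> Omega -> R).
Hypothesis T0 : 0 <= T.
Hypothesis ito : is_ito_integral P F T (fun t w => B t w j ord0) H M.

Lemma ito_jointly_measurable : jointly_measurable T H.
Proof. by case: ito => -[]. Qed.

Lemma ito_adapted t : 0 <= t <= T -> adapted t (M t).
Proof. by case: ito => _ [_ aM] _ _ tT; apply/adapted_rv; exact: aM. Qed.

Let mM t : 0 <= t <= T -> measurable_fun setT (M t).
Proof. by move=> tT; exact: (adapted_measurable cP BM (ito_adapted tT)). Qed.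

Let Lsimple (S : simple_process F) t : 0 <= t -> Ltwo P (simple_ito (fun t w => B t w j ord0) S t).
Proof.
move=> t0; have -> : simple_ito (fun t w => B t w j ord0) S t =
    elem_sum (sp_size S) (simple_coef S 0 t) (simple_time S 0 t) j.
  apply/funext => w; rewrite -(simple_ito_increment S j t0 w) simple_ito0 subr0//.
apply: (elem_sum_Ltwo (s := 0) (t := t)) => //.
- exact: simple_time_bounds.
- exact: simple_time_le.
- exact: simple_coef_bounded.
- exact: simple_coef_adapted.
Qed.

Lemma simple_approx s t e : 0 <= s <= T -> 0 <= t <= T -> 0 < e ->
  exists S : simple_process F,
    [/\ Ltwo nu (proc_on T (fun u w => simple_val S u w - H u w)),
     Ex nu (fun z => proc_on T (fun u w => simple_val S u w - H u w) z ^+ 2) <= e &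
     forall r, r = s \/ r = t ->
       Ltwo P (fun w => simple_ito (fun t w => B t w j ord0) S r w - M r w) /\
       Ex P (fun w => (simple_ito (fun t w => B t w j ord0) S r w - M r w) ^+ 2) <= e].
Proof.
move=> sT tT e0; case: ito => _ _ _ [S [cH cM]].
have [n [h1 h2 h3]] : exists n, [/\
    (\int[P]_w \int[leb]_(s in `[0%R, T]) ((simple_val (S n) s w - H s w) ^+ 2)%:E < e%:E)%E,
    (\int[P]_w ((simple_ito (fun t w => B t w j ord0) (S n) s w - M s w) ^+ 2)%:E < e%:E)%E &
    (\int[P]_w ((simple_ito (fun t w => B t w j ord0) (S n) t w - M t w) ^+ 2)%:E < e%:E)%E].
  have := filterI (eventually_lt cH e0)
    (filterI (eventually_lt (cM s sT) e0) (eventually_lt (cM t tT) e0)).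
  by move=> [N _ HN]; exists N; have [] := HN N (leqnn N); move=> ? [].
have mJ : jointly_measurable T (fun u w => simple_val (S n) u w - H u w).
  by apply: measurable_funB; [exact: measurable_simple_val|exact: ito_jointly_measurable].
have [L1 E1] := Ltwo_proc_on mJ h1.
exists (S n); split=> //; first by rewrite -lee_fin ltW.
have key r : 0 <= r <= T ->
   (\int[P]_w ((simple_ito (fun t w => B t w j ord0) (S n) r w - M r w) ^+ 2)%:E < e%:E)%E ->
    Ltwo P (fun w => simple_ito (fun t w => B t w j ord0) (S n) r w - M r w) /\
    Ex P (fun w => (simple_ito (fun t w => B t w j ord0) (S n) r w - M r w) ^+ 2) <= e.
  move=> rT hr; have /andP[r0 _] := rT.
  have m : measurable_fun setT (fun w => simple_ito (fun t w => B t w j ord0) (S n) r w - M r w).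
    by apply: measurable_funB; [case: (Lsimple (S n) r0)|exact: mM].
  have L : Lone P (fun w => (simple_ito (fun t w => B t w j ord0) (S n) r w - M r w) ^+ 2).
    apply: Lone_ge0P; [exact: measurable_funX|by move=> w; exact: sqr_ge0|].
    by apply: lt_trans hr _; rewrite ltry.
  by split; [split|rewrite -lee_fin EFin_Ex// ltW].
by move=> r [->|->]; exact: key.
Qed.

Lemma ito_Ltwo t : 0 <= t <= T -> Ltwo P (M t).
Proof.
move=> tT; have [S [_ _ /(_ t (or_introl erefl))[L _]]] := simple_approx tT tT ltr01.
have /andP[t0 _] := tT; have := LtwoB (Lsimple S t0) L.
by under eq_fun do rewrite opprB addrC subrK.
Qed.

(** H is a simple process minus an approximation error: the first is bounded on [0, T], the second
    is square integrable for a late approximant. *)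
Lemma ito_integrand_Ltwo : Ltwo nu (proc_on T H).
Proof.
have h : 0 <= (0 : R) <= T by rewrite lexx.
have [S [L _ _]] := simple_approx h h ltr01.
have LS : Ltwo nu (proc_on T (simple_val S)).
  have mS : measurable_fun setT (proc_on T (simple_val S)).
    by apply: measurable_proc_on; exact: measurable_simple_val.
  have [C HC] : exists C : R, forall z, `|proc_on T (simple_val S) z| <= C * closed_window T z.2.
    have /choice[f Hf] : forall k, exists M : R, forall w, `|sp_coef S k w| <= M.
      exact: sp_coef_bounded.
    exists (\sum_(k < sp_size S) f k) => z; rewrite /proc_on normrM.
    rewrite [X in _ * X]ger0_norm ?ler0n// ler_wpM2r ?ler0n//.
    apply: le_trans (ler_norm_sum _ _ _) _; apply: ler_sum => k _.
    rewrite normrM -[leRHS]mulr1 ler_pM//.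
    by rewrite ger0_norm ?ler0n//; case: (_ && _).
  have cw : closed_window T = \1_(`[0, T]%classic).
    by apply/funext => u; rewrite /closed_window indicE mem_setE in_itv.
  have mcw : measurable_fun setT (closed_window T : measurableTypeR R -> R).
    by rewrite cw; exact: measurable_indic.
  have Lcw : Lone leb (closed_window T).
    apply: Lone_ge0P => //.
    under eq_integral do rewrite cw.
    rewrite integral_indic//= setIT lebesgue_measure_itv/=.
    by case: ifP => _; rewrite ?ltry.
  have [Lr _] := Lone_rect (Lone_cst P (C ^+ 2)) Lcw.
  split=> //; apply: (Lone_le _ _ Lr); first exact: measurable_funX.
  move=> z; rewrite ger0_norm ?sqr_ge0//.
  have := HC z; rewrite /closed_window; case: (0 <= z.2 <= T) => /= h'.
    rewrite mulr1 in h'; rewrite mulr1 -real_normK ?num_real// lerXn2r// nnegrE//.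
    exact: le_trans h'.
  by move: h'; rewrite !mulr0 normr_le0 => /eqP ->; rewrite expr0n.
have := LtwoB LS L; rewrite (_ : (fun z => _ - _) = proc_on T H)//.
by apply/funext => z; rewrite /proc_on; ring.
Qed.

Section Increment.
Variables s t : R.
Hypotheses (s0 : 0 <= s) (st : s <= t) (tT : t <= T).

Let hs : 0 <= s <= T. Proof. by rewrite s0 (le_trans st). Qed.
Let ht : 0 <= t <= T. Proof. by rewrite (le_trans s0). Qed.

Lemma ito_window_Ltwo : Ltwo nu (proc_window s t H).
Proof. by have [] := Ltwo_proc_window s0 tT ito_integrand_Ltwo. Qed.

Lemma ito_increment_Ltwo : Ltwo P (fun w => M t w - M s w).
Proof. by apply: LtwoB; exact: ito_Ltwo. Qed.

(** Clamping an approximating simple process to [s, t] turns its increment into an elementary sum,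
    to which the computations above apply. *)
Lemma ito_approx e : 0 < e -> exists n c (r : nat -> R), [/\
  (forall k, s <= r k <= t), (forall k, r k <= r k.+1),
  (forall k, exists M : R, forall w, `|c k w| <= M), (forall k, adapted (r k) (c k)) &
  Ex P (fun w => (M t w - M s w - elem_sum n c r j w) ^+ 2) <= e /\
  Ex nu (fun z => (elem_val n c r z - proc_window s t H z) ^+ 2) <= e].
Proof.
(* e / 4 because the errors at the two end points combine under (f - g)^2 <= 2 f^2 + 2 g^2. *)
move=> e0; have e4 : 0 < e / 4 by rewrite divr_gt0.
have [S [L1 E1 HS]] := simple_approx hs ht e4.
have [Ls Es] := HS s (or_introl erefl); have [Lt Et] := HS t (or_intror erefl).
exists (sp_size S), (simple_coef S s t), (simple_time S s t); split.
- exact: simple_time_bounds.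
- exact: simple_time_le.
- exact: simple_coef_bounded.
- exact: simple_coef_adapted.
split.
  under eq_Ex do rewrite -(simple_ito_increment S j st).
  set f := fun w => simple_ito (fun t w => B t w j ord0) S s w - M s w in Ls Es.
  set g := fun w => simple_ito (fun t w => B t w j ord0) S t w - M t w in Lt Et.
  have -> : Ex P (fun w => (M t w - M s w - (simple_ito (fun t w => B t w j ord0) S t w -
      simple_ito (fun t w => B t w j ord0) S s w)) ^+ 2) = Ex P (fun w => (f w + - g w) ^+ 2).
    by apply: eq_Ex => w; rewrite /f /g; ring.
  apply: le_trans (Ex_sqrD_le Ls (LtwoN Lt)) _.
  have -> : Ex P (fun w => (- g w) ^+ 2) = Ex P (fun w => g w ^+ 2).
    by apply: eq_Ex => w; rewrite sqrrN.
  lra.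
have [Lw Ew] := Ltwo_proc_window s0 tT L1.
apply: le_trans (_ : _ <= e / 4) _; last by lra.
apply: le_trans E1; apply: le_trans Ew.
rewrite le_eqVlt; apply/orP; left; apply/eqP; apply: eq_Ex => z.
by rewrite -simple_val_window// /proc_window; congr (_ ^+ 2); ring.
Qed.

Lemma ito_mean a : adapted s a -> Ltwo P a -> Ex P (fun w => a w * (M t w - M s w)) = 0.
Proof.
move=> aa La; rewrite -(Ex0 P).
rewrite [RHS](_ : _ = Ex P (fun w : Omega => (fun=> 0) w * (fun=> 0) w)); last first.
  by apply: eq_Ex => w; rewrite mulr0.
apply: Ltwo_limit_eq => //; [exact: ito_increment_Ltwo|exact: Ltwo0|exact: Ltwo0|].
move=> e e0; have [n [c [r [h1 h2 h3 h4 [h5 _]]]]] := ito_approx e0.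
exists (elem_sum n c r j), (fun=> 0); split.
- exact: (elem_sum_Ltwo _ _ s0 h1 h2 h3 h4).
- exact: Ltwo0.
- exact: h5.
- by under eq_Ex do rewrite subrr expr0n/=; rewrite Ex0 ltW.
rewrite (elem_sum_mean n j s0 h1 h2 h3 h4 aa La).
by under eq_Ex do rewrite mulr0; rewrite Ex0.
Qed.

Lemma ito_sqr : Ex P (fun w => (M t w - M s w) ^+ 2) <= Ex nu (fun z => proc_window s t H z ^+ 2).
Proof.
apply: Ltwo_limit_sqr_le; [exact: ito_increment_Ltwo|exact: ito_window_Ltwo|].
move=> e e0; have [n [c [r [h1 h2 h3 h4 [h5 h6]]]]] := ito_approx e0.
exists (elem_sum n c r j), (elem_val n c r); split=> //.
- exact: (elem_sum_Ltwo _ _ s0 h1 h2 h3 h4).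
- exact: (elem_val_Ltwo _ h3 h4).
- by rewrite (elem_sum_sqr n j s0 h1 h2 h3 h4).
Qed.

(** Limit of [elem_sum_cov]. It ties the integrand to the Brownian increment, both for frozen
    coefficients and for the gradient of the scheme. *)
Lemma ito_cov a i : adapted s a -> (exists M : R, forall w, `|a w| <= M) ->
  Ex P (fun w => a w * incB B s t w i ord0 * (M t w - M s w)) =
  Ex nu (fun z => (i == j)%:R * a z.1 * window s t z.2 * proc_window s t H z).
Proof.
move=> aa ab; have [C aC] := ab.
have La : Ltwo P a by apply: (@Ltwo_bounded _ _ _ P C) => //; exact: (adapted_measurable cP BM aa).
apply: Ltwo_limit_eq; [|exact: ito_increment_Ltwo| |exact: ito_window_Ltwo|].
- exact: (inc_Ltwo cP BM s0 st i aa La).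
- have L2 : Ltwo P (fun w => (i == j)%:R * a w) by exact: LtwoZ.
  have [L _] := Lone_rect L2.2 (Lone_window s t).
  split; last by under eq_fun do rewrite exprMn window_sqr.
  apply: measurable_funM; first exact: measurableT_comp L2.1 measurable_fst.
  exact: measurableT_comp (measurable_window _ _) measurable_snd.
move=> e e0; have [n [c [r [h1 h2 h3 h4 [h5 h6]]]]] := ito_approx e0.
exists (elem_sum n c r j), (elem_val n c r); split=> //.
- exact: (elem_sum_Ltwo _ _ s0 h1 h2 h3 h4).
- exact: (elem_val_Ltwo _ h3 h4).
- exact: (elem_sum_cov n j s0 st h1 h2 h3 h4 i aa ab).
Qed.

End Increment.
End ItoFacts.
End ItoIntegral.

(** * Integrals along paths *)

Section PathIntegral.
Context {R : realType} {dd : measure_display} {Omega : measurableType dd}.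
Variable P : probability Omega R.
Local Notation leb := (@lebesgue_measure R).
Local Notation nu := (P \x leb)%E.
Implicit Types (f : R -> Omega -> R) (a b s t T : R).

Lemma window_add a b c u : a <= b -> b <= c -> window a b u + window b c u = window a c u.
Proof.
move=> ab bc; rewrite /window; case: (ltP a u) => au; last first.
  by rewrite [b < u]ltNge (le_trans au ab) /= add0r.
case: (leP u b) => ub /=; last by rewrite add0r.
by rewrite (le_trans ub bc) addr0.
Qed.

Lemma measurable_proc_fun n T (V : R -> Omega -> 'cV[R]_n) (F : 'cV[R]_n -> R) :
  vmeasurable F ->
  (forall i, measurable_fun setT (proc_on T (fun u w => V u w i ord0))) ->
  measurable_fun setT (proc_on T (fun u w => F (V u w))).
Proof.
move=> mF mV; pose W z : 'cV[R]_n := \col_i proc_on T (fun u w => V u w i ord0) z.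
have mW : coord_measurable W by move=> i; under eq_fun do rewrite mxE; exact: mV.
have mFW := mF _ _ _ mW.
have cw : closed_window T = \1_(`[0, T]%classic).
  by apply/funext => u; rewrite /closed_window indicE mem_setE in_itv.
have mcw : measurable_fun setT (fun z : Omega * measurableTypeR R => closed_window T z.2).
  have m1 : measurable_fun setT (closed_window T : measurableTypeR R -> R).
    by rewrite cw; exact: measurable_indic.
  exact: measurableT_comp m1 measurable_snd.
apply: (eq_measurable_fun _ _ (measurable_funM mFW mcw)) => z _.
rewrite /proc_on /= /closed_window; case: (boolP (0 <= z.2 <= T)) => h; last by rewrite !mulr0.
congr (F _ * _); apply/colP => i; rewrite mxE /proc_on /closed_window h mulr1//.
Qed.

Lemma measurable_proc_cst T (a : Omega -> R) : measurable_fun setT a ->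
  measurable_fun setT (proc_on T (fun=> a)).
Proof.
move=> ma; apply: measurable_proc_on; apply: measurable_funTS.
exact: measurableT_comp ma measurable_snd.
Qed.

Lemma measurable_procB T f f' : measurable_fun setT (proc_on T f) ->
  measurable_fun setT (proc_on T f') ->
  measurable_fun setT (proc_on T (fun u w => f u w - f' u w)).
Proof.
move=> mf mf'; rewrite (_ : proc_on _ _ = fun z => proc_on T f z - proc_on T f' z).
  exact: measurable_funB.
by apply/funext => z; rewrite /proc_on mulrBl.
Qed.

Lemma sub_window T s t f : 0 <= s -> t <= T -> Ltwo nu (proc_window 0 T f) ->
  Ltwo nu (proc_window s t f) /\
  Ex nu (fun z => proc_window s t f z ^+ 2) <= Ex nu (fun z => proc_window 0 T f z ^+ 2).
Proof.
move=> s0 tT Lf.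
have E z : proc_window s t f z = window s t z.2 * proc_window 0 T f z.
  rewrite /proc_window; case: (eqVneq (window s t z.2) 0) => [->|/window_neq0/andP[u1 u2]].
    by rewrite mulr0 mul0r.
  by rewrite /window u1 u2 (le_lt_trans s0 u1) (le_trans u2 tT) /= mul1r.
have mw : measurable_fun setT (fun z : Omega * measurableTypeR R => window s t z.2).
  exact: measurableT_comp (measurable_window s t) measurable_snd.
have wb (z : Omega * measurableTypeR R) : `|window s t z.2| <= 1 by rewrite ger0_norm ?window_ge0 ?window_le1.
have L : Ltwo nu (proc_window s t f).
  have -> : proc_window s t f = fun z => window s t z.2 * proc_window 0 T f z.
    exact/funext.
  exact: (Ltwo_bounded_mul mw wb Lf).
split=> //; apply: Ex_le => [||z]; [exact: L.2|exact: Lf.2|].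
by rewrite E exprMn window_sqr ler_piMl ?sqr_ge0 ?window_le1.
Qed.

Definition pint s t f w := Ex leb (fun u => proc_window s t f (w, u)).

Section Window.
Variables (T s t : R).
Hypotheses (s0 : 0 <= s) (st : s <= t) (tT : t <= T).

Lemma proc_window_idem f z : proc_window s t f z * window s t z.2 = proc_window s t f z.
Proof. by rewrite /proc_window -mulrA -expr2 window_sqr. Qed.

Lemma Ltwo_proc_window_Lone f : Ltwo nu (proc_window s t f) -> Lone nu (proc_window s t f).
Proof.
move=> L; have [Lw _] := Lone_rect (Lone_cst P 1) (Lone_window s t).
have L2 : Ltwo nu (fun z => window s t z.2).
  split; first exact: measurableT_comp (measurable_window _ _) measurable_snd.
  by under eq_fun do rewrite window_sqr -[window _ _ _]mul1r.
have := LtwoM L L2; by under eq_fun do rewrite proc_window_idem.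
Qed.

Lemma pint_Ltwo f : Ltwo nu (proc_window s t f) ->
  Ltwo P (pint s t f) /\
  Ex P (fun w => pint s t f w ^+ 2) <= (t - s) * Ex nu (fun z => proc_window s t f z ^+ 2).
Proof.
move=> L; have [L1 E1] := section_integral L (Ltwo_window s t) (Lone_window s t).
have Ew : Ex leb (fun u => window s t u ^+ 2) = t - s.
  by under eq_Ex do rewrite window_sqr; exact: Ex_window.
rewrite Ew in E1.
have E w : Ex leb (fun u => proc_window s t f (w, u) * window s t u) = pint s t f w.
  by apply: eq_Ex => u; exact: proc_window_idem.
by split; [move: L1; under eq_fun do rewrite E|move: E1; under eq_Ex do rewrite E].
Qed.

Lemma section_Lone f : Ltwo nu (proc_window s t f) ->
  {ae P, forall w, Lone leb (fun u => proc_window s t f (w, u))}.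
Proof. by move=> /Ltwo_proc_window_Lone/Ex_section[]. Qed.

Lemma pintB f f' : Ltwo nu (proc_window s t f) -> Ltwo nu (proc_window s t f') ->
  {ae P, forall w, pint s t (fun u w => f u w - f' u w) w = pint s t f w - pint s t f' w}.
Proof.
move=> /section_Lone L /section_Lone L'; apply: filterS2 L L' => w L L'.
by rewrite /pint -ExB//; apply: eq_Ex => u; rewrite /proc_window mulrBl.
Qed.

Lemma pint_cst (a : Omega -> R) w : pint s t (fun=> a) w = (t - s) * a w.
Proof. by rewrite /pint /proc_window (ExZ (a w) (Lone_window s t)) Ex_window// mulrC. Qed.

Lemma Ltwo_window_cst (a : Omega -> R) : Ltwo P a -> Ltwo nu (proc_window s t (fun=> a)) /\
  Ex nu (fun z => proc_window s t (fun=> a) z ^+ 2) = (t - s) * Ex P (fun w => a w ^+ 2).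
Proof.
move=> [ma La]; have [L E] := Lone_rect La (Lone_window s t); split; first split.
- apply: measurable_funM; first exact: measurableT_comp ma measurable_fst.
  exact: measurableT_comp (measurable_window _ _) measurable_snd.
- by under eq_fun do rewrite exprMn window_sqr.
under eq_Ex do rewrite exprMn window_sqr.
by rewrite E Ex_window// mulrC.
Qed.

(** The closed interval and the half-open window differ by the point s, of Lebesgue measure 0. *)
Lemma Rintegral_pint f w : measurable_fun setT (proc_on T f) ->
  \int[leb]_(u in `[s, t]) f u w = pint s t f w.
Proof.
move=> mf; have mw : measurable_fun setT (fun u : measurableTypeR R => proc_on T f (w, u)).
  exact: measurable_section1.
have E u : (fun u => f u w) \_ `[s, t] u = proc_on T f (w, u) * (s <= u <= t)%R%:R.
  case: (boolP (s <= u <= t)) => h.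
    rewrite mulr1 patchT; last by apply: mem_set; rewrite /= in_itv.
    case/andP: h => h1 h2.
    by rewrite /proc_on /closed_window (le_trans s0 h1) (le_trans h2 tT) mulr1.
  by rewrite mulr0 patchN//; apply/negP => /set_mem; rewrite /= in_itv/= (negbTE h).
rewrite Rintegral_mkcond -/(Ex leb _).
have Ei u : (s <= u <= t)%R%:R = \1_(`[s, t]%classic) u :> R.
  by rewrite indicE mem_setE in_itv.
rewrite (_ : Ex leb _ = Ex leb (fun u => proc_on T f (w, u) * \1_(`[s, t]%classic) u)); last first.
  by apply: eq_Ex => u; rewrite E Ei.
rewrite (_ : pint s t f w = Ex leb (fun u => proc_on T f (w, u) * window s t u)); last first.
  by apply: eq_Ex => u; rewrite (proc_window_on _ _ s0 tT).
apply: ae_eq_Ex.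
- by apply: measurable_funM => //; exact: measurable_indic.
- by apply: measurable_funM => //; exact: measurable_window.
exists [set s]; split; [exact: measurable_set1|exact: lebesgue_measure_set1|].
move=> u /= H; apply: contrapT => us; apply: H; congr (_ * _).
rewrite -Ei /window; congr (nat_of_bool _)%:R; congr (_ && _).
by rewrite le_eqVlt; case: eqP => // e; case: us.
Qed.

End Window.

Lemma pint_add a b c f w : a <= b -> b <= c ->
  Lone leb (fun u => proc_window a b f (w, u)) -> Lone leb (fun u => proc_window b c f (w, u)) ->
  pint a b f w + pint b c f w = pint a c f w.
Proof.
move=> ab bc L1 L2; rewrite /pint -ExD//; apply: eq_Ex => u.
by rewrite /proc_window -mulrDr window_add.
Qed.

Lemma sum_windows f T (n : nat) (h : R) : 0 <= h -> n%:R * h <= T ->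
  Ltwo nu (proc_window 0 T f) ->
  \sum_(k < n) Ex nu (fun z => proc_window (k%:R * h) (k.+1%:R * h) f z ^+ 2) <=
  Ex nu (fun z => proc_window 0 T f z ^+ 2).
Proof.
move=> h0 hT L; have c k : 0 <= k%:R * h :> R by rewrite mulr_ge0.
have kh j k : (j <= k)%N -> j%:R * h <= k%:R * h by move=> jk; rewrite ler_wpM2r// ler_nat.
have [L0 E0] := sub_window (lexx 0) hT L; apply: le_trans E0.
have Lk (k : 'I_n) : Lone nu (fun z => proc_window (k%:R * h) (k.+1%:R * h) f z ^+ 2).
  have kT : k.+1%:R * h <= T by apply: le_trans hT; apply: kh.
  by have [[]] := sub_window (c k) kT L.
rewrite -Ex_sum//; apply: Ex_le; [exact: Lone_sum|exact: L0.2|] => z.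
have E j k z' : proc_window j k f z' ^+ 2 = f z'.2 z'.1 ^+ 2 * window j k z'.2.
  by rewrite exprMn window_sqr.
under eq_bigr do rewrite E; rewrite E -mulr_sumr ler_wpM2l ?sqr_ge0//.
rewrite le_eqVlt; apply/orP; left; apply/eqP.
elim: n {hT L0 Lk} => [|n IH].
  by rewrite big_ord0 mul0r /window; case: (ltP 0 z.2) => //= z0; rewrite leNgt z0.
rewrite big_ord_recr/= IH window_add// ler_wpM2r// ler_nat//.
Qed.

(* Splitting [0, T] into intervals of length r with C r <= 1/2 absorbs the
   integral term on each of them. *)
Lemma gronwall_integral (C T : R) : 0 <= C -> 0 <= T -> exists2 K, 0 <= K &
  forall q n : R -> R, (forall u, 0 <= q u) -> (forall u, 0 <= n u) ->
  Lone leb (fun u => q u * window 0 T u) -> Lone leb (fun u => n u * window 0 T u) ->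
  (forall t, 0 < t -> t <= T -> q t <= n t + C * Ex leb (fun u => q u * window 0 t u)) ->
  Ex leb (fun u => q u * window 0 T u) <= K * Ex leb (fun u => n u * window 0 T u).
Proof.
move=> C0 T0.
have [m m0 mC] : exists2 m : nat, (0 < m)%N & 2 * C * T <= m%:R.
  have H : 0 <= 2 * C * T by rewrite !mulr_ge0.
  have := archi_boundP H; set m := Num.bound _ => /ltW mH.
  by exists m.+1 => //; apply: le_trans mH _; rewrite ler_nat.
set r := T / m%:R; have mp : 0 < m%:R :> R by rewrite ltr0n.
have r0 : 0 <= r by rewrite divr_ge0.
have Cr : 2 * C * r <= 1 by rewrite /r mulrA ler_pdivrMr// mul1r.
have mr : m%:R * r = T by rewrite /r mulrCA divff ?mulr1// gt_eqF.
(* On the next interval J <= N + (Ph + J) / 2, hence Ph + J <= 2 Ph + 2 N. *)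
exists (iter m (fun K => 2 * K + 2) 0).
  by elim: (m) => //= k IH; rewrite addr_ge0// mulr_ge0.
move=> q n q0 n0 Lq Ln H.
set N := Ex leb (fun u => n u * window 0 T u).
have N0 : 0 <= N by apply: Ex_ge0 => u; rewrite mulr_ge0// window_ge0.
have sub (f : R -> R) a b : 0 <= a -> b <= T -> Lone leb (fun u => f u * window 0 T u) ->
    Lone leb (fun u => f u * window a b u).
  move=> a0 bT L; have Ew u : f u * window a b u = window a b u * (f u * window 0 T u).
    case: (eqVneq (window a b u) 0) => [->|/window_neq0/andP[u1 u2]]; first by rewrite mulr0 mul0r.
    by rewrite /window u1 u2 (le_lt_trans a0 u1) (le_trans u2 bT)/= mulr1 mul1r.
  under eq_fun do rewrite Ew.
  apply: (Lone_bounded_mul (c := 1) (measurable_window a b) _ L) => u.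
  by rewrite ger0_norm ?window_ge0 ?window_le1.
suff key k : (k <= m)%N -> Ex leb (fun u => q u * window 0 (k%:R * r) u) <=
    iter k (fun K => 2 * K + 2) 0 * N by rewrite -mr; exact: key.
elim: k => [_|k IH km] /=.
  rewrite mul0r mul0r -[leRHS](Ex0 leb); apply: Ex_le; [exact: sub|exact: Lone0|].
  by move=> u; rewrite /window; case: (ltP 0 u) => /= u0; rewrite ?mulr0// leNgt u0 mulr0.
set a := k%:R * r; set b := k.+1%:R * r.
have ba : b = a + r by rewrite /b /a -natr1 mulrDl mul1r.
have a0 : 0 <= a by rewrite mulr_ge0.
have ab : a <= b by rewrite ba lerDl.
have bT : b <= T by rewrite -mr ler_wpM2r// ler_nat.
have Lqa := sub q 0 a (lexx 0) (le_trans ab bT) Lq.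
have Lqab := sub q a b a0 bT Lq; have Lqb := sub q 0 b (lexx 0) bT Lq.
have Lnab := sub n a b a0 bT Ln.
set J := Ex leb (fun u => q u * window a b u).
set Ph := Ex leb (fun u => q u * window 0 a u) in IH *.
have split : Ex leb (fun u => q u * window 0 b u) = Ph + J.
  rewrite /Ph /J -ExD//; apply: eq_Ex => u; rewrite -mulrDr window_add//.
have J0 : 0 <= J by apply: Ex_ge0 => u; rewrite mulr_ge0// window_ge0.
have Ph0 : 0 <= Ph by apply: Ex_ge0 => u; rewrite mulr_ge0// window_ge0.
have nJ : Ex leb (fun u => n u * window a b u) <= N.
  apply: Ex_le => // u; rewrite ler_wpM2l// /window.
  case: (boolP (a < u <= b)) => // /andP[u1 u2].
  by rewrite (le_lt_trans a0 u1) (le_trans u2 bT).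
have J1 : J <= N + C * (Ph + J) * r.
  have Lw := LoneZ (C * (Ph + J)) (Lone_window a b).
  apply: (@le_trans _ _ (Ex leb (fun u => n u * window a b u + C * (Ph + J) * window a b u))).
    apply: Ex_le => //; first exact: LoneD.
    move=> u; rewrite -mulrDl; case: (eqVneq (window a b u) 0) => [->|wu].
      by rewrite !mulr0.
    have /andP[u1 u2] := window_neq0 wu.
    rewrite ler_wpM2r ?window_ge0//; apply: le_trans (H u (le_lt_trans a0 u1) (le_trans u2 bT)) _.
    rewrite lerD2l ler_wpM2l// -split; apply: Ex_le => //.
      by apply: sub => //; exact: le_trans u2 bT.
    move=> v; rewrite ler_wpM2l// /window; case: (boolP (0 < v <= u)) => // /andP[v1 v2].
    by rewrite v1 (le_trans v2 u2).
  rewrite ExD// ExZ; last exact: Lone_window.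
  rewrite Ex_window// (_ : b - a = r); last by rewrite ba addrC addKr.
  by rewrite lerD2r.
have PJ : C * (Ph + J) * r <= (Ph + J) / 2.
  have := ler_wpM2r (addr_ge0 Ph0 J0) Cr; lra.
have := IH (ltnW km); rewrite split; lra.
Qed.

End PathIntegral.

(** * Forward equation *)

Section RiemannSum.
Context {R : realType} {dd : measure_display} {Omega : measurableType dd}.
Context (P : probability Omega R) (d : nat) (B : R -> Omega -> 'cV[R]_d).
Hypotheses (cP : measure_is_complete P) (BM : standard_brownian_motion P B).
Local Notation leb := (@lebesgue_measure R).
Local Notation nu := (P \x leb)%E.
Local Notation adapted := (adapted P B).
Variables (T : R) (j : 'I_d) (H M : R -> Omega -> R).
Hypothesis T0 : 0 <= T.
Hypothesis ito : is_ito_integral P (augmented_filtration P B) T (fun t w => B t w j ord0) H M.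
Variables s t : R.
Hypotheses (s0 : 0 <= s) (st : s <= t) (tT : t <= T).

Lemma ito_riemann a : adapted s a -> (exists C : R, forall w, `|a w| <= C) ->
  Ltwo P (fun w => a w * incB B s t w j ord0) /\
  Ex P (fun w => (M t w - M s w - a w * incB B s t w j ord0) ^+ 2) <=
  Ex nu (fun z => proc_window s t (fun u w => H u w - a w) z ^+ 2).
Proof.
move=> aa ab; have [C aC] := ab.
have ma := adapted_measurable cP BM aa.
have La : Ltwo P a by apply: (@Ltwo_bounded _ _ _ P C).
have Lai := inc_Ltwo cP BM s0 st j aa La.
split=> //.
have LM := ito_increment_Ltwo cP BM ito s0 st tT.
have LH := ito_window_Ltwo cP BM T0 ito s0 tT.
have [Law Eaw] := Ltwo_window_cst st La.
rewrite Ex_sqrB//.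
have -> : Ex nu (fun z => proc_window s t (fun u w => H u w - a w) z ^+ 2) =
    Ex nu (fun z => (proc_window s t H z - proc_window s t (fun=> a) z) ^+ 2).
  by apply: eq_Ex => z; rewrite /proc_window mulrBl.
rewrite [leRHS]Ex_sqrB// Eaw.
have := ito_cov cP BM T0 ito s0 st tT j aa ab.
have [_] := inc_cov cP BM s0 st j j (adapted_sqr aa) La.2.
rewrite eqxx mul1r => E1 E2.
have -> : Ex P (fun w => (a w * incB B s t w j ord0) ^+ 2) = (t - s) * Ex P (fun w => a w ^+ 2).
  by rewrite -E1; apply: eq_Ex => w; ring.
have -> : Ex P (fun w => (M t w - M s w) * (a w * incB B s t w j ord0)) =
    Ex nu (fun z => proc_window s t H z * proc_window s t (fun=> a) z).
  under eq_Ex do rewrite mulrC; rewrite E2; apply: eq_Ex => z.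
  by rewrite mul1r mulrC.
by rewrite lerD2r lerD2r; exact: (ito_sqr cP BM T0 ito s0 st tT).
Qed.

End RiemannSum.

Section ForwardEquation.
Context {R : realType} {dd : measure_display} {Omega : measurableType dd}.
Context (P : probability Omega R) (d : nat) (B : R -> Omega -> 'cV[R]_d).
Hypotheses (cP : measure_is_complete P) (BM : standard_brownian_motion P B).
Local Notation leb := (@lebesgue_measure R).
Local Notation nu := (P \x leb)%E.
Local Notation adapted := (adapted P B).
Local Notation F := (augmented_filtration P B).
Variables (T S Ls Lb : R) (sig : 'cV[R]_d -> 'M[R]_d) (b : 'cV[R]_d -> 'cV[R]_d).
Variables (x : 'cV[R]_d) (X : R -> Omega -> 'cV[R]_d) (M : 'I_d -> 'I_d -> R -> Omega -> R).
Hypotheses (T0 : 0 <= T) (Ls0 : 0 <= Ls) (Lb0 : 0 <= Lb) (S0 : 0 <= S).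
Hypothesis bL : forall x x', hsnorm (b x - b x') <= Lb * hsnorm (x - x').
Hypothesis sL : forall x x', hsnorm (sig x - sig x') <= Ls * hsnorm (x - x').
Hypothesis sS : forall x i j, `|sig x i j| <= S.
Hypothesis aX : forall i, measurable_adapted F T (fun t w => X t w i ord0).
Hypothesis cX : {ae P, forall w, {within `[0, T], continuous (X ^~ w)}}.
Hypothesis ito : forall i j, is_ito_integral P F T (fun t w => B t w j ord0)
  (fun t w => sig (X t w) i j) (M i j).
Hypothesis eqX : {ae P, forall w, forall (t : R) i, 0 <= t <= T ->
  X t w i ord0 = x i ord0 + \sum_(j < d) M i j t w
    + \int[leb]_(s in `[0, t]) b (X s w) i ord0}.

Let bX i u w := b (X u w) i ord0.

Lemma vmeasurable_drift i : vmeasurable (fun v => b v i ord0).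
Proof.
apply/continuous_vmeasurable/(lipschitz_continuous (c := Lb)) => v v'.
apply: le_trans (bL v v'); have := hs_entry_le (b v - b v') i ord0.
by rewrite !mxE.
Qed.

Lemma vmeasurable_diffusion i j : vmeasurable (fun v => sig v i j).
Proof.
apply/continuous_vmeasurable/(lipschitz_continuous (c := Ls)) => v v'.
apply: le_trans (sL v v'); have := hs_entry_le (sig v - sig v') i j.
by rewrite !mxE.
Qed.

Lemma adapted_forward t i : 0 <= t <= T -> adapted t (fun w => X t w i ord0).
Proof. by move=> tT; apply/adapted_rv; case: (aX i) => _; exact. Qed.

Lemma measurable_forward i : measurable_fun setT (proc_on T (fun u w => X u w i ord0)).
Proof. by apply: measurable_proc_on; case: (aX i). Qed.

Lemma measurable_forward_drift i : measurable_fun setT (proc_on T (bX i)).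
Proof. by apply: (measurable_proc_fun (vmeasurable_drift i)); exact: measurable_forward. Qed.

Let b0 := hsnorm (b 0).
Let b00 : 0 <= b0. Proof. exact: hsnorm_ge0. Qed.

Lemma drift_growth v : hsnorm (b v) ^+ 2 <= 2 * b0 ^+ 2 + 2 * Lb ^+ 2 * hsnorm v ^+ 2.
Proof.
have h : hsnorm (b v) <= b0 + Lb * hsnorm v.
  have := ler_hsnormD (b v - b 0) (b 0); rewrite subrK => h1; apply: (le_trans h1).
  by rewrite addrC lerD2l; have := bL v 0; rewrite subr0.
have g0 : 0 <= b0 + Lb * hsnorm v by rewrite addr_ge0// mulr_ge0// hsnorm_ge0.
have : hsnorm (b v) ^+ 2 <= (b0 + Lb * hsnorm v) ^+ 2 by rewrite lerXn2r ?nnegrE// hsnorm_ge0.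
have := sqr_ge0 (b0 - Lb * hsnorm v); lra.
Qed.

Let q u w := hsnorm (X u w) ^+ 2.

Let measurable_q : measurable_fun setT (proc_on T q).
Proof.
rewrite /q (_ : proc_on T _ = fun z => \sum_i proc_on T (fun u w => X u w i ord0) z ^+ 2).
  by apply: measurable_sum => i; apply: measurable_funX; exact: measurable_forward.
apply/funext => z; rewrite /proc_on hsnorm_sqrv mulr_suml; apply: eq_bigr => i _.
by rewrite exprMn /closed_window; case: (_ <= _ <= _); rewrite ?expr1n// expr0n.
Qed.

Let nsq u w := 2 * (\sum_i (x i ord0 + \sum_(j < d) M i j u w) ^+ 2) + 4 * T ^+ 2 * b0 ^+ 2.

Let Lmart i j : Ltwo nu (proc_window 0 T (M i j)).
Proof.
have jm : measurable_fun setT (proc_on T (M i j)).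
  by apply: measurable_proc_on; case: (ito i j) => _ [].
have h0 : 0 <= (0 : R) <= T by rewrite lexx.
have LM0 := ito_Ltwo cP BM (ito i j) h0.
set c := 2 * Ex nu (fun z => proc_window 0 T (fun t w => sig (X t w) i j) z ^+ 2)
  + 2 * Ex P (fun w => M i j 0 w ^+ 2).
have c0 : 0 <= c by rewrite addr_ge0// mulr_ge0// Ex_sqr_ge0.
have [] := @section_bound _ _ _ _ _ P leb (fun z => proc_on T (M i j) z ^+ 2) (window 0 T) c.
- exact: measurable_funX.
- by move=> z; exact: sqr_ge0.
- exact: Lone_window.
- by move=> u; exact: window_ge0.
- exact: c0.
- move=> u /window_neq0/andP[u0 uT].
  have hu : 0 <= u <= T by rewrite uT ltW.
  have -> : (fun w => proc_on T (M i j) (w, u) ^+ 2) = fun w => M i j u w ^+ 2.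
    by apply/funext => w; rewrite /proc_on /closed_window hu mulr1.
  have LMu := ito_Ltwo cP BM (ito i j) hu; split; first exact: LMu.2.
  have LB := ito_increment_Ltwo cP BM (ito i j) (lexx 0) (ltW u0) uT.
  have := Ex_sqrD_le LB LM0.
  under eq_Ex do rewrite subrK; move=> h; apply: (le_trans h).
  rewrite lerD2r ler_wpM2l//; apply: le_trans (ito_sqr cP BM T0 (ito i j) (lexx 0) (ltW u0) uT) _.
  have [Lw _] := Ltwo_proc_window (lexx 0) (lexx T) (ito_integrand_Ltwo cP BM T0 (ito i j)).
  by have [] := sub_window (lexx 0) uT Lw.
move=> L _; have m : measurable_fun setT (proc_window 0 T (M i j)).
  exact: measurable_proc_window jm.
split=> //; move: L; congr (Lone nu _); apply/funext => z.
by rewrite (proc_window_on _ _ (lexx 0) (lexx T)) [in RHS]exprMn window_sqr.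
Qed.

Let Lnoise i : Ltwo nu (proc_window 0 T (fun u w => x i ord0 + \sum_(j < d) M i j u w)).
Proof.
have [L1 _] := Ltwo_window_cst T0 (Ltwo_cst P (x i ord0)).
have L2 : Ltwo nu (fun z => \sum_(j < d) proc_window 0 T (M i j) z).
  by apply: Ltwo_sum => j _; exact: Lmart.
have := LtwoD L1 L2; congr (Ltwo nu _); apply/funext => z.
by rewrite /proc_window mulrDl mulr_suml.
Qed.

Let Lnsq : Lone nu (fun z => nsq z.2 z.1 * window 0 T z.2).
Proof.
have L1 : Lone nu (fun z => \sum_(i < d)
    proc_window 0 T (fun u w => x i ord0 + \sum_(j < d) M i j u w) z ^+ 2).
  by apply: Lone_sum => i _; have [] := Lnoise i.
have [L2 _] := Lone_rect (Lone_cst P (4 * T ^+ 2 * b0 ^+ 2)) (Lone_window 0 T).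
have := LoneD (LoneZ 2 L1) L2; congr (Lone nu _); apply/funext => z.
rewrite /nsq [RHS]mulrDl -[in RHS]mulrA mulr_suml; congr (_ * _ + _); apply: eq_bigr => i _.
by rewrite exprMn window_sqr.
Qed.

Lemma continuous_hsnorm_sqr : continuous (fun v : 'cV[R]_d => hsnorm v ^+ 2).
Proof.
have c1 : continuous (@hsnorm R d 1).
  apply: (lipschitz_continuous (c := 1)) => v v'; rewrite mul1r ler_norml.
  have := ler_hsnormD (v - v') v'; have := ler_hsnormD (v' - v) v.
  by rewrite !subrK hsnorm_distC; lra.
by move=> v; apply: continuousM; exact: c1.
Qed.

(** Continuity makes the time integral finite path by path, before any moment of X is known. *)
Let Lone_path w : {within `[0, T], continuous (X ^~ w)} ->
  Lone leb (fun u => q u w * window 0 T u).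
Proof.
move=> cw.
have cq : {within `[0, T], continuous (fun u => q u w)}.
  move=> u; apply: (@continuous_comp (subspace `[0, T]) _ _ (X ^~ w) (fun v => hsnorm v ^+ 2)).
    exact: cw.
  exact: continuous_hsnorm_sqr.
have L := continuous_compact_integrable (@segment_compact _ 0 T) cq.
have L2 : leb.-integrable `]0, T] (EFin \o (fun u => q u w)).
  apply: integrableS L => //.
  by move=> u; rewrite /= !in_itv/= => /andP[/ltW -> ->].
move: L2; rewrite integrable_mkcond//.
congr (integrable _ _ _); apply/funext => u.
rewrite /= /window; case: (boolP (0 < u <= T)) => h.
  by rewrite mulr1 patchT//; apply: mem_set; rewrite /= in_itv.
by rewrite mulr0 patchN//; apply/negP => /set_mem; rewrite /= in_itv/= (negbTE h).
Qed.

Let path_bound w : {within `[0, T], continuous (X ^~ w)} ->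
  (forall (t : R) i, 0 <= t <= T -> X t w i ord0 = x i ord0 + \sum_(j < d) M i j t w
    + \int[leb]_(s in `[0, t]) b (X s w) i ord0) ->
  forall t, 0 < t -> t <= T ->
  q t w <= nsq t w + 4 * T * Lb ^+ 2 * Ex leb (fun u => q u w * window 0 t u).
Proof.
move=> cw ew t t0 tT.
have Lq0 := Lone_path cw.
have mq : measurable_fun setT (fun u : measurableTypeR R => q u w * window 0 t u).
  have m1 := measurable_proc_window (lexx 0) tT measurable_q.
  exact: (measurable_section1 w m1).
have Lq : Lone leb (fun u => q u w * window 0 t u).
  apply: (Lone_le mq _ Lq0) => u; rewrite ger0_norm; last by rewrite mulr_ge0 ?sqr_ge0 ?window_ge0.
  rewrite ler_wpM2l ?sqr_ge0// /window; case: (boolP (0 < u <= t)) => // /andP[u1 u2].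
  by rewrite u1 (le_trans u2 tT).
have Lb2 : Lone leb (fun u => hsnorm (b (X u w)) ^+ 2 * window 0 t u).
  have Lg := LoneD (LoneZ (2 * b0 ^+ 2) (Lone_window 0 t)) (LoneZ (2 * Lb ^+ 2) Lq).
  apply: (Lone_le _ _ Lg) => [|u].
    rewrite (_ : (fun u => _) = fun u => \sum_i proc_window 0 t (bX i) (w, u) ^+ 2); last first.
      apply/funext => u; rewrite hsnorm_sqrv mulr_suml; apply: eq_bigr => i _.
      by rewrite exprMn window_sqr.
    apply: measurable_sum => i; apply: measurable_funX.
    apply: measurable_section1.
    exact: (measurable_proc_window (lexx 0) tT (measurable_forward_drift i)).
  rewrite ger0_norm; last by rewrite mulr_ge0 ?sqr_ge0 ?window_ge0.
  by have := ler_wpM2r (window_ge0 0 t u) (drift_growth (X u w)); rewrite -/(q u w); lra.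
have Lbi i : Ltwo leb (fun u => proc_window 0 t (bX i) (w, u)).
  have m : measurable_fun setT (fun u : measurableTypeR R => proc_window 0 t (bX i) (w, u)).
    apply: measurable_section1.
    exact: (measurable_proc_window (lexx 0) tT (measurable_forward_drift i)).
  split=> //; apply: (Lone_le _ _ Lb2); first exact: measurable_funX.
  move=> u; rewrite ger0_norm ?sqr_ge0// exprMn window_sqr ler_wpM2r ?window_ge0//.
  rewrite -[leLHS]real_normK ?num_real// lerXn2r ?nnegrE ?hsnorm_ge0//.
  exact: hs_entry_le.
have pb i : pint 0 t (bX i) w ^+ 2 <= t * Ex leb (fun u => proc_window 0 t (bX i) (w, u) ^+ 2).
  have := Ex_CS (Lbi i) (Ltwo_window 0 t).
  under eq_Ex do rewrite proc_window_idem.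
  under [X in _ <= _ * X -> _]eq_Ex do rewrite window_sqr.
  by rewrite (Ex_window (ltW t0)) subr0 mulrC.
have Es : \sum_i Ex leb (fun u => proc_window 0 t (bX i) (w, u) ^+ 2) =
    Ex leb (fun u => hsnorm (b (X u w)) ^+ 2 * window 0 t u).
  rewrite -Ex_sum; last by move=> i _; case: (Lbi i).
  apply: eq_Ex => u; rewrite hsnorm_sqrv mulr_suml; apply: eq_bigr => i _.
  by rewrite exprMn window_sqr.
have Eb : Ex leb (fun u => hsnorm (b (X u w)) ^+ 2 * window 0 t u) <=
    2 * b0 ^+ 2 * t + 2 * Lb ^+ 2 * Ex leb (fun u => q u w * window 0 t u).
  rewrite -[X in _ * X + _](subr0 t) -(Ex_window (ltW t0)) -(ExZ _ (Lone_window 0 t)) -(ExZ _ Lq).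
  rewrite -ExD; [|exact/LoneZ/Lone_window|exact: LoneZ].
  apply: Ex_le => //; first by apply: LoneD; [exact/LoneZ/Lone_window|exact: LoneZ].
  by move=> u; have := ler_wpM2r (window_ge0 0 t u) (drift_growth (X u w)); rewrite -/(q u w); lra.
have ht : 0 <= t <= T by rewrite tT ltW.
have q1 : q t w <= 2 * (\sum_i (x i ord0 + \sum_(j < d) M i j t w) ^+ 2) +
    2 * \sum_i pint 0 t (bX i) w ^+ 2.
  rewrite /q hsnorm_sqrv !mulr_sumr -big_split/=; apply: ler_sum => i _.
  rewrite (ew t i ht) (Rintegral_pint (lexx 0) tT w (measurable_forward_drift i)).
  move: (x i ord0 + _) (pint _ _ _ _) => y1 y2.
  by have := sqr_ge0 (y1 - y2); lra.
have q2 : \sum_i pint 0 t (bX i) w ^+ 2 <= t * Ex leb (fun u => hsnorm (b (X u w)) ^+ 2 * window 0 t u).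
  by rewrite -Es mulr_sumr; apply: ler_sum.
apply: (le_trans q1); rewrite /nsq -addrA lerD2l.
set E := Ex leb (fun u => q u w * window 0 t u) in Eb *.
have E0 : 0 <= E by apply: Ex_ge0 => u; rewrite mulr_ge0 ?sqr_ge0 ?window_ge0.
have := ler_wpM2l (ltW t0) Eb.
set bnd := 2 * b0 ^+ 2 * t + 2 * Lb ^+ 2 * E => h3.
have bnd0 : 0 <= bnd by rewrite addr_ge0// !mulr_ge0// ?sqr_ge0// ltW.
have h4 := ler_wpM2r bnd0 tT.
have : 2 * b0 ^+ 2 * t <= 2 * b0 ^+ 2 * T by rewrite ler_wpM2l// mulr_ge0// sqr_ge0.
move=> /(ler_wpM2l T0); move: q2 h3 h4; rewrite /bnd.
move: (\sum_i _) (Ex leb _) => y1 y2; lra.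
Qed.

(** Moments of X are not part of the definition of a solution. Gronwall is therefore applied on each
    path, where all integrals are finite, and expectations are taken afterwards. *)
Lemma forward_sqr_Lone : Lone nu (proc_window 0 T (fun u w => hsnorm (X u w) ^+ 2)).
Proof.
have C0 : 0 <= 4 * T * Lb ^+ 2 by rewrite !mulr_ge0// sqr_ge0.
have [K K0 HK] := gronwall_integral C0 T0.
have [aeN [LN _]] := Ex_section Lnsq.
have mqw : measurable_fun setT (fun z => proc_window 0 T q z).
  exact: (measurable_proc_window (lexx 0) (lexx T) measurable_q).
have qw0 z : 0 <= proc_window 0 T q z by rewrite mulr_ge0 ?sqr_ge0 ?window_ge0.
have mE : measurable_fun setT (EFin \o proc_window 0 T q) by exact/measurable_EFinP.
have E0 z : (0 <= (EFin \o proc_window 0 T q) z)%E by rewrite lee_fin.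
apply: Lone_ge0P => //; rewrite (fubini_tonelli1 _ mE E0).
have LKN := LoneZ K LN.
apply: (@le_lt_trans _ _ (\int[P]_w (K * Ex leb (fun u => nsq u w * window 0 T u))%:E)%E).
  apply: ae_ge0_le_integral => //.
  - by move=> w _; apply: integral_ge0.
  - exact: (measurable_fun_fubini_tonelli_F _ mE E0).
  - move=> w _; rewrite lee_fin mulr_ge0//; apply: Ex_ge0 => u.
    rewrite mulr_ge0 ?window_ge0// addr_ge0// mulr_ge0 ?sqr_ge0//.
      by apply: sumr_ge0 => j _; exact: sqr_ge0.
    by rewrite mulr_ge0// sqr_ge0.
  - exact/measurable_EFinP/(Lone_meas LKN).
  apply: filterS3 cX eqX aeN => w cw ew Lw _.
  rewrite /fubini_F -EFin_Ex; last exact: Lone_path.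
  rewrite lee_fin; apply: HK => //.
  - by move=> u; exact: sqr_ge0.
  - move=> u; rewrite /nsq addr_ge0// mulr_ge0 ?sqr_ge0//.
      by apply: sumr_ge0 => j _; exact: sqr_ge0.
    by rewrite mulr_ge0// sqr_ge0.
  - exact: Lone_path.
  - exact: path_bound.
by rewrite -EFin_Ex// ltry.
Qed.

Lemma forward_drift_Ltwo i : Ltwo nu (proc_window 0 T (bX i)).
Proof.
have m : measurable_fun setT (proc_window 0 T (bX i)).
  exact: (measurable_proc_window (lexx 0) (lexx T) (measurable_forward_drift i)).
have [Lw _] := Lone_rect (Lone_cst P (2 * b0 ^+ 2)) (Lone_window 0 T).
have Lg := LoneD Lw (LoneZ (2 * Lb ^+ 2) forward_sqr_Lone).
split=> //; apply: (Lone_le _ _ Lg); first exact: measurable_funX.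
move=> z; rewrite ger0_norm ?sqr_ge0// exprMn window_sqr.
rewrite [leRHS](_ : _ = (2 * b0 ^+ 2 + 2 * Lb ^+ 2 * hsnorm (X z.2 z.1) ^+ 2) * window 0 T z.2);
  last by rewrite /proc_window; ring.
rewrite ler_wpM2r ?window_ge0//; apply: le_trans (drift_growth _).
rewrite -[leLHS]real_normK ?num_real// lerXn2r ?nnegrE ?hsnorm_ge0//.
exact: hs_entry_le.
Qed.

Lemma forward_increment s t i : 0 <= s -> s <= t -> t <= T ->
  {ae P, forall w, X t w i ord0 - X s w i ord0 =
    \sum_(j < d) (M i j t w - M i j s w) + pint s t (bX i) w}.
Proof.
move=> s0 st tT; have LB := forward_drift_Ltwo i.
have sT := le_trans st tT; have t0 := le_trans s0 st.
have [L1 _] := sub_window (lexx 0) sT LB; have [L2 _] := sub_window s0 tT LB.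
apply: filterS3 eqX (section_Lone L1) (section_Lone L2) => w ew l1 l2.
rewrite !ew ?s0 ?t0 ?sT ?tT// !(Rintegral_pint (lexx 0) _ w (measurable_forward_drift i))//.
by rewrite -(pint_add s0 st l1 l2) sumrB; ring.
Qed.

Lemma forward_rv_Ltwo t i : 0 <= t <= T -> Ltwo P (fun w => X t w i ord0).
Proof.
move=> /andP[t0 tT]; have LB := forward_drift_Ltwo i.
have [L1 _] := sub_window (lexx 0) tT LB; have [L2 _] := pint_Ltwo t0 L1.
have m : measurable_fun setT (fun w => X t w i ord0).
  by apply: (adapted_measurable cP BM (t := t)); apply: adapted_forward; rewrite t0.
apply: (ae_eq_Ltwo (f := fun w => x i ord0 + \sum_(j < d) M i j t w + pint 0 t (bX i) w)) => //.
  apply: filterS eqX => w ew; rewrite ew ?t0//.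
  by rewrite (Rintegral_pint (lexx 0) _ w (measurable_forward_drift i)).
apply: LtwoD => //; apply: LtwoD; first exact: Ltwo_cst.
by apply: Ltwo_sum => j _; apply: (ito_Ltwo cP BM (ito i j)); rewrite t0.
Qed.

(** The diffusion contributes d^2 S^2 per unit of time, the drift its total energy on [0, T]. *)
Definition forward_const : R := 2 * (d%:R * (d%:R * S ^+ 2)) +
  2 * \sum_(i < d) Ex nu (fun z => proc_window 0 T (bX i) z ^+ 2).

Lemma forward_const_ge0 : 0 <= forward_const.
Proof.
rewrite addr_ge0// mulr_ge0// ?mulr_ge0// ?sqr_ge0//.
by apply: sumr_ge0 => i _; exact: Ex_sqr_ge0.
Qed.

Lemma forward_increment_sqr s t i : 0 <= s -> s <= t -> t <= T ->
  Ex P (fun w => (X t w i ord0 - X s w i ord0) ^+ 2) <= forward_const * (t - s).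
Proof.
move=> s0 st tT; have sT := le_trans st tT; have t0 := le_trans s0 st.
have ts : 0 <= t - s by rewrite subr_ge0.
have [L2 E2] := sub_window s0 tT (forward_drift_Ltwo i); have [Lp Ep] := pint_Ltwo st L2.
have LM j : Ltwo P (fun w => M i j t w - M i j s w).
  exact: (ito_increment_Ltwo cP BM (ito i j) s0 st tT).
have LS : Ltwo P (fun w => \sum_(j < d) (M i j t w - M i j s w)) by apply: Ltwo_sum.
have mX r : 0 <= r <= T -> measurable_fun setT (fun w => X r w i ord0).
  by move=> rT; apply: (adapted_measurable cP BM (t := r)); exact: adapted_forward.
have -> : Ex P (fun w => (X t w i ord0 - X s w i ord0) ^+ 2) =
    Ex P (fun w => (\sum_(j < d) (M i j t w - M i j s w) + pint s t (bX i) w) ^+ 2).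
  apply: ae_eq_Ex.
  - by apply: measurable_funX; apply: measurable_funB; apply: mX; rewrite ?s0 ?t0.
  - by apply: measurable_funX; have [] := LtwoD LS Lp.
  by apply: filterS (forward_increment i s0 st tT) => w ->.
apply: le_trans (Ex_sqrD_le LS Lp) _.
have E1 : Ex P (fun w => (\sum_(j < d) (M i j t w - M i j s w)) ^+ 2) <=
    d%:R * (d%:R * S ^+ 2) * (t - s).
  apply: le_trans (Ex_sqr_sum_le LM) _; rewrite card_ord -mulrA ler_wpM2l//.
  rewrite (_ : d%:R * S ^+ 2 * (t - s) = \sum_(j < d) (S ^+ 2 * (t - s))); last first.
    by rewrite sumr_const card_ord -[RHS]mulr_natl mulrA.
  apply: ler_sum => j _; apply: le_trans (ito_sqr cP BM T0 (ito i j) s0 st tT) _.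
  rewrite -(Ex_window st) -(ExZ _ (Lone_window s t)).
  have [Lr Er] := Lone_rect (Lone_cst P (S ^+ 2)) (Lone_window s t).
  rewrite [leRHS](_ : _ = Ex nu (fun z => S ^+ 2 * window s t z.2)); last first.
    by rewrite Er Ex_cst (ExZ _ (Lone_window s t)).
  have [Ls' _] := Ltwo_proc_window s0 tT (ito_integrand_Ltwo cP BM T0 (ito i j)).
  apply: Ex_le => //; first exact: Ls'.2.
  move=> z; rewrite exprMn window_sqr ler_wpM2r ?window_ge0//.
  by rewrite -[leLHS]real_normK ?num_real// lerXn2r ?nnegrE.
have E3 : Ex nu (fun z => proc_window 0 T (bX i) z ^+ 2) <=
    \sum_(i < d) Ex nu (fun z => proc_window 0 T (bX i) z ^+ 2).
  rewrite (bigD1 i)//= lerDl; apply: sumr_ge0 => k _; exact: Ex_sqr_ge0.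
have := ler_wpM2l ts (le_trans E2 E3); rewrite /forward_const.
move: Ep E1; move: (Ex P _) (Ex P _) (Ex nu _) (\sum_(i < d) _) => y1 y2 y3 y4; lra.
Qed.

Lemma forward_window_increment s t i : 0 <= s -> s <= t -> t <= T ->
  Ltwo nu (proc_window s t (fun u w => X u w i ord0 - X s w i ord0)) /\
  Ex nu (fun z => proc_window s t (fun u w => X u w i ord0 - X s w i ord0) z ^+ 2) <=
    forward_const * (t - s) * (t - s).
Proof.
move=> s0 st tT; have sT := le_trans st tT.
have hs : 0 <= s <= T by rewrite s0.
have ms : measurable_fun setT (fun w => X s w i ord0).
  by apply: (adapted_measurable cP BM (t := s)); exact: adapted_forward.
have m := measurable_procB (measurable_forward i) (measurable_proc_cst T ms).
have c0 : 0 <= forward_const * (t - s) by rewrite mulr_ge0 ?forward_const_ge0// subr_ge0.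
have [||||||L E] := @section_bound _ _ _ _ _ P leb
  (fun z => proc_on T (fun u w => X u w i ord0 - X s w i ord0) z ^+ 2) (window s t)
  (forward_const * (t - s)).
- exact: measurable_funX.
- by move=> z; exact: sqr_ge0.
- exact: Lone_window.
- by move=> u; exact: window_ge0.
- exact: c0.
- move=> u /window_neq0/andP[su ut]; have uT := le_trans ut tT.
  have hu : 0 <= u <= T by rewrite uT (le_trans s0)// ltW.
  have -> : (fun w => proc_on T (fun u w => X u w i ord0 - X s w i ord0) (w, u) ^+ 2) =
      fun w => (X u w i ord0 - X s w i ord0) ^+ 2.
    by apply/funext => w; rewrite /proc_on /closed_window hu mulr1.
  split; first by have [] := LtwoB (forward_rv_Ltwo i hu) (forward_rv_Ltwo i hs).
  apply: le_trans (forward_increment_sqr i s0 (ltW su) uT) _.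
  by rewrite ler_wpM2l ?forward_const_ge0// lerD2r.
have Ez z : proc_on T (fun u w => X u w i ord0 - X s w i ord0) z ^+ 2 * window s t z.2 =
    proc_window s t (fun u w => X u w i ord0 - X s w i ord0) z ^+ 2.
  by rewrite (proc_window_on _ _ s0 tT) [in RHS]exprMn window_sqr.
rewrite Ex_window// in E; split.
  split; first exact: (measurable_proc_window s0 tT m).
  by move: L; under eq_fun do rewrite Ez.
by move: E; under eq_Ex do rewrite Ez.
Qed.

(** [f] is matrix valued, so that the same estimate covers sigma and, with one column, b. *)
Lemma lipschitz_window p m (f : 'cV[R]_d -> 'M[R]_(p, m)) c s t (xi : Omega -> 'cV[R]_d) :
  0 <= s -> t <= T -> (forall v v', hsnorm (f v - f v') <= c * hsnorm (v - v')) -> 0 <= c ->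
  (forall k l, vmeasurable (fun v => f v k l)) ->
  (forall i, measurable_fun setT (fun w => xi w i ord0)) ->
  (forall i, Ltwo nu (proc_window s t (fun u w => X u w i ord0 - xi w i ord0))) ->
  (forall k l, Ltwo nu (proc_window s t (fun u w => f (X u w) k l - f (xi w) k l))) /\
  \sum_k \sum_l Ex nu (fun z => proc_window s t (fun u w => f (X u w) k l - f (xi w) k l) z ^+ 2)
  <= c ^+ 2 * \sum_i Ex nu (fun z => proc_window s t (fun u w => X u w i ord0 - xi w i ord0) z ^+ 2).
Proof.
move=> s0 tT fL c0 mf mxi LX.
pose D z := \sum_i proc_window s t (fun u w => X u w i ord0 - xi w i ord0) z ^+ 2.
have LD : Lone nu D by apply: Lone_sum => i _; have [] := LX i.
have bnd z : \sum_k \sum_l proc_window s t (fun u w => f (X u w) k l - f (xi w) k l) z ^+ 2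
    <= c ^+ 2 * D z.
  have -> : \sum_k \sum_l proc_window s t (fun u w => f (X u w) k l - f (xi w) k l) z ^+ 2 =
      hsnorm (f (X z.2 z.1) - f (xi z.1)) ^+ 2 * window s t z.2.
    rewrite hsnorm_sqr mulr_suml; apply: eq_bigr => k _; rewrite mulr_suml.
    by apply: eq_bigr => l _; rewrite exprMn window_sqr !mxE.
  have -> : D z = hsnorm (X z.2 z.1 - xi z.1) ^+ 2 * window s t z.2.
    rewrite /D hsnorm_sqrv mulr_suml; apply: eq_bigr => k _.
    by rewrite exprMn window_sqr !mxE.
  rewrite mulrA ler_wpM2r ?window_ge0// -exprMn lerXn2r ?nnegrE ?hsnorm_ge0//.
  by rewrite mulr_ge0// hsnorm_ge0.
have L k l : Ltwo nu (proc_window s t (fun u w => f (X u w) k l - f (xi w) k l)).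
  have m1 : measurable_fun setT (proc_window s t (fun u w => f (X u w) k l - f (xi w) k l)).
    apply: (measurable_proc_window s0 tT); apply: measurable_procB.
      by apply: (measurable_proc_fun (mf k l)); exact: measurable_forward.
    by apply: measurable_proc_cst; apply: mf.
  split=> //; apply: (Lone_le _ _ (LoneZ (c ^+ 2) LD)); first exact: measurable_funX.
  move=> z; rewrite ger0_norm ?sqr_ge0//; apply: le_trans (bnd z).
  rewrite (bigD1 k)//= (bigD1 l)//= -addrA lerDl addr_ge0//.
    by apply: sumr_ge0 => l' _; exact: sqr_ge0.
  by apply: sumr_ge0 => k' _; apply: sumr_ge0 => l' _; exact: sqr_ge0.
split=> //.
rewrite -Ex_sum; last by move=> i _; have [] := LX i.
rewrite -(ExZ _ LD).
under eq_bigr => k _ do (rewrite -Ex_sum; last by move=> l _; have [] := L k l).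
have LS k : Lone nu (fun z => \sum_l proc_window s t (fun u w => f (X u w) k l - f (xi w) k l) z ^+ 2).
  by apply: Lone_sum => l _; have [] := L k l.
rewrite -Ex_sum//; apply: Ex_le => //; [exact: Lone_sum|exact: LoneZ].
Qed.

Definition step_const := 2 * d%:R * Ls ^+ 2 + 2 * Lb ^+ 2.

Lemma step_const_ge0 : 0 <= step_const.
Proof. by rewrite addr_ge0// mulr_ge0 ?sqr_ge0// mulr_ge0. Qed.

Section EulerStep.
Variables (s t : R) (xi : Omega -> 'cV[R]_d).
Hypotheses (s0 : 0 <= s) (st : s < t) (tT : t <= T) (h1 : t - s <= 1).
Hypothesis axi : forall i, adapted s (fun w => xi w i ord0).
Hypothesis Lxi : forall i, Ltwo P (fun w => xi w i ord0).

Let h := t - s.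
Let h0 : 0 < h. Proof. by rewrite subr_gt0. Qed.
Let sT : s <= T. Proof. exact: le_trans (ltW st) tT. Qed.
Let hs : 0 <= s <= T. Proof. by rewrite s0. Qed.
Let ht : 0 <= t <= T. Proof. by rewrite tT (le_trans s0)// ltW. Qed.
Let st' := ltW st.
Let mxi i : measurable_fun setT (fun w => xi w i ord0).
Proof. exact: (adapted_measurable cP BM (@axi i)). Qed.

Let asig i j : adapted s (fun w => sig (xi w) i j).
Proof. exact: (adapted_vcomp (vmeasurable_diffusion i j) axi). Qed.

Let ab i : adapted s (fun w => b (xi w) i ord0).
Proof. exact: (adapted_vcomp (vmeasurable_drift i) axi). Qed.

Let Lbxi i : Ltwo P (fun w => b (xi w) i ord0).
Proof.
have m := adapted_measurable cP BM (@ab i).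
have Lx : Lone P (fun w => hsnorm (xi w) ^+ 2).
  by under eq_fun do rewrite hsnorm_sqrv; apply: Lone_sum => k _; have [] := Lxi k.
have Lg := LoneD (Lone_cst P (2 * b0 ^+ 2)) (LoneZ (2 * Lb ^+ 2) Lx).
split=> //; apply: (Lone_le _ _ Lg); first exact: measurable_funX.
move=> w; rewrite ger0_norm ?sqr_ge0//; apply: le_trans (drift_growth _).
rewrite -[leLHS]real_normK ?num_real// lerXn2r ?nnegrE ?hsnorm_ge0//.
exact: hs_entry_le.
Qed.

Let sb i j : exists C : R, forall w, `|sig (xi w) i j| <= C.
Proof. by exists S => w. Qed.

Let xi' w := euler h b sig (xi w) (incB B s t w).

Let xi'E w i : xi' w i ord0 = xi w i ord0 + h * b (xi w) i ord0 +
  \sum_(j < d) sig (xi w) i j * incB B s t w j ord0.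
Proof. by rewrite /xi' /euler !mxE. Qed.

Lemma euler_adapted i : adapted t (fun w => xi' w i ord0).
Proof.
under eq_fun do rewrite xi'E.
apply: adapted_add; last first.
  apply: adapted_sum => j; apply: adapted_mul; first exact: (adapted_le st' (@asig i j)).
  by apply: adapted_incB => //; exact: le_trans st'.
apply: adapted_add; first exact: (adapted_le st' (@axi i)).
by apply: adapted_mul; [exact: adapted_cst|exact: (adapted_le st' (@ab i))].
Qed.

Let Lsi i j : Ltwo P (fun w => sig (xi w) i j * incB B s t w j ord0).
Proof. by have [] := ito_riemann cP BM T0 (ito i j) s0 st' tT (@asig i j) (sb i j). Qed.

Lemma euler_Ltwo i : Ltwo P (fun w => xi' w i ord0).
Proof.
under eq_fun do rewrite xi'E.
apply: LtwoD; last by apply: Ltwo_sum => j _; exact: Lsi.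
by apply: LtwoD => //; exact: LtwoZ.
Qed.

(** The martingale part m of the defect is orthogonal to the error e at time s ([Eem]), so only the
    drift part be meets the factor 1 + 1 / h of Young's inequality. *)
Lemma euler_error :
  \sum_i Ex P (fun w => (X t w i ord0 - xi' w i ord0) ^+ 2) <=
  (1 + (1 + 2 * step_const) * h) * \sum_i Ex P (fun w => (X s w i ord0 - xi w i ord0) ^+ 2)
  + 2 * step_const * d%:R * forward_const * h ^+ 2.
Proof.
pose e i w := X s w i ord0 - xi w i ord0.
have Le i : Ltwo P (e i) by apply: LtwoB => //; exact: forward_rv_Ltwo.
have ae_ i : adapted s (e i).
  by apply: adapted_sub; [exact: adapted_forward|exact: (@axi i)].
have Lw i : Ltwo nu (proc_window s t (fun u w => X u w i ord0 - xi w i ord0)) /\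
  Ex nu (fun z => proc_window s t (fun u w => X u w i ord0 - xi w i ord0) z ^+ 2) <=
   2 * (forward_const * h * h) + 2 * (h * Ex P (fun w => e i w ^+ 2)).
  have [L1 E1] := forward_window_increment i s0 st' tT.
  have [L2 E2] := Ltwo_window_cst st' (Le i).
  have Ez z : proc_window s t (fun u w => X u w i ord0 - xi w i ord0) z =
     proc_window s t (fun u w => X u w i ord0 - X s w i ord0) z + proc_window s t (fun=> e i) z.
    by rewrite /proc_window /e; ring.
  split; first by have := LtwoD L1 L2; congr (Ltwo nu _); apply/funext => z; rewrite Ez.
  under eq_Ex do rewrite Ez.
  by apply: le_trans (Ex_sqrD_le L1 L2) _; rewrite E2 lerD2r ler_wpM2l.
have Lw1 i := proj1 (Lw i).
set Dw := \sum_i Ex nu (fun z => proc_window s t (fun u w => X u w i ord0 - xi w i ord0) z ^+ 2).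
set A := \sum_i Ex P (fun w => (X s w i ord0 - xi w i ord0) ^+ 2).
have A0 : 0 <= A by apply: sumr_ge0 => i _; exact: Ex_sqr_ge0.
have DA : Dw <= 2 * d%:R * forward_const * h ^+ 2 + 2 * h * A.
  apply: (@le_trans _ _ (\sum_(i < d) (2 * (forward_const * h * h) +
     2 * (h * Ex P (fun w => e i w ^+ 2))))).
    by apply: ler_sum => i _; case: (Lw i).
  rewrite big_split/= sumr_const card_ord -!mulr_sumr -/A -[_ *+ d]mulr_natl.
  by rewrite le_eqVlt; apply/orP; left; apply/eqP; ring.
have [Lsw Esw] := lipschitz_window s0 tT sL Ls0 vmeasurable_diffusion mxi Lw1.
have vdr k (l : 'I_1) : vmeasurable (fun v => b v k l).
  by rewrite (ord1 l); exact: vmeasurable_drift.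
have [Lbw Ebw] := lipschitz_window s0 tT bL Lb0 vdr mxi Lw1.
pose m i w := \sum_(j < d) (M i j t w - M i j s w - sig (xi w) i j * incB B s t w j ord0).
pose be i := pint s t (fun u w => b (X u w) i ord0 - b (xi w) i ord0).
have LM i j : Ltwo P (fun w => M i j t w - M i j s w).
  exact: (ito_increment_Ltwo cP BM (ito i j) s0 st' tT).
have Lmj i j : Ltwo P (fun w => M i j t w - M i j s w - sig (xi w) i j * incB B s t w j ord0).
  by apply: LtwoB.
have Lm i : Ltwo P (m i) by apply: Ltwo_sum.
have [Lbe Ebe] : (forall i, Ltwo P (be i)) /\ (forall i, Ex P (fun w => be i w ^+ 2) <=
    h * Ex nu (fun z => proc_window s t (fun u w => b (X u w) i ord0 - b (xi w) i ord0) z ^+ 2)).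
  by split=> i; have [] := pint_Ltwo st' (Lbw i ord0).
have Em i : Ex P (fun w => m i w ^+ 2) <= d%:R * \sum_j Ex nu (fun z =>
    proc_window s t (fun u w => sig (X u w) i j - sig (xi w) i j) z ^+ 2).
  apply: le_trans (Ex_sqr_sum_le (Lmj i)) _; rewrite card_ord ler_wpM2l//.
  apply: ler_sum => j _.
  by have [] := ito_riemann cP BM T0 (ito i j) s0 st' tT (@asig i j) (sb i j).
have Eem i : Ex P (fun w => e i w * m i w) = 0.
  under eq_Ex do rewrite mulr_sumr.
  rewrite Ex_sum; last by move=> j _; exact: (LtwoM (Le i) (Lmj i j)).
  apply: big1 => j _; under eq_Ex do rewrite mulrBr mulrA.
  have Les : Lone P (fun w => e i w * sig (xi w) i j).
    by apply: LtwoM => //; apply: (@Ltwo_bounded _ _ _ P S) => //; exact: (adapted_measurable cP BM (@asig i j)).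
  have [Li Ei] := inc_mean cP BM s0 st' j (adapted_mul (ae_ i) (@asig i j)) Les.
  rewrite ExB//; last exact: (LtwoM (Le i) (LM i j)).
  by rewrite Ei (ito_mean cP BM (ito i j) s0 st' tT (ae_ i) (Le i)) subrr.
have key i : Ex P (fun w => (X t w i ord0 - xi' w i ord0) ^+ 2) <=
    (1 + h) * (Ex P (fun w => e i w ^+ 2) + Ex P (fun w => m i w ^+ 2)) +
    (1 + h^-1) * Ex P (fun w => be i w ^+ 2).
  have Lem := LtwoD (Le i) (Lm i); have Lall := LtwoD Lem (Lbe i).
  have -> : Ex P (fun w => (X t w i ord0 - xi' w i ord0) ^+ 2) =
      Ex P (fun w => (e i w + m i w + be i w) ^+ 2).
    have [Lb1 _] := sub_window s0 tT (forward_drift_Ltwo i).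
    have [Lb2 _] := Ltwo_window_cst st' (Lbxi i).
    apply: ae_eq_Ex.
    - apply: measurable_funX; apply: measurable_funB.
        by apply: (adapted_measurable cP BM (t := t)); exact: adapted_forward.
      exact: (adapted_measurable cP BM (@euler_adapted i)).
    - by apply: measurable_funX; case: Lall.
    apply: filterS2 (forward_increment i s0 st' tT) (pintB Lb1 Lb2) => w e1 e2.
    rewrite /be e2 xi'E /m sumrB (pint_cst st') -/h.
    congr (_ ^+ 2); rewrite /e; move: e1.
    move: (\sum_(j < d) (M i j t w - _)) (\sum_(j < d) (_ * _)) (pint _ _ _ _) (b _ _ _) => y1 y2 y3 y4.
    by move: (X t w i ord0) (X s w i ord0) (xi w i ord0) => y5 y6 y7; lra.
  apply: le_trans (Ex_sqr_perturb h0 Lall Lem) _.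
  rewrite (Ex_sqrD (Le i) (Lm i)) Eem mulr0 addr0 lerD2l.
  rewrite [X in _ * X <= _](_ : _ = Ex P (fun w => be i w ^+ 2))//.
  by apply: eq_Ex => w; congr (_ ^+ 2); ring.
apply: le_trans (ler_sum _ (fun i _ => key i)) _.
rewrite big_split/= -!mulr_sumr big_split/=.
have -> : \sum_i Ex P (fun w => e i w ^+ 2) = A by [].
have S1 : \sum_i Ex P (fun w => m i w ^+ 2) <= d%:R * (Ls ^+ 2 * Dw).
  apply: le_trans (ler_sum _ (fun i _ => Em i)) _; rewrite -mulr_sumr ler_wpM2l//.
have S2 : \sum_i Ex P (fun w => be i w ^+ 2) <= h * (Lb ^+ 2 * Dw).
  apply: le_trans (ler_sum _ (fun i _ => Ebe i)) _; rewrite -mulr_sumr ler_wpM2l ?(ltW h0)//.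
  apply: le_trans Ebw; apply: ler_sum => i _; rewrite big_ord1//.
have hh : h <= 1 := h1.
have t1 : 0 <= 1 + h^-1 by rewrite addr_ge0// invr_ge0 ltW.
have D0 : 0 <= Dw by apply: sumr_ge0 => i _; exact: Ex_sqr_ge0.
have U1 : (1 + h) * \sum_i Ex P (fun w => m i w ^+ 2) <= 2 * (d%:R * (Ls ^+ 2 * Dw)).
  have hp : 0 <= 1 + h by rewrite addr_ge0// ltW.
  have m0 : 0 <= \sum_i Ex P (fun w => m i w ^+ 2).
    by apply: sumr_ge0 => i _; exact: Ex_sqr_ge0.
  by apply: (ler_pM hp m0 _ S1); move: hh; lra.
have U2 : (1 + h^-1) * \sum_i Ex P (fun w => be i w ^+ 2) <= 2 * (Lb ^+ 2 * Dw).
  have e2 : (1 + h^-1) * h <= 2 by rewrite mulrDl mulVf ?gt_eqF// mul1r; lra.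
  have LD0 : 0 <= Lb ^+ 2 * Dw by rewrite mulr_ge0 ?sqr_ge0.
  apply: le_trans (ler_wpM2l t1 S2) _; rewrite [leLHS]mulrA; exact: ler_wpM2r LD0 _ _ e2.
have U3 := ler_wpM2l step_const_ge0 DA.
move: U1 U2 U3; rewrite /step_const; move: (\sum_i _) (\sum_i _) => y1 y2; lra.
Qed.

End EulerStep.

End ForwardEquation.

(** * Backward equation *)

Section ConditionalStep.
Context {R : realType} {dd : measure_display} {Omega : measurableType dd}.
Context (P : probability Omega R) (d : nat).
Variables (b : 'cV[R]_d -> 'cV[R]_d) (sig : 'cV[R]_d -> 'M[R]_d).
Hypothesis mb : forall i, vmeasurable (fun v => b v i ord0).
Hypothesis ms : forall i j, vmeasurable (fun v => sig v i j).
Variables (h : R) (z : Omega -> 'cV[R]_d).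
Hypothesis mz : coord_measurable z.

(** The two arguments live in arbitrary measurable spaces: the statement serves both for the full
    sigma-algebra and for the pair formed by past and increment. *)
Lemma measurable_euler_pair d1 d2 (T1 : measurableType d1) (T2 : measurableType d2)
  (xi : T1 -> 'cV[R]_d) (y : T2 -> 'cV[R]_d) (V : 'cV[R]_d -> R) :
  coord_measurable xi -> coord_measurable y -> vmeasurable V ->
  measurable_fun setT (fun p : T1 * T2 => V (euler h b sig (xi p.1) (y p.2))).
Proof.
move=> mxi my mV; apply: mV => i.
under eq_fun do rewrite /euler !mxE.
apply: measurable_funD; first apply: measurable_funD.
- exact: measurableT_comp (mxi i) measurable_fst.
- apply: measurable_funM => //; exact: measurableT_comp (@mb i _ _ _ mxi) measurable_fst.
apply: measurable_sum => j; apply: measurable_funM.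
  exact: measurableT_comp (@ms i j _ _ _ mxi) measurable_fst.
exact: measurableT_comp (my j) measurable_snd.
Qed.

Lemma vmeasurable_Ex_euler C (V psi : 'cV[R]_d -> R) : vmeasurable V -> vmeasurable psi ->
  (forall v, `|V v| <= C) -> (forall v, `|psi v| <= C) ->
  vmeasurable (fun x => Ex P (fun w => V (euler h b sig x (z w)) * psi (z w))).
Proof.
move=> mV mpsi VC pC d1 T1 xi mxi.
have C0 : 0 <= C by apply: le_trans (VC 0).
(* Adding C^2 makes the integrand nonnegative, so that Tonelli yields measurability of the partial
   integral. *)
pose f (p : T1 * Omega) := V (euler h b sig (xi p.1) (z p.2)) * psi (z p.2) + C ^+ 2.
have mVp : measurable_fun setT (fun p : T1 * Omega =>
    V (euler h b sig (xi p.1) (z p.2)) * psi (z p.2)).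
  apply: measurable_funM; first exact: (measurable_euler_pair mxi mz mV).
  exact: measurableT_comp (mpsi _ _ _ mz) measurable_snd.
have mf : measurable_fun setT f by apply: measurable_funD.
have Vpn x w : `|V (euler h b sig x (z w)) * psi (z w)| <= C ^+ 2.
  by rewrite normrM expr2 ler_pM.
have f0 p : (0 <= (EFin \o f) p)%E.
  by rewrite lee_fin -lerBlDr sub0r; have := Vpn (xi p.1) p.2; rewrite ler_norml => /andP[].
have mE : measurable_fun setT (EFin \o f) by exact/measurable_EFinP.
have m1 := measurable_fun_fubini_tonelli_F (m2 := P) _ mE f0.
have m2 : measurable_fun setT (fun u => fine (fubini_F P (EFin \o f) u) - C ^+ 2).
  by apply: measurable_funB => //; exact: measurableT_comp m1.
apply: (eq_measurable_fun _ _ m2) => u _.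
have L : Lone P (fun w => V (euler h b sig (xi u) (z w)) * psi (z w)).
  apply: (@Lone_bounded _ _ _ P (C ^+ 2)); last exact: Vpn.
  have := measurable_section1 u mVp; apply.
rewrite -[fine _]/(Ex P (fun w => f (u, w))) /f /= (ExD L (Lone_cst P _)) Ex_cst.
by rewrite addrK.
Qed.

End ConditionalStep.

Section AdaptedFreeze.
Context {R : realType} {dd : measure_display} {Omega : measurableType dd}.
Context (P : probability Omega R) (d : nat) (B : R -> Omega -> 'cV[R]_d).
Hypotheses (cP : measure_is_complete P) (BM : standard_brownian_motion P B).
Local Notation adapted := (adapted P B).
Variables (b : 'cV[R]_d -> 'cV[R]_d) (sig : 'cV[R]_d -> 'M[R]_d).
Hypothesis mb : forall i, vmeasurable (fun v => b v i ord0).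
Hypothesis ms : forall i j, vmeasurable (fun v => sig v i j).
Variables (s t h C : R) (xi : Omega -> 'cV[R]_d) (V psi : 'cV[R]_d -> R) (a : Omega -> R).
Hypotheses (s0 : 0 <= s) (st : s < t).
Hypothesis axi : forall i, adapted s (fun w => xi w i ord0).
Hypotheses (mV : vmeasurable V) (mpsi : vmeasurable psi).
Hypotheses (VC : forall v, `|V v| <= C) (pC : forall v, `|psi v| <= C).
Hypotheses (aa : adapted s a) (La : Ltwo P a).

Local Notation z := (incB B s t).

Lemma adapted_Ex_euler :
  adapted s (fun w => Ex P (fun w' => V (euler h b sig (xi w) (z w')) * psi (z w'))).
Proof.
have [mz _] := gaussian_inc BM s0 st.
exact: (adapted_vcomp (vmeasurable_Ex_euler P mb ms h mz mV mpsi VC pC) axi).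
Qed.

(** Conditional expectation of one Euler step given F_s, in tested form: a ranges over
    square-integrable past variables. *)
Lemma Ex_euler_freeze :
  Ex P (fun w => a w * (V (euler h b sig (xi w) (z w)) * psi (z w))) =
  Ex P (fun w => a w * Ex P (fun w' => V (euler h b sig (xi w) (z w')) * psi (z w'))).
Proof.
have [mz _] := gaussian_inc BM s0 st.
have mxi : coord_measurable xi by move=> i; exact: (adapted_measurable cP BM (@axi i)).
have Vpn x w : `|V (euler h b sig x (z w)) * psi (z w)| <= C ^+ 2.
  by rewrite normrM expr2 ler_pM.
have mVp : measurable_fun setT (fun p : Omega * Omega =>
    V (euler h b sig (xi p.1) (z p.2)) * psi (z p.2)).
  apply: measurable_funM; first exact: (measurable_euler_pair mb ms h mxi mz mV).
  exact: measurableT_comp (@mpsi _ _ _ mz) measurable_snd.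
pose Psi (p : Omega * Omega) := a p.1 * (V (euler h b sig (xi p.1) (z p.2)) * psi (z p.2)).
rewrite (adapted_inc_freeze cP BM s0 st Psi).
- apply: eq_Ex => w; rewrite /Psi /= ExZ//.
  by apply: (@Lone_bounded _ _ _ P (C ^+ 2)) => //; exact: (measurable_section1 w mVp).
- apply: measurable_funM; first exact: measurableT_comp aa measurable_fst.
  apply: measurable_funM.
    have cxi : coord_measurable (xi : g_sigma_algebraType (filtration_gen P B s) -> 'cV[R]_d).
      by move=> i; exact: (@axi i).
    exact: (measurable_euler_pair mb ms h cxi (@inc_coord_measurable _ _ _ _ B s t) mV).
  exact: measurableT_comp (@mpsi _ _ _ (@inc_coord_measurable _ _ _ _ B s t)) measurable_snd.
apply: LtwoM => //; apply: (@Ltwo_bounded _ _ _ P (C ^+ 2)) => //.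
apply: measurable_funM; last exact: mpsi.
apply: mV => i; under eq_fun do rewrite /euler !mxE.
apply: measurable_funD; first by apply: measurable_funD => //; apply: measurable_funM => //; exact: mb.
by apply: measurable_sum => j; apply: measurable_funM; [exact: ms|exact: mz].
Qed.

End AdaptedFreeze.

Section BackwardEquation.
Context {R : realType} {dd : measure_display} {Omega : measurableType dd}.
Context (P : probability Omega R) (d : nat) (B : R -> Omega -> 'cV[R]_d).
Hypotheses (cP : measure_is_complete P) (BM : standard_brownian_motion P B).
Local Notation leb := (@lebesgue_measure R).
Local Notation nu := (P \x leb)%E.
Local Notation adapted := (adapted P B).
Local Notation F := (augmented_filtration P B).
Variables (T k l : R) (g : R -> 'cV[R]_d -> R) (phi : 'cV[R]_d -> R).
Variables (X : R -> Omega -> 'cV[R]_d) (Y : R -> Omega -> R) (Z : R -> Omega -> 'cV[R]_d).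
Variable N : 'I_d -> R -> Omega -> R.
Hypotheses (T0 : 0 <= T) (k0 : 0 <= k) (l0 : 0 <= l).
Hypothesis gL : forall a a' u u',
  `|g a u - g a' u'| <= k * `|a - a'| + l * hsnorm (u - u').
Hypothesis aY : measurable_adapted F T Y.
Hypothesis aZ : forall i, measurable_adapted F T (fun t w => Z t w i ord0).
Hypothesis LY : Ltwo nu (proc_window 0 T Y).
Hypothesis ito : forall j, is_ito_integral P F T (fun t w => B t w j ord0)
  (fun t w => Z t w j ord0) (N j).
Hypothesis eqY : {ae P, forall w, forall t : R, 0 <= t <= T ->
  Y t w = phi (X T w) + \int[leb]_(s in `[t, T]) g (Y s w) (Z s w)
    - \sum_(j < d) (N j T w - N j t w)}.
Hypothesis Lphi : Ltwo P (fun w => phi (X T w)).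

Let G u w := g (Y u w) (Z u w).

Lemma generator_sqr a u : g a u ^+ 2 <= 3 * (g 0 0 ^+ 2 + k ^+ 2 * a ^+ 2 + l ^+ 2 * hsnorm u ^+ 2).
Proof.
have h : `|g a u| <= `|g 0 0| + k * `|a| + l * hsnorm u.
  have := gL a 0 u 0; rewrite !subr0 => h1.
  have := ler_normD (g a u - g 0 0) (g 0 0); rewrite subrK; lra.
have n0 : 0 <= hsnorm u := hsnorm_ge0 u.
have g0 : 0 <= `|g 0 0| + k * `|a| + l * hsnorm u by rewrite !addr_ge0// mulr_ge0.
have : g a u ^+ 2 <= (`|g 0 0| + k * `|a| + l * hsnorm u) ^+ 2.
  by rewrite -[leLHS]real_normK ?num_real// lerXn2r ?nnegrE.
rewrite -[g 0 0 ^+ 2]real_normK ?num_real// -[a ^+ 2]real_normK ?num_real//.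
move: (`|g 0 0|) (`|a|) (hsnorm u) => x1 x2 x3.
have := sqr_ge0 (x1 - k * x2); have := sqr_ge0 (x1 - l * x3); have := sqr_ge0 (k * x2 - l * x3).
lra.
Qed.

(** Stack y and v into one vector of dimension 1 + d, on which g is Lipschitz, hence continuous and
    Borel. *)
Lemma measurable_generator d1 (T1 : measurableType d1) (y : T1 -> R) (v : T1 -> 'cV[R]_d) :
  measurable_fun setT y -> coord_measurable v -> measurable_fun setT (fun w => g (y w) (v w)).
Proof.
move=> my mv; pose f (u : 'cV[R]_(1 + d)) := g (usubmx u ord0 ord0) (dsubmx u).
have hs (u : 'cV[R]_(1 + d)) :
    `|usubmx u ord0 ord0| <= hsnorm u /\ hsnorm (dsubmx u) <= hsnorm u.
  split; first by rewrite mxE; exact: hs_entry_le.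
  rewrite -[leLHS]ger0_norm ?hsnorm_ge0// -[leRHS]ger0_norm ?hsnorm_ge0//.
  rewrite -ler_sqr ?nnegrE// !real_normK ?num_real// !hsnorm_sqrv.
  rewrite [leRHS]big_split_ord/=; under eq_bigr do rewrite mxE.
  by rewrite lerDr; apply: sumr_ge0 => i _; exact: sqr_ge0.
have fL u u' : `|f u - f u'| <= (k + l) * hsnorm (u - u').
  apply: le_trans (gL _ _ _ _) _; rewrite mulrDl lerD//.
    rewrite ler_wpM2l//; have [+ _] := hs (u - u'); congr (`|_| <= _).
    by rewrite !mxE.
  rewrite ler_wpM2l//; have [_] := hs (u - u'); congr (hsnorm _ <= _).
  by apply/colP => i; rewrite !mxE.
have mf := continuous_vmeasurable (lipschitz_continuous fL).
pose W w : 'cV[R]_(1 + d) := col_mx ((y w)%:M) (v w).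
have mW : coord_measurable W.
  move=> i; case: (split_ordP i) => j ->.
    under eq_fun do rewrite /W col_mxEu mxE (ord1 j) eqxx mulr1n.
    exact: my.
  under eq_fun do rewrite /W col_mxEd.
  exact: mv.
apply: (eq_measurable_fun _ _ (mf _ _ _ mW)) => w _.
by rewrite /f /W col_mxKu col_mxKd mxE eqxx mulr1n.
Qed.

Lemma adapted_generator t y (v : Omega -> 'cV[R]_d) : adapted t y ->
  (forall i, adapted t (fun w => v w i ord0)) -> adapted t (fun w => g (y w) (v w)).
Proof. by move=> ay av; exact: measurable_generator. Qed.

Lemma measurable_on_generator : measurable_fun setT (proc_on T G).
Proof.
have mY : measurable_fun setT (proc_on T Y) by apply: measurable_proc_on; case: aY.
have mZ i : measurable_fun setT (proc_on T (fun u w => Z u w i ord0)).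
  by apply: measurable_proc_on; case: (aZ i).
pose W z : 'cV[R]_d := \col_i proc_on T (fun u w => Z u w i ord0) z.
have mW : coord_measurable W by move=> i; under eq_fun do rewrite mxE; exact: mZ.
have mG := measurable_generator mY mW.
have m1 : measurable_fun setT (proc_on T (fun=> (fun=> 1 : R)) : Omega * measurableTypeR R -> R).
  exact: measurable_proc_cst.
apply: (eq_measurable_fun _ _ (measurable_funM mG m1)) => z _.
rewrite /proc_on /= mul1r /closed_window; case: (boolP (0 <= z.2 <= T)) => h; last by rewrite !mulr0.
rewrite !mulr1; congr (g _ _); apply/colP => i.
by rewrite mxE /proc_on /closed_window h mulr1.
Qed.

Lemma backward_Z_Ltwo i : Ltwo nu (proc_window 0 T (fun u w => Z u w i ord0)).
Proof.
by have [] := Ltwo_proc_window (lexx 0) (lexx T) (ito_integrand_Ltwo cP BM T0 (ito i)).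
Qed.

Lemma backward_generator_Ltwo : Ltwo nu (proc_window 0 T G).
Proof.
have m : measurable_fun setT (proc_window 0 T G).
  exact: (measurable_proc_window (lexx 0) (lexx T) measurable_on_generator).
have [L0 _] := Lone_rect (Lone_cst P (3 * g 0 0 ^+ 2)) (Lone_window 0 T).
have L1 := LoneZ (3 * k ^+ 2) LY.2.
have L2 : Lone nu (fun z => 3 * l ^+ 2 * \sum_(i < d) proc_window 0 T (fun u w => Z u w i ord0) z ^+ 2).
  by apply: LoneZ; apply: Lone_sum => i _; have [] := backward_Z_Ltwo i.
have Lg := LoneD (LoneD L0 L1) L2.
split=> //; apply: (Lone_le _ _ Lg); first exact: measurable_funX.
move=> z; rewrite ger0_norm ?sqr_ge0//.
rewrite [leRHS](_ : _ = 3 * (g 0 0 ^+ 2 + k ^+ 2 * Y z.2 z.1 ^+ 2 + l ^+ 2 * hsnorm (Z z.2 z.1) ^+ 2)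
    * window 0 T z.2); last first.
  have -> : \sum_(i < d) proc_window 0 T (fun u w => Z u w i ord0) z ^+ 2 =
      hsnorm (Z z.2 z.1) ^+ 2 * window 0 T z.2.
    by rewrite hsnorm_sqrv mulr_suml; apply: eq_bigr => i _; rewrite exprMn window_sqr.
  by rewrite [proc_window 0 T Y z ^+ 2]exprMn window_sqr; ring.
rewrite /proc_window exprMn window_sqr ler_wpM2r ?window_ge0//.
exact: generator_sqr.
Qed.

Lemma adapted_backward t : 0 <= t <= T -> adapted t (Y t).
Proof. by move=> tT; apply/adapted_rv; case: aY => _; exact. Qed.

Lemma backward_increment s t : 0 <= s -> s <= t -> t <= T ->
  {ae P, forall w, Y t w - Y s w = \sum_(j < d) (N j t w - N j s w) - pint s t G w}.
Proof.
move=> s0 st tT; have LG := backward_generator_Ltwo.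
have sT := le_trans st tT; have t0 := le_trans s0 st.
have [L1 _] := sub_window s0 tT LG; have [L2 _] := sub_window t0 (lexx T) LG.
apply: filterS3 eqY (section_Lone L1) (section_Lone L2) => w ew l1 l2.
rewrite !ew ?s0 ?t0 ?sT ?tT// !(Rintegral_pint _ (lexx T) w measurable_on_generator)//.
rewrite -(pint_add st tT l1 l2).
have -> : \sum_(j < d) (N j t w - N j s w) =
    \sum_(j < d) (N j T w - N j s w) - \sum_(j < d) (N j T w - N j t w).
  by rewrite -sumrB; apply: eq_bigr => j _; ring.
by ring.
Qed.

Lemma backward_rv_Ltwo t : 0 <= t <= T -> Ltwo P (Y t).
Proof.
move=> tT; have /andP[t0 tT'] := tT; have TT : 0 <= T <= T by rewrite T0 lexx.
have [L1 _] := sub_window t0 (lexx T) backward_generator_Ltwo; have [L2 _] := pint_Ltwo tT' L1.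
have m : measurable_fun setT (Y t).
  by apply: (adapted_measurable cP BM (t := t)); exact: adapted_backward.
apply: (ae_eq_Ltwo (f := fun w => phi (X T w) + pint t T G w - \sum_(j < d) (N j T w - N j t w))) => //.
  apply: filterS eqY => w ew; rewrite ew//.
  by rewrite (Rintegral_pint t0 (lexx T) w measurable_on_generator).
apply: LtwoB; first exact: LtwoD.
apply: Ltwo_sum => j _; apply: LtwoB; exact: (ito_Ltwo cP BM (ito j)).
Qed.

Let sqG s t := Ex nu (fun z => proc_window s t G z ^+ 2).
Let sqZ s t := \sum_(j < d) Ex nu (fun z => proc_window s t (fun u w => Z u w j ord0) z ^+ 2).

Lemma backward_martingale_sqr s t : 0 <= s -> s <= t -> t <= T ->
  Ltwo P (fun w => \sum_(j < d) (N j t w - N j s w)) /\ Ex P (fun w => (\sum_(j < d) (N j t w - N j s w)) ^+ 2) <= d%:R * sqZ s t.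
Proof.
move=> s0 st tT.
have LN j : Ltwo P (fun w => N j t w - N j s w).
  exact: (ito_increment_Ltwo cP BM (ito j) s0 st tT).
split; first by apply: Ltwo_sum.
apply: le_trans (Ex_sqr_sum_le LN) _; rewrite card_ord ler_wpM2l//.
by apply: ler_sum => j _; exact: (ito_sqr cP BM T0 (ito j) s0 st tT).
Qed.

(** The oscillation of Y is measured by the energies of Z and of the driver on the cell, quantities
    that are summable over the grid. *)
Lemma backward_increment_sqr s u t : 0 <= s -> s <= u -> u <= t -> t <= T ->
  Ex P (fun w => (Y u w - Y s w) ^+ 2) <= 2 * (d%:R * sqZ s t) + 2 * ((t - s) * sqG s t).
Proof.
move=> s0 su ut tT; have uT := le_trans ut tT; have u0 := le_trans s0 su.
have sT := le_trans su uT; have st := le_trans su ut.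
have [LM EM] := backward_martingale_sqr s0 su uT.
have [LG _] := sub_window s0 uT backward_generator_Ltwo; have [Lp Ep] := pint_Ltwo su LG.
have mon f : Ltwo nu (proc_window 0 T f) ->
    Ex nu (fun z => proc_window s u f z ^+ 2) <= Ex nu (fun z => proc_window s t f z ^+ 2).
  move=> Lf; have [L1 _] := sub_window s0 uT Lf; have [L2 _] := sub_window s0 tT Lf.
  apply: Ex_le => [||z]; [exact: L1.2|exact: L2.2|].
  rewrite !exprMn !window_sqr ler_wpM2l ?sqr_ge0// /window.
  by case: (boolP (s < z.2 <= u)) => [/andP[-> h]|_]; rewrite ?(le_trans h ut).
have -> : Ex P (fun w => (Y u w - Y s w) ^+ 2) =
    Ex P (fun w => (\sum_(j < d) (N j u w - N j s w) + - pint s u G w) ^+ 2).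
  apply: ae_eq_Ex.
  - apply: measurable_funX; apply: measurable_funB.
      by case: (@backward_rv_Ltwo u _); rewrite ?u0.
    by case: (@backward_rv_Ltwo s _); rewrite ?s0.
  - by apply: measurable_funX; have [] := LtwoD LM (LtwoN Lp).
  by apply: filterS (backward_increment s0 su uT) => w ->.
apply: le_trans (Ex_sqrD_le LM (LtwoN Lp)) _.
have -> : Ex P (fun w => (- pint s u G w) ^+ 2) = Ex P (fun w => pint s u G w ^+ 2).
  by apply: eq_Ex => w; rewrite sqrrN.
apply: lerD; rewrite ler_wpM2l//.
  apply: le_trans EM _; rewrite ler_wpM2l//; apply: ler_sum => j _.
  exact/mon/backward_Z_Ltwo.
apply: le_trans Ep _; rewrite ler_pM ?subr_ge0 ?lerD2r//; last exact/mon/backward_generator_Ltwo.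
exact: Ex_sqr_ge0.
Qed.

Lemma backward_window_increment s t : 0 <= s -> s <= t -> t <= T ->
  Ltwo nu (proc_window s t (fun u w => Y u w - Y s w)) /\ Ex nu (fun z => proc_window s t (fun u w => Y u w - Y s w) z ^+ 2) <=
    (2 * (d%:R * sqZ s t) + 2 * ((t - s) * sqG s t)) * (t - s).
Proof.
move=> s0 st tT; have sT := le_trans st tT.
have hs : 0 <= s <= T by rewrite s0.
have [mYs _] := backward_rv_Ltwo hs.
have mY : measurable_fun setT (proc_on T Y) by apply: measurable_proc_on; case: aY.
have m := measurable_procB mY (measurable_proc_cst T mYs).
set c := 2 * (d%:R * sqZ s t) + 2 * ((t - s) * sqG s t).
have c0 : 0 <= c.
  rewrite /c addr_ge0// mulr_ge0// mulr_ge0// ?subr_ge0//; last exact: Ex_sqr_ge0.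
  by apply: sumr_ge0 => j _; exact: Ex_sqr_ge0.
have [||||||L E] := @section_bound _ _ _ _ _ P leb
  (fun z => proc_on T (fun u w => Y u w - Y s w) z ^+ 2) (window s t) c.
- exact: measurable_funX.
- by move=> z; exact: sqr_ge0.
- exact: Lone_window.
- by move=> u; exact: window_ge0.
- exact: c0.
- move=> u /window_neq0/andP[su ut]; have uT := le_trans ut tT.
  have hu : 0 <= u <= T by rewrite uT (le_trans s0)// ltW.
  have -> : (fun w => proc_on T (fun u w => Y u w - Y s w) (w, u) ^+ 2) =
      fun w => (Y u w - Y s w) ^+ 2.
    by apply/funext => w; rewrite /proc_on /closed_window hu mulr1.
  split; first by have [] := LtwoB (backward_rv_Ltwo hu) (backward_rv_Ltwo hs).
  exact: (backward_increment_sqr s0 (ltW su) ut tT).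
have Ez z : proc_on T (fun u w => Y u w - Y s w) z ^+ 2 * window s t z.2 =
    proc_window s t (fun u w => Y u w - Y s w) z ^+ 2.
  by rewrite (proc_window_on _ _ s0 tT) [in RHS]exprMn window_sqr.
rewrite Ex_window// in E; split.
  split; first exact: (measurable_proc_window s0 tT m).
  by move: L; under eq_fun do rewrite Ez.
by move: E; under eq_Ex do rewrite Ez.
Qed.

Section BackwardStep.
Variables (b : 'cV[R]_d -> 'cV[R]_d) (sig : 'cV[R]_d -> 'M[R]_d).
Hypothesis mb : forall i, vmeasurable (fun v => b v i ord0).
Hypothesis ms : forall i j, vmeasurable (fun v => sig v i j).
Variables (s t K M : R) (xi : Omega -> 'cV[R]_d) (V : 'cV[R]_d -> R) (c : 'I_d -> Omega -> R).
Hypotheses (s0 : 0 <= s) (st : s < t) (tT : t <= T) (h1 : t - s <= 1) (K0 : 0 < K).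
Hypothesis axi : forall i, adapted s (fun w => xi w i ord0).
Hypotheses (mV : vmeasurable V) (VM : forall v, `|V v| <= M).
Hypothesis ac : forall j, adapted s (c j).
Hypothesis cb : forall j, exists C : R, forall w, `|c j w| <= C.

Local Notation z := (incB B s t).
Let h := t - s.
Let h0 : 0 < h. Proof. by rewrite subr_gt0. Qed.
Let hge0 : 0 <= h. Proof. exact: ltW. Qed.
Let st' : s <= t. Proof. exact: ltW. Qed.
Let sT : s <= T. Proof. exact: le_trans tT. Qed.
Let hs : 0 <= s <= T. Proof. by rewrite s0. Qed.
Let ht : 0 <= t <= T. Proof. by rewrite tT (le_trans s0). Qed.
Let K0' : 0 <= K. Proof. exact: ltW. Qed.
Let Gz : gaussian_vector P h z. Proof. exact: gaussian_inc. Qed.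
Let mz : coord_measurable z. Proof. by case: Gz. Qed.
Let M0 : 0 <= M. Proof. exact: le_trans (VM 0). Qed.
Let meas f : adapted s f -> measurable_fun setT f.
Proof. exact: (adapted_measurable cP BM). Qed.

Let m w := smean P h z b sig V (xi w).
Let ze w := sgrad P h K z b sig V (xi w).
Let Yt w := V (euler h b sig (xi w) (z w)).
Let Ys w := snext P h K z b sig g V (xi w).
Let tau_ j w := tau P K z j (z w).

(** One bound for V, the truncated noise and the constant 1, the functions fed to
    [Ex_euler_freeze]. *)
Let C := M + 2 * K + 1.
Let VC v : `|V v| <= C.
Proof. by apply: le_trans (VM v) _; rewrite /C -addrA lerDl addr_ge0// mulr_ge0. Qed.
Let oneC v : `|(fun _ : 'cV[R]_d => 1) v| <= C.
Proof. by rewrite normr1 /C lerDr addr_ge0// mulr_ge0. Qed.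
Let tauC j v : `|tau P K z j v| <= C.
Proof. by apply: le_trans (tau_bound K0' Gz j v) _; have M1 := M0; rewrite /C; lra. Qed.

Let am : adapted s m.
Proof.
have := adapted_Ex_euler BM mb ms h s0 st axi mV (vmeasurable_cst 1) VC oneC.
congr (adapted s _); apply/funext => w; apply: eq_Ex => w'; rewrite mulr1//.
Qed.

Let aze j : adapted s (fun w => ze w j ord0).
Proof.
have H := adapted_Ex_euler BM mb ms h s0 st axi mV (vmeasurable_tau P K z j) VC (tauC j).
have := adapted_mul (adapted_cst s h^-1) H.
by congr (adapted s _); apply/funext => w; rewrite /ze mxE.
Qed.

Let mM w : `|m w| <= M. Proof. exact: (smean_bound b sig Gz mV VM). Qed.

Let zeb w : h * hsnorm (ze w) ^+ 2 <= d%:R * (4 * M ^+ 2).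
Proof.
apply: le_trans (sgrad_le_svar b sig h0 K0' Gz mV VM (xi w)) _; rewrite ler_wpM2l//.
rewrite /svar -[leRHS](Ex_cst P).
have LV := Ltwo_euler b sig Gz (xi w) mV VM.
apply: Ex_le => [||w']; [by have [] := LtwoB LV (Ltwo_cst P (smean P h z b sig V (xi w)))|exact: Lone_cst|].
have := VM (euler h b sig (xi w) (z w')); have := mM w; rewrite -/(m w).
move: (V _) (m w) => x1 x2 h2 h3.
rewrite -[leLHS]real_normK ?num_real// (_ : 4 * M ^+ 2 = (M + M) ^+ 2); last by ring.
rewrite lerXn2r ?nnegrE ?addr_ge0//; apply: le_trans (ler_normB _ _) _; exact: lerD.
Qed.

Let abs_le (x c0 : R) : x ^+ 2 <= c0 -> `|x| <= 1 + c0.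
Proof.
move=> xc; rewrite -real_normK ?num_real// in xc.
have := sqr_ge0 (`|x| - 2^-1); have : 0 <= `|x| by []; lra.
Qed.

Let zej j : exists C0 : R, forall w, `|ze w j ord0| <= C0.
Proof.
exists (1 + d%:R * (4 * M ^+ 2) / h) => w; apply: abs_le.
rewrite ler_pdivlMr// mulrC; apply: le_trans (zeb w); rewrite ler_wpM2l//.
rewrite -[leLHS]real_normK ?num_real// lerXn2r ?nnegrE ?hsnorm_ge0//.
exact: hs_entry_le.
Qed.

Let gm w := g (m w) (ze w).
Let agm : adapted s gm. Proof. exact: adapted_generator. Qed.

(** Bounds h times the squared driver: the discrete gradient of a bounded function is only
    controlled up to a factor h^(-1/2). *)
Definition step_bound := 3 * (g 0 0 ^+ 2 + k ^+ 2 * M ^+ 2 + l ^+ 2 * (d%:R * (4 * M ^+ 2))).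

Let gmb w : h * gm w ^+ 2 <= step_bound.
Proof.
have := ler_wpM2l hge0 (generator_sqr (m w) (ze w)); move=> H; apply: (le_trans H).
have m2 : m w ^+ 2 <= M ^+ 2.
  by rewrite -[leLHS]real_normK ?num_real// lerXn2r ?nnegrE.
have := ler_wpM2l (sqr_ge0 k) m2; have := ler_wpM2l (sqr_ge0 l) (zeb w).
have hh : h <= 1 := h1.
have := ler_wpM2r (sqr_ge0 (g 0 0)) hh.
have := ler_wpM2r (mulr_ge0 (sqr_ge0 k) (sqr_ge0 (m w))) hh.
rewrite /step_bound; move: (g 0 0 ^+ 2) (k ^+ 2) (m w ^+ 2) (l ^+ 2) (hsnorm _ ^+ 2) => x1 x2 x3 x4 x5.
rewrite !mulrDr; move: (M ^+ 2) => x6; move: (d%:R * (4 * x6)) => x7; nra.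
Qed.

Let Lgm : Ltwo P gm.
Proof.
apply: (@Ltwo_bounded _ _ _ P (1 + step_bound / h)); first exact: meas.
by move=> w; apply: abs_le; rewrite ler_pdivlMr// mulrC; exact: gmb.
Qed.

Let Lm : Ltwo P m.
Proof. by apply: (@Ltwo_bounded _ _ _ P M) => //; exact: meas. Qed.

Let mYt : measurable_fun setT Yt.
Proof.
apply: mV => i; under eq_fun do rewrite /euler !mxE.
have mxi j : measurable_fun setT (fun w => xi w j ord0) by exact: meas.
apply: measurable_funD; first by apply: measurable_funD => //; apply: measurable_funM => //; exact: mb.
by apply: measurable_sum => j; apply: measurable_funM; [exact: ms|exact: mz].
Qed.

Let LYt : Ltwo P Yt. Proof. by apply: (@Ltwo_bounded _ _ _ P M) => // w; exact: VM. Qed.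

Let YsE w : Ys w = m w + h * gm w. Proof. by []. Qed.
Let LYs : Ltwo P Ys. Proof. exact: (LtwoD Lm (LtwoZ h Lgm)). Qed.
Let aYs : adapted s Ys.
Proof. by apply: adapted_add => //; apply: adapted_mul => //; exact: adapted_cst. Qed.

Let Ltau j : Ltwo P (tau_ j). Proof. exact: Ltwo_tau K0' Gz j. Qed.

(** Tested form of m = E[Yt | F_s]; [cond_grad] is the same for h ze = E[Yt tau | F_s]. *)
Let cond_mean a : adapted s a -> Ltwo P a -> Ex P (fun w => a w * (Yt w - m w)) = 0.
Proof.
move=> aa La; under eq_Ex do rewrite mulrBr.
rewrite ExB; [|exact: (LtwoM La LYt)|exact: (LtwoM La Lm)].
apply/eqP; rewrite subr_eq0; apply/eqP.
have := Ex_euler_freeze cP BM mb ms h s0 st axi mV (vmeasurable_cst 1) VC oneC aa La.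
rewrite (_ : Ex P (fun w => a w * Yt w) = Ex P (fun w => a w * (V (euler h b sig (xi w) (z w)) * 1))).
  by move=> ->; apply: eq_Ex => w; congr (_ * _); apply: eq_Ex => w'; rewrite mulr1.
by apply: eq_Ex => w; rewrite mulr1.
Qed.

Let cond_grad a j : adapted s a -> Ltwo P a ->
  Ex P (fun w => a w * (Yt w * tau_ j w)) = h * Ex P (fun w => a w * ze w j ord0).
Proof.
move=> aa La.
have -> := Ex_euler_freeze cP BM mb ms h s0 st axi mV (vmeasurable_tau P K z j) VC (tauC j) aa La.
have [C0 zC0] := zej j.
have Lz : Ltwo P (fun w => ze w j ord0) by apply: (@Ltwo_bounded _ _ _ P C0) => //; exact: meas.
rewrite -ExZ; last exact: LtwoM.
by apply: eq_Ex => w; rewrite /ze mxE; field; rewrite gt_eqF.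
Qed.

Let tau_mean a j : adapted s a -> Lone P a -> Ex P (fun w => a w * tau_ j w) = 0.
Proof.
move=> aa La; have Lt := Ltwo_Lone (Ltau j).
have [_ ->] := adapted_inc_mul cP BM s0 st aa La (vmeasurable_tau P K z j) Lt.
by rewrite (Ex_tau K0' Gz) mulr0.
Qed.

Let tau_sqr a j : adapted s a -> Ltwo P a ->
  Ex P (fun w => (a w * tau_ j w) ^+ 2) <= h * Ex P (fun w => a w ^+ 2).
Proof.
move=> aa La; under eq_Ex do rewrite exprMn.
have mt2 : vmeasurable (fun v => tau P K z j v ^+ 2).
  by apply: (vmeasurableM (F := tau P K z j)); exact: vmeasurable_tau.
have [_ ->] := adapted_inc_mul cP BM s0 st (adapted_sqr aa) La.2 mt2 (Ltau j).2.
by rewrite mulrC ler_wpM2r ?Ex_sqr_ge0//; exact: (Ex_tau_sqr h0 K0' Gz).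
Qed.

(** The constant of [gaussian_fourth] divided by the K^2 that comes from squaring [clip_sub_le]. *)
Definition clip_const := 512 * expR 2^-1 / K ^+ 2.

Lemma clip_const_gt0 : 0 < clip_const.
Proof.
apply: divr_gt0; last exact: exprn_gt0.
apply: mulr_gt0; last exact: expR_gt0.
by have -> : (0 < 512%:R :> R) = (0 < 512)%N by exact: ltr0n.
Qed.

Let gap j w := z w j ord0 - tau_ j w.

(** z minus tau is D - E D with D = z - clip z, so its second moment is a variance, at most E D^2 <=
    E z^4 / K^2. *)
Let gap_sqr j : Ltwo P (gap j) /\ Ex P (fun w => gap j w ^+ 2) <= clip_const * h ^+ 2.
Proof.
have Lz : Ltwo P (fun w => z w j ord0) := gaussian_Ltwo h0 Gz j.
have L : Ltwo P (gap j) by exact: LtwoB.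
split=> //; pose D w := z w j ord0 - clip K (z w j ord0).
have Lc : Ltwo P (fun w => clip K (z w j ord0)).
  apply: (@Ltwo_bounded _ _ _ P K); last by move=> w; exact: clip_bound.
  by apply: measurableT_comp (mz j); exact: measurable_clip.
have LD : Ltwo P D by exact: LtwoB.
have gE w : gap j w = D w - Ex P D.
  rewrite /gap /tau_ /tau /D (ExB (Ltwo_Lone Lz) (Ltwo_Lone Lc)) (gaussian_mean h0 Gz).
  by ring.
have -> : Ex P (fun w => gap j w ^+ 2) = Ex P (fun w => (D w - Ex P D) ^+ 2).
  by apply: eq_Ex => w; rewrite gE.
rewrite Ex_sqrB//; last exact: Ltwo_cst.
have -> : Ex P (fun w => D w * Ex P D) = Ex P D ^+ 2.
  by under eq_Ex do rewrite mulrC; rewrite ExZ//; exact: Ltwo_Lone.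
rewrite Ex_cst.
have [L4 E4] := gaussian_fourth h0 Gz j.
have : Ex P (fun w => D w ^+ 2) <= clip_const * h ^+ 2.
  apply: (@le_trans _ _ (Ex P (fun w => (K ^+ 2)^-1 * z w j ord0 ^+ 4))).
    apply: Ex_le => [||w]; [exact: LD.2|exact: LoneZ|].
    rewrite mulrC ler_pdivlMr ?exprn_gt0//.
    have := clip_sub_le K0' (z w j ord0); rewrite -/(D w).
    move=> H; have : (`|D w| * K) ^+ 2 <= (z w j ord0 ^+ 2) ^+ 2.
      by rewrite lerXn2r ?nnegrE ?sqr_ge0 ?H// mulr_ge0// ltW.
    by rewrite exprMn real_normK ?num_real// -exprM.
  rewrite ExZ// /clip_const mulrAC [leLHS]mulrC ler_wpM2r ?invr_ge0 ?sqr_ge0//.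
by have := sqr_ge0 (Ex P D); lra.
Qed.

Let vgap j : vmeasurable (fun v => v j ord0 - tau P K z j v).
Proof. by apply: vmeasurableB; [exact: vmeasurable_coord|exact: vmeasurable_tau]. Qed.

Let gap_mul_sqr a j : adapted s a -> Ltwo P a ->
  Ltwo P (fun w => a w * gap j w) /\
  Ex P (fun w => (a w * gap j w) ^+ 2) <= clip_const * h ^+ 2 * Ex P (fun w => a w ^+ 2).
Proof.
move=> aa La; have [Lg Eg] := gap_sqr j.
have mg2 : vmeasurable (fun v => (v j ord0 - tau P K z j v) ^+ 2).
  by apply: (vmeasurableM (F := fun v => v j ord0 - tau P K z j v)); exact: vgap.
have [L E] := adapted_inc_mul cP BM s0 st (adapted_sqr aa) La.2 mg2 Lg.2.
have E' w : (a w * gap j w) ^+ 2 = a w ^+ 2 * (z w j ord0 - tau P K z j (z w)) ^+ 2.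
  by rewrite exprMn.
split; last by under eq_Ex do rewrite E'; rewrite E mulrC ler_wpM2r ?Ex_sqr_ge0.
split; first by apply: measurable_funM; [exact: meas|exact: Lg.1].
by under eq_fun do rewrite E'.
Qed.

Let dN w := \sum_(j < d) (N j t w - N j s w).
(** Error of the martingale increment. It is orthogonal to the error at time s, so its second moment
    appears on the left-hand side in [backward_step]. *)
Let xe w := dN w - (Yt w - m w).

Let LdN : Ltwo P dN. Proof. by have [] := backward_martingale_sqr s0 st' tT. Qed.
Let LNj j : Ltwo P (fun w => N j t w - N j s w).
Proof. exact: (ito_increment_Ltwo cP BM (ito j) s0 st' tT). Qed.
Let Lxe : Ltwo P xe. Proof. exact: (LtwoB LdN (LtwoB LYt Lm)). Qed.

Let Lc j : Ltwo P (c j).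
Proof. by have [C0 H] := cb j; apply: (@Ltwo_bounded _ _ _ P C0) => //; exact: meas. Qed.
Let Lze j : Ltwo P (fun w => ze w j ord0).
Proof. by have [C0 H] := zej j; apply: (@Ltwo_bounded _ _ _ P C0) => //; exact: meas. Qed.

Let Zj j u w := Z u w j ord0.
Let LZ j : Ltwo nu (proc_window s t (Zj j)).
Proof. by have [] := sub_window s0 tT (backward_Z_Ltwo j). Qed.

(** Z has no regularity in time; c is a bounded variable known at time s that approximates it on the
    cell. *)
Let WZj j := Ex nu (fun p => proc_window s t (fun u w => Z u w j ord0 - c j w) p ^+ 2).

Let LZc j (a : Omega -> R) : Ltwo P a ->
  Ltwo nu (proc_window s t (fun u w => Z u w j ord0 - a w)).
Proof.
move=> La; have [L _] := Ltwo_window_cst st' La; have := LtwoB (LZ j) L.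
by congr (Ltwo nu _); apply/funext => p; rewrite /proc_window mulrBl.
Qed.

(** With a = c - ze, h E a^2 is the sum of three pairings: a tau with xe, a (z - tau) with dN, and -
    a with Z - c over the cell. Young's inequality charges each of them a third of h E a^2. *)
Lemma gradient_error j :
  h * Ex P (fun w => (c j w - ze w j ord0) ^+ 2) <=
  3 * (Ex P (fun w => xe w ^+ 2) + clip_const * h * Ex P (fun w => dN w ^+ 2) + WZj j).
Proof.
pose a w := c j w - ze w j ord0.
have aa : adapted s a by apply: adapted_sub; [exact: (@ac j)|exact: (@aze j)].
have La : Ltwo P a by exact: LtwoB.
have ab : exists C0 : R, forall w, `|a w| <= C0.
  have [C1 H1] := cb j; have [C2 H2] := zej j; exists (C1 + C2) => w.
  by apply: le_trans (ler_normB _ _) _; exact: lerD.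
have [Ca aC] := ab; have ma := meas aa.
have kap0 := clip_const_gt0.
have [Lag Eag] := gap_mul_sqr j aa La.
have Lat : Ltwo P (fun w => a w * tau_ j w) by exact: (Ltwo_bounded_mul ma aC (Ltau j)).
have Laz : Ltwo P (fun w => a w * z w j ord0) by exact: (inc_Ltwo cP BM s0 st' j aa La).
have [Lw Ew] := Ltwo_window_cst st' La.
have [Lcw _] := Ltwo_window_cst st' (Lc j).
have LW := LZc j (Lc j).
have E1 : Ex P (fun w => a w * z w j ord0 * dN w) =
    Ex nu (fun p => proc_window s t (fun=> a) p * proc_window s t (Zj j) p).
  under eq_Ex do rewrite /dN mulr_sumr.
  rewrite Ex_sum; last by move=> i _; exact: LtwoM.
  rewrite (bigD1 j)//= big1 => [|i ij].
    rewrite addr0 (ito_cov cP BM T0 (ito j) s0 st' tT j aa ab) eqxx.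
    by apply: eq_Ex => p; rewrite mul1r.
  rewrite (ito_cov cP BM T0 (ito i) s0 st' tT j aa ab) eq_sym (negbTE ij).
  by under eq_Ex do rewrite !mul0r; rewrite Ex0.
have Eac : Ex nu (fun p => proc_window s t (fun=> a) p * proc_window s t (fun=> c j) p) =
    h * Ex P (fun w => a w * c j w).
  have Lac : Lone P (fun w => a w * c j w) by exact: LtwoM.
  have [_ Er] := Lone_rect Lac (Lone_window s t).
  rewrite (Ex_window st') -/h in Er; rewrite mulrC -Er; apply: eq_Ex => p.
  by rewrite /proc_window mulrACA -expr2 window_sqr.
have E2 : Ex P (fun w => a w * tau_ j w * xe w) = Ex P (fun w => a w * tau_ j w * dN w) -
    h * Ex P (fun w => a w * ze w j ord0).
  have Lam : Lone P (fun w => a w * m w) by exact: LtwoM.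
  have L1 : Lone P (fun w => a w * tau_ j w * dN w) by exact: LtwoM.
  have L2 : Lone P (fun w => a w * tau_ j w * Yt w) by exact: LtwoM.
  have L3 : Lone P (fun w => a w * tau_ j w * m w) by exact: LtwoM.
  have -> : Ex P (fun w => a w * tau_ j w * xe w) = Ex P (fun w => a w * tau_ j w * dN w -
      (a w * tau_ j w * Yt w - a w * tau_ j w * m w)).
    by apply: eq_Ex => w; rewrite /xe; ring.
  rewrite ExB//; last exact: LoneB.
  rewrite ExB// -(cond_grad j aa La).
  have -> : Ex P (fun w => a w * tau_ j w * m w) = 0.
    rewrite -[RHS](tau_mean j (adapted_mul aa am) Lam); apply: eq_Ex => w; ring.
  rewrite subr0; congr (_ - _); apply: eq_Ex => w; ring.
have E3 : Ex P (fun w => a w * gap j w * dN w) = Ex P (fun w => a w * z w j ord0 * dN w) -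
    Ex P (fun w => a w * tau_ j w * dN w).
  rewrite -ExB; [|exact: LtwoM|exact: LtwoM].
  by apply: eq_Ex => w; rewrite /gap; ring.
have E4 : Ex nu (fun p => - proc_window s t (fun=> a) p *
    proc_window s t (fun u w => Z u w j ord0 - c j w) p) =
   h * Ex P (fun w => a w * c j w) - Ex nu (fun p => proc_window s t (fun=> a) p * proc_window s t (Zj j) p).
  rewrite -Eac -ExB; [|exact: LtwoM|exact: LtwoM].
  apply: eq_Ex => p; rewrite /proc_window /Zj; move: (c j _) (a _) (Z _ _ _ _) (window _ _ _) => x1 x2 x3 x4.
  by ring.
have E5 : h * Ex P (fun w => a w ^+ 2) = h * Ex P (fun w => a w * c j w) - h * Ex P (fun w => a w * ze w j ord0).
  rewrite -mulrBr -ExB; [|exact: LtwoM|exact: LtwoM].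
  by congr (_ * _); apply: eq_Ex => w; rewrite /a; ring.
have th : 0 < 3^-1 :> R by rewrite invr_gt0.
have Y1 := Ex_young th Lat Lxe.
(* E (a gap)^2 carries a factor h^2; this constant scales it to (1/3) h E a^2 and leaves a factor h
   in front of E dN^2. *)
have c3 : 0 < (3 * clip_const * h)^-1 by rewrite invr_gt0; apply: mulr_gt0 h0; apply: mulr_gt0 kap0.
have Y2 := Ex_young c3 Lag LdN.
have Y3 := Ex_young th (LtwoN Lw) LW.
have Ta := tau_sqr j aa La.
have N2 : Ex nu (fun p => (- proc_window s t (fun=> a) p) ^+ 2) = h * Ex P (fun w => a w ^+ 2).
  by rewrite -Ew; apply: eq_Ex => p; rewrite sqrrN.
rewrite N2 E4 in Y3; rewrite E2 in Y1; rewrite E3 E1 in Y2.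
have G2 := ler_wpM2l (ltW c3) Eag.
rewrite (_ : (3 * clip_const * h)^-1 * (clip_const * h ^+ 2 * Ex P (fun w => a w ^+ 2)) =
   3^-1 * (h * Ex P (fun w => a w ^+ 2))) in G2; last first.
  move: kap0 h0 {c3 Y2}; move: clip_const => kap kap0 h0'.
  by field; rewrite !gt_eqF.
rewrite !invrK in Y1 Y2 Y3.
rewrite -/a -/(WZj j) in Y3 *.
move: Y1 Y2 Y3 Ta G2 E5; rewrite -/(WZj j); move: clip_const {c3 kap0 Eag} => kap.
move: (Ex P (fun w => (a w * gap j w) ^+ 2)) (Ex P (fun w => (a w * tau_ j w) ^+ 2)) => x1 x2.
move: (Ex P (fun w => xe w ^+ 2)) (Ex P (fun w => dN w ^+ 2)) (Ex P (fun w => a w ^+ 2)) => x3 x4 x5.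
move: (Ex P _) (Ex P _) (Ex P _) (Ex nu _) (WZj j) => x6 x7 x8 x9 x10; lra.
Qed.

Let ds w := Y s w - Ys w.
Let dt w := Y t w - Yt w.
Let LY0 : Ltwo P (Y s). Proof. exact: (backward_rv_Ltwo hs). Qed.
Let Lds : Ltwo P ds. Proof. exact: (LtwoB LY0 LYs). Qed.
Let Ldt : Ltwo P dt. Proof. exact: (LtwoB (backward_rv_Ltwo ht) LYt). Qed.

(** Y_u - m is the oscillation Y_u - Y_s, plus the current error ds, plus one step h gm of the
    driver. *)
Let window_Y_error : Ltwo nu (proc_window s t (fun u w => Y u w - m w)) /\
  Ex nu (fun p => proc_window s t (fun u w => Y u w - m w) p ^+ 2) <=
  2 * ((2 * (d%:R * sqZ s t) + 2 * (h * sqG s t)) * h) + 4 * h * Ex P (fun w => ds w ^+ 2)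
    + 4 * h ^+ 2 * step_bound.
Proof.
have [L1 E1] := backward_window_increment s0 st' tT.
have Le : Ltwo P (fun w => ds w + h * gm w) by exact: (LtwoD Lds (LtwoZ h Lgm)).
have [L2 E2] := Ltwo_window_cst st' Le.
have W p : proc_window s t (fun u w => Y u w - m w) p =
    proc_window s t (fun u w => Y u w - Y s w) p + proc_window s t (fun=> (fun w => ds w + h * gm w)) p.
  rewrite /proc_window -mulrDl /ds YsE; congr (_ * _).
  by move: (Y _ _) (Y s _) (m _) (gm _) => x1 x2 x3 x4; ring.
split.
  by have := LtwoD L1 L2; congr (Ltwo nu _); apply/funext => p; rewrite W.
have -> : Ex nu (fun p => proc_window s t (fun u w => Y u w - m w) p ^+ 2) = Ex nu (fun p =>
    (proc_window s t (fun u w => Y u w - Y s w) p +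
     proc_window s t (fun=> (fun w => ds w + h * gm w)) p) ^+ 2).
  by apply: eq_Ex => p; rewrite W.
apply: le_trans (Ex_sqrD_le L1 L2) _; rewrite -[leRHS]addrA.
apply: lerD; first by rewrite ler_wpM2l.
rewrite E2 -/h.
have L3 : Ltwo P (fun w => h * gm w) := LtwoZ h Lgm.
have G3 : Ex P (fun w => (h * gm w) ^+ 2) <= h * step_bound.
  have -> : Ex P (fun w => (h * gm w) ^+ 2) = h * Ex P (fun w => h * gm w ^+ 2).
    rewrite -ExZ; last by apply: LoneZ; exact: Lgm.2.
    by apply: eq_Ex => w; move: (gm w) => x1; ring.
  rewrite ler_wpM2l// -[leRHS](Ex_cst P).
  by apply: Ex_le => [||w]; [apply: LoneZ; exact: Lgm.2|exact: Lone_cst|exact: gmb].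
have := ler_wpM2l hge0 (Ex_sqrD_le Lds L3); have := ler_wpM2l hge0 G3.
by move: (Ex P _) (Ex P _) (Ex P _) step_bound => x1 x2 x3 x4; lra.
Qed.

(** Z - ze = (Z - c) + (c - ze): the freezing error and the quantity bounded in [gradient_error]. *)
Let window_Z_error : Ltwo nu (proc_window s t (fun u w => hsnorm (Z u w - ze w))) /\
  Ex nu (fun p => proc_window s t (fun u w => hsnorm (Z u w - ze w)) p ^+ 2) <=
  8 * (\sum_(j < d) WZj j) + 6 * (d%:R * Ex P (fun w => xe w ^+ 2)) +
  6 * (d%:R * (clip_const * h * (d%:R * sqZ s t))).
Proof.
have W p : proc_window s t (fun u w => hsnorm (Z u w - ze w)) p ^+ 2 =
    \sum_(j < d) proc_window s t (fun u w => Z u w j ord0 - ze w j ord0) p ^+ 2.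
  rewrite exprMn hsnorm_sqrv mulr_suml window_sqr; apply: eq_bigr => j _.
  by rewrite exprMn window_sqr !mxE.
have LW j := LZc j (Lze j).
have H j : Ex nu (fun p => proc_window s t (fun u w => Z u w j ord0 - ze w j ord0) p ^+ 2) <=
    8 * WZj j + 6 * Ex P (fun w => xe w ^+ 2) + 6 * (clip_const * h * (d%:R * sqZ s t)).
  have La : Ltwo P (fun w => c j w - ze w j ord0) by exact: (LtwoB (Lc j) (Lze j)).
  have [L2 E2] := Ltwo_window_cst st' La.
  have L1 := LZc j (Lc j).
  have -> : Ex nu (fun p => proc_window s t (fun u w => Z u w j ord0 - ze w j ord0) p ^+ 2) =
     Ex nu (fun p => (proc_window s t (fun u w => Z u w j ord0 - c j w) p +
       proc_window s t (fun=> (fun w => c j w - ze w j ord0)) p) ^+ 2).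
    apply: eq_Ex => p; rewrite /proc_window -mulrDl; congr ((_ * _) ^+ 2).
    by move: (Z _ _ _ _) (c _ _) (ze _ _ _) => x1 x2 x3; ring.
  apply: le_trans (Ex_sqrD_le L1 L2) _; rewrite E2 -/h -/(WZj j).
  have := gradient_error j.
  have EN : Ex P (fun w => dN w ^+ 2) <= d%:R * sqZ s t by have [] := backward_martingale_sqr s0 st' tT.
  have kh : 0 <= clip_const * h by apply: mulr_ge0 hge0; exact: ltW clip_const_gt0.
  have := ler_wpM2l kh EN.
  move: (clip_const * h) {kh EN E2} => kh.
  move: (kh * Ex P _) (kh * (d%:R * _)) => x1 x2.
  move: (WZj j) => x3; move: (Ex P (fun w => xe w ^+ 2)) => x4; move: (Ex P _) => x5.
  by lra.
have sq : Lone nu (fun p => proc_window s t (fun u w => hsnorm (Z u w - ze w)) p ^+ 2).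
  by under eq_fun do rewrite W; apply: Lone_sum => j _; exact: (LW j).2.
split.
  split=> //.
  have -> : proc_window s t (fun u w => hsnorm (Z u w - ze w)) =
      fun p => Num.sqrt (proc_window s t (fun u w => hsnorm (Z u w - ze w)) p ^+ 2).
    by apply/funext => p; rewrite sqrtr_sqr ger0_norm// mulr_ge0 ?hsnorm_ge0 ?window_ge0.
  have ms' : measurable_fun setT (Num.sqrt : R -> R).
    by apply: continuous_measurable_fun; exact: sqrt_continuous.
  exact: (measurableT_comp ms' (Lone_meas sq)).
under eq_Ex do rewrite W.
rewrite Ex_sum; last by move=> j _; exact: (LW j).2.
apply: (@le_trans _ _ (\sum_(j < d) (8 * WZj j + 6 * Ex P (fun w => xe w ^+ 2) + 6 * (clip_const * h * (d%:R * sqZ s t))))).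
  by apply: ler_sum => j _; exact: H.
have cst (x : R) : \sum_(j < d) x = d%:R * x by rewrite sumr_const card_ord mulr_natl.
move: (Ex P _) (clip_const * h * _) => x2 x3.
by rewrite !big_split/= -mulr_sumr !cst !(mulrCA d%:R).
Qed.

(** 24 d l^2 makes the coefficient of E xe^2 at most 1, so that the left-hand side absorbs it; 16
    k^2 does the same for h E ds^2; the 1 ensures positivity and an inverse at most 1. *)
Definition step_coef := 24 * d%:R * l ^+ 2 + 16 * k ^+ 2 + 1.
Local Notation al := step_coef.

(** ds + xe - dt is the integral of the driver error over the cell, and ds is orthogonal to xe.
    Hence E ds^2 + E xe^2 stands on the left, and Young's inequality with parameter [al * h]
    separates dt from the driver error. *)
Lemma backward_step : al * h <= 1 ->
  (1 - h) * Ex P (fun w => ds w ^+ 2) <= (1 + al * h) * Ex P (fun w => dt w ^+ 2) +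
  4 * (k ^+ 2 * (2 * ((2 * (d%:R * sqZ s t) + 2 * (h * sqG s t)) * h) + 4 * h ^+ 2 * step_bound) +
       l ^+ 2 * (8 * (\sum_(j < d) WZj j) + 6 * (d%:R * (clip_const * h * (d%:R * sqZ s t))))).
Proof.
move=> alh.
have al0 : 0 < al by rewrite /al ltr_wpDl// addr_ge0// !mulr_ge0// ?sqr_ge0.
have alh0 : 0 < al * h by exact: mulr_gt0.
have [LWY EWY] := window_Y_error; have [LWZ EWZ] := window_Z_error.
have [Lgw _] := Ltwo_window_cst st' Lgm.
have [LG _] := sub_window s0 tT backward_generator_Ltwo.
have LD : Ltwo nu (proc_window s t (fun u w => G u w - gm w)).
  have := LtwoB LG Lgw; congr (Ltwo nu _); apply/funext => p; by rewrite /proc_window -mulrBl.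
have [Lp Ep] := pint_Ltwo st' LD.
have ED : Ex nu (fun p => proc_window s t (fun u w => G u w - gm w) p ^+ 2) <=
    2 * k ^+ 2 * Ex nu (fun p => proc_window s t (fun u w => Y u w - m w) p ^+ 2) +
    2 * l ^+ 2 * Ex nu (fun p => proc_window s t (fun u w => hsnorm (Z u w - ze w)) p ^+ 2).
  rewrite -(ExZ (2 * k ^+ 2) LWY.2) -(ExZ (2 * l ^+ 2) LWZ.2).
  rewrite -(ExD (LoneZ (2 * k ^+ 2) LWY.2) (LoneZ (2 * l ^+ 2) LWZ.2)).
  apply: Ex_le => [||p]; [exact: LD.2|exact: LoneD (LoneZ _ LWY.2) (LoneZ _ LWZ.2)|].
  rewrite /proc_window !exprMn !window_sqr !mulrA -mulrDl ler_wpM2r ?window_ge0//.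
  have := gL (Y p.2 p.1) (m p.1) (Z p.2 p.1) (ze p.1).
  have := hsnorm_ge0 (Z p.2 p.1 - ze p.1).
  rewrite -/(G _ _) -/(gm _); move: (G _ _ - gm _) (Y _ _ - m _) (hsnorm _) => x1 x2 x3 x30 H.
  have H' : x1 ^+ 2 <= (k * `|x2| + l * x3) ^+ 2.
    rewrite -[leLHS]real_normK ?num_real// lerXn2r ?nnegrE//.
    by rewrite addr_ge0// mulr_ge0.
  apply: le_trans H' _;   have E2 : (k * `|x2|) ^+ 2 = (k * x2) ^+ 2 by rewrite !exprMn real_normK ?num_real.
  by have := sqr_ge0 (k * `|x2| - l * x3); move: E2; move: `|x2| => x4; lra.
have Lf : Ltwo P (fun w => ds w + xe w) by exact: (LtwoD Lds Lxe).
have := Ex_sqr_perturb alh0 Lf Ldt.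
have -> : Ex P (fun w => (ds w + xe w - dt w) ^+ 2) =
    Ex P (fun w => pint s t (fun u w => G u w - gm w) w ^+ 2).
  apply: ae_eq_Ex.
  - by apply: measurable_funX; exact: (LtwoB Lf Ldt).1.
  - by apply: measurable_funX; exact: Lp.1.
  have PB : {ae P, forall w, pint s t (fun u w => G u w - gm w) w = pint s t G w - h * gm w}.
    by apply: filterS (pintB LG Lgw) => w ->; rewrite (pint_cst st').
  apply: filterS2 (backward_increment s0 st' tT) PB => w e1 ->.
  congr (_ ^+ 2); move: e1; rewrite /ds /xe /dt /dN YsE.
  by move: (Y s w) (Y t w) (Yt w) (m w) (gm w) (\sum_(j < d) _) (pint s t G w) => x1 x2 x3 x4 x5 x6 x7; lra.
have -> : Ex P (fun w => (ds w + xe w) ^+ 2) = Ex P (fun w => ds w ^+ 2) + Ex P (fun w => xe w ^+ 2).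
  rewrite (Ex_sqrD Lds Lxe).
  have -> : Ex P (fun w => ds w * xe w) = 0.
    have ads : adapted s ds by apply: adapted_sub aYs; exact: adapted_backward.
    have L1 := LtwoM Lds LdN; have L2 := LtwoM Lds (LtwoB LYt Lm).
    have -> : Ex P (fun w => ds w * xe w) = Ex P (fun w => ds w * dN w - ds w * (Yt w - m w)).
      by apply: eq_Ex => w; rewrite -mulrBr.
    rewrite (ExB L1 L2) (cond_mean ads Lds) subr0.
    have -> : Ex P (fun w => ds w * dN w) = Ex P (fun w => \sum_(j < d) ds w * (N j t w - N j s w)).
      by apply: eq_Ex => w; rewrite mulr_sumr.
    rewrite Ex_sum; last by move=> j _; exact: (LtwoM Lds (LNj j)).
    by apply: big1 => j _; exact: (ito_mean cP BM (ito j) s0 st' tT ads Lds).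
  by rewrite mulr0 addr0.
set DS := Ex P (fun w => ds w ^+ 2); set DT := Ex P (fun w => dt w ^+ 2).
set XE := Ex P (fun w => xe w ^+ 2) in EWZ *.
move=> H.
have th : (1 + (al * h)^-1) * (h * 1) <= 2 / al.
  have -> : (1 + (al * h)^-1) * (h * 1) = (1 + al * h) / al.
    by field; rewrite !gt_eqF.
  by rewrite ler_pM2r ?invr_gt0//; lra.
have XE0 : 0 <= XE by exact: Ex_sqr_ge0.
have DS0 : 0 <= DS by exact: Ex_sqr_ge0.
move: EWY EWZ; rewrite -/DS.
set QY := Ex nu _; set QZ := Ex nu _ => EWY EWZ.
set A1 := 2 * (_ * h) in EWY *; set A2 := 4 * h ^+ 2 * step_bound in EWY *.
set A3 := 8 * _ in EWZ *; set A4 := 6 * (d%:R * (clip_const * _ * _)) in EWZ *.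
set EG := Ex P (fun w => pint _ _ _ _ ^+ 2) in H Ep.
have QY0 : 0 <= QY by exact: Ex_sqr_ge0.
have QZ0 : 0 <= QZ by exact: Ex_sqr_ge0.
have H1 : EG <= h * (2 * k ^+ 2 * QY + 2 * l ^+ 2 * QZ).
  by apply: le_trans Ep _; rewrite -/h ler_wpM2l.
have H2 : (1 + (al * h)^-1) * EG <= 4 / al * (k ^+ 2 * QY + l ^+ 2 * QZ).
  have p0 : 0 <= 1 + (al * h)^-1 by rewrite addr_ge0// invr_ge0 ltW.
  apply: le_trans (ler_wpM2l p0 H1) _.
  have q0 : 0 <= 2 * k ^+ 2 * QY + 2 * l ^+ 2 * QZ.
    by rewrite addr_ge0// !mulr_ge0// sqr_ge0.
  have := ler_wpM2r q0 th; rewrite mulr1 => H3; rewrite mulrA; apply: le_trans H3 _.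
  by rewrite le_eqVlt; apply/orP; left; apply/eqP; ring.
have ai : al^-1 <= 1 by rewrite invf_le1// /al lerDr addr_ge0// !mulr_ge0// sqr_ge0.
have ai0 : 0 <= al^-1 by rewrite invr_ge0 ltW.
have ak : 16 * k ^+ 2 * al^-1 <= 1.
  rewrite ler_pdivrMr// mul1r /al.
  by have := mulr_ge0 (ler0n R d) (sqr_ge0 l); lra.
have ad : 24 * d%:R * l ^+ 2 * al^-1 <= 1.
  by rewrite ler_pdivrMr// mul1r /al; have := sqr_ge0 k; lra.
have A10 : 0 <= A1.
  rewrite /A1 mulr_ge0// mulr_ge0// addr_ge0// !mulr_ge0//; last exact: Ex_sqr_ge0.
  by apply: sumr_ge0 => j _; exact: Ex_sqr_ge0.
have A20 : 0 <= A2.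
  apply: mulr_ge0; first by rewrite mulr_ge0 ?sqr_ge0.
  by rewrite /step_bound; do ?[exact: sqr_ge0 | exact: ler0n | apply: addr_ge0 | apply: mulr_ge0].
have A30 : 0 <= A3.
  by rewrite /A3 mulr_ge0//; apply: sumr_ge0 => j _; exact: Ex_sqr_ge0.
have A40 : 0 <= A4.
  rewrite /A4 mulr_ge0// mulr_ge0// mulr_ge0//; first by rewrite mulr_ge0// ltW// clip_const_gt0.
  by rewrite mulr_ge0//; apply: sumr_ge0 => j _; exact: Ex_sqr_ge0.
have k2 := sqr_ge0 k; have l2 := sqr_ge0 l.
have B1 := ler_wpM2l (mulr_ge0 ai0 k2) EWY.
have B2 := ler_wpM2l (mulr_ge0 ai0 l2) EWZ.
have B3 := ler_wpM2r (mulr_ge0 hge0 DS0) ak.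
have B4 := ler_wpM2r XE0 ad.
have B5 := ler_wpM2r (mulr_ge0 k2 (addr_ge0 A10 A20)) ai.
have B6 := ler_wpM2r (mulr_ge0 l2 (addr_ge0 A30 A40)) ai.
move: H H2 B1 B2 B3 B4 B5 B6.
move: (al * h) => x1; move: al^-1 ((1 + x1^-1) * EG) => x2 x3.
move: (k ^+ 2) (l ^+ 2) => x4 x5; move=> *; lra.
Qed.

End BackwardStep.

End BackwardEquation.

(** * Piecewise constant approximation of integrands *)

Section DiscreteGronwall.
Context {R : realType}.

Lemma discrete_gronwall (x e : nat -> R) (q : R) (n : nat) : 1 <= q ->
  (forall k, 0 <= x k) -> (forall k, 0 <= e k) ->
  (forall k, (k < n)%N -> x k.+1 <= q * (x k + e k)) ->
  x n <= q ^+ n * (x 0%N + \sum_(k < n) e k).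
Proof.
move=> q1 x0 e0; have q0 : 0 <= q by exact: le_trans q1.
elim: n => [|n IH] H; first by rewrite expr0 mul1r big_ord0 addr0.
apply: le_trans (H n _) _ => //.
have IHn := IH (fun k kn => H k (ltnW kn)).
rewrite big_ord_recr/= exprS -mulrA ler_wpM2l// addrA mulrDr lerD//.
by rewrite ler_peMl// exprn_ege1.
Qed.

Lemma expR_bound (c h : R) n : 0 <= c -> 0 <= h -> (1 + c * h) ^+ n <= expR (c * (n%:R * h)).
Proof.
move=> c0 h0; rewrite mulrCA expRM_natl.
by rewrite lerXn2r ?nnegrE ?expR_ge0 ?expR_ge1Dx// addr_ge0// mulr_ge0.
Qed.

End DiscreteGronwall.

Section FrozenSimple.
Context {R : realType} {dd : measure_display} {Omega : measurableType dd}.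
Context (P : probability Omega R) (d : nat) (B : R -> Omega -> 'cV[R]_d).
Hypotheses (cP : measure_is_complete P) (BM : standard_brownian_motion P B).
Local Notation leb := (@lebesgue_measure R).
Local Notation nu := (P \x leb)%E.
Local Notation adapted := (adapted P B).
Local Notation F := (augmented_filtration P B).

Section OneSimple.
Variable S : simple_process F.

(* With t_i <= s < t_i+1 instead of t_i < s <= t_i+1 this is the value of the
   process just after s, which is still known at time s. *)
Definition frozen s w :=
  \sum_(i < sp_size S) sp_coef S i w * (sp_time S i <= s < sp_time S i.+1)%R%:R.

Lemma frozen_adapted s : adapted s (frozen s).
Proof.
apply: adapted_sum => i; case: (boolP (sp_time S i <= s)) => ts /=.
  apply: adapted_mul; last exact: adapted_cst.
  by apply: (adapted_le ts); apply/adapted_rv; exact: sp_coef_adapted.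
by under eq_fun do rewrite mulr0; exact: adapted_cst.
Qed.

Let coef_bounds : exists f : nat -> R, forall i w, `|sp_coef S i w| <= f i.
Proof.
have /choice[f Hf] : forall i, exists M : R, forall w, `|sp_coef S i w| <= M.
  exact: sp_coef_bounded.
by exists f.
Qed.

Lemma frozen_bounded s : exists C : R, forall w, `|frozen s w| <= C.
Proof.
have [f Hf] := coef_bounds; exists (\sum_(i < sp_size S) f i) => w.
apply: le_trans (ler_norm_sum _ _ _) _; apply: ler_sum => i _.
rewrite normrM -[leRHS]mulr1 ler_pM// ger0_norm ?ler0n//.
by case: (_ && _); rewrite ?lexx ?ler01.
Qed.

(** The values at u and at the left end s of the cell differ only through a partition time between
    them, and then u lies within h after that time. *)
Lemma simple_val_frozen (f : nat -> R) s h u w : (forall i w, `|sp_coef S i w| <= f i) ->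
  s < u <= s + h -> `|simple_val S u w - frozen s w| <=
  \sum_(i < sp_size S) f i * (window (sp_time S i) (sp_time S i + h) u +
    window (sp_time S i.+1) (sp_time S i.+1 + h) u).
Proof.
move=> Hf /andP[su us]; rewrite /simple_val /frozen -sumrB.
apply: le_trans (ler_norm_sum _ _ _) _; apply: ler_sum => i _.
rewrite -mulrBr normrM ler_pM// /window.
set a := sp_time S i; set a' := sp_time S i.+1.
have lh v : s < v -> u <= v + h by move=> sv; apply: le_trans us _; rewrite lerD2r ltW.
case: (leP a s) => as_ /=.
  have -> /= : a < u by exact: le_lt_trans su.
  case: (ltP s a') => sa /=.
    case: (leP u a') => ua /=; first by rewrite subrr normr0 addr_ge0// ler0n.
    by rewrite sub0r normrN normr1 (lh a' sa) lerDr ler0n.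
  by rewrite [u <= a']leNgt (le_lt_trans sa su)/= subrr normr0 addr_ge0// ler0n.
rewrite subr0 ger0_norm ?ler0n// lh// andbT.
by case: (a < u) => //=; [case: (u <= a') => /=; rewrite ?lerDl ?addr_ge0 ?ler0n|rewrite addr_ge0// ler0n].
Qed.

Let Lwin a h T : 0 <= h -> Ltwo nu (fun z => window a (a + h) z.2 * window 0 T z.2) /\
  Ex nu (fun z => (window a (a + h) z.2 * window 0 T z.2) ^+ 2) <= h.
Proof.
move=> h0; have ah : a <= a + h by rewrite lerDl.
have [L E] := Ltwo_window_cst ah (Ltwo_cst P 1).
have m : measurable_fun setT (fun z : Omega * measurableTypeR R => window a (a + h) z.2 * window 0 T z.2).
  by apply: measurable_funM; apply: measurableT_comp (@measurable_snd _ _ _ _); exact: measurable_window.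
have le (z : Omega * measurableTypeR R) : (window a (a + h) z.2 * window 0 T z.2) ^+ 2 <=
    proc_window a (a + h) (fun=> (fun=> 1)) z ^+ 2 :> R.
  rewrite /proc_window mul1r exprMn !window_sqr ler_piMr ?window_ge0//; exact: window_le1.
have L' : Ltwo nu (fun z => window a (a + h) z.2 * window 0 T z.2).
  split=> //; apply: (Lone_le _ _ L.2); first exact: measurable_funX.
  by move=> z; rewrite (ger0_norm (sqr_ge0 _)); exact: le.
split=> //; have := Ex_le L'.2 L.2 le; rewrite E (_ : Ex P _ = 1).
  by rewrite mulr1 (_ : a + h - a = h); last by ring.
by rewrite -[RHS](Ex_cst P); apply: eq_Ex => w; rewrite expr1n.
Qed.

(** Each partition time spoils a set of times of length at most h, so the squared error is linear in
    h for a fixed simple process. *)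
Lemma frozen_error T : exists2 C : R, 0 <= C & forall h n, 0 < h -> n%:R * h <= T ->
  (forall k, (k < n)%N -> Ltwo nu (proc_window (k%:R * h) (k.+1%:R * h)
     (fun u w => simple_val S u w - frozen (k%:R * h) w))) /\
  \sum_(k < n) Ex nu (fun z => proc_window (k%:R * h) (k.+1%:R * h)
     (fun u w => simple_val S u w - frozen (k%:R * h) w) z ^+ 2) <= C * h.
Proof.
have [f Hf] := coef_bounds; set m := sp_size S.
have f0 i : 0 <= f i by apply: le_trans (Hf i point).
exists (m%:R * \sum_(i < m) (4 * f i ^+ 2)).
  by rewrite mulr_ge0// sumr_ge0// => i _; rewrite mulr_ge0// sqr_ge0.
move=> h n h0 nT; have hge := ltW h0.
pose q (u : R) (w : Omega) := \sum_(i < m) f i * (window (sp_time S i) (sp_time S i + h) u +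
    window (sp_time S i.+1) (sp_time S i.+1 + h) u).
pose p a (z : Omega * measurableTypeR R) := window a (a + h) z.2 * window 0 T z.2.
pose Q i z := f i * (p (sp_time S i) z + p (sp_time S i.+1) z).
have LQ i : Ltwo nu (Q i).
  have [L1 _] := Lwin (sp_time S i) T hge; have [L2 _] := Lwin (sp_time S i.+1) T hge.
  exact: (LtwoZ (f i) (LtwoD L1 L2)).
have qE : proc_window 0 T q = fun z => \sum_(i < m) Q i z.
  apply/funext => z; rewrite /proc_window /q mulr_suml; apply: eq_bigr => i _.
  by rewrite /Q /p -mulrA mulrDl.
have Lq : Ltwo nu (proc_window 0 T q) by rewrite qE; apply: Ltwo_sum => i _; exact: LQ.
have Eq : Ex nu (fun z => proc_window 0 T q z ^+ 2) <=
      m%:R * (\sum_(i < m) (4 * f i ^+ 2)) * h.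
  rewrite qE; apply: le_trans (Ex_sqr_sum_le (fun i : 'I_m => LQ i)) _.
  rewrite card_ord -mulrA mulr_suml ler_wpM2l//; apply: ler_sum => i _.
  have [L1 E1] := Lwin (sp_time S i) T hge; have [L2 E2] := Lwin (sp_time S i.+1) T hge.
  rewrite /Q; under eq_Ex do rewrite exprMn.
  rewrite ExZ; last exact: (LtwoD L1 L2).2.
  rewrite (_ : 4 * f i ^+ 2 * h = f i ^+ 2 * (4 * h)); last by ring.
  apply: ler_wpM2l; first exact: sqr_ge0.
  by apply: le_trans (Ex_sqrD_le L1 L2) _; lra.
have kh j k : (j <= k)%N -> j%:R * h <= k%:R * h by move=> jk; rewrite ler_wpM2r// ler_nat.
have kT k : (k < n)%N -> k.+1%:R * h <= T by move=> kn; apply: le_trans nT; apply: kh.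
have k0 k : 0 <= k%:R * h by rewrite mulr_ge0.
have le k z : proc_window (k%:R * h) (k.+1%:R * h) (fun u w => simple_val S u w - frozen (k%:R * h) w) z ^+ 2
    <= proc_window (k%:R * h) (k.+1%:R * h) q z ^+ 2.
  rewrite /proc_window !exprMn !window_sqr.
  case: (eqVneq (window (k%:R * h) (k.+1%:R * h) z.2) 0) => [->|/window_neq0 uk]; first by rewrite !mulr0.
  rewrite ler_wpM2r ?window_ge0//.
  have := @simple_val_frozen f (k%:R * h) h z.2 z.1 Hf; rewrite -natr1 mulrDl mul1r in uk.
  move=> /(_ uk) H; rewrite -[leLHS]real_normK ?num_real// lerXn2r ?nnegrE//.
  by apply: sumr_ge0 => i _; rewrite mulr_ge0// addr_ge0// window_ge0.
have L k : (k < n)%N -> Ltwo nu (proc_window (k%:R * h) (k.+1%:R * h)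
     (fun u w => simple_val S u w - frozen (k%:R * h) w)).
  move=> kn; have [Lk _] := sub_window (k0 k) (kT k kn) Lq.
  have mS : measurable_fun setT (proc_on T (simple_val S)).
    by apply: measurable_proc_on; exact: measurable_simple_val.
  have mc := adapted_measurable cP BM (@frozen_adapted (k%:R * h)).
  have mk := measurable_proc_window (k0 k) (kT k kn) (measurable_procB mS (measurable_proc_cst T mc)).
  split=> //; apply: (Lone_le _ _ Lk.2); first exact: measurable_funX.
  by move=> z; rewrite (ger0_norm (sqr_ge0 _)); exact: le.
split=> //; apply: le_trans Eq; apply: le_trans (sum_windows hge nT Lq).
apply: ler_sum => k _; have kn := ltn_ord k.
have [Lk _] := sub_window (k0 k) (kT k kn) Lq.
by apply: Ex_le => [||z]; [exact: (L k kn).2|exact: Lk.2|exact: le].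
Qed.

End OneSimple.

(** Two approximations of tolerance e / 4 each: a simple process chosen once for H, then its value
    frozen at the grid points, which needs a mesh depending on that process. *)
Lemma ito_frozen (T : R) j H M e : 0 <= T ->
  is_ito_integral P F T (fun t w => B t w j ord0) H M -> 0 < e ->
  exists2 h1 : R, 0 < h1 & forall h n, 0 < h -> h <= h1 -> n%:R * h <= T ->
  exists c : nat -> Omega -> R,
    [/\ forall k, adapted (k%:R * h) (c k), forall k, exists C : R, forall w, `|c k w| <= C &
     \sum_(k < n) Ex nu (fun z => proc_window (k%:R * h) (k.+1%:R * h)
       (fun u w => H u w - c k w) z ^+ 2) <= e].
Proof.
move=> T0 ito e0; have hT : 0 <= T <= T by rewrite T0 lexx.
have e4 : 0 < e / 4 by rewrite divr_gt0.
have [S [L E _]] := simple_approx cP BM ito hT hT e4.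
have [C C0 HC] := frozen_error S T.
exists (e / (4 * (C + 1))); first by rewrite divr_gt0// mulr_gt0// ltr_wpDl.
move=> h n h0 hh nT; exists (fun k => frozen S (k%:R * h)); split.
- by move=> k; exact: frozen_adapted.
- by move=> k; exact: frozen_bounded.
have [LC EC] := HC h n h0 nT.
have [L1 E1] := Ltwo_proc_window (lexx 0) (lexx T) L.
have S1 := sum_windows (ltW h0) nT L1.
have hC : C * h <= e / 4.
  rewrite ler_pdivlMr ?mulr_gt0// in hh; last by rewrite ltr_wpDl.
  by move: hh; nra.
apply: (@le_trans _ _ (2 * \sum_(k < n) Ex nu (fun z => proc_window (k%:R * h) (k.+1%:R * h)
       (fun u w => simple_val S u w - H u w) z ^+ 2) + 2 * \sum_(k < n) Ex nu (fun z => proc_window (k%:R * h) (k.+1%:R * h)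
     (fun u w => simple_val S u w - frozen S (k%:R * h) w) z ^+ 2))).
  rewrite !mulr_sumr -big_split/=; apply: ler_sum => k _; have kn := ltn_ord k.
  have kT : k.+1%:R * h <= T by apply: le_trans nT; apply: ler_wpM2r; [exact: ltW|rewrite ler_nat].
  have k0 : 0 <= k%:R * h by rewrite mulr_ge0// ltW.
  have [Lk _] := sub_window k0 kT L1.
  have := Ex_sqrD_le (LtwoN Lk) (LC k kn).
  have -> : Ex nu (fun z => (- proc_window (k%:R * h) (k.+1%:R * h)
       (fun u w => simple_val S u w - H u w) z) ^+ 2) = Ex nu (fun z => proc_window (k%:R * h) (k.+1%:R * h)
       (fun u w => simple_val S u w - H u w) z ^+ 2).
    by apply: eq_Ex => z; rewrite sqrrN.
  move=> H2; apply: le_trans H2.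
  rewrite le_eqVlt; apply/orP; left; apply/eqP; apply: eq_Ex => z.
  rewrite /proc_window -mulNr -mulrDl; congr ((_ * _) ^+ 2).
  by move: (simple_val _ _ _) (H _ _) (frozen _ _ _) => x1 x2 x3; ring.
have E2 := le_trans S1 (le_trans E1 E).
by move: E2 EC; lra.
Qed.

Lemma ito_frozen_family (T : R) (H M : 'I_d -> R -> Omega -> R) e : 0 <= T ->
  (forall j, is_ito_integral P F T (fun t w => B t w j ord0) (H j) (M j)) -> 0 < e ->
  exists2 h1 : R, 0 < h1 & forall h n, 0 < h -> h <= h1 -> n%:R * h <= T ->
  exists c : 'I_d -> nat -> Omega -> R,
    [/\ forall j k, adapted (k%:R * h) (c j k), forall j k, exists C : R, forall w, `|c j k w| <= C &
     \sum_(k < n) \sum_(j < d) Ex nu (fun z => proc_window (k%:R * h) (k.+1%:R * h)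
       (fun u w => H j u w - c j k w) z ^+ 2) <= d%:R * e].
Proof.
move=> T0 ito e0.
have /choice[f Hf] : forall j, exists h1 : R, 0 < h1 /\ forall h n, 0 < h -> h <= h1 -> n%:R * h <= T ->
  exists c : nat -> Omega -> R,
    [/\ forall k, adapted (k%:R * h) (c k), forall k, exists C : R, forall w, `|c k w| <= C &
     \sum_(k < n) Ex nu (fun z => proc_window (k%:R * h) (k.+1%:R * h)
       (fun u w => H j u w - c k w) z ^+ 2) <= e].
  by move=> j; have [h1 h10 Hh] := ito_frozen T0 (ito j) e0; exists h1.
have f0 j : 0 <= (f j)^-1 by rewrite invr_ge0 ltW// (Hf j).1.
have s0 : 0 <= \sum_(j < d) (f j)^-1 by apply: sumr_ge0.
(* A common lower bound of the thresholds f j; the 1 keeps it positive for d = 0. *)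
exists (1 + \sum_(j < d) (f j)^-1)^-1; first by rewrite invr_gt0 ltr_wpDr.
move=> h n h0 hh nT.
have /choice[c Hc] : forall j, exists c : nat -> Omega -> R,
    [/\ forall k, adapted (k%:R * h) (c k), forall k, exists C : R, forall w, `|c k w| <= C &
     \sum_(k < n) Ex nu (fun z => proc_window (k%:R * h) (k.+1%:R * h)
       (fun u w => H j u w - c k w) z ^+ 2) <= e].
  move=> j; have [fj Hj] := Hf j; apply: Hj => //; apply: le_trans hh _.
  rewrite -[leRHS]invrK lef_pV2 ?posrE ?invr_gt0 ?ltr_wpDr//.
  by rewrite (bigD1 j)//= addrCA lerDl addr_ge0// sumr_ge0.
exists c; split=> [j|j|]; [by case: (Hc j)|by case: (Hc j)|].
rewrite exchange_big/= -[d in d%:R * e]card_ord mulr_natl -sumr_const.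
by apply: ler_sum => j _; case: (Hc j).
Qed.

End FrozenSimple.

(** * Convergence of the scheme *)

Section ItoZero.
Context {R : realType} {dd : measure_display} {Omega : measurableType dd}.
Context (P : probability Omega R) (d : nat) (B : R -> Omega -> 'cV[R]_d).
Hypotheses (cP : measure_is_complete P) (BM : standard_brownian_motion P B).
Local Notation F := (augmented_filtration P B).

(** Integrals of simple processes vanish at time 0, and the value of M at 0 is their mean-square
    limit. *)
Lemma ito_zero (T : R) j H M : 0 <= T ->
  is_ito_integral P F T (fun t w => B t w j ord0) H M -> Ex P (fun w => M 0 w ^+ 2) = 0.
Proof.
move=> T0 ito; have h0 : 0 <= (0 : R) <= T by apply/andP; split.
apply/eqP; rewrite eq_le Ex_sqr_ge0 andbT; apply/ler_addgt0Pr => e e0; rewrite add0r.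
have [S [_ _ /(_ 0 (or_introl erefl))[_ E]]] := simple_approx cP BM ito h0 h0 e0.
apply: le_trans E; rewrite le_eqVlt; apply/orP; left; apply/eqP.
by apply: eq_Ex => w; rewrite simple_ito0 sub0r sqrrN.
Qed.

End ItoZero.

Section Grid.
Context {R : realType} {dd : measure_display} {Omega : measurableType dd}.
Context (P : probability Omega R) (d : nat) (B : R -> Omega -> 'cV[R]_d).
Hypothesis BM : standard_brownian_motion P B.

Lemma grid_step (h : R) k : k.+1%:R * h - k%:R * h = h.
Proof. by rewrite -natr1; ring. Qed.

Lemma schemeS (h K : R) z b sig g phi j : @scheme _ _ _ P d h K z b sig g phi j.+1 =
  snext P h K (z j) b sig g (scheme P h K z b sig g phi j).
Proof. by []. Qed.

(* Step j of the scheme runs backwards in time, hence the reversed index; for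
   j >= n the truncated subtraction still yields an increment over one cell. *)
Definition grid_noise (h : R) (n j : nat) : Omega -> 'cV[R]_d :=
  incB B ((n.-1 - j)%N%:R * h) ((n.-1 - j)%N.+1%:R * h).

Lemma gaussian_grid_noise h n j : 0 < h -> gaussian_vector P h (grid_noise h n j).
Proof.
move=> h0; rewrite -[h in gaussian_vector _ h](grid_step h (n.-1 - j)%N).
apply: (gaussian_inc BM); first by rewrite mulr_ge0// ltW.
by rewrite ltr_pM2r// ltr_nat.
Qed.

Variables (b : 'cV[R]_d -> 'cV[R]_d) (sig : 'cV[R]_d -> 'M[R]_d).

Fixpoint grid_euler (h : R) (x : 'cV[R]_d) (k : nat) (w : Omega) : 'cV[R]_d :=
  if k is k'.+1 then
    euler h b sig (grid_euler h x k' w) (incB B (k'%:R * h) (k'.+1%:R * h) w)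
  else x.

Lemma scheme_grid h K g phi n k : (k < n)%N ->
  scheme P h K (grid_noise h n) b sig g phi (n - k) =
  snext P h K (incB B (k%:R * h) (k.+1%:R * h)) b sig g
    (scheme P h K (grid_noise h n) b sig g phi (n - k.+1)).
Proof.
move=> kn; have Ek : (n.-1 - (n - k.+1))%N = k by lia.
by rewrite -[in LHS](subnSK kn) schemeS {1}/grid_noise Ek.
Qed.

End Grid.

Section SchemeBound.
Context dd (T : measurableType dd) (R : realType) (P : probability T R).
Context (d : nat) (h K : R) (z : nat -> T -> 'cV[R]_d).
Variables (b : 'cV[R]_d -> 'cV[R]_d) (sig : 'cV[R]_d -> 'M[R]_d).
Variables (g : R -> 'cV[R]_d -> R) (phi : 'cV[R]_d -> R).
Hypotheses (h0 : 0 < h) (K0 : 0 <= K) (Gz : forall j, gaussian_vector P h (z j)).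
Variables (k l Lb Ls C m0 : R).
Hypotheses (k0 : 0 < k) (l0 : 0 <= l) (Lb0 : 0 <= Lb) (Ls0 : 0 <= Ls).
Hypotheses (m00 : 0 <= m0).
Hypothesis bL : forall x x', hsnorm (b x - b x') <= Lb * hsnorm (x - x').
Hypothesis sL : forall x x', hsnorm (sig x - sig x') <= Ls * hsnorm (x - x').
Hypothesis gL : forall a a' u u',
  `|g a u - g a' u'| <= k * `|a - a'| + l * hsnorm (u - u').
Hypothesis phiB : forall x, `|phi x| <= C.
Hypothesis phiL : forall x y, `|phi x - phi y| <= m0 * hsnorm (x - y).
Hypotheses (hk : h * k <= 8^-1) (lK : 2 * K * d%:R * l <= 4^-1).

Let schemeE j : scheme P h K z b sig g phi j =
  fun x => (1 + h * k) ^+ j * disc P h K z b sig g phi k j x.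
Proof.
have s0 : 0 < 1 + h * k by rewrite ltr_wpDr// mulr_ge0// ltW.
by apply/funext => x; rewrite /disc mulrA divff ?mul1r// gt_eqF// exprn_gt0.
Qed.

Lemma vmeasurable_scheme j : vmeasurable (scheme P h K z b sig g phi j).
Proof.
have [m _ _ _] := scheme_invariant h0 K0 Gz k0 l0 Lb0 Ls0 m00 bL sL gL phiB phiL hk lK j.
by rewrite schemeE => d1 T1 V mV; apply: measurable_funM => //; exact: m.
Qed.

Lemma scheme_le j (S : R) x : j%:R * h <= S ->
  `|scheme P h K z b sig g phi j x| <= expR (k * S) * (C + `|g 0 0| / k).
Proof.
move=> jS; have [_ H _ _] := scheme_invariant h0 K0 Gz k0 l0 Lb0 Ls0 m00 bL sL gL phiB phiL hk lK j.
have s1 : 1 <= 1 + h * k by rewrite lerDl mulr_ge0// ltW.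
have s0 : 0 < 1 + h * k by exact: lt_le_trans s1.
rewrite schemeE normrM ger0_norm ?exprn_ge0 ?(ltW s0)//.
apply: ler_pM => //; first by rewrite exprn_ge0// ltW.
  rewrite [h * k]mulrC; apply: le_trans (expR_bound j (ltW k0) (ltW h0)) _.
  by rewrite ler_expR ler_wpM2l// ltW.
apply: le_trans (H x) _; rewrite lerD2l ler_piMr//; first by rewrite divr_ge0// ltW.
by rewrite gerBl invr_ge0 exprn_ge0// ltW.
Qed.

End SchemeBound.

Section ForwardGrid.
Context {R : realType} {dd : measure_display} {Omega : measurableType dd}.
Context (P : probability Omega R) (d : nat) (B : R -> Omega -> 'cV[R]_d).
Hypotheses (cP : measure_is_complete P) (BM : standard_brownian_motion P B).
Local Notation F := (augmented_filtration P B).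
Local Notation leb := (@lebesgue_measure R).
Local Notation adapted := (adapted P B).
Variables (T Ls Lb S : R) (sig : 'cV[R]_d -> 'M[R]_d) (b : 'cV[R]_d -> 'cV[R]_d).
Variables (x : 'cV[R]_d) (X : R -> Omega -> 'cV[R]_d) (M : 'I_d -> 'I_d -> R -> Omega -> R).
Hypotheses (T0 : 0 <= T) (Ls0 : 0 <= Ls) (Lb0 : 0 <= Lb) (S0 : 0 <= S).
Hypothesis bL : forall x x', hsnorm (b x - b x') <= Lb * hsnorm (x - x').
Hypothesis sL : forall x x', hsnorm (sig x - sig x') <= Ls * hsnorm (x - x').
Hypothesis sS : forall x i j, `|sig x i j| <= S.
Hypothesis aX : forall i, measurable_adapted F T (fun t w => X t w i ord0).
Hypothesis cX : {ae P, forall w, {within `[0, T], continuous (X ^~ w)}}.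
Hypothesis ito : forall i j, is_ito_integral P F T (fun t w => B t w j ord0)
  (fun t w => sig (X t w) i j) (M i j).
Hypothesis eqX : {ae P, forall w, forall (t : R) i, 0 <= t <= T ->
  X t w i ord0 = x i ord0 + \sum_(j < d) M i j t w
    + \int[leb]_(s in `[0, t]) b (X s w) i ord0}.

Lemma forward_start i : Ex P (fun w => (X 0 w i ord0 - x i ord0) ^+ 2) = 0.
Proof.
have h0 : 0 <= (0 : R) <= T by apply/andP; split.
have LX := forward_rv_Ltwo cP BM T0 Lb0 bL aX cX ito eqX i h0.
have LM j : Ltwo P (M i j 0) by exact: (ito_Ltwo cP BM (ito i j)).
have -> : Ex P (fun w => (X 0 w i ord0 - x i ord0) ^+ 2) = Ex P (fun w => (\sum_(j < d) M i j 0 w) ^+ 2).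
  apply: ae_eq_Ex.
  - by apply: measurable_funX; exact: (LtwoB LX (Ltwo_cst P (x i ord0))).1.
  - by apply: measurable_funX; apply: measurable_sum => j; exact: (LM j).1.
  apply: filterS eqX => w ew; rewrite ew//.
  rewrite set_itv1 Rintegral_set1; congr (_ ^+ 2); ring.
apply/eqP; rewrite eq_le Ex_sqr_ge0 andbT; apply: le_trans (Ex_sqr_sum_le LM) _.
by rewrite big1 ?mulr0// => j _; exact: (ito_zero cP BM T0 (ito i j)).
Qed.

Let ge := grid_euler B b sig.

Lemma grid_euler_adapted h k i : 0 < h -> adapted (k%:R * h) (fun w => ge h x k w i ord0).
Proof.
move=> h0; elim: k i => [|k IH] i; first exact: adapted_cst.
have k0 : 0 <= k%:R * h by rewrite mulr_ge0// ltW.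
have kk : k%:R * h < k.+1%:R * h by rewrite ltr_pM2r// ltr_nat.
by have := euler_adapted bL sL k0 kk IH i; rewrite grid_step.
Qed.

Lemma grid_euler_Ltwo h k i : 0 < h -> k%:R * h <= T ->
  Ltwo P (fun w => ge h x k w i ord0).
Proof.
move=> h0; elim: k i => [|k IH] i kT; first exact: Ltwo_cst.
have k0 : 0 <= k%:R * h by rewrite mulr_ge0// ltW.
have kk : k%:R * h < k.+1%:R * h by rewrite ltr_pM2r// ltr_nat.
have IHk j := IH j (le_trans (ltW kk) kT).
have := euler_Ltwo cP BM T0 Lb0 bL sL sS ito k0 kk kT (fun i => @grid_euler_adapted h k i h0) IHk i.
by rewrite grid_step.
Qed.

Definition grid_const : R := expR ((1 + 2 * step_const d Ls Lb) * T) *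
  (2 * step_const d Ls Lb * d%:R * forward_const P T S b X * T).

Lemma grid_euler_error h n : 0 < h -> h <= 1 -> n%:R * h = T ->
  \sum_i Ex P (fun w => (X T w i ord0 - ge h x n w i ord0) ^+ 2) <= grid_const * h.
Proof.
move=> h0 h1 nT.
set c := 1 + 2 * step_const d Ls Lb; set C := 2 * step_const d Ls Lb * d%:R * forward_const P T S b X.
have sc : 0 <= step_const d Ls Lb by exact: step_const_ge0.
have fc : 0 <= forward_const P T S b X by exact: forward_const_ge0.
have c0 : 0 <= c by rewrite addr_ge0// mulr_ge0.
have C0 : 0 <= C by rewrite !mulr_ge0.
pose a k := \sum_i Ex P (fun w => (X (k%:R * h) w i ord0 - ge h x k w i ord0) ^+ 2).
have := @discrete_gronwall R a (fun=> C * h ^+ 2) (1 + c * h) n.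
have -> : a n = \sum_i Ex P (fun w => (X T w i ord0 - ge h x n w i ord0) ^+ 2) by rewrite /a nT.
have -> : a 0%N = 0 by rewrite /a big1// => i _; rewrite mul0r; exact: forward_start.
rewrite add0r sumr_const card_ord => H.
have E : C * h ^+ 2 *+ n = C * T * h by rewrite -mulr_natl -nT; ring.
rewrite E in H; apply: (@le_trans _ _ ((1 + c * h) ^+ n * (C * T * h))); last first.
  rewrite /grid_const -/c -/C -[leRHS]mulrA; apply: ler_wpM2r.
    by apply: mulr_ge0 (ltW h0); apply: mulr_ge0.
  by have := expR_bound n c0 (ltW h0); rewrite nT.
apply: H => [|k|k|k kn].
- by rewrite lerDl mulr_ge0// ltW.
- by apply: sumr_ge0 => i _; exact: Ex_sqr_ge0.
- by rewrite mulr_ge0// sqr_ge0.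
have k0 : 0 <= k%:R * h by rewrite mulr_ge0// ltW.
have kk : k%:R * h < k.+1%:R * h by rewrite ltr_pM2r// ltr_nat.
have kT : k.+1%:R * h <= T by rewrite -nT; apply: ler_wpM2r; [exact: ltW|rewrite ler_nat].
have d1 : k.+1%:R * h - k%:R * h <= 1 by rewrite grid_step.
have := euler_error cP BM T0 Ls0 Lb0 S0 bL sL sS aX cX ito eqX k0 kk kT d1
  (fun i => @grid_euler_adapted h k i h0)
  (fun i => @grid_euler_Ltwo h k i h0 (le_trans (ltW kk) kT)).
rewrite grid_step -/c -/C => H1; apply: (le_trans H1).
rewrite -/(a k) mulrDr lerD2l -[leLHS]mul1r; apply: ler_wpM2r; first by rewrite mulr_ge0// sqr_ge0.
by rewrite lerDl mulr_ge0// ltW.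
Qed.

End ForwardGrid.

Section BackwardGrid.
Context {R : realType} {dd : measure_display} {Omega : measurableType dd}.
Context (P : probability Omega R) (d : nat) (B : R -> Omega -> 'cV[R]_d).
Hypotheses (cP : measure_is_complete P) (BM : standard_brownian_motion P B).
Local Notation F := (augmented_filtration P B).
Local Notation leb := (@lebesgue_measure R).
Local Notation nu := (P \x leb)%E.
Local Notation adapted := (adapted P B).
Variables (T k l Ls Lb S : R) (sig : 'cV[R]_d -> 'M[R]_d) (b : 'cV[R]_d -> 'cV[R]_d).
Variables (g : R -> 'cV[R]_d -> R) (phi : 'cV[R]_d -> R).
Variables (x : 'cV[R]_d) (X : R -> Omega -> 'cV[R]_d) (M : 'I_d -> 'I_d -> R -> Omega -> R).
Variables (Y : R -> Omega -> R) (Z : R -> Omega -> 'cV[R]_d) (N : 'I_d -> R -> Omega -> R).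
Hypotheses (T0 : 0 < T) (k0 : 0 < k) (l0 : 0 <= l) (Ls0 : 0 <= Ls) (Lb0 : 0 <= Lb) (S0 : 0 <= S).
Hypothesis bL : forall x x', hsnorm (b x - b x') <= Lb * hsnorm (x - x').
Hypothesis sL : forall x x', hsnorm (sig x - sig x') <= Ls * hsnorm (x - x').
Hypothesis sS : forall x i j, `|sig x i j| <= S.
Hypothesis gL : forall a a' u u',
  `|g a u - g a' u'| <= k * `|a - a'| + l * hsnorm (u - u').
Hypothesis aX : forall i, measurable_adapted F T (fun t w => X t w i ord0).
Hypothesis cX : {ae P, forall w, {within `[0, T], continuous (X ^~ w)}}.
Hypothesis itoX : forall i j, is_ito_integral P F T (fun t w => B t w j ord0)
  (fun t w => sig (X t w) i j) (M i j).
Hypothesis eqX : {ae P, forall w, forall (t : R) i, 0 <= t <= T ->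
  X t w i ord0 = x i ord0 + \sum_(j < d) M i j t w
    + \int[leb]_(s in `[0, t]) b (X s w) i ord0}.
Hypothesis aY : measurable_adapted F T Y.
Hypothesis aZ : forall i, measurable_adapted F T (fun t w => Z t w i ord0).
Hypothesis LY : Ltwo nu (proc_window 0 T Y).
Hypothesis itoZ : forall j, is_ito_integral P F T (fun t w => B t w j ord0)
  (fun t w => Z t w j ord0) (N j).
Hypothesis eqY : {ae P, forall w, forall t : R, 0 <= t <= T ->
  Y t w = phi (X T w) + \int[leb]_(s in `[t, T]) g (Y s w) (Z s w)
    - \sum_(j < d) (N j T w - N j t w)}.
Hypothesis Lphi : Ltwo P (fun w => phi (X T w)).

Let T0' : 0 <= T. Proof. exact: ltW. Qed.
Let G u w := g (Y u w) (Z u w).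

Lemma backward_end : {ae P, forall w, Y T w = phi (X T w)}.
Proof.
have hT : 0 <= T <= T by rewrite T0' lexx.
apply: filterS eqY => w ew; rewrite ew// set_itv1 Rintegral_set1 addr0 big1 ?subr0// => j _.
by rewrite subrr.
Qed.

Variables (phim : 'cV[R]_d -> R) (C m0 K : R).
Hypotheses (m00 : 0 <= m0) (K0 : 0 < K) (lK : 2 * K * d%:R * l <= 4^-1).
Hypothesis phiB : forall x, `|phim x| <= C.
Hypothesis phiL : forall x y, `|phim x - phim y| <= m0 * hsnorm (x - y).

Local Notation al := (step_coef d k l).
Let al0 : 0 <= al.
Proof. by rewrite /step_coef; do ?[exact: sqr_ge0 | exact: ler0n | apply: addr_ge0 | apply: mulr_ge0]. Qed.

Let M1 := expR (k * T) * (C + `|g 0 0| / k).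
Let sb := step_bound k l g M1.
Let sb0 : 0 <= sb.
Proof.
by rewrite /sb /step_bound; do ?[exact: sqr_ge0 | exact: ler0n | apply: addr_ge0 | apply: mulr_ge0].
Qed.

Let ge := grid_euler B b sig.
Let scm h n := scheme P h K (grid_noise B h n) b sig g phim.
Let GG h i := Ex nu (fun z => proc_window (i%:R * h) (i.+1%:R * h) G z ^+ 2).
Let ZZ h i := \sum_(j < d) Ex nu (fun z =>
  proc_window (i%:R * h) (i.+1%:R * h) (fun u w => Z u w j ord0) z ^+ 2).
Let WZ h (c : 'I_d -> nat -> Omega -> R) i := \sum_(j < d) Ex nu (fun z =>
  proc_window (i%:R * h) (i.+1%:R * h) (fun u w => Z u w j ord0 - c j i w) z ^+ 2).
Let err h c i :=
  4 * (k ^+ 2 * (2 * ((2 * (d%:R * ZZ h i) + 2 * (h * GG h i)) * h) + 4 * h ^+ 2 * sb) +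
       l ^+ 2 * (8 * WZ h c i + 6 * (d%:R * (clip_const K * h * (d%:R * ZZ h i))))).
Let D h n i := Ex P (fun w => (Y (i%:R * h) w - scm h n (n - i) (ge h x i w)) ^+ 2).
Let SG := Ex nu (fun z => proc_window 0 T G z ^+ 2).
Let SZ := \sum_(j < d) Ex nu (fun z => proc_window 0 T (fun u w => Z u w j ord0) z ^+ 2).

Section Mesh.
Variables (h : R) (n : nat) (c : 'I_d -> nat -> Omega -> R).
Hypotheses (h0 : 0 < h) (nT : n%:R * h = T) (h2 : h <= 2^-1) (alh : al * h <= 1) (hk : h * k <= 8^-1).
Hypothesis ac : forall j i, adapted (i%:R * h) (c j i).
Hypothesis cb : forall j i, exists C : R, forall w, `|c j i w| <= C.

Let Gz j : gaussian_vector P h (grid_noise B h n j). Proof. exact: gaussian_grid_noise. Qed.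

Let err_ge0 i : 0 <= err h c i.
Proof.
have s (f : 'I_d -> R) : (forall j, 0 <= f j) -> 0 <= \sum_j f j by move=> f0; apply: sumr_ge0.
have kp := ltW (@clip_const_gt0 _ _ K0).
rewrite /err /ZZ /GG /WZ.
by do ?[exact: sqr_ge0 | exact: ler0n | exact: Ex_sqr_ge0 | exact: ltW | exact: sb0 | exact: kp |
  apply: addr_ge0 | apply: s => ? | apply: mulr_ge0].
Qed.

Let backward_grid_step i : (i < n)%N -> D h n i <= (1 + (2 * al + 2) * h) * (D h n i.+1 + err h c i).
Proof.
move=> ln.
have i0 : 0 <= i%:R * h by rewrite mulr_ge0// ltW.
have ii : i%:R * h < i.+1%:R * h by rewrite ltr_pM2r// ltr_nat.
have iT : i.+1%:R * h <= T by rewrite -nT; apply: ler_wpM2r; [exact: ltW|rewrite ler_nat].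
have d1 : i.+1%:R * h - i%:R * h <= 1 by have h2' := h2; rewrite grid_step; lra.
have ai : al * (i.+1%:R * h - i%:R * h) <= 1 by rewrite grid_step.
have mV := vmeasurable_scheme h0 (ltW K0) Gz k0 l0 Lb0 Ls0 m00 bL sL gL phiB phiL hk lK (n - i.+1).
have VM v : `|scm h n (n - i.+1) v| <= M1.
  apply: (scheme_le h0 (ltW K0) Gz k0 l0 Lb0 Ls0 m00 bL sL gL phiB phiL hk lK).
  by rewrite -nT; apply: ler_wpM2r; [exact: ltW|rewrite ler_nat leq_subr].
have := backward_step (phi := phi) (X := X) cP BM T0' (ltW k0) l0 gL aY aZ LY itoZ eqY Lphi
  (vmeasurable_drift bL) (vmeasurable_diffusion sL) i0 ii iT d1 K0
  (fun j => @grid_euler_adapted _ _ _ P d B _ _ sig b x bL sL h i j h0) mV VM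
  (fun j => @ac j i) (fun j => cb j i) ai.
rewrite grid_step -(scheme_grid P B b sig h K g phim ln).
rewrite -/(D h n i) -/(D h n i.+1) -/(err h c i).
have D0 : 0 <= D h n i by exact: Ex_sqr_ge0.
have D1 : 0 <= D h n i.+1 by exact: Ex_sqr_ge0.
move: (err_ge0 i) D0 D1; move: (err h c i) (D h n i) (D h n i.+1) => e x1 x2 e0 x10 x20 H.
have q2 : 0 <= 1 + 2 * h by have := h0; lra.
(* (1 + 2 h)(1 - h) >= 1 for h <= 1/2, which brings the factor 1 - h to the other side. *)
have H1 : x1 <= (1 + 2 * h) * ((1 - h) * x1).
  rewrite mulrA ler_peMl//.
  have := h0; have := h2; nra.
apply: (le_trans H1); apply: le_trans (ler_wpM2l q2 H) _.
have a1 := alh; have a2 := al0; have b0 := h0; have b2 := h2.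
have P1 : (1 + 2 * h) * (1 + al * h) <= 1 + (2 * al + 2) * h.
  have h2' : 0 <= 1 - 2 * h by lra.
  by have := mulr_ge0 (mulr_ge0 a2 (ltW b0)) h2'; lra.
have P2 : 1 + 2 * h <= 1 + (2 * al + 2) * h by nra.
by rewrite mulrDr [leRHS]mulrDr mulrA; apply: lerD; apply: ler_wpM2r.
Qed.

Lemma backward_grid : Ex P (fun w => (Y 0 w - scm h n n x) ^+ 2) <=
  expR ((2 * al + 2) * T) *
  (Ex P (fun w => (phi (X T w) - phim (ge h x n w)) ^+ 2) + \sum_(i < n) err h c i).
Proof.
have b0 : 0 <= 2 * al + 2 by have a0 := al0; lra.
(* The recursion runs from time T down to 0, hence the index n - i. *)
have := @discrete_gronwall R (fun i => D h n (n - i)) (fun i => err h c (n - i.+1)) (1 + (2 * al + 2) * h) n.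
rewrite subnn subn0 => H.
have -> : Ex P (fun w => (Y 0 w - scm h n n x) ^+ 2) = D h n 0 by rewrite /D mul0r subn0.
have <- : D h n n = Ex P (fun w => (phi (X T w) - phim (ge h x n w)) ^+ 2).
  have hT : 0 <= T <= T by rewrite T0' lexx.
  have L1 := backward_rv_Ltwo (phi := phi) (X := X) cP BM T0' (ltW k0) l0 gL aY aZ LY itoZ eqY Lphi hT.
  have mph := continuous_vmeasurable (lipschitz_continuous phiL).
  have mg : coord_measurable (ge h x n).
    by move=> i; exact: (adapted_measurable cP BM (@grid_euler_adapted _ _ _ P d B _ _ sig b x bL sL h n i h0)).
  rewrite /D nT subnn; apply: ae_eq_Ex.
  - by apply: measurable_funX; apply: measurable_funB; [exact: L1.1|exact: mph].
  - by apply: measurable_funX; apply: measurable_funB; [exact: Lphi.1|exact: mph].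
  by apply: filterS backward_end => w ->.
have <- : \sum_(i < n) err h c (n - i.+1) = \sum_(i < n) err h c i.
  by rewrite [RHS](reindex_inj rev_ord_inj).
apply: (@le_trans _ _ ((1 + (2 * al + 2) * h) ^+ n * (D h n n + \sum_(k0 < n) err h c (n - k0.+1)))).
  apply: H => [|i|i|i ln].
  - by rewrite lerDl mulr_ge0// ltW.
  - exact: Ex_sqr_ge0.
  - exact: err_ge0.
  have Ei : (n - i.+1).+1 = (n - i)%N by exact: subnSK.
  have li : (n - i.+1 < n)%N by rewrite Ei leq_subr.
  by have := backward_grid_step li; rewrite Ei.
have p0 : 0 <= D h n n + \sum_(k0 < n) err h c (n - k0.+1).
  by rewrite addr_ge0 ?Ex_sqr_ge0// sumr_ge0.
by apply: ler_wpM2r => //; have := expR_bound n b0 (ltW h0); rewrite nT.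
Qed.

(** Energies summed over cells are at most the total energies, so everything is of order h except
    the freezing error of Z, which is kept as it is. *)
Lemma sum_err : h <= 1 -> \sum_(i < n) err h c i <=
  4 * (k ^+ 2 * (4 * (d%:R * SZ) + 4 * SG + 4 * T * sb) +
    l ^+ 2 * (6 * (d%:R * (clip_const K * (d%:R * SZ))))) * h +
  32 * l ^+ 2 * \sum_(i < n) WZ h c i.
Proof.
move=> h1; have hge := ltW h0.
have nT' : n%:R * h <= T by rewrite nT.
have sZ : \sum_(i < n) ZZ h i <= SZ.
  rewrite /ZZ /SZ exchange_big/=; apply: ler_sum => j _; apply: sum_windows => //.
  exact: (backward_Z_Ltwo cP BM T0' itoZ).
have sG : \sum_(i < n) GG h i <= SG.
  apply: sum_windows => //.
  exact: (backward_generator_Ltwo cP BM T0' (ltW k0) l0 gL aY aZ LY itoZ).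
have G0 : 0 <= \sum_(i < n) GG h i by apply: sumr_ge0 => i _; exact: Ex_sqr_ge0.
have key (z1 z2 w : nat -> R) (a1 a2 a3 a4 a5 : R) :
    \sum_(i < n) (a1 * z1 i + a2 * z2 i + a3 + a4 * z1 i + a5 * w i) =
    a1 * (\sum_(i < n) z1 i) + a2 * (\sum_(i < n) z2 i) + n%:R * a3 + a4 * (\sum_(i < n) z1 i) +
    a5 * (\sum_(i < n) w i).
  by rewrite !big_split/= -!mulr_sumr sumr_const card_ord mulr_natl.
rewrite [leLHS](_ : _ = 4 * (k ^+ 2 * (4 * (d%:R * (\sum_(i < n) ZZ h i)) + 4 * (h * (\sum_(i < n) GG h i)) + 4 * T * sb) +
    l ^+ 2 * (6 * (d%:R * (clip_const K * (d%:R * (\sum_(i < n) ZZ h i)))))) * h +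
  32 * l ^+ 2 * \sum_(i < n) WZ h c i); last first.
  have E i : err h c i = 16 * k ^+ 2 * d%:R * h * ZZ h i + 16 * k ^+ 2 * h ^+ 2 * GG h i +
      16 * k ^+ 2 * (h ^+ 2 * sb) + 24 * l ^+ 2 * d%:R * clip_const K * h * d%:R * ZZ h i +
      32 * l ^+ 2 * WZ h c i.
    rewrite /err; move: (ZZ h i) (GG h i) (WZ h c i) (clip_const K) sb => x1 x2 x3 x4 x5.
    by ring.
  rewrite (eq_bigr _ (fun (i : 'I_n) _ => E i)) key -nT.
  move: (\sum_(i < n) ZZ h i) (\sum_(i < n) GG h i) (\sum_(i < n) WZ h c i) (clip_const K) sb => x1 x2 x3 x4 x5.
  by ring.
rewrite lerD2r ler_wpM2r// ler_wpM2l// lerD//.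
  rewrite ler_wpM2l ?sqr_ge0// lerD2r lerD//; first by rewrite !ler_wpM2l.
  by rewrite ler_wpM2l//; nra.
have kp := ltW (@clip_const_gt0 _ _ K0).
by rewrite ler_wpM2l ?sqr_ge0// ler_wpM2l// ler_wpM2l// ler_wpM2l// ler_wpM2l.
Qed.

End Mesh.

(** The terminal value [phim] of the scheme is Lipschitz, while [phi] belongs to the equation; they
    are compared only at X_T, without a rate in h. *)
Lemma scheme_convergence e : 0 < e -> exists2 h1 : R, 0 < h1 &
  forall h n, 0 < h -> h <= h1 -> n%:R * h = T ->
  Ex P (fun w => (Y 0 w - scm h n n x) ^+ 2) <=
  2 * expR ((2 * al + 2) * T) * Ex P (fun w => (phi (X T w) - phim (X T w)) ^+ 2) + e.
Proof.
move=> e0; have a0 := al0.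
set E := expR _; have E0 : 0 < E by exact: expR_gt0.
set CE := 4 * (k ^+ 2 * (4 * (d%:R * SZ) + 4 * SG + 4 * T * sb) +
    l ^+ 2 * (6 * (d%:R * (clip_const K * (d%:R * SZ))))).
have SZ0 : 0 <= SZ by apply: sumr_ge0 => j _; exact: Ex_sqr_ge0.
have SG0 : 0 <= SG by exact: Ex_sqr_ge0.
have kp := ltW (@clip_const_gt0 _ _ K0).
have CE0 : 0 <= CE.
  rewrite /CE; do ?[exact: sqr_ge0 | exact: ler0n | exact: SZ0 | exact: SG0 | exact: T0' | exact: sb0 |
    exact: kp | apply: addr_ge0 | apply: mulr_ge0].
pose CF := 2 * m0 ^+ 2 * grid_const P T Ls Lb S b X.
have CF0 : 0 <= CF.
  have sc : 0 <= step_const d Ls Lb by exact: step_const_ge0.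
  have fc : 0 <= forward_const P T S b X by exact: forward_const_ge0.
  rewrite /CF /grid_const; do ?[exact: sqr_ge0 | exact: ler0n | exact: T0' | exact: sc | exact: fc |
    exact: expR_ge0 | apply: mulr_ge0].
have q0 : 0 <= 32 * l ^+ 2 * d%:R by rewrite !mulr_ge0// sqr_ge0.
set q := 32 * l ^+ 2 * d%:R in q0.
have q1 : 0 < q + 1 by rewrite ltr_wpDl.
(* Half of e is spent on freezing Z (F3), half on the terms of order h (F4); q + 1 avoids a division
   by 0. *)
pose e' := e / (2 * E * (q + 1)).
have e'0 : 0 < e' by rewrite divr_gt0// !mulr_gt0.
have [h2 h20 Hc] := ito_frozen_family cP BM T0' itoZ e'0.
pose Q := 2 * E * (CE + CF) / e.
have Q0 : 0 <= Q by rewrite divr_ge0 ?(ltW e0)// mulr_ge0 ?addr_ge0// mulr_ge0// ltW.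
have h2i : 0 < h2^-1 by rewrite invr_gt0.
have S0' : 0 < 2 + al + 8 * k + Q + h2^-1 by have := k0; lra.
(* The inverse of the sum of the reciprocals of all thresholds on h. *)
exists (2 + al + 8 * k + Q + h2^-1)^-1; first by rewrite invr_gt0.
move=> h n h0 hh nT.
have hS : h * (2 + al + 8 * k + Q + h2^-1) <= 1 by rewrite -ler_pdivlMr// mul1r.
have ha : 0 <= h * al by rewrite mulr_ge0// ltW.
have hkk : 0 <= h * k by rewrite mulr_ge0// ltW.
have hQ : 0 <= h * Q by rewrite mulr_ge0// ltW.
have hi : 0 <= h * h2^-1 by rewrite mulr_ge0// ltW.
have B1 : h <= 2^-1 by move: hS ha hkk hQ hi; lra.
have B2 : al * h <= 1 by move: hS ha hkk hQ hi h0; lra.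
have B3 : h * k <= 8^-1 by move: hS ha hkk hQ hi h0; lra.
have B4 : h <= h2.
  have : h * h2^-1 <= 1 by move: hS ha hkk hQ hi h0; lra.
  by rewrite ler_pdivrMr// mul1r.
have B5 : h * Q <= 1 by move: hS ha hkk hQ hi h0; lra.
have B6 : h <= 1 by move: B1; lra.
have nT' : n%:R * h <= T by rewrite nT.
have [c [ac cb Sc]] := Hc h n h0 B4 nT'.
apply: le_trans (backward_grid h0 nT B1 B2 B3 ac cb) _; rewrite -/E.
have SE := sum_err c h0 nT B6; rewrite -/CE in SE.
have LX i : Ltwo P (fun w => X T w i ord0).
  by apply: (forward_rv_Ltwo cP BM T0' Lb0 bL aX cX itoX eqX); rewrite T0' lexx.
have Lge i : Ltwo P (fun w => ge h x n w i ord0).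
  exact: (grid_euler_Ltwo cP BM x T0' Lb0 bL sL sS itoX i h0 nT').
have mph := continuous_vmeasurable (lipschitz_continuous phiL).
have L1 : Ltwo P (fun w => phim (X T w)).
  by apply: (@Ltwo_bounded _ _ _ P C) => //; apply: mph => i; exact: (LX i).1.
have L2 : Ltwo P (fun w => phim (ge h x n w)).
  by apply: (@Ltwo_bounded _ _ _ P C) => //; apply: mph => i; exact: (Lge i).1.
have F1 : Ex P (fun w => (phi (X T w) - phim (ge h x n w)) ^+ 2) <=
    2 * Ex P (fun w => (phi (X T w) - phim (X T w)) ^+ 2) +
    2 * Ex P (fun w => (phim (X T w) - phim (ge h x n w)) ^+ 2).
  have := Ex_sqrD_le (LtwoB Lphi L1) (LtwoB L1 L2).
  move=> H; apply: le_trans H; rewrite le_eqVlt; apply/orP; left; apply/eqP.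
  by apply: eq_Ex => w; move: (phi _) (phim _) (phim _) => x1 x2 x3; ring.
have F2 : Ex P (fun w => (phim (X T w) - phim (ge h x n w)) ^+ 2) <= m0 ^+ 2 * (grid_const P T Ls Lb S b X * h).
  have := grid_euler_error cP BM T0' Ls0 Lb0 S0 bL sL sS aX cX itoX eqX h0 B6 nT.
  move=> H; apply: le_trans (ler_wpM2l (sqr_ge0 m0) H).
  have LD i : Ltwo P (fun w => X T w i ord0 - ge h x n w i ord0) by exact: LtwoB.
  rewrite -Ex_sum; last by move=> i _; exact: (LD i).2.
  have Ls2 : Lone P (fun w => \sum_i (X T w i ord0 - ge h x n w i ord0) ^+ 2).
    by apply: Lone_sum => i _; exact: (LD i).2.
  rewrite -ExZ//; apply: Ex_le => [||w]; [exact: (LtwoB L1 L2).2|exact: LoneZ|].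
  have := phiL (X T w) (ge h x n w) => H1.
  rewrite -[leLHS]real_normK ?num_real//.
  apply: (@le_trans _ _ ((m0 * hsnorm (X T w - ge h x n w)) ^+ 2)).
    by rewrite lerXn2r ?nnegrE// mulr_ge0// hsnorm_ge0.
  by rewrite exprMn hsnorm_sqrv ler_wpM2l ?sqr_ge0//; apply: ler_sum => i _; rewrite !mxE.
have F3 : E * (q * e') <= e / 2.
  rewrite /e' (_ : E * (q * (e / (2 * E * (q + 1)))) = e / 2 * (q / (q + 1))); last first.
    by field; rewrite !gt_eqF.
  rewrite ler_piMr ?divr_ge0 ?(ltW e0)//.
  by rewrite ler_pdivrMr// mul1r lerDl.
have F4 : E * ((CE + CF) * h) <= e / 2.
  have := B5; rewrite /Q => B5'.
  have -> : E * ((CE + CF) * h) = h * (2 * E * (CE + CF) / e) * (e / 2).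
    by field; rewrite gt_eqF.
  by rewrite ler_piMl// divr_ge0// ltW.
have F5 : 32 * l ^+ 2 * (\sum_(i < n) WZ h c i) <= q * e'.
  rewrite /q -[leRHS]mulrA ler_wpM2l// mulr_ge0// sqr_ge0//.
have EE := ltW E0.
set A := Ex P (fun w => (phi (X T w) - phim (X T w)) ^+ 2) in F1 *.
apply: (@le_trans _ _ (E * (2 * A + (CE + CF) * h + q * e'))); last first.
  by rewrite !mulrDr; move: F3 F4; lra.
rewrite ler_wpM2l//; move: F1 F2 SE F5; rewrite /CF; lra.
Qed.

End BackwardGrid.

(** * Value function *)

Section LipschitzApproximation.
Context {R : realType} {d : nat}.
Variables (phi : 'cV[R]_d -> R) (C : R).
Hypotheses (cphi : continuous phi) (phiC : forall x, `|phi x| <= C).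

(** The largest m-Lipschitz function below phi (Pasch-Hausdorff envelope); it keeps the bound of
    phi. *)
Definition inf_convolution (m : nat) x : R := inf (range (fun y => phi y + m%:R * hsnorm (x - y))).
Local Notation f := inf_convolution.

Let lowC y : - C <= phi y. Proof. by have := phiC y; rewrite ler_norml => /andP[]. Qed.
Let uppC y : phi y <= C. Proof. by have := phiC y; rewrite ler_norml => /andP[]. Qed.

Let lower m x y : - C <= phi y + m%:R * hsnorm (x - y).
Proof. by rewrite (le_trans (lowC y))// lerDl mulr_ge0// hsnorm_ge0. Qed.

Lemma inf_convolution_le m x y : f m x <= phi y + m%:R * hsnorm (x - y).
Proof. by apply: ge_inf; [exists (- C) => _ [z _ <-]|exists y]. Qed.

Lemma inf_convolution_ge m x c : (forall y, c <= phi y + m%:R * hsnorm (x - y)) -> c <= f m x.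
Proof. by move=> H; apply: lb_le_inf; [exists (phi x + m%:R * hsnorm (x - x)), x|move=> _ [y _ <-]]. Qed.

Lemma inf_convolution_le_self m x : f m x <= phi x.
Proof. by have := inf_convolution_le m x x; rewrite subrr hsnorm0 mulr0 addr0. Qed.

Lemma inf_convolution_bound m x : `|f m x| <= C.
Proof.
rewrite ler_norml; apply/andP; split; last exact: le_trans (inf_convolution_le_self m x) (uppC x).
by apply: inf_convolution_ge => y; exact: lower.
Qed.

Lemma inf_convolution_lipschitz m x y : `|f m x - f m y| <= m%:R * hsnorm (x - y).
Proof.
have H u v : f m u - f m v <= m%:R * hsnorm (u - v).
  rewrite lerBlDr -lerBlDl; apply: inf_convolution_ge => z.
  rewrite lerBlDl; apply: le_trans (inf_convolution_le m u z) _.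
  rewrite addrCA lerD2l -mulrDr ler_wpM2l//.
  by have := ler_hsnormD (u - v) (v - z); rewrite addrA subrK.
by rewrite ler_norml H andbT lerNl opprB hsnorm_distC.
Qed.

Lemma inf_convolution_cvg x (e : R) : 0 < e -> exists N : nat, forall m, (N <= m)%N -> phi x - e <= f m x.
Proof.
move=> e0; have /continuous_hs/(_ x e e0)[r r0 Hr] := cphi.
have C0 : 0 <= C by apply: le_trans (phiC x).
(* For |x - y| >= r the penalty is at least 2 C, so such y cannot bring the infimum below phi(x). *)
exists (Num.bound (2 * C / r)) => m Nm; apply: inf_convolution_ge => y.
case: (ltP (hsnorm (x - y)) r) => xy.
  have := Hr _ xy; have n0 : 0 <= m%:R * hsnorm (x - y) by rewrite mulr_ge0// hsnorm_ge0.
  by rewrite ltr_norml => /andP[_]; lra.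
have h1 : 2 * C <= m%:R * r.
  rewrite -ler_pdivrMr//.
  have q0 : 0 <= 2 * C / r by rewrite divr_ge0 ?(ltW r0)// mulr_ge0.
  apply: le_trans (ltW (archi_boundP q0)) _; by rewrite ler_nat.
have h2 : m%:R * r <= m%:R * hsnorm (x - y) by rewrite ler_wpM2l.
have := lowC y; have := uppC x; lra.
Qed.

End LipschitzApproximation.

Section MeanSquare.
Context {R : realType} {dd : measure_display} {Omega : measurableType dd}.
Context (P : probability Omega R).

Lemma inf_convolution_sqr_cvg d (phi : 'cV[R]_d -> R) (C : R) (V : Omega -> 'cV[R]_d) (e : R) :
  continuous phi -> (forall x, `|phi x| <= C) -> coord_measurable V -> 0 < e ->
  exists N : nat, forall m, (N <= m)%N ->
    Ex P (fun w => (phi (V w) - inf_convolution phi m (V w)) ^+ 2) <= e.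
Proof.
move=> cphi phiC mV e0; pose f := inf_convolution phi.
have mf m : measurable_fun setT (fun w => f m (V w)).
  exact: (continuous_vmeasurable (lipschitz_continuous (inf_convolution_lipschitz phiC m)) mV).
have mp : measurable_fun setT (fun w => phi (V w)) by exact: (continuous_vmeasurable cphi).
have C0 : 0 <= C by apply: le_trans (phiC 0).
have m2 m : measurable_fun setT (fun w => (phi (V w) - f m (V w)) ^+ 2).
  by apply: measurable_funX; exact: measurable_funB.
have b2 m w : `|(phi (V w) - f m (V w)) ^+ 2| <= (2 * C) ^+ 2.
  rewrite ger0_norm ?sqr_ge0// -[leLHS]real_normK ?num_real// lerXn2r ?nnegrE//.
    by rewrite mulr_ge0.
  apply: le_trans (ler_normB _ _) _; have := phiC (V w); have := inf_convolution_bound phiC m (V w).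
  by rewrite -/f; lra.
have L2 m : Lone P (fun w => (phi (V w) - f m (V w)) ^+ 2) := Lone_bounded P (m2 m) (b2 m).
have cv : (fun m => \int[P]_w ((phi (V w) - f m (V w)) ^+ 2)%:E)%E @ \oo --> (\int[P]_w (0 : \bar R))%E.
  apply: (@dominated_cvg _ _ _ P setT measurableT (fun m w => ((phi (V w) - f m (V w)) ^+ 2)%:E)
    (fun=> 0%E) (fun=> ((2 * C) ^+ 2)%:E)).
  - by move=> m; apply/measurable_EFinP.
  - move=> w _; apply/fine_cvgP; split; first exact: nearW.
    apply/cvgrPdist_le => r r0.
    have s0 : 0 < Num.sqrt r by rewrite sqrtr_gt0.
    have [N HN] := inf_convolution_cvg cphi phiC (V w) s0.
    exists N => // m /= Nm; have := HN m Nm; have := inf_convolution_le_self phiC m (V w).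
    rewrite -/f sub0r normrN ger0_norm ?sqr_ge0// => h1 h2.
    rewrite -[leRHS]sqr_sqrtr ?(ltW r0)// lerXn2r ?nnegrE ?(ltW s0)//; first by rewrite subr_ge0.
    by lra.
  - by [].
  - exact: Lone_cst.
  - by move=> m w _; rewrite lee_fin.
rewrite integral0 in cv; have [N _ HN] := eventually_lt cv e0.
exists N => m Nm; have := HN m Nm; rewrite /= -EFin_Ex// lte_fin; exact: ltW.
Qed.

Lemma Ex_sqr_eq0 (f : Omega -> R) : Ltwo P f -> Ex P (fun w => f w ^+ 2) <= 0 ->
  {ae P, forall w, f w = 0}.
Proof.
move=> Lf E0; have E : Ex P (fun w => f w ^+ 2) = 0 by apply/eqP; rewrite eq_le E0 Ex_sqr_ge0.
have m2 : measurable_fun setT (fun w => (f w ^+ 2)%:E) by apply/measurable_EFinP; exact: Lone_meas Lf.2.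
have [+ _] := ae_eq_integral_abs P measurableT m2.
have -> : (\int[P]_w `|(f w ^+ 2)%:E|)%E = 0%E.
  under eq_integral do rewrite gee0_abs ?lee_fin ?sqr_ge0//.
  by rewrite -(EFin_Ex Lf.2) E.
move=> /(_ erefl); apply: filterS => w /(_ I) /eqP.
by rewrite eqe sqrf_eq0 => /eqP.
Qed.

(** E (f - c)^2 is the variance of f plus (E f - c)^2. As the scheme is a constant c, its
    convergence controls both terms. *)
Lemma Ex_sub_cst (f : Omega -> R) c : Ltwo P f ->
  Ex P (fun w => (f w - Ex P f) ^+ 2) <= Ex P (fun w => (f w - c) ^+ 2) /\
  (Ex P f - c) ^+ 2 <= Ex P (fun w => (f w - c) ^+ 2).
Proof.
move=> Lf; have E a : Ex P (fun w => (f w - a) ^+ 2) = Ex P (fun w => f w ^+ 2) - 2 * (a * Ex P f) + a ^+ 2.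
  rewrite (Ex_sqrB Lf (Ltwo_cst P a)) Ex_cst; congr (_ - 2 * _ + _).
  by under eq_Ex do rewrite mulrC; rewrite (ExZ _ (Ltwo_Lone Lf)).
split; rewrite !E; first by have := sqr_ge0 (Ex P f - c); lra.
by have := Ex_sqr_le Lf; lra.
Qed.

End MeanSquare.

Section Value.
Context {R : realType} {dd : measure_display} {Omega : measurableType dd}.
Context (P : probability Omega R) (d : nat) (B : R -> Omega -> 'cV[R]_d).
Hypotheses (cP : measure_is_complete P) (BM : standard_brownian_motion P B).
Variables (T k l Ls Lb S C : R) (sig : 'cV[R]_d -> 'M[R]_d) (b : 'cV[R]_d -> 'cV[R]_d).
Variables (g : R -> 'cV[R]_d -> R) (phi : 'cV[R]_d -> R).
Hypotheses (T0 : 0 < T) (k0 : 0 < k) (l0 : 0 <= l) (Ls0 : 0 <= Ls) (Lb0 : 0 <= Lb) (S0 : 0 <= S).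
Hypothesis bL : forall x x', hsnorm (b x - b x') <= Lb * hsnorm (x - x').
Hypothesis sL : forall x x', hsnorm (sig x - sig x') <= Ls * hsnorm (x - x').
Hypothesis sS : forall x i j, `|sig x i j| <= S.
Hypothesis gL : forall a a' u u',
  `|g a u - g a' u'| <= k * `|a - a'| + l * hsnorm (u - u').
Hypotheses (cphi : continuous phi) (phiC : forall x, `|phi x| <= C).

(** Dictated by 2 K d l <= 1/4 alone, hence independent of the mesh and of the terminal value. *)
Let K := (8 * d%:R * l + 1)^-1.
Let D0 : 0 < 8 * d%:R * l + 1 :> R. Proof. by rewrite ltr_wpDl// !mulr_ge0. Qed.
Let K0 : 0 < K. Proof. by rewrite invr_gt0. Qed.
Let lK : 2 * K * d%:R * l <= 4^-1.
Proof.
rewrite (_ : 2 * K * d%:R * l = 2 * d%:R * l / (8 * d%:R * l + 1)); last by rewrite /K; ring.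
by rewrite ler_pdivrMr//; lra.
Qed.

Let fm := inf_convolution phi.
Let fL m x y : `|fm m x - fm m y| <= m%:R * hsnorm (x - y).
Proof. exact: inf_convolution_lipschitz. Qed.
Let fC m x : `|fm m x| <= C. Proof. exact: inf_convolution_bound. Qed.
Let s h n m := scheme P h K (grid_noise B h n) b sig g (fm m) n.

Let mesh (h1 : R) : 0 < h1 -> exists h n, [/\ 0 < h, h <= h1 & n%:R * h = T].
Proof.
move=> h10; have q0 : 0 <= T / h1 by rewrite divr_ge0 ?ltW.
have Hn := archi_boundP q0; set n := Num.bound _ in Hn.
have n0 : 0 < n%:R :> R by apply: le_lt_trans Hn.
exists (T / n%:R), n; split; first exact: divr_gt0.
  by rewrite ler_pdivrMr// mulrC -ler_pdivrMr// ltW.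
by rewrite mulrC divfK// gt_eqF.
Qed.

Section OneSolution.
Variables (x : 'cV[R]_d) (X : R -> Omega -> 'cV[R]_d) (Y : R -> Omega -> R) (Z : R -> Omega -> 'cV[R]_d).
Hypothesis sol : fbsde_solution P B T sig b g phi x X Y Z.

(** The index m is chosen before the mesh, since the admissible mesh depends on the Lipschitz
    constant m of the regularised terminal value. *)
Lemma value_scheme (e : R) : 0 < e -> exists N : nat, forall m, (N <= m)%N ->
  exists2 h1 : R, 0 < h1 & forall h n, 0 < h -> h <= h1 -> n%:R * h = T ->
  Ltwo P (Y 0) /\ Ex P (fun w => (Y 0 w - s h n m x) ^+ 2) <= e.
Proof.
move=> e0; have [[aX cX [M [itoX eqX]]] [[aY aZ] _ LY _ [N [itoZ eqY]]]] := sol.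
have T0' := ltW T0; have hT : 0 <= T <= T by rewrite T0' lexx.
have h0 : 0 <= (0 : R) <= T by apply/andP; split.
have LX i : Ltwo P (fun w => X T w i ord0).
  exact: (forward_rv_Ltwo cP BM T0' Lb0 bL aX cX itoX eqX).
have mX : coord_measurable (X T) by move=> i; exact: (LX i).1.
have Lphi : Ltwo P (fun w => phi (X T w)).
  by apply: (@Ltwo_bounded _ _ _ P C) => //; exact: (continuous_vmeasurable cphi).
have LY' : Ltwo (P \x lebesgue_measure)%E (proc_window 0 T Y).
  have [L1 _] := Ltwo_proc_on aY.1 LY.
  by have [] := Ltwo_proc_window (lexx 0) (lexx T) L1.
have LY0 := backward_rv_Ltwo (phi := phi) (X := X) cP BM T0' (ltW k0) l0 gL aY aZ LY' itoZ eqY Lphi h0.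
set A := 2 * expR ((2 * step_coef d k l + 2) * T).
have A0 : 0 < A by rewrite mulr_gt0// expR_gt0.
have e2 : 0 < e / 2 by rewrite divr_gt0.
have [m1 Hm] := inf_convolution_sqr_cvg P cphi phiC mX (divr_gt0 e2 A0).
exists m1 => m mm.
have [h1 h10 H] := scheme_convergence (phi := phi) (X := X) cP BM T0 k0 l0 Ls0 Lb0 S0 bL sL sS gL
  aX cX itoX eqX aY aZ LY' itoZ eqY Lphi (ler0n R m) K0 lK (fC m) (fL m) e2.
exists h1 => // h n hp hh nT; split=> //; apply: le_trans (H h n hp hh nT) _.
have := ler_wpM2l (ltW A0) (Hm m mm); rewrite -/A.
rewrite (_ : A * (e / 2 / A) = e / 2); last by field; rewrite gt_eqF.
by move: (Ex P _) => x1; lra.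
Qed.

Lemma value_ae : {ae P, forall w, Y 0 w = Ex P (Y 0)}.
Proof.
have LY : Ltwo P (Y 0).
  have [N /(_ N (leqnn N))[h1 h10 H]] := value_scheme ltr01.
  by have [h [n [a1 a2 a3]]] := mesh h10; case: (H h n a1 a2 a3).
have L1 := LtwoB LY (Ltwo_cst P (Ex P (Y 0))).
have E0 : Ex P (fun w => (Y 0 w - Ex P (Y 0)) ^+ 2) <= 0.
  apply/ler_addgt0Pr => e e0; rewrite add0r.
  have [N /(_ N (leqnn N))[h1 h10 H]] := value_scheme e0.
  have [h [n [a1 a2 a3]]] := mesh h10; have [_ E] := H h n a1 a2 a3.
  by have [E1 _] := Ex_sub_cst (s h n N x) LY; exact: le_trans E1 E.
by apply: filterS (Ex_sqr_eq0 L1 E0) => w /eqP; rewrite subr_eq0 => /eqP.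
Qed.

Lemma value_scheme_mean (e : R) : 0 < e -> exists N : nat, forall m, (N <= m)%N ->
  exists2 h1 : R, 0 < h1 & forall h n, 0 < h -> h <= h1 -> n%:R * h = T ->
  `|Ex P (Y 0) - s h n m x| <= e.
Proof.
move=> e0; have [N H] := value_scheme (exprn_gt0 2 e0).
exists N => m Nm; have [h1 h10 H1] := H m Nm; exists h1 => // h n hp hh nT.
have [LY E] := H1 h n hp hh nT; have [_ E1] := Ex_sub_cst (s h n m x) LY.
have := le_trans E1 E; rewrite -[leLHS]real_normK ?num_real// ler_sqr ?nnegrE ?(ltW e0)//.
Qed.

End OneSolution.

Lemma value_estimate (lam M L : R) x y X Y Z X' Y' Z' :
  fbsde_solution P B T sig b g phi x X Y Z -> fbsde_solution P B T sig b g phi y X' Y' Z' ->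
  0 < lam -> (forall v, loewner_le lam%:M (sig v)) ->
  C + `|g 0 0| / k <= M -> 0 < M -> 2 * (Lb + l * Ls) + 3 / 2 * Ls ^+ 2 <= L ->
  `|Ex P (Y 0) - Ex P (Y' 0)| <=
    expR (k * T) * (scheme_const d k l lam * M * Num.sqrt (1 + T) / Num.sqrt (decay_factor L T)
      * hsnorm (x - y)).
Proof.
move=> sx sy lam0 ell MC M0 LE; set rhs := expR _ * _.
have C0 : 0 <= C by apply: le_trans (phiC 0).
apply/ler_addgt0Pr => e e0; have e2 : 0 < e / 2 by rewrite divr_gt0.
have [N1 H1] := value_scheme_mean sx e2; have [N2 H2] := value_scheme_mean sy e2.
(* A common index and a common mesh make both approximations values of one and the same scheme
   function, at x and at y. *)
pose m := maxn N1 N2.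
have [h1 h10 {}H1] := H1 m (leq_maxl _ _); have [h2 h20 {}H2] := H2 m (leq_maxr _ _).
have [h3 h30 H3] := scheme_estimate P k0 l0 lam0 Lb0 Ls0 C0 (ler0n R m) ell bL sL gL (fC m) (fL m) MC M0 LE T0.
have hm : 0 < Num.min h1 (Num.min h2 h3) by rewrite !lt_min h10 h20.
have [h [n [hp hh nT]]] := mesh hm.
move: hh; rewrite !le_min => /and3P[hh1 hh2 hh3].
have {}H1 := H1 h n hp hh1 nT; have {}H2 := H2 h n hp hh2 nT.
have {}H3 := H3 h n K (grid_noise B h n) hp hh3 nT (ltW K0) lK (fun j => gaussian_grid_noise BM n j hp) x y.
rewrite -/rhs -/(s h n m) in H3.
move: H1 H2 H3; move: (Ex P _) (Ex P _) (s _ _ _ _) (s _ _ _ _) rhs => x1 x2 x3 x4 x5 H1 H2 H3.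
have -> : x2 - x1 = (x2 - x4) + (x4 - x3) + (x3 - x1) by ring.
have := ler_normD (x2 - x4 + (x4 - x3)) (x3 - x1); have := ler_normD (x2 - x4) (x4 - x3).
by rewrite (distrC x3 x1); lra.
Qed.

End Value.

(** * Absorption of the time factor and conclusion *)

Section Growth.
Context {R : realType}.

(** Trades the factor sqrt(1 + T) of [value_estimate] for exp(4 L_g^2 T), the surplus of mu over
    K_g. *)
Lemma sqrt1D_le_expR (a t : R) : 0 < a -> 0 <= t -> Num.sqrt (1 + t) <= (1 + a^-1) * expR (a * t).
Proof.
move=> a0 t0; have t1 : 1 <= 1 + t by rewrite lerDl.
have h1 : Num.sqrt (1 + t) <= 1 + t.
  have p0 : 0 <= 1 + t by lra.
  rewrite -{2}(ger0_norm p0) -sqrtr_sqr ler_sqrt ?sqr_ge0//.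
  by rewrite expr2 ler_peMl.
apply: (le_trans h1).
have ai : 0 < a^-1 by rewrite invr_gt0.
apply: (@le_trans _ _ ((1 + a^-1) * (1 + a * t))).
  rewrite (_ : (1 + a^-1) * (1 + a * t) = 1 + t + (a^-1 + a * t)); last by field; rewrite gt_eqF.
  by rewrite lerDl addr_ge0// ?(ltW ai)// mulr_ge0// ltW.
by rewrite ler_wpM2l ?expR_ge1Dx// addr_ge0// ltW.
Qed.

End Growth.

Theorem theorem3p1 (R : realType) (d : nat)
    (Lambda_sigma lambda_sigma K_g L_g g0 : R)
    (lambda_gt0 : 0 < lambda_sigma) (lambda_le : lambda_sigma <= Lambda_sigma)
    (K_g_gt0 : 0 < K_g) (L_g_gt0 : 0 < L_g) :
  exists C : R, 0 < C /\
  forall (dd : measure_display) (Omega : measurableType dd)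
    (P : probability Omega R) (B : R -> Omega -> 'cV[R]_d)
    (T L_sigma L_b : R) (sigma : 'cV[R]_d -> 'M[R]_d)
    (b : 'cV[R]_d -> 'cV[R]_d) (g : R -> 'cV[R]_d -> R)
    (phi : 'cV[R]_d -> R)
    (X : 'cV[R]_d -> R -> Omega -> 'cV[R]_d)
    (Y : 'cV[R]_d -> R -> Omega -> R)
    (Z : 'cV[R]_d -> R -> Omega -> 'cV[R]_d),
  measure_is_complete P ->
  standard_brownian_motion P B ->
  0 < T ->
  (forall x, sigma x \is symmetricmx) ->
  (forall x x', hsnorm (sigma x - sigma x') <= L_sigma * hsnorm (x - x')) ->
  (forall x x', hsnorm (b x - b x') <= L_b * hsnorm (x - x')) ->
  (forall x, loewner_le (lambda_sigma%:M) (sigma x) /\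
             loewner_le (sigma x) (Lambda_sigma%:M)) ->
  (forall y y' z z',
     `|g y z - g y' z'| <= K_g * `|y - y'| + L_g * hsnorm (z - z')) ->
  g 0 0 = g0 ->
  Cb phi ->
  (forall x, fbsde_solution P B T sigma b g phi x (X x) (Y x) (Z x)) ->
  let mu := K_g + 4 * L_g ^+ 2 in
  let L := 2 * (L_g * L_sigma + L_b + 2 * L_sigma ^+ 2) in
  exists u : 'cV[R]_d -> R,
    (forall x, {ae P, forall w, Y x 0 w = u x}) /\
    forall x y,
      `|u x - u y| <= C * (supnorm phi + `|g0| / mu)
        * (expR (mu * T) / Num.sqrt (decay_factor L T)) * hsnorm (x - y).
Proof.
have a0 : 0 < 4 * L_g ^+ 2 by rewrite mulr_gt0// exprn_gt0.
pose sc := scheme_const d K_g L_g lambda_sigma.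
have sc0 : 0 < sc.
  rewrite /sc /scheme_const ltr_wpDr//; first by rewrite divr_ge0 ?sqr_ge0// !mulr_ge0.
  by rewrite ltr_wpDl// !addr_ge0// !mulr_ge0 ?sqr_ge0 ?addr_ge0// ltW.
pose mu' := K_g + 4 * L_g ^+ 2.
have mu0 : 0 < mu' by rewrite addr_gt0.
(* The estimate produces |g0| / K_g; this equals kap |g0| / mu, and kap >= 1 lets the same factor
   multiply the norm of phi. *)
pose kap := mu' / K_g.
have kap1 : 1 <= kap by rewrite ler_pdivlMr// mul1r lerDl ltW.
have kap0 : 0 < kap by exact: lt_le_trans kap1.
pose A := 1 + (4 * L_g ^+ 2)^-1.
have A0 : 0 < A by rewrite addr_gt0// invr_gt0.
exists (sc * kap * A); split; first by apply: mulr_gt0 A0; apply: mulr_gt0.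
move=> dd Omega P B T Ls Lb sig b g phi X Y Z cP BM T0 sym sL bL ell gL g00 [cphi [C0 phiC0]] sol mu L.
have sS v i j : `|sig v i j| <= 2 * Lambda_sigma.
  by have [lo hi] := ell v; exact: (loewner_entry_bounded (sym v) (ltW lambda_gt0) lo hi).
have S0 : 0 <= 2 * Lambda_sigma by rewrite mulr_ge0// (le_trans (ltW lambda_gt0)).
pose C := supnorm phi.
have phiC v : `|phi v| <= C.
  by apply: ub_le_sup; [exists C0 => _ [w _ <-]|exists v].
have Cge : 0 <= C by apply: le_trans (phiC 0).
(* Absolute values suffice for almost sure constancy; the sign of the given constants is known only
   once two distinct points are at hand. *)
have nb v v' : hsnorm (b v - b v') <= `|Lb| * hsnorm (v - v').
  by apply: le_trans (bL v v') _; rewrite ler_wpM2r ?hsnorm_ge0// ler_norm.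
have ns v v' : hsnorm (sig v - sig v') <= `|Ls| * hsnorm (v - v').
  by apply: le_trans (sL v v') _; rewrite ler_wpM2r ?hsnorm_ge0// ler_norm.
exists (fun x => Ex P (Y x 0)); split.
  move=> x; exact: (value_ae cP BM T0 K_g_gt0 (ltW L_g_gt0) (normr_ge0 _) (normr_ge0 _) S0
    nb ns sS gL cphi phiC (sol x)).
move=> x y; have [->|xy] := eqVneq x y.
  by rewrite !subrr normr0 hsnorm0 mulr0.
have hxy : 0 < hsnorm (x - y).
  rewrite lt_neqAle hsnorm_ge0 andbT eq_sym; apply: contra_neq xy => /hsnorm0_eq0/eqP.
  by rewrite subr_eq0 => /eqP.
have Ls0 : 0 <= Ls.
  by rewrite -(pmulr_lge0 _ hxy); apply: le_trans (sL x y); exact: hsnorm_ge0.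
have Lb0 : 0 <= Lb.
  by rewrite -(pmulr_lge0 _ hxy); apply: le_trans (bL x y); exact: hsnorm_ge0.
have LE : 2 * (Lb + L_g * Ls) + 3 / 2 * Ls ^+ 2 <= L.
  by rewrite /L; have := sqr_ge0 Ls; lra.
have L0 : 0 <= L.
  by rewrite /L mulr_ge0// !addr_ge0// ?mulr_ge0 ?sqr_ge0// ltW.
have dec0 : 0 < Num.sqrt (decay_factor L T) by rewrite sqrtr_gt0 decay_factor_gt0.
pose W := Num.sqrt (1 + T) / Num.sqrt (decay_factor L T) * hsnorm (x - y).
have W0 : 0 <= W by rewrite mulr_ge0 ?hsnorm_ge0// divr_ge0 ?sqrtr_ge0.
(* The strict inequality provides M > 0 even if phi and g0 vanish; the limit is taken next. *)
have est M : C + `|g 0 0| / K_g < M -> `|Ex P (Y x 0) - Ex P (Y y 0)| <= expR (K_g * T) * (sc * M * W).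
  move=> CM; have M0 : 0 < M.
    by apply: le_lt_trans CM; rewrite addr_ge0// divr_ge0// ltW.
  have := value_estimate cP BM T0 K_g_gt0 (ltW L_g_gt0) Ls0 Lb0 S0 bL sL sS gL cphi phiC
    (sol x) (sol y) lambda_gt0 (fun v => (ell v).1) (ltW CM) M0 LE.
  by rewrite /W /sc !mulrA.
have {}est : `|Ex P (Y x 0) - Ex P (Y y 0)| <= expR (K_g * T) * (sc * (C + `|g 0 0| / K_g) * W).
  have q0 : 0 <= expR (K_g * T) * (sc * W) by rewrite mulr_ge0 ?expR_ge0// mulr_ge0// ltW.
  set q := expR (K_g * T) * (sc * W) in q0.
  have q1 : 0 < q + 1 by rewrite ltr_wpDl.
  apply/ler_addgt0Pr => e e0.
  have d0 : 0 < e / (q + 1) by rewrite divr_gt0.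
  have := est (C + `|g 0 0| / K_g + e / (q + 1)); rewrite ltrDl => /(_ d0) H; apply: (le_trans H).
  have H2 : q * (e / (q + 1)) <= e.
    by rewrite mulrCA ler_piMr ?(ltW e0)// ler_pdivrMr// mul1r lerDl.
  by move: H2; rewrite /q; move: (e / _) => x1; lra.
apply: (le_trans est).
have MC : C + `|g 0 0| / K_g <= kap * (C + `|g0| / mu).
  rewrite g00 mulrDr lerD//; first by rewrite ler_peMl.
  rewrite /kap /mu -/mu' (_ : mu' / K_g * (`|g0| / mu') = `|g0| / K_g)//.
  by field; rewrite !gt_eqF.
have RT : expR (K_g * T) * Num.sqrt (1 + T) <= A * expR (mu * T).
  have -> : mu * T = K_g * T + 4 * L_g ^+ 2 * T by rewrite /mu; ring.
  rewrite expRD mulrCA; apply: ler_wpM2l; first exact: expR_ge0.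
  exact: (sqrt1D_le_expR a0 (ltW T0)).
have D0 : 0 <= hsnorm (x - y) / Num.sqrt (decay_factor L T).
  by rewrite divr_ge0 ?hsnorm_ge0// ltW.
rewrite (_ : expR (K_g * T) * (sc * (C + `|g 0 0| / K_g) * W) =
  sc * (C + `|g 0 0| / K_g) * (expR (K_g * T) * Num.sqrt (1 + T)) *
  (hsnorm (x - y) / Num.sqrt (decay_factor L T))); last by rewrite /W; ring.
rewrite [leRHS](_ : _ = sc * (kap * (C + `|g0| / mu)) * (A * expR (mu * T)) *
  (hsnorm (x - y) / Num.sqrt (decay_factor L T))); last by rewrite /C; ring.
apply: ler_wpM2r => //; apply: ler_pM => //.
- by rewrite mulr_ge0 ?(ltW sc0)// addr_ge0// divr_ge0// ltW.
by rewrite ler_wpM2l// ltW.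
Qed.
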